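(* Let $\mathcal F$ be a non-dicritical foliation in $(\mathbb{C}^2,0)$ and let $C$ be a curve which is a union of convergent separatrices of $\mathcal F$. Then $$GSV_0(\mathcal F,C)=\Delta_0(\mathcal F,C).$$
   Context: A foliation $\mathcal{F}$ in $(\mathbb{C}^2,0)$ is given by $\omega=0$, with $\omega=P\,dx+Q\,dy$ and $P,Q\in\mathbb{C}\{x,y\}$ relatively prime. A separatrix of $\mathcal F$ is a formal irreducible curve $f=0$, $f\in\mathbb{C}[[x,y]]$, $f(0,0)=0$, that is invariant, i.e. $\omega\wedge df=fh\,dx\wedge dy$ for some $h\in\mathbb{C}[[x,y]]$; it is convergent if one can take $f\in\mathbb{C}\{x,y\}$. $\mathcal F$ is non-dicritical if it has only finitely many separatrices. Polar excess. For a formal curve $C$ with reduced equation $f=0$, all of whose branches are separatrices of $\mathcal F$, let $p_0(\mathcal F,C)=i_0(\{aP+bQ=0\},C)$ for generic $(a:b)\in\mathbb{P}^1_{\mathbb C}$ (the value is constant on a non-empty Zariski open set of $(a:b)$), where $i_0$ is intersection multiplicity at $0$. Let $\nu_0(C)$ be the order of $f$ at $0$ and $\mu_0(C)=\dim_{\mathbb C}\mathbb{C}[[x,y]]/(f_x,f_y)$ the Milnor number of $C$. The $C$-polar excess is $$\Delta_0(\mathcal F,C)=p_0(\mathcal F,C)-\mu_0(C)-\nu_0(C)+1$$ (equivalently $p_0(\mathcal F,C)-p_0(\mathcal G_f,C)$, where $\mathcal G_f$ is the foliation $df=0$). GSV-index. If $C$ is a convergent curve invariant by $\mathcal F$ with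 reduced equation $f=0$, $f\in\mathbb{C}\{x,y\}$, there is a decomposition $g\omega=k\,df+f\eta$ with $g,k\in\mathbb{C}\{x,y\}$ each relatively prime to $f$, and $\eta$ a germ of holomorphic 1-form. Then $$GSV_0(\mathcal F,C)=\frac{1}{2\pi i}\int_{\partial C}\frac{g}{k}\,d\left(\frac{k}{g}\right),$$ where $\partial C=C\cap S^3_\epsilon$, $S^3_\epsilon$ is a small sphere centered at $0\in\mathbb{C}^2$ bounding the ball $B^4_\epsilon$, and $\partial C$ is oriented as the boundary of $C\cap B^4_\epsilon$. *)

(* Defs.v *)
(* MathComp and MathComp-Analysis. *)
From HB Require Import structures.
From mathcomp Require Import all_boot all_order all_algebra.
From mathcomp Require Import complex.
From mathcomp Require Import all_classical all_reals all_analysis.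

Set Implicit Arguments.
Unset Strict Implicit.
Unset Printing Implicit Defensive.

Import Order.TTheory GRing.Theory Num.Theory.
Import numFieldNormedType.Exports.

Local Open Scope classical_set_scope.
Local Open Scope complex_scope.
Local Open Scope ring_scope.

(** * Formal power series in one variable *)

(* A record rather than an alias of [nat -> K], which already carries the
   pointwise product. *)
Record fps (K : Type) := Fps { fps_coef :> nat -> K }.

HB.instance Definition _ (K : Type) := gen_eqMixin (fps K).
HB.instance Definition _ (K : Type) := gen_choiceMixin (fps K).

Lemma fpsP (K : Type) (f g : fps K) : (forall n, f n = g n) -> f = g.
Proof. by case: f g => [f] [g] /= fg; congr Fps; apply/funext. Qed.

Section FpsRing.
Variable K : comNzRingType.
Implicit Types f g h : fps K.

Definition fps_const (a : K) : fps K := Fps (fun n => if n == 0 then a else 0).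
Definition fps_add f g : fps K := Fps (fun n => f n + g n).
Definition fps_opp f : fps K := Fps (fun n => - f n).
Definition fps_mul f g : fps K :=
  Fps (fun n => \sum_(j < n.+1) f j * g (n - j)%N).
Definition fps_deriv f : fps K := Fps (fun n => f n.+1 *+ n.+1).

Fact fps_addA : associative fps_add.
Proof. by move=> f g h; apply: fpsP => n /=; rewrite addrA. Qed.
Fact fps_addC : commutative fps_add.
Proof. by move=> f g; apply: fpsP => n /=; rewrite addrC. Qed.
Fact fps_add0 : left_id (fps_const 0) fps_add.
Proof. by move=> f; apply: fpsP => n /=; rewrite if_same add0r. Qed.
Fact fps_addN : left_inverse (fps_const 0) fps_opp fps_add.
Proof. by move=> f; apply: fpsP => n /=; rewrite if_same addNr. Qed.

HB.instance Definition _ := GRing.isZmodule.Build (fps K)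
  fps_addA fps_addC fps_add0 fps_addN.

Fact fps_mulC : commutative fps_mul.
Proof.
move=> f g; apply: fpsP => n /=.
rewrite (reindex_inj rev_ord_inj) /=.
by apply: eq_bigr => j _; rewrite subSS (sub_ordK j) mulrC.
Qed.

Fact fps_mul_rev f g n : fps_mul f g n = \sum_(j < n.+1) f (n - j)%N * g j.
Proof.
by rewrite fps_mulC /=; apply: eq_bigr => j _; rewrite mulrC.
Qed.

Fact fps_mulA : associative fps_mul.
Proof.
move=> f g h; apply: fpsP => i; rewrite [RHS]fps_mul_rev /=.
pose coef3 j k := f j * (g (i - j - k)%N * h k).
transitivity (\sum_(j < i.+1) \sum_(k < i.+1 | (k <= i - j)%N) coef3 j k).
  apply: eq_bigr => /= j _; rewrite [X in _ * X]fps_mul_rev big_distrr /=.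
  by rewrite (big_ord_narrow_leq (leq_subr _ _)).
rewrite (exchange_big_dep predT) //=; apply: eq_bigr => k _.
transitivity (\sum_(j < i.+1 | (j <= i - k)%N) coef3 j k).
  apply: eq_bigl => j; rewrite -ltnS -(ltnS j) -!subSn ?leq_ord //.
  by rewrite -subn_gt0 -(subn_gt0 j) -!subnDA addnC.
rewrite (big_ord_narrow_leq (leq_subr _ _)) big_distrl /=.
by apply: eq_bigr => j _; rewrite /coef3 -!subnDA addnC mulrA.
Qed.

Fact fps_mul1 : left_id (fps_const 1) fps_mul.
Proof.
move=> f; apply: fpsP => n /=.
by rewrite big_ord_recl subn0 mul1r big1 ?addr0 // => j _; rewrite mul0r.
Qed.

Fact fps_mulDl : left_distributive fps_mul fps_add.
Proof.
move=> f g h; apply: fpsP => n /=; rewrite -big_split /=.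
by apply: eq_bigr => j _; rewrite mulrDl.
Qed.

Fact fps_const1_neq0 : fps_const 1 != 0 :> fps K.
Proof.
by apply/eqP => /(congr1 (fun f : fps K => f 0)) /= /eqP; rewrite oner_eq0.
Qed.

HB.instance Definition _ := GRing.Zmodule_isComNzRing.Build (fps K)
  fps_mulA fps_mulC fps_mul1 fps_mulDl fps_const1_neq0.

End FpsRing.

(** * Formal and convergent power series in two variables *)

(* C[[x,y]], as C[[x]][[y]], where C = R[i]. *)
Notation fps2 R := (fps (fps R[i])).

Section PlaneGerms.
Variable R : realType.
Local Notation C := R[i].
Local Notation normc := ComplexField.Normc.normc.

Implicit Types f g h P Q : fps2 R.

(* The coefficient of x^i y^j. *)
Definition coef2 f (i j : nat) : C := f j i.

Definition const2 (a : C) : fps2 R := fps_const (fps_const a).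

Definition ddx f : fps2 R := Fps (fun j => fps_deriv (f j)).
Definition ddy f : fps2 R := fps_deriv f.

Definition formal_unit f := exists g, f * g = 1.

Definition formal_irreducible f :=
  [/\ f <> 0, ~ formal_unit f &
      forall g h, f = g * h -> formal_unit g \/ formal_unit h].

(* f = 0 and g = 0 are the same formal curve. *)
Definition associate f g := exists2 u, formal_unit u & f = u * g.

(* Absolute convergence at some point (r, r) with r > 0. *)
Definition convergent f :=
  exists2 r : R, 0 < r &
    exists M : R, forall n : nat,
      \sum_(i < n) \sum_(j < n) normc (coef2 f i j) * r ^+ (i + j) <= M.

(* No common divisor in the ring C{x,y} other than its units. *)
Definition coprime_cv f g :=
  forall d, convergent d ->
    (exists2 u, convergent u & f = d * u) ->
    (exists2 v, convergent v & g = d * v) ->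
    exists2 w, convergent w & d * w = 1.

Definition clim (u : nat -> C) : C :=
  lim ((fun n => complex.Re (u n)) @ \oo) +i*
  lim ((fun n => complex.Im (u n)) @ \oo).

(* The value f(x, y); meaningful for convergent f and (x, y) near 0. *)
Definition eval f (z : C * C) : C :=
  clim (fun n => \sum_(i < n) \sum_(j < n)
                   coef2 f i j * z.1 ^+ i * z.2 ^+ j).

(** * Order at 0, intersection multiplicity, Milnor number *)

Definition is_order0 f (n : nat) :=
  (exists i j, (i + j)%N = n /\ coef2 f i j <> 0) /\
  (forall i j, (i + j < n)%N -> coef2 f i j = 0).

Definition order0 f : nat := xget 0%N [set n | is_order0 f n].

Definition ideal2 f g : set (fps2 R) := [set h | exists a b, h = a * f + b * g].

(* dim_C C[[x,y]] / I = n: the classes of e_1, ..., e_n form a basis. *)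
Definition quotient_dim (I : set (fps2 R)) (n : nat) :=
  exists e : 'I_n -> fps2 R,
    (forall h, exists c : 'I_n -> C, I (h - \sum_i const2 (c i) * e i)) /\
    (forall c : 'I_n -> C, I (\sum_i const2 (c i) * e i) -> forall i, c i = 0).

(* i_0({g = 0}, {f = 0}) = n; no n satisfies this when the multiplicity is
   infinite. *)
Definition intersection_mult g f (n : nat) := quotient_dim (ideal2 g f) n.

Definition milnor f : nat :=
  xget 0%N [set n | quotient_dim (ideal2 (ddx f) (ddy f)) n].

(** * Foliations *)

(* The pair (P, Q) stands for the 1-form P dx + Q dy. *)
Definition foliation P Q :=
  [/\ convergent P, convergent Q & coprime_cv P Q].

(* omega /\ df = (P f_y - Q f_x) dx /\ dy. *)
Definition separatrix P Q f :=
  [/\ formal_irreducible f, coef2 f 0 0 = 0 &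
      exists h, P * ddy f - Q * ddx f = f * h].

Definition non_dicritical P Q :=
  exists s : seq (fps2 R),
    forall f, separatrix P Q f -> exists2 g, g \in s & associate f g.

(* f = 0 is a reduced equation, in C{x,y}, of a (nonempty) union of convergent
   separatrices: f is a product of pairwise non-associate equations of
   convergent separatrices. A unit factor can be absorbed by any of them. *)
Definition convergent_separatrices P Q f :=
  exists s : seq (fps2 R),
    [/\ s <> [::],
        forall g, g \in s -> separatrix P Q g /\ convergent g,
        forall i j, (i < j < size s)%N -> ~ associate s`_i s`_j &
        f = \prod_(g <- s) g].

(** * Polar excess *)

(* Z holds on a nonempty Zariski open subset of the projective line, i.e. at
   all points (a : b) but finitely many. *)
Definition generic_P1 (Z : C -> C -> Prop) :=
  exists s : seq (C * C),
    (forall l, l \in s -> l <> (0, 0)) /\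
    (forall a b, (a, b) <> (0, 0) ->
       (forall l, l \in s -> a * l.2 <> b * l.1) -> Z a b).

Definition polar_intersection P Q f : nat :=
  xget 0%N [set p | generic_P1 (fun a b =>
    intersection_mult (const2 a * P + const2 b * Q) f p)].

Definition polar_excess P Q f : int :=
  (polar_intersection P Q f)%:Z - (milnor f)%:Z - (order0 f)%:Z + 1.

(** * GSV-index *)

(* g omega = k df + f (a dx + b dy). *)
Definition gsv_decomposition P Q f g k :=
  [/\ convergent g, convergent k, coprime_cv g f, coprime_cv k f &
      exists a b, [/\ convergent a, convergent b,
                      g * P = k * ddx f + f * a &
                      g * Q = k * ddy f + f * b]].

Definition cderive (u : R -> C) (s : R) : C :=
  derive1 (fun t => complex.Re (u t)) s +i*
  derive1 (fun t => complex.Im (u t)) s.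

Definition C1_real (u : R -> R) :=
  (forall s : R, derivable u s 1) /\ continuous (derive1 u).

Definition C1_complex (u : R -> C) :=
  C1_real (fun s => complex.Re (u s)) /\ C1_real (fun s => complex.Im (u s)).

Definition cintegral01 (u : R -> C) : C :=
  Rintegral lebesgue_measure `[0, 1] (fun s => complex.Re (u s)) +i*
  Rintegral lebesgue_measure `[0, 1] (fun s => complex.Im (u s)).

(* The oriented 1-manifold {f = 0} /\ S^3_eps, as a disjoint union of n simple
   closed C^1 curves, each given as a 1-periodic function. At a point c of the
   link, with tangent vector c', multiplication by -i preserves the (complex)
   tangent line of the curve f = 0; c' is positive for the orientation as a
   boundary when -i c' points out of the ball, i.e. when
     0 < Re <-i c', c> = Im (x' conj(x) + y' conj(y)).
   This also forces c' <> 0. *)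
Definition link_parametrization f (eps : R) (n : nat)
    (c : 'I_n -> R -> C * C) :=
  [/\ forall l, C1_complex (fun s => (c l s).1) /\
                C1_complex (fun s => (c l s).2),
      forall l s, c l (s + 1) = c l s,
      forall l l' s s', 0 <= s < 1 -> 0 <= s' < 1 ->
        c l s = c l' s' -> l = l' /\ s = s',
      forall z : C * C,
        (eval f z = 0 /\ normc z.1 ^+ 2 + normc z.2 ^+ 2 = eps ^+ 2) <->
        (exists l s, c l s = z) &
      forall l s,
        0 < complex.Im (cderive (fun t => (c l t).1) s * conjc (c l s).1 +
                        cderive (fun t => (c l t).2) s * conjc (c l s).2)].

(* The integral of (g/k) d(k/g) along the closed curve c. *)
Definition gsv_integral g k (c : R -> C * C) : C :=
  cintegral01 (fun s =>
    eval g (c s) / eval k (c s) *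
    cderive (fun t => eval k (c t) / eval g (c t)) s).

Definition is_GSV P Q f (v : C) :=
  exists g k, gsv_decomposition P Q f g k /\
    exists2 eps0 : R, 0 < eps0 &
      forall eps : R, 0 < eps < eps0 ->
        exists n (c : 'I_n -> R -> C * C),
          link_parametrization f eps c /\
          v = (0 +i* (2 * pi))^-1 * \sum_l gsv_integral g k (c l).

(* The defining property has at most one solution: it does not depend on the
   decomposition, on eps or on the parametrization. *)
Definition GSV P Q f : C := xget 0 [set v | is_GSV P Q f v].

End PlaneGerms.

(* Main.v *)
Require Import Defs.
From HB Require Import structures.
From mathcomp Require Import all_boot all_order all_algebra complex.
From mathcomp Require Import all_classical all_reals all_analysis.
From mathcomp Require Import cyclic separable cyclotomic.
From mathcomp Require Import ring lra zify.

Set Implicit Arguments.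
Unset Strict Implicit.
Unset Printing Implicit Defensive.

Import Order.TTheory GRing.Theory Num.Theory.
Import numFieldNormedType.Exports.

Local Open Scope ring_scope.

(** Along a branch t |-> (t^q, v(t)) or (0, t) of f, the decomposition
    g omega = k df + f eta gives ord g + ord (a P + b Q) = ord k + ord (a f_x + b f_y)
    for generic (a : b). Summing over the branches, intersection multiplicities
    are additive and, by Teissier's formula, the generic polar a f_x + b f_y meets
    f = 0 with multiplicity mu + nu - 1; hence the sum of ord k - ord g is the
    polar excess. Generic g = a f_x + b f_y and k = a P + b Q do provide a
    decomposition.

    On a small sphere every component of the link of f = 0 stays on one branch
    and lifts to its parameter disc. There |x|^2 + |y|^2 is strictly increasing
    along rays, so the orientation condition makes the argument of the lift
    increase, and by injectivity the lift winds exactly once around 0, meeting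
    every ray. So components and branches correspond bijectively and each
    integral is 2 pi i (ord k - ord g). Conversely the level curves of
    |x|^2 + |y|^2 in the parameter discs, which by the implicit function theorem
    are C^1 graphs over the argument, form a link. *)

(** * Formal power series *)

(** [GSV], [milnor], [polar_intersection] and [order0] are values of [xget], so each requires a
    solution and its uniqueness; this is why links have to be constructed and not only analysed.
    Intersection and Milnor numbers are dimensions of quotients, whereas the argument counts orders
    along parametrizations. The two meet through a conductor: the image of C[[x,y]] in C[[t]] under
    a branch contains D C[[t]] for some D <> 0, so it has finite codimension, and multiplication by
    a series then shifts codimensions by its order. The integrals need actual functions, so branches
    must converge. Puiseux's algorithm is therefore run inside convergent series: a shift given by
    the implicit function theorem removes the coefficient of degree n - 1, after which one Newton
    step lowers the order in y, and finitely many steps reach a root. No limit of approximate roots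
    is taken. Series in one variable are embedded in two variables as [tconst u], so that a single
    theory of norms, substitution and evaluation serves both. *)

Lemma sum_ord_single (V : nmodType) n a (F : nat -> V) : (a < n)%N ->
  (forall i, (i < n)%N -> i != a -> F i = 0) -> \sum_(i < n) F i = F a.
Proof.
move=> an h; rewrite (bigD1 (Ordinal an)) //= big1 ?addr0 // => i.
by rewrite -val_eqE /= => ia; apply: h.
Qed.

Lemma sum2_single (V : nmodType) n a b (F : nat -> nat -> V) : (a < n)%N -> (b < n)%N ->
  (forall i j, (i == a) && (j == b) = false -> F i j = 0) ->
  \sum_(i < n) \sum_(j < n) F i j = F a b.
Proof.
move=> an bn h; rewrite (@sum_ord_single _ _ a (fun i => \sum_(j < n) F i j)) //.
  by rewrite (@sum_ord_single _ _ b) // => j _ /negbTE jb; rewrite h // jb andbF.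
by move=> i _ /negbTE ia; rewrite big1 // => j _; rewrite h // ia.
Qed.

Lemma leibniz_exp (K : comNzRingType) (D : K -> K) :
  (forall x y, D (x * y) = D x * y + x * D y) ->
  forall x n, D (x ^+ n) = x ^+ n.-1 * D x *+ n.
Proof.
move=> DM x; have D1 : D 1 = 0.
  by have := DM 1 1; rewrite !mulr1 mul1r -{1}[D 1]addr0 => /addrI <-.
elim=> [|n IH]; first by rewrite expr0 D1 mulr0n.
rewrite exprS DM IH [in RHS]mulrS; congr (_ + _); first by rewrite mulrC.
case: n {IH} => [|n]; first by rewrite !mulr0n mulr0.
by rewrite mulrnAr mulrA -exprS.
Qed.

(* The ring of power series over K, up to isomorphism. Working with a variable
   of this type prevents unification from unfolding series into nested
   convolution sums. *)
Record fps_theory (K : comNzRingType) := FpsTheory {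
  ser :> comNzRingType;
  co : ser -> nat -> K;
  mk : (nat -> K) -> ser;
  coK : forall F n, co (mk F) n = F n;
  coP : forall f g, (forall n, co f n = co g n) -> f = g;
  coDE : forall f g n, co (f + g) n = co f n + co g n;
  coNE : forall f n, co (- f) n = - co f n;
  co1E : forall n, co 1 n = (n == 0%N)%:R;
  coME : forall f g n, co (f * g) n = \sum_(j < n.+1) co f j * co g (n - j)%N
}.
Arguments co {K f} _ _ : rename.
Arguments mk {K f} _ : rename.

(** Series rings carry no integral domain structure here, so the absence of zero divisors is a
    proposition, which [dom_ser] passes from coefficients to series. *)
Definition dom (K : comNzRingType) := forall a b : K, a * b = 0 -> a = 0 \/ b = 0.

Lemma mul_neq0 (K : comNzRingType) (f g : K) : dom K -> f <> 0 -> g <> 0 -> f * g <> 0.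
Proof. by move=> dK f0 g0 /dK []. Qed.

Lemma dom_mulI (K : comNzRingType) (a b c : K) : dom K -> a <> 0 -> a * b = a * c -> b = c.
Proof.
move=> dK a0 e; have : a * (b - c) = 0 by rewrite mulrBr e subrr.
by move/dK => [//|/eqP]; rewrite subr_eq0 => /eqP.
Qed.

Lemma dom_prod (K : comNzRingType) (I : eqType) (r : seq I) (F : I -> K) : dom K ->
  \prod_(i <- r) F i = 0 -> exists2 i, i \in r & F i = 0.
Proof.
move=> dK; elim: r => [|x r IH]; first by rewrite big_nil => /eqP; rewrite oner_eq0.
rewrite big_cons => /dK [h|/IH [i ir Fi]]; first by exists x; rewrite ?mem_head.
by exists i; rewrite // inE ir orbT.
Qed.

Section FpsBase.
Variables (K : comNzRingType) (T : fps_theory K).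
Implicit Types f g : T.

Lemma coBE f g n : co (f - g) n = co f n - co g n.
Proof. by rewrite coDE coNE. Qed.
Lemma co0E n : co (0 : T) n = 0.
Proof. by rewrite -[0](subrr 0) coBE subrr. Qed.

Lemma co_sumE (I : Type) (r : seq I) (P : pred I) (F : I -> T) n :
  co (\sum_(i <- r | P i) F i) n = \sum_(i <- r | P i) co (F i) n.
Proof. by elim/big_rec2: _ => [|i y1 y2 _ <-]; rewrite ?co0E ?coDE. Qed.

Lemma coMnE f m n : co (f *+ m) n = co f n *+ m.
Proof. by elim: m => [|m IH]; rewrite ?mulr0n ?co0E // !mulrS coDE IH. Qed.

Definition tconst (a : K) : T := mk (fun n => if n == 0%N then a else 0).

Lemma tconstE (a : K) n : co (tconst a) n = if n == 0%N then a else 0.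
Proof. by rewrite coK. Qed.

Lemma tconstM (a : K) f n : co (tconst a * f) n = a * co f n.
Proof.
rewrite coME big_ord_recl subn0 tconstE big1 ?addr0 // => j _.
by rewrite tconstE mul0r.
Qed.

Fact tconst_is_additive : {morph tconst : x y / x - y}.
Proof.
by move=> x y; apply: coP => n; rewrite coBE !tconstE; case: eqP => _; rewrite ?subrr.
Qed.
HB.instance Definition _ :=
  GRing.isZmodMorphism.Build K T tconst tconst_is_additive.

Fact tconst_is_monoid : monoid_morphism tconst.
Proof.
split=> [|x y]; apply: coP => n; first by rewrite tconstE co1E; case: eqP.
by rewrite tconstM !tconstE; case: eqP => _; rewrite ?mulr0.
Qed.
HB.instance Definition _ :=
  GRing.isMonoidMorphism.Build K T tconst tconst_is_monoid.

Definition tX : T := mk (fun n => (n == 1%N)%:R).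

Lemma tXE n : co tX n = (n == 1%N)%:R. Proof. by rewrite coK. Qed.

Lemma tXM f n : co (tX * f) n = if n is m.+1 then co f m else 0.
Proof.
rewrite coME; case: n => [|n].
  by rewrite big_ord_recl big_ord0 tXE mul0r addr0.
rewrite !big_ord_recl !tXE /= mul0r add0r mul1r subSS subn0 big1 ?addr0 // => i _.
by rewrite tXE mul0r.
Qed.

Lemma tXnM k f n : co (tX ^+ k * f) n = if (n < k)%N then 0 else co f (n - k)%N.
Proof.
elim: k n => [|k IH] n; first by rewrite expr0 mul1r subn0.
by rewrite exprS -mulrA tXM; case: n => [|n] //; rewrite IH ltnS subSS.
Qed.

Lemma tXnE k n : co (tX ^+ k) n = (n == k)%:R.
Proof.
rewrite -[_ ^+ k]mulr1 tXnM co1E.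
by case: ltngtP => [//|h|->]; rewrite ?subnn // subn_eq0 leqNgt h.
Qed.

Definition tshift k f : T := mk (fun n => co f (n + k)%N).

Lemma tshiftE k f n : co (tshift k f) n = co f (n + k)%N. Proof. by rewrite coK. Qed.

Lemma tshiftK k f :
  (forall n, (n < k)%N -> co f n = 0) -> f = tX ^+ k * tshift k f.
Proof.
move=> h; apply: coP => n; rewrite tXnM; case: ltnP => hn; first exact: h.
by rewrite tshiftE subnK.
Qed.

Definition cst0 f : K := co f 0%N.

Fact cst0_is_additive : {morph cst0 : x y / x - y}.
Proof. by move=> x y; rewrite /cst0 coBE. Qed.
HB.instance Definition _ :=
  GRing.isZmodMorphism.Build T K cst0 cst0_is_additive.

Fact cst0_is_monoid : monoid_morphism cst0.
Proof.
by split=> [|x y]; rewrite /cst0 ?co1E // coME big_ord_recl big_ord0 addr0.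
Qed.
HB.instance Definition _ :=
  GRing.isMonoidMorphism.Build T K cst0 cst0_is_monoid.

Lemma coM0 f g : co (f * g) 0%N = co f 0%N * co g 0%N.
Proof. exact: (rmorphM cst0). Qed.

Definition has_ord f n := (forall i, (i < n)%N -> co f i = 0) /\ co f n <> 0.

(** The zero series has no order; the default of [xget] gives it the value 0. *)
Definition ord f : nat := xget 0%N [set n | has_ord f n]%classic.

Lemma has_ord_inj f m n : has_ord f m -> has_ord f n -> m = n.
Proof.
move=> [a1 a2] [b1 b2]; case: (ltngtP m n) => // h; first by case: a2; exact: b1.
by case: b2; exact: a1.
Qed.

Lemma ordP f : f <> 0 -> has_ord f (ord f).
Proof.
move=> f0; rewrite /ord; case: xgetP => [m -> //|H].
exfalso; apply: f0; apply: coP => n; rewrite co0E.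
elim/ltn_ind: n => n IH; apply: contrapT => fn; exact: (H n).
Qed.

Lemma ordE f n : has_ord f n -> ord f = n.
Proof.
move=> h; rewrite /ord; case: xgetP => [m -> h'|H]; first exact: has_ord_inj h' h.
by case: (H n).
Qed.

Lemma has_ord_neq0 f n : has_ord f n -> f <> 0.
Proof. by move=> [_ h] f0; apply: h; rewrite f0 co0E. Qed.

Lemma has_ordE f n : has_ord f n -> exists2 u : T, f = tX ^+ n * u & co u 0%N <> 0.
Proof. by move=> [a b]; exists (tshift n f); [exact: tshiftK | rewrite tshiftE add0n]. Qed.

Lemma has_ord_mulX n (u : T) : co u 0%N <> 0 -> has_ord (tX ^+ n * u) n.
Proof.
by move=> h; split=> [i hi|]; rewrite tXnM ?hi // ltnn subnn.
Qed.

Lemma has_ordM f g m n : dom K -> has_ord f m -> has_ord g n -> has_ord (f * g) (m + n).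
Proof.
move=> dK /has_ordE[u -> u0] /has_ordE[v -> v0].
rewrite mulrACA -exprD; apply: has_ord_mulX => /eqP.
by rewrite coM0 => /eqP /dK [].
Qed.

Lemma dom_ser : dom K -> dom T.
Proof.
move=> dK a b ab; case: (pselect (a = 0)) => a0; first by left.
right; apply: contrapT => b0.
exact: (has_ord_neq0 (has_ordM dK (ordP a0) (ordP b0)) ab).
Qed.

Lemma ordM f g : dom K -> f <> 0 -> g <> 0 -> ord (f * g) = (ord f + ord g)%N.
Proof. by move=> dK f0 g0; apply: ordE; apply: has_ordM => //; exact: ordP. Qed.

Definition tderiv f : T := mk (fun n => co f n.+1 *+ n.+1).

Lemma tderivE f n : co (tderiv f) n = co f n.+1 *+ n.+1. Proof. by rewrite coK. Qed.

Fact tderiv_is_additive : {morph tderiv : x y / x - y}.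
Proof. by move=> x y; apply: coP => n; rewrite !(tderivE, coBE) mulrnBl. Qed.
HB.instance Definition _ :=
  GRing.isZmodMorphism.Build T T tderiv tderiv_is_additive.

Lemma tderivM f g : tderiv (f * g) = tderiv f * g + f * tderiv g.
Proof.
apply: coP => n; rewrite coDE tderivE !coME -sumrMnl.
(* The factor n + 1 is split as j + (n + 1 - j), one part for each term of the Leibniz rule. *)
transitivity (\sum_(j < n.+2) (co f j *+ j * co g (n.+1 - j)%N
                          + co f j * (co g (n.+1 - j)%N *+ (n.+1 - j)))).
  apply: eq_bigr => j _; rewrite mulrnAr mulrnAl -mulrnDr subnKC //.
  by rewrite -ltnS.
rewrite big_split /=; congr (_ + _).
  rewrite big_ord_recl mulr0n mul0r add0r.
  by apply: eq_bigr => j _; rewrite tderivE subSS.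
rewrite big_ord_recr /= subnn mulr0n mulr0 addr0.
by apply: eq_bigr => j _; rewrite tderivE subSn // -ltnS.
Qed.

Lemma tderiv_const a : tderiv (tconst a) = 0.
Proof. by apply: coP => n; rewrite tderivE tconstE mul0rn co0E. Qed.
End FpsBase.
Arguments tconst {K T}.
Arguments tX {K T}.
Arguments cst0 {K T}.

Section FpsMap.
Variables (K L : comNzRingType) (T : fps_theory K) (U : fps_theory L).
Variable phi : {rmorphism K -> L}.

Definition tmap (f : T) : U := mk (fun n => phi (co f n)).

Lemma tmapE f n : co (tmap f) n = phi (co f n). Proof. by rewrite coK. Qed.

Fact tmap_is_additive : {morph tmap : x y / x - y}.
Proof. by move=> x y; apply: coP => n; rewrite !(tmapE, coBE) rmorphB. Qed.
HB.instance Definition _ :=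
  GRing.isZmodMorphism.Build T U tmap tmap_is_additive.

Fact tmap_is_monoid : monoid_morphism tmap.
Proof.
split=> [|x y]; apply: coP => n; rewrite !tmapE.
  by rewrite !co1E; case: eqP => _; rewrite ?rmorph1 ?rmorph0.
by rewrite !coME rmorph_sum; apply: eq_bigr => j _; rewrite rmorphM !tmapE.
Qed.
HB.instance Definition _ :=
  GRing.isMonoidMorphism.Build T U tmap tmap_is_monoid.
End FpsMap.

(** * Substitution in two variables *)

Section TwoVar.
Variables (R : realType) (T1 : fps_theory R[i]) (T2 : fps_theory T1).
Local Notation C := R[i].
Local Notation S := (T2 : comNzRingType).
Implicit Types (f g h X Y : T2) (c : C) (u v : T1).

Lemma domC : dom C.
Proof.
by move=> a b /eqP; rewrite mulf_eq0 => /orP[] /eqP ->; [left|right].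
Qed.
Lemma dom1 : dom T1. Proof. exact: dom_ser domC. Qed.
Lemma dom2 : dom T2. Proof. exact: dom_ser dom1. Qed.
#[local] Hint Resolve domC dom1 dom2 : core.

Definition c2 f i j : C := co (co f j) i.
Definition k2 c : T2 := tconst (tconst c).

HB.instance Definition _ := GRing.RMorphism.copy k2
  ((@tconst _ T2 : T1 -> T2) \o (@tconst _ T1 : C -> T1)).

Lemma c2D f g i j : c2 (f + g) i j = c2 f i j + c2 g i j.
Proof. by rewrite /c2 !coDE. Qed.
Lemma c2B f g i j : c2 (f - g) i j = c2 f i j - c2 g i j.
Proof. by rewrite /c2 !coBE. Qed.
Lemma c2N f i j : c2 (- f) i j = - c2 f i j.
Proof. by rewrite /c2 !coNE. Qed.
Lemma c20 i j : c2 (0 : T2) i j = 0.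
Proof. by rewrite /c2 !co0E. Qed.
Lemma c2_const c i j : c2 (k2 c) i j = if (i == 0%N) && (j == 0%N) then c else 0.
Proof. by rewrite /c2 /k2 tconstE andbC; case: (j == 0%N); rewrite ?(tconstE, co0E). Qed.
Lemma c21 i j : c2 (1 : T2) i j = ((i == 0%N) && (j == 0%N))%:R.
Proof. by rewrite -(rmorph1 (@k2)) c2_const; case: ifP. Qed.
Lemma c2_sum (I : Type) (r : seq I) (P : pred I) (F : I -> T2) i j :
  c2 (\sum_(k <- r | P k) F k) i j = \sum_(k <- r | P k) c2 (F k) i j.
Proof. by rewrite /c2 !co_sumE. Qed.
Lemma c2M f g i j : c2 (f * g) i j =
  \sum_(b < j.+1) \sum_(a < i.+1) c2 f a b * c2 g (i - a) (j - b).
Proof. by rewrite /c2 coME co_sumE; apply: eq_bigr => b _; rewrite coME. Qed.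
Lemma c2_constM c f i j : c2 (k2 c * f) i j = c * c2 f i j.
Proof. by rewrite /c2 /k2 !tconstM. Qed.
Lemma c2_tconst (u : T1) i j : c2 (tconst u) i j = if j == 0%N then co u i else 0.
Proof. by rewrite /c2 tconstE; case: (j == 0%N); rewrite ?(tconstE, co0E). Qed.

Lemma c2P f g : (forall i j, c2 f i j = c2 g i j) -> f = g.
Proof. by move=> h; apply: coP => j; apply: coP => i; exact: h. Qed.

Definition vX : T2 := tconst tX.
Definition vY : T2 := tX.

Lemma c2_XM a f i j :
  c2 (vX ^+ a * f) i j = if (i < a)%N then 0 else c2 f (i - a) j.
Proof. by rewrite /c2 -rmorphXn tconstM tXnM. Qed.

Lemma c2_YM b f i j :
  c2 (vY ^+ b * f) i j = if (j < b)%N then 0 else c2 f i (j - b).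
Proof. by rewrite /c2 tXnM; case: ltnP => _ //; rewrite co0E. Qed.

Lemma c2_mon a b i j :
  c2 (vX ^+ a * vY ^+ b) i j = ((i == a) && (j == b))%:R.
Proof.
rewrite c2_XM /c2 tXnE.
case: ltnP => h; first by rewrite ltn_eqF.
by case: (j == b); rewrite ?andbF ?co0E // co1E andbT subn_eq0 eqn_leq h andbT.
Qed.

Lemma c2_X i j : c2 vX i j = ((i == 1%N) && (j == 0%N))%:R.
Proof. by rewrite -c2_mon expr1 expr0 mulr1. Qed.
Lemma c2_Y i j : c2 vY i j = ((i == 0%N) && (j == 1%N))%:R.
Proof. by rewrite -c2_mon expr1 expr0 mul1r. Qed.

(** Membership in the n-th power of the maximal ideal. Identities between series are proved modulo
    all these powers, by [low_eq]. *)
Definition low n f := forall i j, (i + j < n)%N -> c2 f i j = 0.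

Lemma low0 n : low n 0. Proof. by move=> i j _; rewrite c20. Qed.
Lemma lowD n f g : low n f -> low n g -> low n (f + g).
Proof. by move=> a b i j h; rewrite c2D a ?b ?addr0. Qed.
Lemma lowN n f : low n f -> low n (- f).
Proof. by move=> a i j h; rewrite c2N a ?oppr0. Qed.
Lemma lowB n f g : low n f -> low n g -> low n (f - g).
Proof. by move=> a b; apply: lowD => //; exact: lowN. Qed.
Lemma lowW m n f : (m <= n)%N -> low n f -> low m f.
Proof. by move=> mn h i j ij; apply: h; exact: leq_trans ij mn. Qed.
Lemma lowM m n f g : low m f -> low n g -> low (m + n) (f * g).
Proof.
move=> a b i j h; rewrite c2M big1 // => y _; rewrite big1 // => x _.
case: (ltnP (x + y) m) => xy; first by rewrite a ?mul0r.
rewrite b ?mulr0 //.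
have xi : (x <= i)%N by rewrite -ltnS.
have yj : (y <= j)%N by rewrite -ltnS.
by rewrite -(ltn_add2l (x + y)) addnACA !subnKC // (leq_trans h) // leq_add2r.
Qed.
Lemma lowMl n f g : low n f -> low n (g * f).
Proof. by move=> h; rewrite -[n]add0n; apply: lowM. Qed.
Lemma lowMr n f g : low n f -> low n (f * g).
Proof. by rewrite mulrC; exact: lowMl. Qed.
Lemma lowX n f : low 1 f -> low n (f ^+ n).
Proof. by move=> h; elim: n => [|n IH] //; rewrite exprS -add1n; apply: lowM. Qed.
Lemma low_sum n (I : Type) (r : seq I) (P : pred I) (F : I -> T2) :
  (forall i, P i -> low n (F i)) -> low n (\sum_(i <- r | P i) F i).
Proof. by move=> h; elim/big_rec: _ => [|i x Pi]; [exact: low0 | apply: lowD; exact: h]. Qed.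

Lemma low_eq0 f : (forall n, low n f) -> f = 0.
Proof. by move=> h; apply: c2P => i j; rewrite c20 (h (i + j).+1). Qed.
Lemma low_eq f g : (forall n, low n (f - g)) -> f = g.
Proof. by move=> h; apply/eqP; rewrite -subr_eq0; apply/eqP; exact: low_eq0. Qed.

Lemma low1E f : low 1 f <-> c2 f 0 0 = 0.
Proof.
split=> [h|h i j]; first exact: h.
by rewrite ltnS leqn0 addn_eq0 => /andP[/eqP-> /eqP->].
Qed.
Lemma low_X : low 1 vX. Proof. by apply/low1E; rewrite c2_X. Qed.
Lemma low_Y : low 1 vY. Proof. by apply/low1E; rewrite c2_Y. Qed.

(* The constant terms of X and Y are dropped, so that substitution is always
   a ring morphism. *)
Definition nz X : T2 := X - k2 (c2 X 0 0).

Lemma low_nz X : low 1 (nz X).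
Proof. by apply/low1E; rewrite c2B c2_const subrr. Qed.
Lemma nz_id X : low 1 X -> nz X = X.
Proof. by move/low1E => h; rewrite /nz h rmorph0 subr0. Qed.

Definition psum n f X Y : T2 :=
  \sum_(a < n) \sum_(b < n) k2 (c2 f a b) * nz X ^+ a * nz Y ^+ b.

(** Since X^a Y^b lies in degrees at least a + b, the coefficient of x^i y^j is final in the partial
    sum of length i + j + 1. The sigma type hides the body from unification. *)
Fact subst_spec : {F : T2 -> T2 -> T2 -> T2 | forall X Y f,
  F X Y f = mk (fun j => mk (fun i => c2 (psum (i + j).+1 f X Y) i j))}.
Proof. by exists (fun X Y f => mk (fun j => mk (fun i => c2 (psum (i + j).+1 f X Y) i j))). Qed.
Definition subst : T2 -> T2 -> T2 -> T2 := sval subst_spec.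

Lemma c2_subst X Y f i j : c2 (subst X Y f) i j = c2 (psum (i + j).+1 f X Y) i j.
Proof. by rewrite /subst (svalP subst_spec) {1}/c2 !coK. Qed.

Lemma low_term c a b X Y : low (a + b) (k2 c * nz X ^+ a * nz Y ^+ b).
Proof. by rewrite -mulrA; apply: lowMl; apply: lowM; apply: lowX; exact: low_nz. Qed.

Lemma psum_low m n f X Y : (m <= n)%N -> low m (psum n f X Y - psum m f X Y).
Proof.
elim: n => [|n IH]; first by rewrite leqn0 => /eqP ->; rewrite subrr; exact: low0.
rewrite leq_eqVlt => /orP[/eqP ->|]; first by rewrite subrr; exact: low0.
rewrite ltnS => mn.
have -> : psum n.+1 f X Y = psum n f X Y +
    (\sum_(a < n) k2 (c2 f a n) * nz X ^+ a * nz Y ^+ n +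
    \sum_(b < n.+1) k2 (c2 f n b) * nz X ^+ n * nz Y ^+ b).
  rewrite /psum big_ord_recr addrA; congr (_ + _).
  by rewrite -big_split; apply: eq_bigr => a _; rewrite big_ord_recr.
rewrite addrAC; apply: lowD; first exact: IH.
apply: lowD; apply: low_sum => a _; apply: (lowW _ (@low_term _ _ _ _ _)).
  by rewrite (leq_trans mn) // leq_addl.
by rewrite (leq_trans mn) // leq_addr.
Qed.

Lemma subst_psum n X Y f : low n (subst X Y f - psum n f X Y).
Proof.
move=> i j ij; rewrite c2B c2_subst.
have := psum_low f X Y ij (ltnSn _).
by rewrite c2B => /eqP; rewrite subr_eq0 => /eqP ->; rewrite subrr.
Qed.

Fact subst_is_additive X Y : {morph subst X Y : f g / f - g}.
Proof.
move=> f g; apply: c2P => i j; rewrite c2B !c2_subst -[RHS]c2B; congr c2; rewrite /psum -sumrB; apply: eq_bigr => a _.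
by rewrite -sumrB; apply: eq_bigr => b _; rewrite c2B rmorphB !mulrBl.
Qed.
HB.instance Definition _ X Y :=
  GRing.isZmodMorphism.Build T2 T2 (subst X Y) (subst_is_additive X Y).

Lemma subst_low n X Y f : low n f -> low n (subst X Y f).
Proof.
move=> fn; rewrite -(subrK (psum n f X Y) (subst X Y f)).
apply: lowD; first exact: subst_psum.
apply: low_sum => a _; apply: low_sum => b _.
case: (ltnP (a + b) n) => ab; first by rewrite fn // rmorph0 !mul0r; exact: low0.
exact: (lowW ab (@low_term _ _ _ _ _)).
Qed.

Lemma c2_term c a b i j :
  c2 (k2 c * vX ^+ a * vY ^+ b) i j = if (i == a) && (j == b) then c else 0.
Proof.
by rewrite -mulrA c2_constM c2_mon; case: ifP => _; rewrite ?mulr1 ?mulr0.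
Qed.

Lemma subst_coef X Y c a b t :
  (forall i j, c2 t i j = if (i == a) && (j == b) then c else 0) ->
  subst X Y t = k2 c * nz X ^+ a * nz Y ^+ b.
Proof.
move=> ct.
apply: low_eq => n; rewrite -(subrK (psum (n + (a + b).+1) t X Y) (subst X Y t)) -addrA.
apply: lowD; first by apply: (lowW _ (@subst_psum _ _ _ _)); exact: leq_addr.
rewrite (_ : psum _ _ _ _ = k2 c * nz X ^+ a * nz Y ^+ b).
  by rewrite subrr; exact: low0.
rewrite /psum.
have ha : (a < n + (a + b).+1)%N by rewrite addnS ltnS addnA (leq_trans _ (leq_addr _ _)) ?leq_addl.
have hb : (b < n + (a + b).+1)%N by rewrite addnS ltnS addnA leq_addl.
pose F a' b' := k2 (c2 t a' b') * nz X ^+ a' * nz Y ^+ b'.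
apply: (etrans (y := F a b)); last by rewrite /F ct !eqxx.
by apply: (sum2_single (F := F) ha hb) => i j h; rewrite /F ct h rmorph0 !mul0r.
Qed.

Lemma subst_mon X Y c a b :
  subst X Y (k2 c * vX ^+ a * vY ^+ b) = k2 c * nz X ^+ a * nz Y ^+ b.
Proof. by apply: subst_coef => i j; exact: c2_term. Qed.

Definition trunc n f : T2 := \sum_(a < n) \sum_(b < n) k2 (c2 f a b) * vX ^+ a * vY ^+ b.

Lemma c2_trunc n f i j :
  c2 (trunc n f) i j = if (i < n)%N && (j < n)%N then c2 f i j else 0.
Proof.
rewrite /trunc c2_sum.
have E (a b : nat) : c2 (k2 (c2 f a b) * vX ^+ a * vY ^+ b) i j =
    if (i == a) && (j == b) then c2 f a b else 0.
  exact: c2_term.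
under eq_bigr => a _ do rewrite c2_sum; under eq_bigr => a _ do under eq_bigr => b _ do rewrite E.
case: ltnP => hi /=; last first.
  by rewrite big1 // => a _; rewrite big1 // => b _; rewrite gtn_eqF // (leq_trans _ hi).
case: ltnP => hj; last first.
  by rewrite big1 // => a _; rewrite big1 // => b _; rewrite [j == b]gtn_eqF ?andbF // (leq_trans _ hj).
pose F a b := if (i == a) && (j == b) then c2 f a b else 0.
apply: (etrans (y := F i j)); last by rewrite /F !eqxx.
by apply: (sum2_single (F := F)) => // a b h; rewrite /F (eq_sym i) (eq_sym j) h.
Qed.

Lemma low_trunc n f : low n (f - trunc n f).
Proof.
move=> i j ij; rewrite c2B c2_trunc.
by rewrite (leq_ltn_trans (leq_addr j i)) // (leq_ltn_trans (leq_addl i j)) // subrr.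
Qed.

(** Density of polynomials for the degree filtration: the difference of the two maps vanishes on a
    truncation of f and has high order on the rest. Here k is the number of degrees that the maps
    may lose, 0 for substitutions and 1 for derivations. *)
Lemma additive_ext k (phi psi : T2 -> T2) :
  {morph phi : x y / x - y} -> {morph psi : x y / x - y} ->
  (forall n f, low (n + k) f -> low n (phi f)) ->
  (forall n f, low (n + k) f -> low n (psi f)) ->
  (forall c a b, phi (k2 c * vX ^+ a * vY ^+ b) = psi (k2 c * vX ^+ a * vY ^+ b)) ->
  forall f, phi f = psi f.
Proof.
move=> phiB psiB phil psil e f.
pose d g : T2 := phi g - psi g.
have dB : {morph d : x y / x - y} by move=> x y; rewrite /d phiB psiB; ring.
have d0 : d 0 = 0 by have := dB 0 0; rewrite !subrr.
have dN y : d (- y) = - d y by have := dB 0 y; rewrite sub0r d0 sub0r.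
have dD : {morph d : x y / x + y}.
  by move=> x y; rewrite -{1}[y]opprK dB dN opprK.
apply: low_eq => n; rewrite -/(d f) -(subrK (trunc (n + k) f) f) dD.
have -> : d (trunc (n + k) f) = 0.
  rewrite /trunc (big_morph d dD d0) big1 // => a _.
  by rewrite (big_morph d dD d0) big1 // => b _; rewrite /d e subrr.
have h := @low_trunc (n + k) f.
by rewrite addr0; apply: lowB; [apply: phil | apply: psil].
Qed.

Fact subst_is_monoid X Y : monoid_morphism (subst X Y).
Proof.
have sub1 : subst X Y 1 = 1.
  by have := subst_mon X Y 1 0 0; rewrite !expr0 !rmorph1 !mulr1.
split=> // f g; move: g.
(* Multiplicativity is reduced to monomials in one factor at a time. *)
apply: (@additive_ext 0 (fun g => subst X Y (f * g)) (fun g => subst X Y f * subst X Y g)).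
- by move=> x y; rewrite mulrBr raddfB.
- by move=> x y; rewrite raddfB mulrBr.
- by move=> n g; rewrite addn0 => h; apply: subst_low; apply: lowMl.
- by move=> n g; rewrite addn0 => h; apply: lowMl; apply: subst_low.
move=> c a b; move: f.
pose m := k2 c * vX ^+ a * vY ^+ b; rewrite -/m.
apply: (@additive_ext 0 (fun f => subst X Y (f * m)) (fun f => subst X Y f * subst X Y m)).
- by move=> x y; rewrite mulrBl raddfB.
- by move=> x y; rewrite raddfB mulrBl.
- by move=> n g; rewrite addn0 => h; apply: subst_low; apply: lowMr.
- by move=> n g; rewrite addn0 => h; apply: lowMr; apply: subst_low.
move=> c' a' b'; rewrite /m.
have E : k2 c' * vX ^+ a' * vY ^+ b' * (k2 c * vX ^+ a * vY ^+ b) =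
  k2 (c' * c) * vX ^+ (a' + a) * vY ^+ (b' + b).
  by rewrite rmorphM !exprD; ring.
by rewrite E !subst_mon rmorphM !exprD; ring.
Qed.
HB.instance Definition _ X Y :=
  GRing.isMonoidMorphism.Build T2 T2 (subst X Y) (subst_is_monoid X Y).

Lemma subst_const X Y c : subst X Y (k2 c) = k2 c.
Proof. by have := subst_mon X Y c 0 0; rewrite !expr0 !mulr1. Qed.
Lemma subst_X X Y : low 1 X -> subst X Y vX = X.
Proof. by move=> h; have := subst_mon X Y 1 1 0; rewrite !expr0 !expr1 !rmorph1 !mulr1 !mul1r nz_id. Qed.
Lemma subst_Y X Y : low 1 Y -> subst X Y vY = Y.
Proof. by move=> h; have := subst_mon X Y 1 0 1; rewrite !expr0 !expr1 !rmorph1 !mulr1 !mul1r nz_id. Qed.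

(** Recognizes a substitution from its values at x and y, so that composites, the identity and the
    restriction to an axis are identified without computing coefficients. *)
Lemma subst_uniq (phi : T2 -> T2) :
  {morph phi : x y / x - y} -> {morph phi : x y / x * y} ->
  (forall c, phi (k2 c) = k2 c) -> (forall n f, low n f -> low n (phi f)) ->
  forall f, phi f = subst (phi vX) (phi vY) f.
Proof.
move=> phiB phiM phic phil; apply: (@additive_ext 0).
- exact: phiB.
- exact: rmorphB.
- by move=> n f; rewrite addn0; apply: phil.
- by move=> n f; rewrite addn0; apply: subst_low.
have phiX f n : phi (f ^+ n) = phi f ^+ n.
  elim: n => [|n IH]; first by rewrite !expr0 -(rmorph1 (@k2)) phic.
  by rewrite !exprS phiM IH.
move=> c a b; rewrite subst_mon !phiM !phiX phic.
have -> : nz (phi vX) = phi vX by apply: nz_id; apply: phil; exact: low_X.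
have -> // : nz (phi vY) = phi vY by apply: nz_id; apply: phil; exact: low_Y.
Qed.

Lemma subst_comp U V X Y f : low 1 X -> low 1 Y ->
  subst U V (subst X Y f) = subst (subst U V X) (subst U V Y) f.
Proof.
move=> hX hY.
have -> := @subst_uniq (fun f => subst U V (subst X Y f)) _ _ _ _ f.
- by rewrite (@subst_X X Y hX) (@subst_Y X Y hY).
- by move=> x y; rewrite !rmorphB.
- by move=> x y; rewrite !rmorphM.
- by move=> c; rewrite !subst_const.
- by move=> n g gn; do 2!apply: subst_low.
Qed.

Lemma subst_id f : subst vX vY f = f.
Proof. by rewrite -(@subst_uniq id). Qed.

Definition pdx f : T2 := mk (fun j => tderiv (co f j)).
Definition pdy f : T2 := tderiv f.

Fact pdx_is_additive : {morph pdx : f g / f - g}.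
Proof. by move=> f g; apply: coP => j; rewrite coBE !coK coBE raddfB. Qed.
HB.instance Definition _ := GRing.isZmodMorphism.Build T2 T2 (pdx) pdx_is_additive.

Fact pdy_is_additive : {morph pdy : f g / f - g}.
Proof. exact: (raddfB (@tderiv _ T2)). Qed.
HB.instance Definition _ := GRing.isZmodMorphism.Build T2 T2 (pdy) pdy_is_additive.

Lemma c2_pdx f i j : c2 (pdx f) i j = c2 f i.+1 j *+ i.+1.
Proof. by rewrite /c2 coK tderivE. Qed.
Lemma c2_pdy f i j : c2 (pdy f) i j = c2 f i j.+1 *+ j.+1.
Proof.
by rewrite /c2 /pdy tderivE coMnE.
Qed.

Lemma pdxM f g : pdx (f * g) = pdx f * g + f * pdx g.
Proof.
have E g' j : co (pdx g') j = tderiv (co g' j) by rewrite coK.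
have dsum n (F : 'I_n -> T1) : tderiv (\sum_b F b) = \sum_b tderiv (F b).
  exact: (raddf_sum (@tderiv _ T1)).
apply: coP => j; rewrite E coDE !coME -big_split dsum.
by apply: eq_bigr => b _; rewrite tderivM !E.
Qed.
Lemma pdyM f g : pdy (f * g) = pdy f * g + f * pdy g.
Proof. exact: tderivM. Qed.

Lemma pdx_const c : pdx (k2 c) = 0.
Proof. by apply: c2P => i j; rewrite c2_pdx c2_const -[(i.+1 == 0%N) && _]/false mul0rn c20. Qed.
Lemma pdy_const c : pdy (k2 c) = 0.
Proof. by apply: c2P => i j; rewrite c2_pdy c2_const -[j.+1 == 0%N]/false andbF mul0rn c20. Qed.
Lemma pdx_X : pdx vX = 1.
Proof. by apply: c2P => i j; rewrite c2_pdx c2_X c21 eqSS; case: i => [|i]; rewrite ?mul0rn. Qed.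
Lemma pdx_Y : pdx vY = 0.
Proof. by apply: c2P => i j; rewrite c2_pdx c2_Y -[(i.+1 == 0%N) && _]/false mul0rn c20. Qed.
Lemma pdy_X : pdy vX = 0.
Proof. by apply: c2P => i j; rewrite c2_pdy c2_X -[j.+1 == 0%N]/false andbF mul0rn c20. Qed.
Lemma pdy_Y : pdy vY = 1.
Proof. by apply: c2P => i j; rewrite c2_pdy c2_Y c21 eqSS; case: j => [|j]; rewrite ?andbF ?mul0rn. Qed.

Section ChainRule.
Variable D : T2 -> T2.
Hypothesis DB : {morph D : f g / f - g}.
Hypothesis DM : forall f g, D (f * g) = D f * g + f * D g.
Hypothesis Dc : forall c, D (k2 c) = 0.
Hypothesis Dl : forall n f, low (n + 1) f -> low n (D f).

Lemma low_pdx n f : low (n + 1) f -> low n (pdx f).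
Proof. by move=> h i j ij; rewrite c2_pdx h ?mul0rn // addn1 addSn. Qed.
Lemma low_pdy n f : low (n + 1) f -> low n (pdy f).
Proof. by move=> h i j ij; rewrite c2_pdy h ?mul0rn // addn1 addnS. Qed.

(** D stands for either partial derivative. On monomials the formula is the Leibniz rule;
    [additive_ext] with one degree of loss extends it. *)
Lemma chain_rule X Y f : low 1 X -> low 1 Y ->
  D (subst X Y f) = subst X Y (pdx f) * D X + subst X Y (pdy f) * D Y.
Proof.
move=> hX hY; move: f; apply: (@additive_ext 1 (fun f => D (subst X Y f))
  (fun f => subst X Y (pdx f) * D X + subst X Y (pdy f) * D Y)).
- by move=> x y; rewrite rmorphB DB.
- by move=> x y; rewrite pdx_is_additive pdy_is_additive !rmorphB !mulrBl opprD addrACA.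
- by move=> n f h; apply: Dl; apply: subst_low.
- move=> n f h; apply: lowD; apply: lowMr; apply: subst_low;
    [exact: low_pdx | exact: low_pdy].
move=> c a b; rewrite subst_mon !nz_id //.
rewrite !DM !pdxM !pdyM Dc pdx_const pdy_const !mul0r !add0r.
rewrite !(leibniz_exp DM) !(leibniz_exp pdxM) !(leibniz_exp pdyM).
rewrite pdx_X pdx_Y pdy_X pdy_Y !mulr0 !mul0rn !mulr0 !mul0r addr0 add0r !mulr1.
rewrite !rmorphM !rmorphMn !rmorphXn /= subst_const subst_X // subst_Y //.
rewrite !(mulrnAr, mulrnAl); congr (_ *+ _ + _ *+ _); ring.
Qed.
End ChainRule.

Lemma pdx_subst X Y f : low 1 X -> low 1 Y ->
  pdx (subst X Y f) = subst X Y (pdx f) * pdx X + subst X Y (pdy f) * pdx Y.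
Proof.
apply: chain_rule; [exact: pdx_is_additive | exact: pdxM | exact: pdx_const | exact: low_pdx].
Qed.

Lemma pdy_subst X Y f : low 1 X -> low 1 Y ->
  pdy (subst X Y f) = subst X Y (pdx f) * pdy X + subst X Y (pdy f) * pdy Y.
Proof.
apply: chain_rule; [exact: pdy_is_additive | exact: pdyM | exact: pdy_const | exact: low_pdy].
Qed.

End TwoVar.
Arguments vX {R T1 T2}.
Arguments vY {R T1 T2}.
Arguments k2 {R T1 T2}.
#[global] Hint Resolve domC dom1 dom2 low_X low_Y low0 : core.

(** * Weighted norms and convergence *)

#[global] Arguments ComplexField.Normc.normc : simpl never.

(** The Cauchy sums run over the triangle i + j < n, which is part of the square on the right. *)
Lemma cauchy_prod_le (R : numDomainType) n (F G : nat -> R) :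
  (forall i, 0 <= F i) -> (forall i, 0 <= G i) ->
  \sum_(i < n) \sum_(j < i.+1) F j * G (i - j)%N <=
  (\sum_(i < n) F i) * (\sum_(i < n) G i).
Proof.
elim: n F => [|n IH] F F0 G0; first by rewrite !big_ord0 mul0r.
under eq_bigr => i _ do rewrite big_ord_recl subn0 /=.
rewrite big_split /= -mulr_sumr [X in _ <= X * _]big_ord_recl mulrDl lerD2l.
rewrite big_ord_recl big_ord0 add0r.
rewrite (_ : \sum_(i < n) _ = \sum_(i < n) \sum_(j < i.+1) F j.+1 * G (i - j)%N); last first.
  by apply: eq_bigr => i _; apply: eq_bigr.
apply: (@le_trans _ _ ((\sum_(i < n) F i.+1) * \sum_(i < n) G i)).
  exact: (IH (fun i => F i.+1)).
apply: ler_wpM2l; first by apply: sumr_ge0.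
by rewrite big_ord_recr lerDl.
Qed.

Lemma sum_shift_le (R : numDomainType) n p N (F : nat -> R) : (forall i, 0 <= F i) ->
  (n + p <= N)%N -> \sum_(i < n) F (i + p)%N <= \sum_(i < N) F i.
Proof.
move=> F0 h; rewrite -(big_mkord xpredT (fun i => F (i + p)%N)).
have := big_addn 0 (n + p) p xpredT F; rewrite add0n addnK => <-.
rewrite -(big_mkord xpredT F) [leRHS](@big_cat_nat _ _ _ p) //=; last first.
  by apply: leq_trans h; exact: leq_addl.
rewrite [X in _ + X](@big_cat_nat _ _ _ (n + p)) ?leq_addl //=.
rewrite addrCA lerDl addr_ge0 //; apply: sumr_ge0 => //.
Qed.

Section Seminorm.
Variables (R : numDomainType) (K : comNzRingType) (T : fps_theory K).

(** Abstract, so that [tnorm] can be applied twice, once for each variable. *)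
Definition seminorm (L : comNzRingType) (N : L -> R) :=
  [/\ forall a, 0 <= N a, N 0 = 0, forall a b, N (a + b) <= N a + N b &
      forall a b, N (a * b) <= N a * N b].

Lemma seminorm_sum (L : comNzRingType) (N : L -> R) (I : Type) (r : seq I) (P : pred I) (F : I -> L) :
  seminorm N -> N (\sum_(i <- r | P i) F i) <= \sum_(i <- r | P i) N (F i).
Proof.
case=> N0 N00 ND NM; elim/big_rec2: _ => [|i y1 y2 _ h]; first by rewrite N00.
by apply: le_trans (ND _ _) _; rewrite lerD2l.
Qed.

Lemma seminorm_exp (L : comNzRingType) (N : L -> R) x rho n :
  seminorm N -> N 1 <= 1 -> N x <= rho -> N (x ^+ n) <= rho ^+ n.
Proof.
move=> sN N1 xr; have [N0 _ _ NM] := sN; elim: n => [|n IH]; first by rewrite !expr0.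
by rewrite !exprS; apply: le_trans (NM _ _) _; apply: ler_pM.
Qed.

(** Truncation keeps the sum finite and the norm submultiplicative, because the coefficients below n
    of a product involve only coefficients below n of the factors. *)
Definition tnorm (N : K -> R) n r (u : T) := \sum_(i < n) r ^+ i * N (co u i).

Lemma tnorm_seminorm (N : K -> R) n r : 0 <= r -> seminorm N -> seminorm (tnorm N n r).
Proof.
move=> r0 sN; have [N0 N00 ND NM] := sN; split.
- by move=> u; apply: sumr_ge0 => i _; rewrite mulr_ge0 ?exprn_ge0.
- by rewrite /tnorm big1 // => i _; rewrite co0E N00 mulr0.
- move=> u v; rewrite /tnorm -big_split /=; apply: ler_sum => i _.
  by rewrite -mulrDr coDE ler_wpM2l ?exprn_ge0.
move=> u v; rewrite /tnorm.
apply: le_trans (cauchy_prod_le n (F := fun i => r ^+ i * N (co u i))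
   (G := fun i => r ^+ i * N (co v i)) _ _); last 2 first.
- by move=> i; rewrite mulr_ge0 ?exprn_ge0.
- by move=> i; rewrite mulr_ge0 ?exprn_ge0.
apply: ler_sum => i _; rewrite coME.
apply: (@le_trans _ _ (r ^+ i * \sum_(j < i.+1) N (co u j) * N (co v (i - j)%N))).
  rewrite ler_wpM2l ?exprn_ge0 //; apply: le_trans (seminorm_sum _ _ _ sN) _.
  by apply: ler_sum.
rewrite mulr_sumr; apply: ler_sum => j _.
have ji : (j <= i)%N by rewrite -ltnS.
by rewrite mulrACA -exprD subnKC.
Qed.

Lemma tnorm_mono (N : K -> R) m n r u : 0 <= r -> (forall a, 0 <= N a) -> (m <= n)%N ->
  tnorm N m r u <= tnorm N n r u.
Proof.
move=> r0 N0 /subnKC <-; rewrite /tnorm big_split_ord lerDl.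
by apply: sumr_ge0 => i _; rewrite mulr_ge0 ?exprn_ge0.
Qed.
End Seminorm.

Section Norm2.
Variables (R : realType) (T1 : fps_theory R[i]) (T2 : fps_theory T1).
Local Notation C := R[i].
Implicit Types (f g h X Y : T2) (c : C) (u v : T1) (r s M : R).
Local Notation normc := (@ComplexField.Normc.normc R).

Lemma normc_ge0 c : 0 <= normc c.
Proof. by case: c => a b; exact: sqrtr_ge0. Qed.

Lemma nc0 : normc 0 = 0. Proof. exact: ComplexField.Normc.normc0. Qed.
Lemma nc1 : normc 1 = 1. Proof. exact: ComplexField.Normc.normc1. Qed.
Lemma ncM a b : normc (a * b) = normc a * normc b.
Proof. exact: ComplexField.Normc.normcM. Qed.

Lemma normc_seminorm : seminorm normc.
Proof.
split.
- exact: normc_ge0.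
- exact: nc0.
- exact: le_normcD.
- by move=> a b; rewrite ncM.
Qed.

Definition nm n r s f : R := tnorm (tnorm normc n r) n s f.

Lemma nmE n r s f :
  nm n r s f = \sum_(j < n) \sum_(i < n) r ^+ i * s ^+ j * normc (c2 f i j).
Proof.
apply: eq_bigr => j _; rewrite mulr_sumr; apply: eq_bigr => i _.
by rewrite mulrA [s ^+ j * _]mulrC.
Qed.

Lemma nm_seminorm n r s : 0 <= r -> 0 <= s -> seminorm (nm n r s).
Proof. by move=> r0 s0; do 2!apply: tnorm_seminorm => //; exact: normc_seminorm. Qed.

Lemma nm_ge0 n r s f : 0 <= r -> 0 <= s -> 0 <= nm n r s f.
Proof. by move=> r0 s0; have [] := nm_seminorm n r0 s0. Qed.
Lemma nmD n r s f g : 0 <= r -> 0 <= s -> nm n r s (f + g) <= nm n r s f + nm n r s g.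
Proof. by move=> r0 s0; have [] := nm_seminorm n r0 s0. Qed.
Lemma nmM n r s f g : 0 <= r -> 0 <= s -> nm n r s (f * g) <= nm n r s f * nm n r s g.
Proof. by move=> r0 s0; have [] := nm_seminorm n r0 s0. Qed.

Lemma nm_le n r s r' s' f g :
  (forall i j, (i < n)%N -> (j < n)%N ->
    r ^+ i * s ^+ j * normc (c2 f i j) <= r' ^+ i * s' ^+ j * normc (c2 g i j)) ->
  nm n r s f <= nm n r' s' g.
Proof. by move=> h; rewrite !nmE; apply: ler_sum => j _; apply: ler_sum => i _; apply: h. Qed.

Lemma nm_eq n r s f g :
  (forall i j, (i < n)%N -> (j < n)%N -> c2 f i j = c2 g i j) -> nm n r s f = nm n r s g.
Proof. by move=> h; rewrite !nmE; apply: eq_bigr => j _; apply: eq_bigr => i _; rewrite h. Qed.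

Lemma nm_leM n r s r' s' f g k :
  (forall i j, (i < n)%N -> (j < n)%N ->
    r ^+ i * s ^+ j * normc (c2 f i j) <= k * (r' ^+ i * s' ^+ j * normc (c2 g i j))) ->
  nm n r s f <= k * nm n r' s' g.
Proof.
move=> h; rewrite !nmE mulr_sumr; apply: ler_sum => j _.
by rewrite mulr_sumr; apply: ler_sum => i _; apply: h.
Qed.

Lemma nm_mono_n m n r s f : 0 <= r -> 0 <= s -> (m <= n)%N -> nm m r s f <= nm n r s f.
Proof.
move=> r0 s0 mn; apply: (@le_trans _ _ (tnorm (tnorm normc n r) m s f)).
  by apply: ler_sum => j _; rewrite ler_wpM2l ?exprn_ge0 // tnorm_mono //; exact: normc_ge0.
apply: tnorm_mono => // a; apply: sumr_ge0 => i _.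
by rewrite mulr_ge0 ?exprn_ge0 ?normc_ge0.
Qed.

Lemma weight_ge0 r s i j c : 0 <= r -> 0 <= s -> 0 <= r ^+ i * s ^+ j * normc c.
Proof. by move=> r0 s0; rewrite !mulr_ge0 ?exprn_ge0 ?normc_ge0. Qed.

Lemma nm_mono_r n r s r' s' f : 0 <= r <= r' -> 0 <= s <= s' -> nm n r s f <= nm n r' s' f.
Proof.
move=> /andP[r0 rr] /andP[s0 ss]; apply: nm_le => i j _ _.
rewrite ler_wpM2r ?normc_ge0 // ler_pM ?exprn_ge0 // lerXn2r ?nnegrE //.
  exact: le_trans rr.
exact: le_trans ss.
Qed.

Lemma nm_single n r s a b f : 0 <= r -> 0 <= s ->
  (forall i j, (i == a) && (j == b) = false -> c2 f i j = 0) ->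
  nm n r s f <= r ^+ a * s ^+ b * normc (c2 f a b).
Proof.
move=> r0 s0 h; rewrite nmE exchange_big /=.
pose F i j := r ^+ i * s ^+ j * normc (c2 f i j).
have F0 i j : (i == a) && (j == b) = false -> F i j = 0.
  by move=> /h e; rewrite /F e nc0 mulr0.
case: (boolP ((a < n)%N && (b < n)%N)) => [/andP[an bn]|nab].
  by rewrite (sum2_single (F := F) an bn F0).
rewrite big1 ?weight_ge0 // => i _; rewrite big1 // => j _; apply: F0.
by apply/negP => /andP[/eqP ia /eqP jb]; rewrite -ia -jb !ltn_ord in nab.
Qed.

Lemma nm_const_le n r s c : 0 <= r -> 0 <= s -> nm n r s (k2 c) <= normc c.
Proof.
move=> r0 s0; apply: le_trans (nm_single n (a := 0) (b := 0) r0 s0 _) _.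
  by move=> i j h; rewrite c2_const h.
by rewrite c2_const !expr0 !mul1r.
Qed.

Lemma nm1_le n r s : 0 <= r -> 0 <= s -> nm n r s 1 <= 1.
Proof.
move=> r0 s0; rewrite -(rmorph1 (@k2 _ _ T2)).
by apply: le_trans (nm_const_le n _ r0 s0) _; rewrite nc1.
Qed.

Lemma nm_X n r s : 0 <= r -> 0 <= s -> nm n r s vX <= r.
Proof.
move=> r0 s0; apply: le_trans (nm_single n (a := 1) (b := 0) r0 s0 _) _.
  by move=> i j h; rewrite c2_X h.
by rewrite c2_X !eqxx nc1 !mulr1.
Qed.

Lemma nm_Y n r s : 0 <= r -> 0 <= s -> nm n r s vY <= s.
Proof.
move=> r0 s0; apply: le_trans (nm_single n (a := 0) (b := 1) r0 s0 _) _.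
  by move=> i j h; rewrite c2_Y h.
by rewrite c2_Y !eqxx nc1 mulr1 mul1r.
Qed.

Lemma nm_subst n r s rho sigma X Y f : 0 <= r -> 0 <= s -> low 1 X -> low 1 Y ->
  nm n r s X <= rho -> nm n r s Y <= sigma ->
  nm n r s (subst X Y f) <= nm (n + n) rho sigma f.
Proof.
move=> r0 s0 hX hY nX nY.
have rho0 : 0 <= rho by apply: le_trans nX; exact: nm_ge0.
have sig0 : 0 <= sigma by apply: le_trans nY; exact: nm_ge0.
have sN := nm_seminorm n r0 s0; have [N0 N00 ND NM] := sN.
(* Exponents below n in each variable have total degree below n + n, so this partial sum already has
   the right coefficients. *)
rewrite (@nm_eq _ _ _ _ (psum (n + n) f X Y)) => [|i j hi hj]; last first.
  have := @subst_psum _ _ _ (n + n) X Y f i j.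
  rewrite c2B => h; apply/eqP; rewrite -subr_eq0; apply/eqP; apply: h.
  by rewrite -addSn; apply: leq_add => //; exact: ltnW.
rewrite [leRHS]nmE exchange_big /= /psum.
apply: le_trans (seminorm_sum _ _ _ sN) _; apply: ler_sum => a _.
apply: le_trans (seminorm_sum _ _ _ sN) _; apply: ler_sum => b _.
rewrite !nz_id //.
apply: le_trans (NM _ _) _.
rewrite [leRHS]mulrAC; apply: ler_pM => //; last by apply: seminorm_exp => //; exact: nm1_le.
apply: le_trans (NM _ _) _; rewrite mulrC.
by apply: ler_pM => //; [apply: seminorm_exp => //; exact: nm1_le | exact: nm_const_le].
Qed.

(** A bound uniform in the truncation replaces the value of an infinite norm. *)
Definition bnd r s f M := forall n, nm n r s f <= M.
Definition cvgt f := exists r, 0 < r /\ exists M, bnd r r f M.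

Lemma bnd_ge0 r s f M : bnd r s f M -> 0 <= M.
Proof. by move/(_ 0%N); rewrite nmE big_ord0. Qed.

Lemma bnd_mono r s r' s' f M : 0 <= r' <= r -> 0 <= s' <= s -> bnd r s f M -> bnd r' s' f M.
Proof. by move=> hr hs b n; apply: le_trans (b n); exact: nm_mono_r. Qed.

Lemma cvgtP f r s M : 0 < r -> 0 < s -> bnd r s f M -> cvgt f.
Proof.
move=> r0 s0 b; exists (Num.min r s); split; first by rewrite lt_min r0.
exists M; apply: bnd_mono b; rewrite ge_min lexx ?orbT ?andbT /= le_min !ltW //.
Qed.

Lemma bndD r s f g M N : 0 <= r -> 0 <= s -> bnd r s f M -> bnd r s g N -> bnd r s (f + g) (M + N).
Proof. by move=> r0 s0 bf bg n; apply: le_trans (nmD n f g r0 s0) _; exact: lerD. Qed.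
Lemma bndM r s f g M N : 0 <= r -> 0 <= s -> bnd r s f M -> bnd r s g N -> bnd r s (f * g) (M * N).
Proof. by move=> r0 s0 bf bg n; apply: le_trans (nmM n f g r0 s0) _; apply: ler_pM; rewrite ?nm_ge0. Qed.
Lemma bndN r s f M : bnd r s f M -> bnd r s (- f) M.
Proof.
move=> b n; apply: le_trans (b n); apply: nm_le => i j _ _.
by rewrite c2N normcN.
Qed.
Lemma bnd_const r s c : 0 <= r -> 0 <= s -> bnd r s (k2 c) (normc c).
Proof. by move=> r0 s0 n; exact: nm_const_le. Qed.

Lemma cvgt2 f g : cvgt f -> cvgt g -> exists r, 0 < r /\ exists M N, bnd r r f M /\ bnd r r g N.
Proof.
move=> [r [r0 [M b]]] [s [s0 [N d]]]; exists (Num.min r s); split; first by rewrite lt_min r0.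
exists M, N; split; [apply: bnd_mono b | apply: bnd_mono d];
  by rewrite ge_min lexx ?orbT ?andbT /= le_min !ltW.
Qed.

Lemma cvgtD f g : cvgt f -> cvgt g -> cvgt (f + g).
Proof.
move=> hf /(cvgt2 hf) [r [r0 [M [N [b d]]]]]; exists r; split => //; exists (M + N).
by apply: bndD; rewrite ?ltW.
Qed.
Lemma cvgtM f g : cvgt f -> cvgt g -> cvgt (f * g).
Proof.
move=> hf /(cvgt2 hf) [r [r0 [M [N [b d]]]]]; exists r; split => //; exists (M * N).
by apply: bndM; rewrite ?ltW.
Qed.
Lemma cvgtN f : cvgt f -> cvgt (- f).
Proof. by move=> [r [r0 [M b]]]; exists r; split=> //; exists M; exact: bndN. Qed.
Lemma cvgtB f g : cvgt f -> cvgt g -> cvgt (f - g).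
Proof. by move=> hf hg; apply: cvgtD => //; exact: cvgtN. Qed.
Lemma cvgt_const c : cvgt (k2 c).
Proof. by exists 1; split=> //; exists (normc c); apply: bnd_const. Qed.
Lemma cvgt1 : cvgt 1. Proof. by rewrite -(rmorph1 (@k2 _ _ T2)); exact: cvgt_const. Qed.
Lemma cvgt0 : cvgt 0. Proof. by rewrite -(rmorph0 (@k2 _ _ T2)); exact: cvgt_const. Qed.
Lemma cvgt_X : cvgt vX.
Proof. by exists 1; split=> //; exists 1 => n; apply: nm_X. Qed.
Lemma cvgt_Y : cvgt vY.
Proof. by exists 1; split=> //; exists 1 => n; apply: nm_Y. Qed.
Lemma cvgt_exp f n : cvgt f -> cvgt (f ^+ n).
Proof. by move=> h; elim: n => [|n IH]; [exact: cvgt1 | rewrite exprS; exact: cvgtM]. Qed.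
Lemma cvgt_prod (I : eqType) (r : seq I) (F : I -> T2) :
  (forall i, i \in r -> cvgt (F i)) -> cvgt (\prod_(i <- r) F i).
Proof.
move=> h; rewrite big_seq; elim/big_ind: _ => //; [exact: cvgt1 | exact: cvgtM].
Qed.

(** Without a constant term, every monomial gains at least one factor l when the radius is
    multiplied by l <= 1, so a small l makes the norm small. *)
Lemma bnd_small X : cvgt X -> low 1 X -> forall rho, 0 < rho ->
  exists2 r, 0 < r & bnd r r X rho.
Proof.
move=> [r [r0 [M b]]] hX rho rho0.
have M0 := bnd_ge0 b.
pose l := Num.min 1 (rho / (M + 1)).
have l0 : 0 < l by rewrite lt_min ltr01 divr_gt0 // ltr_wpDl.
have l1 : l <= 1 by rewrite ge_min lexx.
exists (l * r); first by rewrite mulr_gt0.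
move=> n; apply: (@le_trans _ _ (l * nm n r r X)).
  apply: nm_leM => i j _ _; case: (posnP (i + j)) => [ij|ij].
    rewrite hX ?ij // nc0 !mulr0 //.
  rewrite mulrA ler_wpM2r ?normc_ge0 // -!exprD exprMn.
  apply: ler_wpM2r; first by rewrite exprn_ge0 ?ltW.
  case: (i + j)%N ij => // k _; rewrite exprS; apply: ler_piMr; first exact: ltW.
  by apply: exprn_ile1 => //; exact: ltW.
apply: (@le_trans _ _ (l * (M + 1))).
  by rewrite ler_wpM2l ?(ltW l0) // (le_trans (b n)) // lerDl.
by rewrite -ler_pdivlMr ?ltr_wpDl // /l ge_min lexx orbT.
Qed.

Lemma bnd_subst r s rho sigma X Y f M : 0 <= r -> 0 <= s -> low 1 X -> low 1 Y ->
  bnd r s X rho -> bnd r s Y sigma -> bnd rho sigma f M -> bnd r s (subst X Y f) M.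
Proof.
move=> r0 s0 hX hY bX bY bf n; apply: le_trans (bf (n + n)%N).
exact: nm_subst.
Qed.

Lemma cvgt_subst X Y f : cvgt X -> cvgt Y -> low 1 X -> low 1 Y -> cvgt f -> cvgt (subst X Y f).
Proof.
move=> cX cY hX hY [rho [rho0 [M bf]]].
have [r r0 bX] := bnd_small cX hX rho0.
have [s s0 bY] := bnd_small cY hY rho0.
pose t := Num.min r s.
have t0 : 0 < t by rewrite lt_min r0.
exists t; split => //; exists M; apply: bnd_subst bf => //; try exact: ltW.
  by apply: bnd_mono bX; rewrite (ltW t0) /t ge_min lexx.
by apply: bnd_mono bY; rewrite (ltW t0) /t ge_min lexx orbT.
Qed.

Lemma cvgt_sub_coef p q f g k : (0 < k) -> cvgt f ->
  (forall i j, normc (c2 g i j) <= k * normc (c2 f (i + p) (j + q))) -> cvgt g.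
Proof.
move=> k0 [r [r0 [M b]]] h.
pose l := r ^+ (p + q).
have l0 : 0 < l by rewrite exprn_gt0.
exists r; split => //; exists (k / l * M) => n.
apply: le_trans (ler_wpM2l _ (b (n + (p + q))%N)); last by rewrite ltW // divr_gt0.
rewrite nmE [nm (n + _) _ _ _]nmE.
pose F i j := r ^+ i * r ^+ j * normc (c2 f i j).
have F0 i j : 0 <= F i j by apply: weight_ge0; exact: ltW.
apply: (@le_trans _ _ (k / l * \sum_(j < n) \sum_(i < n) F (i + p)%N (j + q)%N)).
  rewrite mulr_sumr; apply: ler_sum => j _; rewrite mulr_sumr; apply: ler_sum => i _.
  apply: le_trans (ler_wpM2l _ (h i j)) _; first by rewrite mulr_ge0 ?exprn_ge0 ?ltW.
  rewrite /F /l le_eqVlt; apply/orP; left; apply/eqP.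
  by rewrite !exprD; field; rewrite ?expf_neq0 ?lt0r_neq0.
apply: ler_wpM2l; first by rewrite ltW // divr_gt0.
apply: (@le_trans _ _ (\sum_(j < n) \sum_(i < n + (p + q)) F i (j + q)%N)).
  apply: ler_sum => j _; apply: (@sum_shift_le _ n p _ (fun i => F i (j + q)%N)) => //.
  by rewrite leq_add2l leq_addr.
apply: (@sum_shift_le _ n q _ (fun j => \sum_(i < n + (p + q)) F i j)).
  by move=> j; apply: sumr_ge0.
by rewrite leq_add2l leq_addl.
Qed.

Lemma cvgt_divX n f g : cvgt f -> f = vX ^+ n * g -> cvgt g.
Proof.
move=> cf e; apply: (@cvgt_sub_coef n 0 f g 1) => // i j.
by rewrite mul1r addn0 e c2_XM ltnNge leq_addl addnK.
Qed.

Lemma cvgt_divY n f g : cvgt f -> f = vY ^+ n * g -> cvgt g.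
Proof.
move=> cf e; apply: (@cvgt_sub_coef 0 n f g 1) => // i j.
by rewrite mul1r addn0 e c2_YM ltnNge leq_addl addnK.
Qed.

Lemma ltn_expR n : (n.+1)%:R <= 2 ^+ n :> R.
Proof. by rewrite -natrX ler_nat ltn_expl. Qed.

(** Halving the radius divides the term of degree n by 2^n, which absorbs the factor n + 1. *)
Lemma cvgt_lin f g : cvgt f ->
  (forall i j, normc (c2 g i j) <= (i + j).+1%:R * normc (c2 f i j)) -> cvgt g.
Proof.
move=> [r [r0 [M b]]] h; exists (r / 2); split; first by rewrite divr_gt0.
exists M => n; apply: le_trans (b n); apply: nm_le => i j _ _.
have -> : (r / 2) ^+ i * (r / 2) ^+ j = (r ^+ i * r ^+ j) * 2^-1 ^+ (i + j).
  by rewrite !exprMn exprD; ring.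
rewrite -[leLHS]mulrA ler_wpM2l ?mulr_ge0 ?exprn_ge0 ?(ltW r0) //.
apply: le_trans (ler_wpM2l _ (h i j)) _; first by rewrite exprn_ge0.
rewrite mulrA ler_piMl ?normc_ge0 // exprVn mulrC ler_pdivrMr ?exprn_gt0 // mul1r.
exact: ltn_expR.
Qed.

Lemma cvgt_pdx f : cvgt f -> cvgt (pdx f).
Proof.
(* The series x f_x has its coefficients at the same places as f, so that [cvgt_lin] compares them
   directly; dividing by x preserves convergence. *)
move=> cf; apply: (@cvgt_divX 1 (vX ^+ 1 * pdx f)) => //.
apply: (cvgt_lin cf) => i j; rewrite c2_XM; case: i => [|i] /=.
  by rewrite nc0 mulr_ge0 ?normc_ge0.
rewrite subSS subn0 c2_pdx normcMn -[_ *+ _]mulr_natl ler_wpM2r ?normc_ge0 // ler_nat.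
by rewrite addSn !ltnS ltnW // ltnS leq_addr.
Qed.

Lemma cvgt_pdy f : cvgt f -> cvgt (pdy f).
Proof.
move=> cf; apply: (@cvgt_divY 1 (vY ^+ 1 * pdy f)) => //.
apply: (cvgt_lin cf) => i j; rewrite c2_YM; case: j => [|j] /=.
  by rewrite nc0 mulr_ge0 ?normc_ge0.
rewrite subSS subn0 c2_pdy normcMn -[_ *+ _]mulr_natl ler_wpM2r ?normc_ge0 // ler_nat.
by rewrite addnS !ltnS ltnW // ltnS leq_addl.
Qed.

End Norm2.

(** * Implicit functions, inverses and quotients of convergent series *)

Section Implicit.
Variables (R : realType) (T1 : fps_theory R[i]) (T2 : fps_theory T1).
Local Notation C := R[i].
Implicit Types (f g h X Y : T2) (c : C) (u v : T1) (r s M : R).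
Local Notation normc := (@ComplexField.Normc.normc R).

Lemma subst_ydrop f : subst vX 0 f = tconst (co f 0).
Proof.
have E g i j : c2 (tconst (co g 0) : T2) i j = if j == 0%N then c2 g i 0 else 0.
  by rewrite c2_tconst.
rewrite (@subst_uniq _ _ _ (fun f : T2 => tconst (co f 0) : T2)).
- congr (subst _ _ f); apply: c2P => i j; rewrite E; case: eqP => [->//|/eqP/negbTE j0].
    by rewrite c2_X j0 andbF.
    by rewrite c20 c2_Y andbF.
  by rewrite c20.
- by move=> x y; rewrite coBE rmorphB.
- by move=> x y; rewrite coM0 rmorphM.
- by move=> c; apply: c2P => i j; rewrite E !c2_const; case: j => [|j]; rewrite ?andbF.
by move=> n g gn i j ij; rewrite E; case: eqP => // j0; apply: gn; rewrite j0 in ij.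
Qed.

Lemma subst_congr n X Y X' Y' f : low 1 X -> low 1 Y -> low 1 X' -> low 1 Y' ->
  low n (X - X') -> low n (Y - Y') -> low n (subst X Y f - subst X' Y' f).
Proof.
move=> hX hY hX' hY' dX dY.
have pX Z Z' k : low n (Z - Z') -> low n (Z ^+ k - Z' ^+ k).
  by move=> h; rewrite subrXX; apply: lowMr.
rewrite -(subrK (psum n f X Y) (subst X Y f)) -addrA; apply: lowD; first exact: subst_psum.
rewrite -opprB -(subrK (psum n f X' Y') (subst X' Y' f)) -addrA; apply: lowN.
apply: lowD; first exact: subst_psum.
rewrite /psum -sumrB; apply: low_sum => a _; rewrite -sumrB; apply: low_sum => b _.
rewrite !nz_id // -!mulrA -mulrBr; apply: lowMl.
have -> : X' ^+ a * Y' ^+ b - X ^+ a * Y ^+ b =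
   - ((X ^+ a - X' ^+ a) * Y' ^+ b + X ^+ a * (Y ^+ b - Y' ^+ b)) by ring.
by apply: lowN; apply: lowD; [apply: lowMr | apply: lowMl]; apply: pX.
Qed.

(** * The fixed point equation y = G(x, y) *)

Section ImplicitIter.
Variable G : T2.
Hypotheses (G00 : c2 G 0 0 = 0) (G01 : c2 G 0 1 = 0).

Let A : T2 := mk (fun j => mk (fun i => c2 G i.+1 j)).
Let B : T2 := mk (fun j => mk (fun i => if i == 0%N then c2 G 0 j.+2 else 0)).

(** A collects the monomials divisible by x, B the pure powers of y from y^2 on. Each term has a
    factor x or y^2 in front, which makes Y -> G(x, Y) gain one degree, hence contracting. *)
Lemma implicit_split : G = vX * A + vY ^+ 2 * B.
Proof.
have cA i j : c2 A i j = c2 G i.+1 j by rewrite /c2 !coK.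
have cB i j : c2 B i j = if i == 0%N then c2 G 0 j.+2 else 0 by rewrite /c2 !coK.
apply: c2P => i j; rewrite c2D -[vX]expr1 c2_XM c2_YM cA cB.
case: i => [|i] /=; last by rewrite subn1 /= if_same addr0.
by rewrite add0r; case: j => [|[|j]] //=; rewrite subSS subSS subn0.
Qed.

Lemma implicit_contract m Y Y' : low 1 Y -> low 1 Y' -> low m (Y - Y') ->
  low m.+1 (subst vX Y G - subst vX Y' G).
Proof.
move=> hY hY' d; rewrite implicit_split expr2 !rmorphD !rmorphM /=.
rewrite !subst_X // !subst_Y //.
have dc f : low m (subst vX Y f - subst vX Y' f).
  by apply: subst_congr => //; rewrite subrr; exact: low0.
have -> a a' b b' : vX * a + Y * Y * b - (vX * a' + Y' * Y' * b') =
  vX * (a - a') + (Y ^+ 2 * (b - b') + (Y + Y') * (Y - Y') * b') by ring.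
apply: lowD; first by rewrite -add1n; apply: lowM => //; exact: dc.
apply: lowD.
  by apply: (@lowW _ _ _ _ (2 + m)%N) => //; apply: lowM; [exact: lowX | exact: dc].
by apply: lowMr; rewrite -add1n; apply: lowM => //; exact: lowD.
Qed.

Let psi k : T2 := iter k (fun Y => subst vX Y G) 0.

Lemma low_psi k : low 1 (psi k).
Proof.
case: k => [|k]; first exact: low0.
by apply: subst_low; apply/low1E.
Qed.

Lemma psi_step k : low k.+1 (psi k.+1 - psi k).
Proof.
elim: k => [|k IH]; first by rewrite /psi /= subr0; exact: low_psi 1%N.
exact: (implicit_contract (low_psi _) (low_psi _) IH).
Qed.

Lemma psi_stable m k : (m <= k)%N -> low m.+1 (psi k - psi m).
Proof.
move=> /subnKC <-; elim: (k - m)%N => [|d IH]; first by rewrite addn0 subrr; exact: low0.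
rewrite addnS -(subrK (psi (m + d)) (psi _)) -addrA; apply: lowD => //.
by apply: (lowW _ (@psi_step (m + d)%N)); rewrite ltnS leq_addr.
Qed.

(** By [psi_stable] the coefficient at x^i y^j no longer changes from iterate i + j on. *)
Let fixp : T2 := mk (fun j => mk (fun i => c2 (psi (i + j)) i j)).

Lemma fixp_psi k : low k.+1 (fixp - psi k).
Proof.
move=> i j ij; rewrite c2B {1}/c2 !coK.
have := @psi_stable (i + j)%N k ij i j (ltnSn _).
by rewrite c2B => /eqP; rewrite subr_eq0 => /eqP ->; rewrite subrr.
Qed.

Lemma low_fixp : low 1 fixp.
Proof. by rewrite -(subrK (psi 0) fixp); apply: lowD; [exact: fixp_psi | exact: low_psi]. Qed.

Lemma fixpE : subst vX fixp G = fixp.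
Proof.
apply: low_eq => n; rewrite -(subrK (psi n.+1) (subst _ _ _)) -addrA; apply: lowD.
  apply: (@lowW _ _ _ _ n.+2); first by rewrite ltnW.
  exact: (implicit_contract low_fixp (low_psi _) (@fixp_psi n)).
by rewrite -opprB; apply: lowN; apply: (@lowW _ _ _ _ n.+2); [rewrite ltnW | exact: fixp_psi].
Qed.

Lemma fixp_cvgt : cvgt G -> cvgt fixp.
Proof.
move=> [r0 [r00 [M b]]]; have M0 := bnd_ge0 b.
pose l := Num.min 1 (r0 / (2 * (M + 1))).
have l0 : 0 < l by rewrite lt_min ltr01 divr_gt0 // mulr_gt0 // ltr_wpDl.
have l1 : l <= 1 by rewrite ge_min lexx.
have lM : l * M <= r0 / 2.
  apply: (@le_trans _ _ (l * (M + 1))); first by rewrite ler_wpM2l ?(ltW l0) // lerDl.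
  rewrite -ler_pdivlMr ?ltr_wpDl // -mulrA -invfM /l ge_min; apply/orP; right.
  by [].
(* The monomials x^i y^j of G satisfy 2 i + j >= 2, so replacing the radii (r0, r0) by (l^2 r0, l
   r0) multiplies the norm of G by at most l^2. As l M <= r0 / 2, this norm is at most rho = l r0,
   and the iteration preserves the ball of radius rho. *)
pose r := l * l * r0; pose rho := l * r0.
have r_0 : 0 < r by rewrite !mulr_gt0.
have rho_0 : 0 < rho by rewrite mulr_gt0.
have bG : bnd r rho G rho.
  move=> n; apply: (@le_trans _ _ (l * l * nm n r0 r0 G)).
    apply: nm_leM => i j _ _.
    case: (boolP ((i == 0%N) && (j <= 1)%N)) => [/andP[/eqP -> j1]|nij].
      have -> : c2 G 0 j = 0 by case: j j1 => [|[|]].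
      by rewrite nc0 !mulr0.
    rewrite mulrA ler_wpM2r ?normc_ge0 // /r /rho 3!exprMn.
    have -> : l ^+ i * l ^+ i * r0 ^+ i * (l ^+ j * r0 ^+ j) =
       l ^+ (i + i + j) * (r0 ^+ i * r0 ^+ j) by rewrite !exprD; ring.
    rewrite ler_wpM2r ?mulr_ge0 ?exprn_ge0 ?(ltW r00) // -expr2.
    have -> : (i + i + j = 2 + (i + i + j - 2))%N.
      by rewrite subnKC //; case: i nij => [|i] //=; rewrite ?add0n -?ltnNge // addSn addnS.
    by rewrite exprD ler_piMr ?exprn_ge0 ?exprn_ile1 ?(ltW l0).
  apply: (@le_trans _ _ (l * l * M)).
    by rewrite ler_wpM2l ?mulr_ge0 ?(ltW l0).
  rewrite -mulrA /rho ler_wpM2l ?(ltW l0) // (le_trans lM) // ler_pdivrMr //.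
  by rewrite ler_peMr ?ltW // ltr1n.
have bpsi k : bnd r r (psi k) rho.
  elim: k => [|k IH]; first by move=> n; rewrite (_ : nm _ _ _ _ = 0) ?ltW //; have [_ ->] := @nm_seminorm _ _ T2 n _ _ (ltW r_0) (ltW r_0).
  apply: (bnd_subst (rho := r) (sigma := rho)) => //; try exact: ltW.
    exact: low_psi.
  by move=> n; apply: nm_X; exact: ltW.
exists r; split => //; exists rho => n.
rewrite (@nm_eq _ _ _ _ _ _ _ (psi (n + n))); first exact: bpsi.
move=> i j hi hj; apply/eqP; rewrite -subr_eq0 -c2B; apply/eqP; apply: fixp_psi.
by rewrite ltnS; apply: leq_add; exact: ltnW.
Qed.

End ImplicitIter.

(** The map y -> y - F / c has the zeros of F as fixed points, and c is chosen to cancel its linear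
    term in y. The fixed point is obtained as a series in two variables; its restriction to y = 0 is
    the solution. *)
Theorem implicit_function (F : T2) : cvgt F -> c2 F 0 0 = 0 -> c2 F 0 1 <> 0 ->
  exists u, [/\ cvgt (tconst u : T2), co u 0 = 0 & subst vX (tconst u) F = 0].
Proof.
move=> cF F00 F01; pose c := c2 F 0 1.
pose G := vY - k2 c^-1 * F.
have G00 : c2 G 0 0 = 0 by rewrite c2B c2_Y c2_constM F00 mulr0 subr0.
have G01 : c2 G 0 1 = 0.
  by rewrite c2B c2_Y c2_constM /c mulVf ?subrr //; exact/eqP.
have cG : cvgt G by apply: cvgtB; [exact: cvgt_Y | apply: cvgtM => //; exact: cvgt_const].
have := fixp_cvgt G00 G01 cG; have := fixpE G00 G01; have := low_fixp G00 G01.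
set p := mk _ => hp pE cp.
have pF : subst vX p F = 0.
  have : subst vX p (k2 c^-1 * F) = 0.
    have -> : k2 c^-1 * F = vY - G by rewrite opprB addrC subrK.
    by rewrite rmorphB /= pE subst_Y // subrr.
  rewrite rmorphM /= subst_const => /(congr1 (fun x => k2 c * x)).
  by rewrite mulrA -rmorphM mulfV ?mulr0 ?rmorph1 ?mul1r //; exact/eqP.
have e : subst vX 0 p = tconst (co p 0) by exact: subst_ydrop.
exists (co p 0); rewrite -e; split.
- by apply: cvgt_subst => //; [exact: cvgt_X | exact: cvgt0].
- by apply/low1E.
have -> : subst vX (subst vX 0 p) F = subst vX 0 (subst vX p F).
  by rewrite subst_comp // subst_X.
by rewrite pF rmorph0.
Qed.

End Implicit.

(** * Inverses and exact division of convergent series *)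

Section Quotient.
Variables (R : realType) (T1 : fps_theory R[i]) (T2 : fps_theory T1).
Local Notation C := R[i].
Implicit Types (f g h X Y : T2) (c : C) (u v : T1) (r s M : R).
Local Notation normc := (@ComplexField.Normc.normc R).

Lemma geometric : exists2 w : T2, (1 - vX) * w = 1 & cvgt w.
Proof.
pose w : T2 := mk (fun j => mk (fun i => (j == 0%N)%:R)).
have wE i j : c2 w i j = (j == 0%N)%:R by rewrite /c2 !coK.
exists w.
  apply: c2P => i j; rewrite mulrBl mul1r c2B -[vX]expr1 c2_XM !wE c21.
  by case: i => [|i]; rewrite ?subr0 //= subrr.
exists (1 / 2); split; first by rewrite divr_gt0.
exists 2 => n; rewrite nmE; case: n => [|n]; first by rewrite big_ord0.
rewrite big_ord_recl [X in _ + X]big1 ?addr0 => [|j _]; last first.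
  by rewrite big1 // => i _; rewrite wE nc0 mulr0.
rewrite (_ : \sum_(i < n.+1) _ = 2 - (1 / 2) ^+ n); first by rewrite gerBl exprn_ge0 // divr_ge0.
rewrite (eq_bigr (fun i : 'I_n.+1 => (1 / 2) ^+ i)); last by move=> i _; rewrite wE nc1 !mulr1.
elim: n => [|n IH]; first by rewrite big_ord_recl big_ord0 !expr0; lra.
by rewrite big_ord_recr /= IH exprS; field.
Qed.

(** Write f = c (1 - X) with X of positive order and substitute X in the geometric series. *)
Lemma inverse f : c2 f 0 0 <> 0 -> exists w, f * w = 1 /\ (cvgt f -> cvgt w).
Proof.
move=> f0; pose c := c2 f 0 0; have c0 : c != 0 by exact/eqP.
pose X := 1 - k2 c^-1 * f.
have hX : low 1 X by apply/low1E; rewrite c2B c21 c2_constM mulVf ?subrr.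
have [g ge gc] := geometric.
exists (k2 c^-1 * subst X 0 g); split=> [|cf].
  have -> : f * (k2 c^-1 * subst X 0 g) = (1 - X) * subst X 0 g by rewrite /X; ring.
  by rewrite -{1}(subst_X 0 hX) -{1}(rmorph1 (subst X 0)) -rmorphB -rmorphM ge rmorph1.
apply: cvgtM; first exact: cvgt_const.
apply: cvgt_subst => //; [|exact: cvgt0].
by apply: cvgtB; [exact: cvgt1 | apply: cvgtM => //; exact: cvgt_const].
Qed.

Definition funit f := exists g, f * g = 1.

Lemma funitE f : funit f <-> c2 f 0 0 <> 0.
Proof.
split=> [[g fg]|/inverse [w [e _]]]; last by exists w.
move=> f0; have /eqP := congr1 (fun f => c2 f 0 0) fg.
by rewrite /= c21 /c2 !coM0 [co (co f 0) 0]f0 mul0r eq_sym oner_eq0.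
Qed.

Lemma c2M0 f g : c2 (f * g) 0 0 = c2 f 0 0 * c2 g 0 0.
Proof. by rewrite /c2 !coM0. Qed.

(** The coefficients in y satisfy x^n h_j = W_j - (v h)_(j-1). Multiplication by x^n scales the norm
    in x by exactly r^n, and the weight s of y is small enough for the second term to cost at most
    half of that. *)
Lemma divide_core n (v W h : T2) : cvgt v -> cvgt W -> W = (vX ^+ n + vY * v) * h -> cvgt h.
Proof.
move=> cv cW e; have [r [r0 [V [Om [bv bW]]]]] := cvgt2 cv cW.
have V0 := bnd_ge0 bv; have Om0 := bnd_ge0 bW.
pose N k (u : T1) : R := tnorm normc k r u.
have sN k : seminorm (N k) by apply: tnorm_seminorm; [exact: ltW | exact: normc_seminorm].
have N0 k u : 0 <= N k u by have [h0 _ _ _] := sN k.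
have Nmono k l u : (k <= l)%N -> N k u <= N l u.
  by move=> kl; apply: tnorm_mono => //; [exact: ltW | exact: normc_ge0].
pose s := Num.min r (r ^+ n / (2 * (V + 1))).
have rn0 : 0 < r ^+ n by rewrite exprn_gt0.
have s0 : 0 < s by rewrite lt_min r0 divr_gt0 // mulr_gt0 // ltr_wpDl.
have sr : s <= r by rewrite ge_min lexx.
have sV : s * V <= r ^+ n / 2.
  apply: (@le_trans _ _ (s * (V + 1))); first by rewrite ler_wpM2l ?(ltW s0) // lerDl.
  by rewrite -ler_pdivlMr ?ltr_wpDl // -mulrA -invfM /s ge_min lexx orbT.
have s0' := ltW s0; have r0' := ltW r0.
have tW J m : \sum_(j < J) s ^+ j * N m (co W j) <= Om.
  apply: (le_trans _ (bW (J + m)%N)).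
  apply: (@le_trans _ _ (nm (J + m) r s W)); last by apply: nm_mono_r; rewrite ?s0' ?r0' ?lexx.
  apply: (@le_trans _ _ (\sum_(j < J + m) s ^+ j * N m (co W j))).
    by rewrite big_split_ord lerDl; apply: sumr_ge0 => j _; rewrite mulr_ge0 ?exprn_ge0.
  by apply: ler_sum => j _; rewrite ler_wpM2l ?exprn_ge0 ?Nmono ?leq_addl.
have tv J m : \sum_(j < J) s ^+ j * N m (co v j) <= V.
  apply: (le_trans _ (bv (J + m)%N)).
  apply: (@le_trans _ _ (nm (J + m) r s v)); last by apply: nm_mono_r; rewrite ?s0' ?r0' ?lexx.
  apply: (@le_trans _ _ (\sum_(j < J + m) s ^+ j * N m (co v j))).
    by rewrite big_split_ord lerDl; apply: sumr_ge0 => j _; rewrite mulr_ge0 ?exprn_ge0.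
  by apply: ler_sum => j _; rewrite ler_wpM2l ?exprn_ge0 ?Nmono ?leq_addl.
have NX k u : r ^+ n * N k u = N (n + k)%N (tX ^+ n * u).
  rewrite /N /tnorm big_split_ord /= [X in _ = X + _]big1 => [|i _].
    rewrite add0r mulr_sumr; apply: eq_bigr => i _.
    by rewrite tXnM ltnNge leq_addr /= addKn exprD mulrA.
  by rewrite tXnM ltn_ord nc0 mulr0.
have he j : tX ^+ n * co h j = co W j - co (vY * (v * h)) j.
  rewrite e mulrDl -mulrA coDE addrK -rmorphXn /= tconstM; by [].
(* the truncation order decreases by n at each step, so that the recursion
   for the coefficients of h closes up *)
pose Z J m := \sum_(j < J) s ^+ j * N (m - n * j)%N (co h j).
have Z0 J m : 0 <= Z J m by apply: sumr_ge0 => j _; rewrite mulr_ge0 ?exprn_ge0.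
have key J m : (n * J <= m)%N -> r ^+ n * Z J m <= Om + s * V * Z J m.
  move=> nJ.
  pose B j := if j is j'.+1 then
        s * \sum_(a < j) (s ^+ a * N (m - n * a)%N (co h a)) * (s ^+ (j' - a) * N m (co v (j' - a)%N))
        else 0.
  have step j : (j < J)%N -> s ^+ j * (r ^+ n * N (m - n * j)%N (co h j)) <=
     s ^+ j * N (n + m)%N (co W j) + B j.
    move=> jJ; rewrite NX he /B.
    have [_ _ ND _] := sN (n + (m - n * j))%N.
    apply: (@le_trans _ _ (s ^+ j * (N (n + m)%N (co W j) + N (n + (m - n * j))%N (co (vY * (v * h)) j)))).
      rewrite ler_wpM2l ?exprn_ge0 //; apply: le_trans (ND _ _) _.
      apply: lerD; first by rewrite Nmono // leq_add2l leq_subr.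
      by rewrite /N /tnorm; apply: ler_sum => i _; rewrite coNE normcN.
    rewrite mulrDr lerD2l {ND}; case: j jJ => [|j] jJ.
      by rewrite tXM; have [_ -> _ _] := sN (n + (m - n * 0))%N; rewrite mulr0.
    rewrite tXM exprS -mulrA ler_wpM2l // [v * h]mulrC coME.
    have kE : (n + (m - n * j.+1) = m - n * j)%N.
      have h1 : (n * j.+1 <= m)%N by apply: leq_trans nJ; rewrite leq_mul2l (ltnW jJ) orbT.
      by rewrite mulnS in h1 *; lia.
    rewrite kE.
    apply: le_trans (ler_wpM2l _ (seminorm_sum _ _ _ (sN _))) _; first by rewrite exprn_ge0.
    rewrite mulr_sumr; apply: ler_sum => a _.
    have aj : (a <= j)%N by rewrite -ltnS.
    rewrite mulrACA -exprD subnKC // ler_wpM2l ?exprn_ge0 //.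
    have [_ _ _ NM] := sN (m - n * j)%N.
    apply: le_trans (NM _ _) _; apply: ler_pM => //; apply: Nmono; last exact: leq_subr.
    by rewrite leq_sub2l // leq_mul2l aj orbT.
  rewrite /Z mulr_sumr (eq_bigr (fun j : 'I_J => s ^+ j * (r ^+ n * N (m - n * j)%N (co h j)))); last first.
    by move=> j _; rewrite mulrCA.
  apply: (@le_trans _ _ (\sum_(j < J) (s ^+ j * N (n + m)%N (co W j) + B j))).
    by apply: ler_sum => j _; exact: step.
  rewrite big_split lerD //=; first exact: tW.
  case: J nJ {step} => [|J] nJ; first by rewrite !big_ord0 mulr0.
  rewrite big_ord_recl add0r /B -/(Z J.+1 m) -mulr_sumr -mulrA ler_wpM2l // [V * _]mulrC.
  apply: le_trans (cauchy_prod_le J (F := fun a => s ^+ a * N (m - n * a)%N (co h a))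
    (G := fun b => s ^+ b * N m (co v b)) _ _) _.
  - by move=> a; rewrite mulr_ge0 ?exprn_ge0.
  - by move=> a; rewrite mulr_ge0 ?exprn_ge0.
  apply: ler_pM => //.
  - by apply: sumr_ge0 => a _; rewrite mulr_ge0 ?exprn_ge0.
  - by apply: sumr_ge0 => a _; rewrite mulr_ge0 ?exprn_ge0.
  by rewrite /Z [leRHS]big_ord_recr lerDl mulr_ge0 ?exprn_ge0.
apply: (@cvgtP _ _ _ h r s (2 * Om / r ^+ n)) => // k.
pose m := (n * k + k)%N.
apply: (@le_trans _ _ (Z k m)).
  apply: ler_sum => j _; rewrite ler_wpM2l ?exprn_ge0 // Nmono // /m.
  by rewrite addnC -addnBA ?leq_addr // leq_mul2l ltnW ?orbT.
have := key k m (leq_addr _ _).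
have := ler_wpM2r (Z0 k m) sV.
rewrite ler_pdivlMr //; move: (Z k m) (r ^+ n) => z q; lra.
Qed.

(** A quotient of convergent series converges as soon as it exists formally. After division by a
    power of y, the restriction of f to y = 0 is x^n times a unit in x; dividing by this unit brings
    f to the shape of [divide_core]. *)
Lemma divide f h : f <> 0 -> cvgt f -> cvgt (f * h) -> cvgt h.
Proof.
move=> f0 cf cfh.
have [f' fE f'0] := has_ordE (ordP f0).
have c' : cvgt f' by apply: cvgt_divY cf fE.
have c'h : cvgt (f' * h) by apply: cvgt_divY cfh _; rewrite {1}fE mulrA.
have [u uE u0] := has_ordE (ordP f'0).
set n := ord _ in uE.
have cu : cvgt (tconst u : T2).
  have : cvgt (subst vX 0 f') by apply: cvgt_subst => //; [exact: cvgt_X|exact: cvgt0].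
  rewrite subst_ydrop uE rmorphM rmorphXn /= => h1.
  exact: cvgt_divX h1 erefl.
have [w [we /(_ cu) cw]] : exists w : T2, tconst u * w = 1 /\ (cvgt (tconst u : T2) -> cvgt w).
  by apply: inverse; rewrite /c2 tconstE.
have wu : u * co w 0 = 1 by rewrite -tconstM we co1E.
have e : w * f' = vX ^+ n + vY * tshift 1 (w * f').
  rewrite -{1}(subrK (vX ^+ n) (w * f')) addrC; congr (_ + _).
  rewrite [LHS](@tshiftK _ _ 1) ?expr1 => [|[|//] _].
    by congr (_ * _); apply: coP => j; rewrite !tshiftE coBE -rmorphXn tconstE addn1 /= subr0.
  rewrite coBE coM0 -rmorphXn tconstE /= uE mulrCA [co w 0 * u]mulrC wu mulr1 subrr //.
apply: (@divide_core n (tshift 1 (w * f')) (w * (f' * h))).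
- apply: (@cvgt_divY _ _ _ 1 (w * f' - vX ^+ n)); last by rewrite expr1 {1}e addrAC subrr add0r.
  by apply: cvgtB; [exact: cvgtM | apply: cvgt_exp; exact: cvgt_X].
- exact: cvgtM.
by rewrite -e mulrA.
Qed.

End Quotient.

(** * Puiseux roots *)

Section Puiseux.
Variables (R : realType) (T1 : fps_theory R[i]) (T2 : fps_theory T1).
Local Notation C := R[i].
Implicit Types (f g h X Y F : T2) (c z : C) (u v : T1).

(** The coefficients of f(z x^q, y); [subst_dilate] identifies it with a substitution. *)
Definition dilate z q f : T2 :=
  mk (fun j => mk (fun i => if (q %| i)%N then z ^+ (i %/ q) * c2 f (i %/ q) j else 0)).

Lemma c2_dilate z q f i j :
  c2 (dilate z q f) i j = if (q %| i)%N then z ^+ (i %/ q) * c2 f (i %/ q) j else 0.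
Proof. by rewrite {1}/c2 !coK. Qed.

Lemma low_dil z q : (0 < q)%N -> low 1 (k2 z * vX ^+ q : T2).
Proof. by move=> q0; apply: lowMl; apply: (lowW q0); apply: lowX. Qed.

Lemma subst_dilate z q f : (0 < q)%N -> subst (k2 z * vX ^+ q) vY f = dilate z q f.
Proof.
move=> q0; apply: (@additive_ext _ _ _ 0).
- exact: rmorphB.
- move=> x y; apply: c2P => i j; rewrite c2B !c2_dilate c2B.
  by case: ifP => _; rewrite ?subrr // mulrBr.
- by move=> n g; rewrite addn0; apply: subst_low.
- move=> n g; rewrite addn0 => gn i j ij; rewrite c2_dilate; case: ifP => // _.
  by rewrite gn ?mulr0 //; apply: leq_ltn_trans ij; rewrite leq_add2r leq_div.
move=> c a b; rewrite subst_mon !nz_id //; last exact: low_dil.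
rewrite exprMn -exprM -rmorphXn mulrA -rmorphM.
apply: c2P => i j; rewrite c2_term c2_dilate c2_term.
case: (boolP (q %| i)%N) => [/dvdnP[k ->]|nd].
  rewrite mulnK // mulnC eqn_pmul2l //.
  by case: eqP => [->|_] /=; rewrite ?mulr0 //; case: eqP => _; rewrite ?mulr0 // mulrC.
by case: eqP nd => // ->; rewrite dvdn_mulr.
Qed.

Lemma subst0_dilate f : subst 0 vY f = dilate 0 1 f.
Proof. by have := @subst_dilate 0 1 f isT; rewrite rmorph0 mul0r. Qed.

Lemma subst_tconst X Y u : low 1 X -> subst X Y (tconst u) = subst X 0 (tconst u).
Proof.
move=> hX; have h0 : low 1 (0 : T2) by exact: low0.
have eu : tconst u = subst vX 0 (tconst u) :> T2 by rewrite subst_ydrop tconstE.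
have E Z : subst X Z (tconst u) = subst X 0 (tconst u).
  rewrite {1}eu; apply: (etrans (@subst_comp _ _ _ X Z vX 0 (tconst u) (@low_X _ _ _) h0)).
  by rewrite (subst_X Z hX) rmorph0.
exact: E.
Qed.

(** The restriction f(0, y). Its order plays the part of the degree of a Weierstrass polynomial and
    is the induction parameter of Puiseux's algorithm. *)
Definition at0 f : T1 := @tmap _ _ T2 T1 (@cst0 _ T1) f.
HB.instance Definition _ := GRing.RMorphism.copy at0 (@tmap _ _ T2 T1 (@cst0 _ T1)).

Lemma at0E f j : co (at0 f) j = c2 f 0 j.
Proof. by rewrite tmapE. Qed.
Lemma at0_tconst u : at0 (tconst u) = tconst (co u 0).
Proof. by apply: coP => j; rewrite at0E c2_tconst tconstE. Qed.
Lemma at0_X : at0 vX = 0.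
Proof. by rewrite at0_tconst tXE rmorph0. Qed.
Lemma at0_Y : at0 vY = tX.
Proof. by apply: coP => j; rewrite at0E c2_Y tXE. Qed.

Lemma at0_subst f : at0 (subst 0 vY f) = at0 f.
Proof.
by rewrite subst0_dilate; apply: coP => j; rewrite !at0E c2_dilate dvdn0 div0n expr0 mul1r.
Qed.

Lemma at0_shift u f : co u 0 = 0 -> at0 (subst vX (vY + tconst u) f) = at0 f.
Proof.
move=> u0; have hu : low 1 (tconst u : T2) by apply/low1E; rewrite c2_tconst.
rewrite -(at0_subst (subst _ _ f)) subst_comp //; last exact: lowD.
have h0 : low 1 (0 : T2) by exact: low0.
rewrite subst_X // [subst _ _ (vY + _)]rmorphD /= subst_Y //.
suff -> : subst 0 vY (tconst u) = 0 :> T2 by rewrite addr0 at0_subst.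
rewrite subst0_dilate.
apply: c2P => i j; rewrite c2_dilate c20 c2_tconst dvd1n divn1.
by case: i => [|i]; rewrite ?u0 ?if_same ?mulr0 // exprS !mul0r.
Qed.

(** The factor m is k!, of which only the positivity is recorded. *)
Lemma iter_pdyE k f : exists2 m, (0 < m)%N &
  forall i, c2 (iter k (@pdy _ _ T2) f) i 0 = c2 f i k *+ m.
Proof.
suff: forall j, exists2 m, (0 < m)%N & forall i, c2 (iter k (@pdy _ _ T2) f) i j = c2 f i (j + k) *+ m.
  by move/(_ 0%N).
elim: k => [|k IH] j; first by exists 1%N => // i; rewrite addn0.
have [m m0 E] := IH j.+1; exists (m * j.+1)%N; first by rewrite muln_gt0 m0.
by move=> i; rewrite iterS c2_pdy E mulrnA addSnnS.
Qed.

Lemma iter_pdy_shift k u f : co u 0 = 0 ->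
  iter k (@pdy _ _ T2) (subst vX (vY + tconst u) f) = subst vX (vY + tconst u) (iter k (@pdy _ _ T2) f).
Proof.
move=> u0; have hu : low 1 (tconst u : T2) by apply/low1E; rewrite c2_tconst.
elim: k f => [|k IH] f //; rewrite !iterSr -IH; congr (iter k _ _).
rewrite pdy_subst //; last exact: lowD.
have -> : pdy (vY + tconst u) = 1 :> T2.
  rewrite -[tconst u]opprK pdy_is_additive raddfN /= /pdy tderiv_const oppr0 subr0.
  exact: pdy_Y.
by rewrite pdy_X mulr0 add0r mulr1.
Qed.

Lemma mulrn_eq0C c m : (0 < m)%N -> c *+ m = 0 -> c = 0.
Proof. by move=> m0 /eqP; rewrite mulrn_eq0 eqn0Ngt m0 /= => /eqP. Qed.

(** The n-th derivative of F in y has order 1 in y, so the implicit function theorem gives its root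
    u(x). After y := y + u(x) this derivative vanishes on y = 0, which is the vanishing of the
    coefficient of y^n. This takes the place of completing the n-th power in a Weierstrass
    polynomial. *)
Lemma tschirnhaus n F : cvgt F -> has_ord (at0 F) n.+1 ->
  exists u, [/\ cvgt (tconst u : T2), co u 0 = 0 & co (subst vX (vY + tconst u) F) n = 0].
Proof.
move=> cF [F0 Fn].
pose D := iter n (@pdy _ _ T2) F.
have cD : cvgt D by rewrite /D; elim: n {F0 Fn D} => [//|n IH]; exact: cvgt_pdy.
have [m m0 mE] := iter_pdyE n F.
have D00 : c2 D 0 0 = 0 by rewrite mE -at0E F0 ?mul0rn.
have D01 : c2 D 0 1 <> 0.
  have [m' m'0 m'E] := iter_pdyE n.+1 F.
  have := m'E 0%N; rewrite iterS c2_pdy -/D mulr1n => -> /(mulrn_eq0C m'0).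
  by rewrite -at0E.
have [u [cu u0 uD]] := implicit_function cD D00 D01.
exists u; split=> //; set F1 := subst _ _ F.
have hu : low 1 (tconst u : T2) by apply/low1E; rewrite c2_tconst.
have [k k0 kE] := iter_pdyE n F1.
apply: coP => i; rewrite co0E; apply: (mulrn_eq0C k0).
rewrite -[co _ _]/(c2 F1 i n) -kE iter_pdy_shift //.
rewrite /c2 (_ : co (subst _ _ _) 0 = 0) ?co0E //.
have : subst vX 0 (subst vX (vY + tconst u) (iter n (@pdy _ _ T2) F)) = 0 :> T2.
  rewrite subst_comp ?subst_X ?rmorphD /= ?subst_Y ?low0 ?add0r //; last exact: lowD.
  by rewrite subst_ydrop tconstE.
rewrite subst_ydrop => /(congr1 (fun f : T2 => co f 0)).
by rewrite /= tconstE co0E.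
Qed.

(** The index j0 minimizes ord (a j) / (n - j), the slope of the edge of the Newton polygon at its
    vertex of height n; the conclusion is this minimality with denominators cleared. *)
Lemma newton_slope n (a : nat -> T1) : (exists2 j, (j < n)%N & a j <> 0) ->
  exists j0, [/\ (j0 < n)%N, a j0 <> 0 & forall j, (j < n)%N -> a j <> 0 ->
    (ord (a j0) * (n - j) <= ord (a j) * (n - j0))%N].
Proof.
move=> [j jn aj]; pose P (i : 'I_n) := `[< a i <> 0 >].
have Pj : P (Ordinal jn) by apply/asboolP.
pose F (i : 'I_n) : R := (ord (a i))%:R / (n - i)%:R.
have pos (i : 'I_n) : 0 < (n - i)%:R :> R by rewrite ltr0n subn_gt0.
case: (@arg_minP _ _ _ (Ordinal jn) P F Pj) => i0 /asboolP Pi0 min.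
exists i0; split => // k kn ak.
have := min (Ordinal kn); rewrite /P /F => /(_ (introT (asboolP _) ak)).
have := pos (Ordinal kn) => /= pk.
by rewrite ler_pdivrMr // mulrAC ler_pdivlMr // -!natrM ler_nat mulnC [X in (_ <= X)%N]mulnC mulnC [X in (_ <= X)%N]mulnC.
Qed.

(* The reduced equation on an edge of the Newton polygon is not an n-th power,
   as its coefficient of degree n - 1 vanishes. *)
Lemma proper_root n (h : {poly C}) j0 : size h = n.+2 -> h`_n = 0 -> (j0 <= n)%N -> h`_j0 != 0 ->
  exists z m (g : {poly C}), [/\ (0 < m)%N, (m <= n)%N, g.[z] <> 0 & h = g * ('X - z%:P) ^+ m].
Proof.
move=> sh hn j0n hj0.
have [z rz] : exists z, root h z by apply/closed_rootP; rewrite sh.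
have [m [g gz hE]] := multiplicity_XsubC h z.
have h0 : h != 0 by rewrite -size_poly_eq0 sh.
have gz' : g.[z] <> 0 by move/implyP: gz => /(_ h0) /negP nr /eqP r; apply: nr.
have m0 : (0 < m)%N.
  rewrite lt0n; apply/eqP => me; move: rz gz'; rewrite hE me expr0 mulr1.
  by move/rootP.
have g0 : g != 0 by apply: contraNneq h0 => g0; rewrite hE g0 mul0r.
have sg : (size g + m = n.+2)%N.
  have := sh; rewrite hE size_Mmonic ?monicXn // ?monic_exp ?monicXsubC //.
  by rewrite size_exp_XsubC addnS.
(* If m > n, then h = c (X - z)^(n+1). The vanishing coefficient of degree n forces z = 0, and then
   the coefficient of degree j0 vanishes as well. *)
exists z, m, g; split=> //; rewrite leqNgt; apply/negP => nm.
have sg1 : size g = 1%N.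
  by apply/eqP; rewrite eqn_leq lt0n size_poly_eq0 g0 andbT; lia.
have mE : m = n.+1 by lia.
have [c c0 gE] := size_poly1P _ (introT eqP sg1).
have e1 : ('X - z%:P) ^+ n.+1 = \prod_(z <- nseq n.+1 z) ('X - z%:P).
  by rewrite big_nseq iter_mulr_1.
have := hn; rewrite hE gE mE coefCM => /eqP.
rewrite mulf_eq0 (negbTE c0) /= e1.
have := @coefPn_prod_XsubC _ (nseq n.+1 z); rewrite size_nseq -[n.+1.-1]/n => -> //.
rewrite oppr_eq0 big_nseq iter_addr_0 mulrn_eq0 /= => /eqP z0.
by move: hj0; rewrite hE gE mE coefCM z0 subr0 coefXn ltn_eqF ?mulr0 ?eqxx // ltnS.
Qed.

Definition tdil q u : T1 := mk (fun i => if (q %| i)%N then co u (i %/ q) else 0).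

Lemma tdilE q u i : co (tdil q u) i = if (q %| i)%N then co u (i %/ q) else 0.
Proof. by rewrite coK. Qed.

Lemma low_Xn q : (0 < q)%N -> low 1 (vX ^+ q : T2).
Proof. by move=> q0; apply: (lowW q0); apply: lowX. Qed.

Lemma subst_tdil q Y u : (0 < q)%N -> subst (vX ^+ q) Y (tconst u) = tconst (tdil q u) :> T2.
Proof.
move=> q0; rewrite subst_tconst; last exact: low_Xn.
rewrite -(@subst_tconst (vX ^+ q) vY); last exact: low_Xn.
have := @subst_dilate 1 q (tconst u) q0; rewrite rmorph1 mul1r => ->.
apply: c2P => i j; rewrite c2_dilate !c2_tconst tdilE expr1n mul1r.
by case: (j == 0%N); rewrite ?if_same.
Qed.

Lemma taylor_split n F : F = \sum_(j < n) tconst (co F j) * vY ^+ j + vY ^+ n * tshift n F.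
Proof.
apply: coP => k; rewrite coDE co_sumE tXnM.
have E j : co (tconst (co F j) * vY ^+ j) k = if k == j then co F j else 0.
  by rewrite tconstM tXnE; case: (k == j); rewrite ?mulr1 ?mulr0.
case: ltnP => kn.
  rewrite addr0 (eq_bigr (fun j : 'I_n => if k == j then co F j else 0)) //.
  rewrite (@sum_ord_single _ _ k (fun j => if k == j then co F j else 0)) ?eqxx //.
  by move=> j _; rewrite eq_sym => /negbTE ->.
rewrite big1 ?add0r ?tshiftE ?subnK // => j _; rewrite E.
by rewrite gtn_eqF // (leq_trans _ kn).
Qed.

(* One step of the Newton-Puiseux algorithm: after x = t^q, y = t^p (z + y') the
   order in y' drops. *)
Lemma newton_step n F : cvgt F -> has_ord (at0 F) n.+2 -> co F n.+1 = 0 -> co F 0 <> 0 ->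
  exists q p z m (H : T2), [/\ (0 < q)%N, (0 < p)%N, (0 < m <= n.+1)%N,
    cvgt H /\ has_ord (at0 H) m &
    exists k, subst (vX ^+ q) (vX ^+ p * (k2 z + vY)) F = vX ^+ k * H].
Proof.
set N := n.+2 => cF [Flow FN] Fn1 F0.
have [j0 [j0n a0 slope]] := @newton_slope N (co F) (ex_intro2 _ _ 0%N isT F0).
set p := ord (co F j0) in slope; set q := (N - j0)%N in slope.
have q0 : (0 < q)%N by rewrite subn_gt0.
have [plow pne] : has_ord (co F j0) p by exact: ordP.
have p0 : (0 < p)%N.
  rewrite lt0n; apply/eqP => p0; apply: pne; rewrite p0.
  by have := Flow j0 j0n; rewrite at0E.
(* By the slope inequality, the j-th coefficient at t^q is divisible by t^(p (N - j)). The constant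
   terms of the quotients [b j] are the coefficients of the edge polynomial h. *)
pose b j := tshift (p * (N - j)) (tdil q (co F j)).
have bE j : (j <= N)%N -> tdil q (co F j) = tX ^+ (p * (N - j)) * b j.
  rewrite leq_eqVlt => /orP[/eqP ->|jN].
    by apply: tshiftK => i; rewrite subnn muln0.
  apply: tshiftK => i hi; rewrite tdilE; case: ifP => // /dvdnP[i' ie].
  rewrite ie mulnK //; case: (pselect (co F j = 0)) => [->|aj]; first by rewrite co0E.
  have [h _] := ordP aj; apply: h; rewrite -(ltn_pmul2r q0) -ie.
  exact: leq_trans hi (slope j jN aj).
have low_zY z : low 1 (vX ^+ p * (k2 z + vY) : T2) by apply: lowMr; exact: low_Xn.
pose h := \poly_(j < N.+1) co (b j) 0.
have hE j : (j <= N)%N -> h`_j = co (b j) 0 by move=> jN; rewrite coef_poly ltnS jN.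
have bN : co (b N) 0 = co (co F N) 0.
  by rewrite tshiftE subnn muln0 tdilE dvdn0 div0n.
have bN0 : co (b N) 0 != 0 by rewrite bN; apply/eqP; move: FN; rewrite at0E.
have sh : size h = N.+1 by apply: size_poly_eq.
have hn1 : h`_n.+1 = 0.
  rewrite hE ?leqnSn // tshiftE add0n Fn1 tdilE co0E if_same //.
have hj0 : h`_j0 != 0.
  rewrite hE; last exact: ltnW.
  by rewrite tshiftE add0n tdilE dvdn_mull // mulnK //; apply/eqP.
have j0n1 : (j0 <= n.+1)%N by rewrite -ltnS.
have [z [m [g [m0 mn gz hgE]]]] := proper_root sh hn1 j0n1 hj0.
(* The terms of degree above N in y keep a factor t^p after division by t^(p N), and p > 0, so they
   do not reach [at0 H]. *)
pose G := subst (vX ^+ q) (vX ^+ p * (k2 z + vY)) (tshift N.+1 F).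
pose H : T2 := \sum_(j < N.+1) tconst (b j) * (k2 z + vY) ^+ j
   + vX ^+ p * ((k2 z + vY) ^+ N.+1 * G).
have HE : subst (vX ^+ q) (vX ^+ p * (k2 z + vY)) F = vX ^+ (p * N) * H.
  rewrite {1}(taylor_split N.+1 F) rmorphD rmorphM rmorphXn /= (subst_Y _ (low_zY z)) -/G.
  rewrite rmorph_sum /H [RHS]mulrDr; congr (_ + _); last first.
    by rewrite exprMn -exprM !mulrA -exprD mulnS addnC.
  rewrite mulr_sumr; apply: eq_bigr => j _.
  rewrite rmorphM rmorphXn /= (subst_Y _ (low_zY z)) subst_tdil // bE; last by rewrite -ltnS.
  rewrite rmorphM rmorphXn /= exprMn -exprM -/vX.
  have -> : (p * N = p * (N - j) + p * j)%N by rewrite -mulnDr subnK // -ltnS.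
  by rewrite exprD; ring.
exists q, p, z, m, H; split => //; [by rewrite m0 | split | by exists (p * N)%N].
  have cS : cvgt (subst (vX ^+ q) (vX ^+ p * (k2 z + vY)) F).
    apply: cvgt_subst => //; [| |exact: low_Xn]; first by apply: cvgt_exp; exact: cvgt_X.
    apply: cvgtM; first by apply: cvgt_exp; exact: cvgt_X.
    by apply: cvgtD; [exact: cvgt_const | exact: cvgt_Y].
  exact: cvgt_divX cS HE.
(* At t = 0 the series H becomes h(z + y), whose order in y is the multiplicity m of the root z. *)
have -> : at0 H = (map_poly (@tconst _ T1) h).[tconst z + tX].
  have a0p : at0 (vX ^+ p : T2) = 0 by rewrite rmorphXn /= at0_X expr0n eqn0Ngt p0.
  have a0z : at0 (k2 z + vY) = tconst z + tX.
    by rewrite rmorphD /= at0_Y at0_tconst tconstE.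
  rewrite /H rmorphD rmorphM /= a0p mul0r addr0 rmorph_sum /= horner_coef size_map_poly sh.
  apply: eq_bigr => j _; rewrite rmorphM rmorphXn /= a0z at0_tconst coef_map /= hE //.
  by rewrite -ltnS.
rewrite hgE rmorphM rmorphXn /= rmorphB /= map_polyX map_polyC /= hornerM horner_exp.
rewrite hornerXsubC addrAC subrr add0r mulrC; apply: has_ord_mulX.
have -> : co (map_poly (@tconst _ T1) g).[tconst z + tX] 0 = g.[z].
  rewrite -/(cst0 _) -horner_map /= -map_poly_comp /= rmorphD /= /cst0 tconstE tXE addr0.
  by congr (_.[_]); rewrite map_poly_id // => x _; rewrite /= /cst0 tconstE.
exact: gz.
Qed.

(** Induction on the order of F(0, y), which [newton_step] lowers. The root Y is allowed both
    variables, so that composing the successive substitutions never leaves the ring; [branch_exists]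
    sets y = 0 at the end. *)
Theorem puiseux_root n F : cvgt F -> has_ord (at0 F) n.+1 ->
  exists q Y, [/\ (0 < q)%N, cvgt Y, low 1 Y & subst (vX ^+ q) Y F = 0].
Proof.
elim/ltn_ind: n F => n IH F cF oF.
have [u [cu u0 Fn]] := tschirnhaus cF oF.
have hu : low 1 (tconst u : T2) by apply/low1E; rewrite c2_tconst.
set F1 := subst _ _ F in Fn.
have cF1 : cvgt F1.
  by apply: cvgt_subst => //; [exact: cvgt_X | apply: cvgtD => //; exact: cvgt_Y | exact: lowD].
case: (pselect (co F1 0 = 0)) => F10.
  exists 1%N, (tconst u); split => //; rewrite expr1.
  have : subst vX 0 F1 = 0 by rewrite subst_ydrop F10 rmorph0.
  rewrite subst_comp //; last exact: lowD.
  by rewrite subst_X // rmorphD /= subst_Y // add0r subst_ydrop tconstE.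
(* In order 1 the coefficient removed by the shift is the constant one, so y = u(x) is already a
   root. *)
case: n IH oF Fn => [_|n IH] oF Fn; first by rewrite Fn in F10.
have oF1 : has_ord (at0 F1) n.+2 by rewrite at0_shift.
have [q [p [z [m [H [q0 p0 /andP[m0 mn] [cH oH] [k HE]]]]]]] := newton_step cF1 oF1 Fn F10.
case: m m0 mn oH => // m _ mn oH.
have [q' [Y' [q'0 cY' hY' HY']]] := IH m mn H cH oH.
have hzY : low 1 (vX ^+ p * (k2 z + vY) : T2) by apply: lowMr; exact: low_Xn.
have hq' := low_Xn q'0; have hq := low_Xn q0.
pose Y1 := subst (vX ^+ q') Y' (vX ^+ p * (k2 z + vY)).
have hY1 : low 1 Y1 by apply: subst_low.
have hqq : low 1 (vX ^+ (q' * q) : T2) by apply: low_Xn; rewrite muln_gt0 q'0.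
have F1r : subst (vX ^+ (q' * q)) Y1 F1 = 0.
  have : subst (vX ^+ q') Y' (subst (vX ^+ q) (vX ^+ p * (k2 z + vY)) F1) = 0.
    by rewrite HE rmorphM /= HY' mulr0.
  by rewrite subst_comp // rmorphXn /= subst_X // -exprM.
have cq' : cvgt (vX ^+ (q' * q) : T2) by apply: cvgt_exp; exact: cvgt_X.
have cY1 : cvgt Y1.
  apply: cvgt_subst => //; first by apply: cvgt_exp; exact: cvgt_X.
  apply: cvgtM; first by apply: cvgt_exp; exact: cvgt_X.
  by apply: cvgtD; [exact: cvgt_const | exact: cvgt_Y].
exists (q' * q)%N, (Y1 + subst (vX ^+ (q' * q)) Y1 (tconst u)); split.
- by rewrite muln_gt0 q'0.
- by apply: cvgtD => //; apply: cvgt_subst.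
- by apply: lowD => //; apply: subst_low.
move: F1r; rewrite subst_comp //; last exact: lowD.
by rewrite subst_X // rmorphD /= subst_Y.
Qed.

End Puiseux.

(** * Branches *)

(** X^n - 1 is separable, so it has n distinct roots, and a group of n roots of unity has a
    primitive one. *)
Lemma prim_root_exists (F : closedFieldType) n :
  (n > 0)%N -> n%:R != 0 :> F -> exists z : F, n.-primitive_root z.
Proof.
move=> n0 nF; have [rs e] := closed_field_poly_normal ('X^n - 1%:P : {poly F}).
have mon : 'X^n - 1%:P \is @monic F by rewrite monicXnsubC.
rewrite (monicP mon) scale1r in e.
have srs : size rs = n.
  have := congr1 (fun p : {poly F} => size p) e.
  by rewrite size_XnsubC // size_prod_XsubC => -[].
have /hasP[z _ zn] : has n.-primitive_root rs.
  apply: has_prim_root => //; last by rewrite srs.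
    by apply/allP => x xr; rewrite /root_of_unity e root_prod_XsubC.
  by rewrite -separable_prod_XsubC -e separable_Xn_sub_1.
by exists z.
Qed.

Section Branch.
Variables (R : realType) (T1 : fps_theory R[i]) (T2 : fps_theory T1).
Local Notation C := R[i].
Implicit Types (f g h W X Y F : T2) (c z : C) (u v w : T1).

Lemma primC q : (0 < q)%N -> exists z : C, q.-primitive_root z.
Proof. by move=> q0; apply: prim_root_exists => //; rewrite pnatr_eq0 -lt0n. Qed.

(** The series u(z t): for z^q = 1 it is a conjugate of u over the series in t^q. *)
Definition rot z u : T1 := mk (fun i => z ^+ i * co u i).

Lemma rotE z u i : co (rot z u) i = z ^+ i * co u i. Proof. by rewrite coK. Qed.
Lemma rot_comp z z' u : rot z (rot z' u) = rot (z * z') u.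
Proof. by apply: coP => i; rewrite !rotE exprMn mulrA. Qed.
Lemma rot1 u : rot 1 u = u.
Proof. by apply: coP => i; rewrite rotE expr1n mul1r. Qed.

Lemma low_rX z : low 1 (k2 z * vX : T2). Proof. exact: lowMl. Qed.

Lemma subst_rot z f i j : c2 (subst (k2 z * vX) vY f) i j = z ^+ i * c2 f i j.
Proof. by rewrite -[vX]expr1 subst_dilate // c2_dilate dvd1n divn1. Qed.

Lemma subst_rot_tconst z Y u : subst (k2 z * vX) Y (tconst u) = tconst (rot z u) :> T2.
Proof.
rewrite subst_tconst; last exact: low_rX.
rewrite -(@subst_tconst _ _ _ _ vY); last exact: low_rX.
by apply: c2P => i j; rewrite subst_rot !c2_tconst rotE; case: (j == 0%N); rewrite ?mulr0.
Qed.

Lemma low_tconst u : co u 0 = 0 -> low 1 (tconst u : T2).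
Proof. by move=> u0; apply/low1E; rewrite c2_tconst. Qed.

Lemma cvgt_rot z u : cvgt (tconst u : T2) -> cvgt (tconst (rot z u) : T2).
Proof.
move=> cu; rewrite -(subst_rot_tconst z 0); apply: cvgt_subst => //; last exact: low_rX.
  by apply: cvgtM; [exact: cvgt_const | exact: cvgt_X].
exact: cvgt0.
Qed.

Lemma dilate_inj q f g : (0 < q)%N -> subst (vX ^+ q) vY f = subst (vX ^+ q) vY g -> f = g.
Proof.
move=> q0; have := @subst_dilate _ _ T2 1 q; rewrite rmorph1 mul1r => E; rewrite !E //.
move=> e; apply: c2P => i j; have := congr1 (fun f => c2 f (i * q) j) e.
by rewrite /= !c2_dilate dvdn_mull // mulnK // !expr1n !mul1r.
Qed.

Lemma c2_dil q f i j : (0 < q)%N ->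
  c2 (subst (vX ^+ q) vY f) i j = if (q %| i)%N then c2 f (i %/ q) j else 0.
Proof.
move=> q0; have := @subst_dilate _ _ T2 1 q; rewrite rmorph1 mul1r => -> //.
by rewrite c2_dilate expr1n mul1r.
Qed.

(** Invariance under x := z x kills the coefficients whose degree in x is not a multiple of q. *)
Lemma undilate q z f : q.-primitive_root z -> subst (k2 z * vX) vY f = f ->
  exists g, f = subst (vX ^+ q) vY g.
Proof.
move=> zq e; have q0 := prim_order_gt0 zq.
exists (mk (fun j => mk (fun i => c2 f (q * i) j))).
apply: c2P => i j; rewrite c2_dil // {2}/c2 !coK; case: ifP => [/divnK <-|nd].
  by rewrite mulnC mulKn // mulnC.
have := congr1 (fun f => c2 f i j) e; rewrite /= subst_rot => /eqP.
rewrite -subr_eq0 -{2}[c2 f i j]mul1r -mulrBl mulf_eq0 subr_eq0 -(prim_order_dvd zq) nd.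
by move=> /eqP.
Qed.

Lemma factor a f : co a 0 = 0 -> subst vX (tconst a) f = 0 -> exists g, f = (vY - tconst a) * g.
Proof.
move=> a0 fa; have ha := low_tconst a0.
have hp : low 1 (vY + tconst a : T2) by exact: lowD.
have hm : low 1 (vY - tconst a : T2) by exact: lowB.
have : co (subst vX (vY + tconst a) f) 0 = 0.
  have : subst vX 0 (subst vX (vY + tconst a) f) = 0.
    by rewrite subst_comp // subst_X // rmorphD /= subst_Y // add0r subst_ydrop tconstE.
  by rewrite subst_ydrop => /(congr1 (fun f : T2 => co f 0)); rewrite /= tconstE co0E.
move=> e; set f' := subst _ _ f in e.
have E : f' = vY * tshift 1 f'.
  by rewrite -[vY]expr1; apply: tshiftK; case.
have E0 : subst vX (vY - tconst a) f' = f.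
  rewrite subst_comp // subst_X //.
  have -> : subst vX (vY - tconst a) (vY + tconst a) = vY :> T2.
    by rewrite rmorphD /= subst_Y // subst_tconst // subst_ydrop tconstE subrK.
  exact: subst_id.
exists (subst vX (vY - tconst a) (tshift 1 f')).
by rewrite -{1}E0 {1}E rmorphM /= subst_Y.
Qed.

(** The roots are distinct and there are no zero divisors, so a root of f other than a remains a
    root of f / (y - a). *)
Lemma factors (s : seq T1) f : uniq s -> (forall a, a \in s -> co a 0 = 0 /\ subst vX (tconst a) f = 0) ->
  exists g, f = \prod_(a <- s) (vY - tconst a) * g.
Proof.
elim: s f => [|a s IH] f; first by exists f; rewrite big_nil mul1r.
move=> /= /andP[nas us] h; have [a0 fa] := h a (mem_head _ _).
have [g ge] := factor a0 fa.
have [|k ke] := IH g us.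
  move=> b bs; have [|b0 fb] := h b; first by rewrite inE bs orbT.
  split => //; move: fb; rewrite ge rmorphM /= => /(@dom2 _ _ T2) [] //.
  rewrite rmorphB /= subst_Y ?subst_tconst //; last exact: low_tconst.
  rewrite subst_ydrop tconstE -rmorphB => /(congr1 (fun f : T2 => co f 0)).
  rewrite /= tconstE co0E => /eqP; rewrite subr_eq0 => /eqP ba.
  by rewrite -ba bs in nas.
by exists k; rewrite big_cons ge ke mulrA.
Qed.

(* W is the equation of the branch t |-> (u t, v t): either x = t^q, y = v(t),
   where W(t^q, y) is the product of the conjugates of y - v(t), or x = 0. *)
Definition puiseux_branch q z v W :=
  [/\ q.-primitive_root z, co v 0 = 0, cvgt (tconst v : T2),
      (forall i, (0 < i < q)%N -> rot (z ^+ i) v <> v) &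
      subst (vX ^+ q) vY W = \prod_(i < q) (vY - tconst (rot (z ^+ i) v))].

Definition branch W u v :=
  (exists q z, u = tX ^+ q /\ puiseux_branch q z v W) \/ [/\ u = 0, v = tX & W = vX].

Definition pull u v f : T1 := co (subst (tconst u) (tconst v) f) 0.
HB.instance Definition _ u v := GRing.RMorphism.copy (pull u v)
  ((@cst0 _ T2) \o subst (tconst u) (tconst v)).

(** * The conjugates of a Puiseux parametrization and their common equation *)

Section PuiseuxBranch.
Variables (q : nat) (z : C) (v : T1).
Hypotheses (zq : q.-primitive_root z) (v0 : co v 0 = 0).
Hypothesis vd : forall i, (0 < i < q)%N -> rot (z ^+ i) v <> v.

Let q0 : (0 < q)%N := prim_order_gt0 zq.
Let vi i := rot (z ^+ i) v.

Lemma conj0 i : co (vi i) 0 = 0. Proof. by rewrite rotE v0 mulr0. Qed.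

Lemma conj_inj i j : (i < q)%N -> (j < q)%N -> vi i = vi j -> i = j.
Proof.
suff W k l : (k < l)%N -> (l < q)%N -> vi k <> vi l.
  move=> iq jq e; case: (ltngtP i j) => // h; first by case: (W _ _ h jq).
  by case: (W _ _ h iq).
move=> kl lq e; apply: (vd (i := l - k)).
  by rewrite subn_gt0 kl (leq_ltn_trans (leq_subr _ _)).
have zk : z ^+ k != 0 by rewrite expf_neq0 // (prim_root_eq0 zq) -lt0n.
have := congr1 (rot (z ^+ k)^-1) e; rewrite !rot_comp mulVf // rot1 => {2}->.
by rewrite -[in RHS](subnK (ltnW kl)) exprD mulrCA mulVf // mulr1.
Qed.

(** Rotating t by a q-th root of unity leaves x = t^q unchanged, so a relation along v holds along
    every conjugate of v. *)
Lemma conj_pull i h : subst (vX ^+ q) (tconst v) h = 0 ->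
  subst (vX ^+ q) (tconst (vi i)) h = 0.
Proof.
have hv := low_tconst v0.
move=> /(congr1 (subst (k2 (z ^+ i) * vX) vY)); rewrite rmorph0 subst_comp //; last exact: low_Xn.
rewrite rmorphXn /= subst_X; last exact: low_rX.
rewrite subst_rot_tconst exprMn -rmorphXn -exprM mulnC exprM (prim_expr_order zq) expr1n.
by rewrite rmorph1 mul1r.
Qed.

Lemma pullE h a : co a 0 = 0 ->
  subst vX (tconst a) (subst (vX ^+ q) vY h) = subst (vX ^+ q) (tconst a) h.
Proof.
move=> a0; have ha := low_tconst a0.
rewrite subst_comp //; last exact: low_Xn.
by rewrite rmorphXn /= subst_X // subst_Y.
Qed.

Definition conj_prod : T2 := \prod_(i < q) (vY - tconst (vi i)).

Lemma rot_conj i : subst (k2 z * vX) vY (vY - tconst (vi i)) = vY - tconst (vi i.+1) :> T2.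
Proof.
by rewrite rmorphB /= subst_Y // subst_rot_tconst rot_comp -exprS.
Qed.

Lemma conj_ordS (i : 'I_q) : vi (ordS i) = vi i.+1.
Proof. by rewrite /vi /= (prim_expr_mod zq). Qed.

Lemma conj_prod_rot : subst (k2 z * vX) vY conj_prod = conj_prod.
Proof.
rewrite /conj_prod [RHS](reindex_inj (@ordS_inj q)) /= rmorph_prod.
by apply: eq_bigr => i _; rewrite /= rot_conj -conj_ordS.
Qed.

Lemma conj_prod_neq0 : conj_prod <> 0.
Proof.
move=> /(dom_prod (@dom2 _ _ T2)) [i _] /(congr1 (fun f => c2 f 0 1)).
by rewrite c2B c2_Y c2_tconst c20 subr0 => /eqP; rewrite oner_eq0.
Qed.

Variable W : T2.
Hypothesis WE : subst (vX ^+ q) vY W = conj_prod.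

Lemma puiseux_vanish : subst (vX ^+ q) (tconst v) W = 0.
Proof.
rewrite -pullE // WE /conj_prod rmorph_prod (bigD1 (Ordinal q0)) //=.
rewrite rmorphB /= subst_Y ?subst_tconst ?subst_ydrop ?tconstE /vi ?expr0 ?rot1 ?subrr ?mul0r //.
exact: low_tconst.
Qed.

(** The series h(t^q, y) vanishes at q distinct conjugates, hence is divisible by their product. The
    quotient is invariant under rotation, so it descends to a series in x = t^q. *)
Lemma puiseux_div h : subst (vX ^+ q) (tconst v) h = 0 -> exists k, h = W * k.
Proof.
move=> hv; set Q := subst (vX ^+ q) vY h.
have [|a|g ge] := @factors [seq vi i | i <- iota 0 q] Q.
- rewrite map_inj_in_uniq ?iota_uniq // => i j; rewrite !mem_iota /= !add0n => iq jq.
  exact: conj_inj.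
- move=> /mapP[i _ ->]; split; first exact: conj0.
  by rewrite /Q pullE ?conj0 //; apply: conj_pull.
rewrite big_map -{1}[q]subn0 big_mkord -/conj_prod in ge.
have gr : subst (k2 z * vX) vY g = g.
  apply: (dom_mulI (@dom2 _ _ T2) conj_prod_neq0); rewrite -{1}conj_prod_rot -rmorphM /= -ge.
  rewrite /Q subst_comp //; last exact: low_Xn.
  rewrite rmorphXn /= subst_X ?subst_Y //; last exact: low_rX.
  by rewrite exprMn -rmorphXn (prim_expr_order zq) rmorph1 mul1r.
have [k ke] := undilate zq gr.
exists k; apply: (dilate_inj q0); by rewrite rmorphM /= WE -ke.
Qed.

(* Lagrange interpolation at the conjugates. *)
Lemma puiseux_conductor : exists2 D : T1, D <> 0 &
  forall w, exists h, subst (vX ^+ q) (tconst v) h = tconst (D * w).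
Proof.
(* D is the value at y = v of the derivative in y of the product of the y - v_i; it is nonzero
   because the conjugates are distinct. *)
exists (\prod_(i < q | i != Ordinal q0) (v - vi i)).
  rewrite -big_filter => e0; have [i + ei] := dom_prod (@dom1 _ T1) e0; rewrite mem_filter => /andP[i0 _]; move/eqP: ei.
  rewrite subr_eq0 => /eqP e; move/eqP: i0; apply; apply: val_inj => /=.
  by apply: conj_inj => //; rewrite -e /vi expr0 rot1.
move=> w.
(* Rotation permutes the summands cyclically, so H descends to a series in x; at y = v only the
   summand i = 0 survives, with value D w. *)
pose H : T2 := \sum_(i < q) tconst (rot (z ^+ i) w) * \prod_(j < q | j != i) (vY - tconst (vi j)).
have Hr : subst (k2 z * vX) vY H = H.
  rewrite /H [RHS](reindex_inj (@ordS_inj q)) /= rmorph_sum; apply: eq_bigr => i _.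
  rewrite rmorphM /= subst_rot_tconst rot_comp -exprS (prim_expr_mod zq); congr (_ * _).
  rewrite [RHS](reindex_inj (@ordS_inj q)) /= rmorph_prod.
  by apply: eq_big => [j|j _]; [rewrite (inj_eq (@ordS_inj q)) | rewrite /= rot_conj -conj_ordS].
have [h he] := undilate zq Hr.
exists h; rewrite -pullE // -he /H rmorph_sum (bigD1 (Ordinal q0)) //= [X in _ + X]big1 => [|i i0].
  have E a : subst vX (tconst v) (tconst a) = tconst a :> T2.
    by rewrite subst_tconst ?subst_ydrop ?tconstE.
  rewrite addr0 rmorphM rmorph_prod /= E expr0 rot1 mulrC rmorphM rmorph_prod; congr (_ * _).
  by apply: eq_bigr => j _; rewrite !rmorphB /= subst_Y ?E //; exact: low_tconst.
rewrite rmorphM rmorph_prod /= (bigD1 (Ordinal q0)) /=; last by rewrite eq_sym.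
rewrite rmorphB /= subst_Y ?subst_tconst ?subst_ydrop ?tconstE //; last exact: low_tconst.
by rewrite /vi expr0 rot1 subrr mul0r mulr0.
Qed.
End PuiseuxBranch.
End Branch.

(** * Branches as parametrized curves, and factorization into branches *)

Section BranchTheory.
Variables (R : realType) (T1 : fps_theory R[i]) (T2 : fps_theory T1).
Local Notation C := R[i].
Implicit Types (f g h W X Y F : T2) (c z : C) (u v w : T1).

Lemma sum_mul_le (q n : nat) (F : nat -> R) : (0 < q)%N -> (forall i, 0 <= F i) ->
  \sum_(i < n) F (q * i)%N <= \sum_(i < q * n) F i.
Proof.
move=> q0 F0; elim: n => [|n IH]; first by rewrite muln0 !big_ord0.
rewrite big_ord_recr mulnSr big_split_ord /=; apply: lerD => //.
by case: q q0 {IH} => // q _; rewrite big_ord_recl /= addn0 lerDl; apply: sumr_ge0.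
Qed.

Lemma cvgt_undil q W : (0 < q)%N -> cvgt (subst (vX ^+ q) vY W) -> cvgt W.
Proof.
move=> q0 [r [r0 [M b]]]; apply: (@cvgtP _ _ _ W (r ^+ q) r M) => //; first exact: exprn_gt0.
move=> n; apply: le_trans (b (q * n)%N); rewrite !nmE.
apply: (@le_trans _ _ (\sum_(j < n) \sum_(i < q * n) r ^+ i * r ^+ j *
    ComplexField.Normc.normc (c2 (subst (vX ^+ q) vY W) i j))).
  apply: ler_sum => j _.
  pose F i := r ^+ i * r ^+ j * ComplexField.Normc.normc (c2 (subst (vX ^+ q) vY W) i j).
  apply: le_trans (@sum_mul_le q n F q0 _); last by move=> i; apply: weight_ge0; exact: ltW.
  rewrite le_eqVlt; apply/orP; left; apply/eqP; apply: eq_bigr => i _.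
  by rewrite /F c2_dil // dvdn_mulr // mulKn // exprM.
pose G j := \sum_(i < q * n) r ^+ i * r ^+ j *
    ComplexField.Normc.normc (c2 (subst (vX ^+ q) vY W) i j).
apply: (@le_trans _ _ (\sum_(j < n + (q * n - n)) G j)).
  rewrite big_split_ord lerDl; apply: sumr_ge0 => j _; apply: sumr_ge0 => i _.
  by apply: weight_ge0; exact: ltW.
by rewrite subnKC // leq_pmull.
Qed.

Lemma subst_pull u v f : co u 0 = 0 -> co v 0 = 0 ->
  subst (tconst u) (tconst v) f = tconst (pull u v f) :> T2.
Proof.
move=> u0 v0; have hu := @low_tconst _ _ T2 _ u0; have hv := @low_tconst _ _ T2 _ v0.
rewrite /pull -subst_ydrop subst_comp // !subst_ydrop !tconstE //.
Qed.

Lemma pull_const u v c : pull u v (k2 c : T2) = tconst c.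
Proof. by rewrite /pull subst_const tconstE. Qed.
Lemma pull_X u v : co u 0 = 0 -> pull u v (vX : T2) = u.
Proof. by move=> u0; rewrite /pull subst_X ?tconstE //; exact: low_tconst. Qed.
Lemma pull_Y u v : co v 0 = 0 -> pull u v (vY : T2) = v.
Proof. by move=> u0; rewrite /pull subst_Y ?tconstE //; exact: low_tconst. Qed.

Lemma pull_low1 u v f : co (pull u v f) 0 = c2 f 0 0.
Proof.
rewrite -[co _ _]/(c2 (subst (tconst u) (tconst v) f) 0 0) c2_subst /psum addn0.
by rewrite !big_ord1 !expr0 !mulr1 c2_const.
Qed.

Lemma pull_deriv u v f : co u 0 = 0 -> co v 0 = 0 ->
  tderiv (pull u v f) = pull u v (pdx f) * tderiv u + pull u v (pdy f) * tderiv v.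
Proof.
move=> u0 v0; have E (g : T2) : tderiv (co g 0) = co (pdx g) 0 by rewrite coK.
rewrite {1}/pull E pdx_subst; [|exact: low_tconst|exact: low_tconst].
by rewrite coDE !coM0 /pull -!E !tconstE.
Qed.

Lemma subst_y u f : subst 0 vX f = tconst (at0 f) :> T2.
Proof.
have E g i j : c2 (tconst (at0 g) : T2) i j = if j == 0%N then c2 g 0 i else 0.
  by rewrite c2_tconst at0E.
rewrite (@subst_uniq _ _ _ (fun f => tconst (at0 f) : T2)).
- by rewrite at0_X at0_Y rmorph0.
- by move=> x y; rewrite !rmorphB.
- by move=> x y; rewrite !rmorphM.
- by move=> c; rewrite at0_tconst tconstE.
by move=> n g gn i j ij; rewrite E; case: eqP => // j0; apply: gn; rewrite j0 addn0 in ij.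
Qed.

Section OneBranch.
Variables (W : T2) (u v : T1).
Hypothesis b : branch W u v.

Lemma branch_u0 : co u 0 = 0.
Proof.
case: b => [[q [z [-> [zq _ _ _ _]]]]|[-> _ _]]; last exact: co0E.
by rewrite tXnE eq_sym eqn0Ngt (prim_order_gt0 zq).
Qed.
Lemma branch_v0 : co v 0 = 0.
Proof. by case: b => [[q [z [_ []]]]|[_ -> _]] //; rewrite tXE. Qed.
Lemma branch_cu : cvgt (tconst u : T2).
Proof.
case: b => [[q [z [-> _]]]|[-> _ _]]; last by rewrite rmorph0; exact: cvgt0.
by rewrite rmorphXn; apply: cvgt_exp; exact: cvgt_X.
Qed.
Lemma branch_cv : cvgt (tconst v : T2).
Proof. by case: b => [[q [z [_ []]]]|[_ -> _]] //; exact: cvgt_X. Qed.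

Lemma branch_vanish : pull u v W = 0.
Proof.
case: b => [[q [z [-> [zq v0 cv vd WE]]]]|[-> -> ->]]; last by rewrite pull_X ?co0E.
by rewrite /pull rmorphXn /= (puiseux_vanish zq v0 WE) co0E.
Qed.

Lemma branch_div h : pull u v h = 0 -> exists k, h = W * k.
Proof.
move=> p0; have s0 : subst (tconst u) (tconst v) h = 0 :> T2.
  by rewrite subst_pull ?p0 ?rmorph0 ?branch_u0 ?branch_v0.
move: s0; case: b => [[q [z [-> [zq v0 cv vd WE]]]]|[-> -> ->]].
  by rewrite rmorphXn /=; exact: (puiseux_div zq v0 vd WE).
rewrite rmorph0 -/vX (subst_y u) => /(congr1 (fun f : T2 => co f 0)); rewrite /= tconstE co0E /= => h0.
exists (mk (fun j => mk (fun i => c2 h i.+1 j))); apply: c2P => i j.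
rewrite -[vX]expr1 c2_XM; case: i => [|i]; first by rewrite -at0E h0 co0E.
by rewrite subn1 /= [RHS]/c2 !coK.
Qed.

(** The image of C[[x,y]] in C[[t]] contains all multiples of D, so it has finite codimension. This
    finiteness is what makes dimension counts along the branch possible. *)
Lemma branch_cond : exists2 D : T1, D <> 0 & forall w, exists h : T2, pull u v h = D * w.
Proof.
case: b => [[q [z [-> [zq v0 cv vd WE]]]]|[-> -> _]].
  have [D D0 DE] := @puiseux_conductor _ _ T2 q z v zq v0 vd.
  by exists D => // w; have [h hE] := DE w; exists h; rewrite /pull rmorphXn /= hE tconstE.
exists 1; first exact/eqP/oner_neq0.
move=> w; exists (mk (fun j => mk (fun i => if i == 0%N then co w j else 0))).
rewrite /pull rmorph0 -/vX (subst_y u) tconstE mul1r; apply: coP => j.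
by rewrite at0E /c2 !coK.
Qed.

Lemma branch_cW : cvgt W.
Proof.
case: b => [[q [z [_ [zq v0 cv vd WE]]]]|[_ _ ->]]; last exact: cvgt_X.
apply: (cvgt_undil (prim_order_gt0 zq)); rewrite WE; apply: cvgt_prod => i _.
by apply: cvgtB; [exact: cvgt_Y | exact: cvgt_rot].
Qed.

Lemma branch_W00 : c2 W 0 0 = 0.
Proof. by rewrite -(pull_low1 u v) branch_vanish co0E. Qed.

Lemma branch_neq0 : W <> 0.
Proof.
case: b => [[q [z [_ [zq v0 cv vd WE]]]]|[_ _ ->]].
  by move=> W0; apply: (@conj_prod_neq0 _ _ T2 q z v); rewrite /conj_prod -WE W0 rmorph0.
by move/(congr1 (fun f => c2 f 1 0)); rewrite c2_X c20 => /eqP; rewrite oner_eq0.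
Qed.

Lemma branch_uv_neq0 : u <> 0 \/ v <> 0.
Proof.
have X0 n : tX ^+ n <> 0 :> T1.
  by move=> e; have := tXnE T1 n n; rewrite e co0E eqxx => /eqP; rewrite eq_sym oner_eq0.
case: b => [[q [z [-> _]]]|[_ -> _]]; [left | right] => //.
by rewrite -[tX]expr1.
Qed.
End OneBranch.

(** Take a root (t^q, v(t)) with q minimal. If the rotation by z^i fixed v with 0 < i < q, then v
    would be a series in t^(q/d) for d = gcd(i, q), and d < q would do as well. So the conjugates
    are distinct, and their product descends to an equation W of the branch. *)
Lemma branch_exists n F : cvgt F -> has_ord (at0 F) n.+1 ->
  exists W u v k m, [/\ branch W u v, F = W * k & has_ord (at0 W) m.+1].
Proof.
move=> cF oF; have [q1 [Y [q10 cY hY FY]]] := puiseux_root cF oF.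
pose P q := `[< (0 < q)%N /\ exists v, [/\ cvgt (tconst v : T2), co v 0 = 0 &
   subst (vX ^+ q) (tconst v) F = 0] >].
have exP : exists q, P q.
  exists q1; apply/asboolP; split=> //; exists (co Y 0); rewrite -subst_ydrop; split.
  - by apply: cvgt_subst => //; [exact: cvgt_X | exact: cvgt0].
  - by have := hY 0%N 0%N isT.
  have := congr1 (subst vX 0) FY; rewrite rmorph0 subst_comp //; last exact: low_Xn.
  by rewrite rmorphXn /= subst_X.
case: (ex_minnP exP) => q /asboolP[q0 [v [cv v0 Fv]]] qmin.
have [z zq] := @primC R q q0.
have vd i : (0 < i < q)%N -> rot (z ^+ i) v <> v.
  move=> /andP[i0 iq] e.
  pose d := gcdn i q; have d0 : (0 < d)%N by rewrite gcdn_gt0 i0.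
  pose e' := (q %/ d)%N.
  have qE : q = (e' * d)%N by rewrite divnK // dvdn_gcdr.
  have dq : (d < q)%N by apply: leq_ltn_trans iq; apply: dvdn_leq => //; exact: dvdn_gcdl.
  have e'0 : (0 < e')%N by move: q0; rewrite qE muln_gt0 => /andP[].
  have ndv k : ~~ (e' %| k)%N -> co v k = 0.
    move=> nd; have := congr1 (fun u => co u k) e; rewrite /= rotE -exprM => /eqP.
    rewrite -subr_eq0 -{2}[co v k]mul1r -mulrBl mulf_eq0 subr_eq0 -(prim_order_dvd zq).
    move=> /orP[|/eqP //] qik; case/negP: nd.
    rewrite -(@Gauss_dvdr e' (i %/ d)); last first.
      by rewrite coprime_sym /coprime -(eqn_pmul2r d0) muln_gcdl !divnK ?dvdn_gcdl ?dvdn_gcdr // mul1n.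
    by rewrite -(dvdn_pmul2r d0) -qE mulnAC divnK ?dvdn_gcdl.
  pose v' : T1 := mk (fun k => co v (k * e')).
  have vv' : v = tdil e' v'.
    apply: coP => k; rewrite tdilE; case: ifP => [/divnK kE|/negbT /ndv //].
    by rewrite coK kE.
  have v'0 : co v' 0 = 0 by rewrite coK.
  have hv' := @low_tconst _ _ T2 _ v'0.
  have h1 : subst (vX ^+ e') vY (subst (vX ^+ d) (tconst v') F) = 0.
    rewrite subst_comp //; last exact: low_Xn.
    by rewrite rmorphXn /= subst_X ?subst_tdil -?vv' -?exprM -?qE //; exact: low_Xn.
  have h2 : subst (vX ^+ d) (tconst v') F = 0.
    by apply: (dilate_inj e'0); rewrite h1 rmorph0.
  suff /qmin : P d by rewrite leqNgt dq.
  apply/asboolP; split=> //; exists v'; split=> //.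
  apply: (cvgt_undil e'0); rewrite subst_tdil // -vv' //.
pose Pr := @conj_prod _ _ T2 q z v.
have [W WE] := undilate zq (@conj_prod_rot _ _ T2 q z v zq).
have br : branch W (tX ^+ q) v.
  by left; exists q, z; split => //; split => //; rewrite -WE.
have [k FW] : exists k, F = W * k.
  by apply: (branch_div br); rewrite /pull rmorphXn /= Fv co0E.
exists W, (tX ^+ q), v, k, q.-1; split => //; rewrite prednK //.
have -> : at0 W = tX ^+ q.
  transitivity (at0 Pr).
    by apply: coP => j; rewrite !at0E /Pr WE c2_dil // dvdn0 div0n.
  rewrite /Pr /conj_prod rmorph_prod (eq_bigr (fun=> tX)) ?prodr_const ?card_ord // => i _.
  by rewrite rmorphB /= at0_Y at0_tconst rotE v0 mulr0 rmorph0 subr0.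
by rewrite -[_ ^+ q]mulr1; apply: has_ord_mulX; rewrite co1E; exact/eqP/oner_neq0.
Qed.

Definition br := (T2 * (T1 * T1))%type.
Definition isbr (b : br) := branch b.1 b.2.1 b.2.2.
Definition pullb (b : br) f := pull b.2.1 b.2.2 f.

(** Each branch split off lowers the order of F(0, y), and [divide] keeps the cofactor convergent.
    In order 0 the remaining factor is a unit. *)
Lemma branch_factorization n F : cvgt F -> has_ord (at0 F) n ->
  exists s e, [/\ forall b, b \in s -> isbr b, funit e & F = e * \prod_(b <- s) b.1].
Proof.
elim/ltn_ind: n F => -[|n] IH F cF oF.
  exists [::], F; split=> //; last by rewrite big_nil mulr1.
  by apply/funitE; have [_] := oF; rewrite at0E.
have [W [u [v [k [m [bW FW oW]]]]]] := branch_exists cF oF.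
have ck : cvgt k.
  by apply: (divide (branch_neq0 bW) (branch_cW bW)); rewrite -FW.
have k0 : at0 k <> 0.
  by move=> k0; apply: (has_ord_neq0 oF); rewrite FW rmorphM /= k0 mulr0.
have ok := ordP k0.
have om : (m.+1 + ord (at0 k) = n.+1)%N.
  apply: (has_ord_inj (f := at0 F)) => //; rewrite FW rmorphM /=.
  exact: has_ordM.
have [|s [e [sb ue kE]]] := IH (ord (at0 k)) _ k ck ok; first by rewrite -om addSn ltnS leq_addl.
exists ((W, (u, v)) :: s), e; split=> //; last by rewrite big_cons FW kE mulrCA.
by move=> b; rewrite inE => /orP[/eqP ->|/sb].
Qed.

Definition firreducible f := [/\ f <> 0, ~ funit f &
  forall g h, f = g * h -> funit g \/ funit h].

(** When f(0, y) = 0 the branch is the line x = 0, which parametrizations (t^q, v(t)) miss; this is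
    the reason for the second case of [branch]. *)
Lemma irreducible_branch f : firreducible f -> cvgt f ->
  exists b e, [/\ isbr b, funit e, cvgt e & f = e * b.1].
Proof.
move=> [f0 nu irr] cf.
have wlog_ W u v k : branch W u v -> f = W * k -> exists b e, [/\ isbr b, funit e, cvgt e & f = e * b.1].
  move=> bW fE; exists (W, (u, v)), k; split => //; last by rewrite mulrC.
    by case: (irr _ _ fE) => // /funitE []; exact: branch_W00 bW.
  by apply: (divide (branch_neq0 bW) (branch_cW bW)); rewrite -fE.
case: (pselect (at0 f = 0)) => [f00|/ordP].
  have bX : branch (vX : T2) 0 tX by right.
  have [k kE] := @branch_div vX 0 tX bX f (ltac:(by rewrite /pull rmorph0 -/vX (subst_y 0) tconstE)).
  exact: wlog_ bX kE.
case E: (ord (at0 f)) => [|n] oF.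
  by exfalso; apply: nu; apply/funitE; have [_] := oF; rewrite at0E.
have [W [u [v [k [m [bW fE _]]]]]] := branch_exists cf oF.
exact: wlog_ bW fE.
Qed.

Lemma isbr_div b h : isbr b -> pullb b h = 0 -> exists k, h = b.1 * k.
Proof. by move=> bb; exact: (branch_div bb). Qed.
Lemma isbr_vanish b : isbr b -> pullb b b.1 = 0.
Proof. by move=> bb; exact: (branch_vanish bb). Qed.

Lemma pullbM b f g : pullb b (f * g) = pullb b f * pullb b g.
Proof. exact: rmorphM. Qed.
Lemma pullbD b f g : pullb b (f + g) = pullb b f + pullb b g.
Proof. exact: rmorphD. Qed.
Lemma pullbB b f g : pullb b (f - g) = pullb b f - pullb b g.
Proof. exact: rmorphB. Qed.
Lemma pullb_const b c : pullb b (k2 c) = tconst c.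
Proof. exact: pull_const. Qed.
Lemma pullb_unit b e : funit e -> pullb b e <> 0.
Proof.
move=> [g /(congr1 (pullb b))]; rewrite pullbM => h e0; move: h; rewrite e0 mul0r.
by rewrite [pullb b 1]rmorph1 => /eqP; rewrite eq_sym oner_eq0.
Qed.
End BranchTheory.

(** * Dimensions of quotients *)

Section Codim.
Variables (K : fieldType) (E : comNzRingType) (ka : {rmorphism K -> E}).
Implicit Types (U V X : set E).

Definition lcomb n (c : 'I_n -> K) (e : 'I_n -> E) := \sum_i ka (c i) * e i.

Definition subspace U := [/\ U 0, forall x y, U x -> U y -> U (x + y) & forall c x, U x -> U (ka c * x)].

Definition indep n U (e : 'I_n -> E) := forall c, U (lcomb c e) -> forall i, c i = 0.

(* dim V / U = n, with no requirement that U is contained in V *)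
Definition qd U V n := exists e : 'I_n -> E,
  [/\ forall i, V (e i), forall v, V v -> exists c, U (v - lcomb c e) & indep U e].

Lemma subspaceN U x : subspace U -> U x -> U (- x).
Proof. by case=> _ _ h /(h (-1)); rewrite rmorphN1 mulN1r. Qed.
Lemma subspaceB U x y : subspace U -> U x -> U y -> U (x - y).
Proof. by move=> sU Ux Uy; have [_ h _] := sU; apply: h => //; exact: subspaceN. Qed.
Lemma subspace_sum U n (F : 'I_n -> E) : subspace U -> (forall i, U (F i)) -> U (\sum_i F i).
Proof. by case=> U0 UD _ h; elim/big_ind: _. Qed.
Lemma subspace_lcomb U n (c : 'I_n -> K) (e : 'I_n -> E) :
  subspace U -> (forall i, U (e i)) -> U (lcomb c e).
Proof. by move=> sU h; apply: subspace_sum => // i; have [_ _] := sU; apply. Qed.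

Lemma lcombZ n k (c : 'I_n -> K) e : lcomb (fun i => k * c i) e = ka k * lcomb c e.
Proof. by rewrite /lcomb mulr_sumr; apply: eq_bigr => i _; rewrite rmorphM mulrA. Qed.

(** For m > n the coordinate matrix of f in the spanning family has a nonzero left kernel vector,
    which is a relation modulo U. *)
Lemma indep_le U V n m (f : 'I_m -> E) : subspace U -> qd U V n ->
  (forall i, V (f i)) -> indep U f -> (m <= n)%N.
Proof.
move=> sU [e [_ span _]] Vf indf.
have [A AE] := choice (fun i => span _ (Vf i)).
pose M := \matrix_(i < m, j < n) A i j.
rewrite leqNgt; apply/negP => nm.
have nf : ~~ row_free M by rewrite /row_free neq_ltn (leq_ltn_trans (rank_leq_col M)).
have /rowV0Pn[x /sub_kermxP xM x0] : kermx M != 0 by rewrite kermx_eq0.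
case/negP: x0; apply/eqP/rowP => i; rewrite mxE.
apply: (indf (fun i => x ord0 i)).
have -> : lcomb (fun i => x ord0 i) f = \sum_i ka (x ord0 i) * (f i - lcomb (A i) e).
  rewrite (eq_bigr (fun i => ka (x ord0 i) * f i - ka (x ord0 i) * lcomb (A i) e)); last first.
    by move=> j _; rewrite mulrBr.
  rewrite sumrB (_ : \sum_i _ * lcomb _ _ = 0) ?subr0 //.
  under eq_bigr => j _ do rewrite /lcomb mulr_sumr.
  rewrite exchange_big big1 // => k _.
  have /rowP/(_ k) := xM; rewrite !mxE => xk.
  rewrite (eq_bigr (fun j => ka (x ord0 j * M j k) * e k)); last first.
    by move=> j _; rewrite mxE rmorphM mulrA.
  by rewrite -mulr_suml -rmorph_sum xk rmorph0 mul0r.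
apply: subspace_sum => // j; have [_ _] := sU; apply; exact: AE.
Qed.

Lemma qd_inj U V m n : subspace U -> qd U V m -> qd U V n -> m = n.
Proof.
move=> sU qm qn; apply/eqP; rewrite eqn_leq; apply/andP; split.
  by case: qm => e [Ve _ ie]; exact: (indep_le sU qn Ve ie).
by case: qn => e [Ve _ ie]; exact: (indep_le sU qm Ve ie).
Qed.

Definition snoc n (e : 'I_n -> E) (v : E) (i : 'I_n.+1) : E :=
  if unlift ord_max i is Some j then e j else v.

Lemma snoc_sum n (c : 'I_n.+1 -> K) e v :
  lcomb c (snoc e v) = lcomb (fun j : 'I_n => c (lift ord_max j)) e + ka (c ord_max) * v.
Proof.
rewrite /lcomb big_ord_recr /= /snoc unlift_none; congr (_ + _).
apply: eq_bigr => i _.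
have -> : widen_ord (leqnSn n) i = lift ord_max i.
  by apply: val_inj; rewrite /= /bump leqNgt ltn_ord.
by rewrite liftK.
Qed.

(** An independent family of maximal size spans: a vector outside its span could be appended. *)
Lemma qd_exists U V N : subspace U -> subspace V ->
  (forall m (f : 'I_m -> E), (forall i, V (f i)) -> indep U f -> (m <= N)%N) ->
  exists n, qd U V n.
Proof.
move=> sU sV bound.
pose P m := `[< exists f : 'I_m -> E, (forall i, V (f i)) /\ indep U f >].
have P0 : exists m, P m.
  by exists 0%N; apply/asboolP; exists (fun=> 0); split=> [[]//|c _ []].
have Pb m : P m -> (m <= N)%N by move=> /asboolP[f [Vf /bound]]; apply.
case: (ex_maxnP P0 Pb) => n /asboolP[e [Ve ie]] nmax.
exists n, e; split=> // v Vv; apply: contrapT => nv.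
suff /nmax : P n.+1 by rewrite ltnn.
apply/asboolP; exists (snoc e v); split=> [i|c].
  by rewrite /snoc; case: unlift.
rewrite snoc_sum => Uc.
have c0 : c ord_max = 0.
  apply: contrapT => /eqP c0; apply: nv.
  exists (fun j => (- (c ord_max)^-1) * c (lift ord_max j)); rewrite lcombZ.
  have [_ _ /(_ (c ord_max)^-1 _ Uc)] := sU.
  by rewrite mulrDr mulrA -rmorphM mulVf // rmorph1 mul1r rmorphN mulNr opprK addrC.
move=> i; case: (unliftP ord_max i) => [j ->|-> //].
by apply: (ie (fun j => c (lift ord_max j))); move: Uc; rewrite c0 rmorph0 mul0r addr0.
Qed.

Lemma qd_chain U V X n m : subspace U -> subspace V -> (U `<=` V)%classic -> (V `<=` X)%classic ->
  qd U V n -> qd V X m -> qd U X (n + m).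
Proof.
move=> sU sV UV VX [e [Ve se ie]] [f [Xf sf i_f]].
pose g (k : 'I_(n + m)) := match fintype.split k with inl i => e i | inr j => f j end.
have gl i : g (lshift m i) = e i by rewrite /g (unsplitK (inl i)).
have gr j : g (rshift n j) = f j by rewrite /g (unsplitK (inr j)).
have gs c : lcomb c g = lcomb (fun i => c (lshift m i)) e + lcomb (fun j => c (rshift n j)) f.
  by rewrite /lcomb big_split_ord; congr (_ + _); apply: eq_bigr => i _; rewrite ?gl ?gr.
exists g; split.
- by move=> k; rewrite /g; case: (fintype.split k) => // i; exact/VX.
- move=> x Xx; have [d Vd] := sf x Xx; have [c Uc] := se _ Vd.
  exists (fun k => match fintype.split k with inl i => c i | inr j => d j end); rewrite gs.
  rewrite (_ : lcomb _ e = lcomb c e); last by apply: eq_bigr => i _; rewrite (unsplitK (inl i)).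
  rewrite (_ : lcomb _ f = lcomb d f); last by apply: eq_bigr => i _; rewrite (unsplitK (inr i)).
  by rewrite [X in x - X]addrC opprD addrA.
move=> c; rewrite gs => Uc.
have df j : c (rshift n j) = 0.
  apply: (i_f (fun j => c (rshift n j))).
  have := subspaceB sV (UV _ Uc) (subspace_lcomb (fun i => c (lshift m i)) sV Ve).
  by rewrite addrAC subrr add0r.
have ce i : c (lshift m i) = 0.
  apply: (ie (fun i => c (lshift m i))); move: Uc; rewrite [X in _ + X]big1 ?addr0 // => j _.
  by rewrite df rmorph0 mul0r.
by move=> k; rewrite -(splitK k); case: (fintype.split k) => i /=.
Qed.

Definition smul (h : E) U : set E := fun x => exists2 y, U y & x = h * y.

Lemma smul_subspace h U : subspace U -> subspace (smul h U).
Proof.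
case=> U0 UD UZ; split.
- by exists 0; rewrite ?mulr0.
- by move=> _ _ [x Ux ->] [y Uy ->]; exists (x + y); rewrite ?mulrDr //; apply: UD.
- by move=> c _ [x Ux ->]; exists (ka c * x); [apply: UZ | rewrite mulrCA].
Qed.

Lemma lcomb_mul n h (c : 'I_n -> K) e : lcomb c (fun i => h * e i) = h * lcomb c e.
Proof. by rewrite /lcomb mulr_sumr; apply: eq_bigr => i _; rewrite mulrCA. Qed.

Lemma qd_smul h U V n : dom E -> h <> 0 -> qd U V n -> qd (smul h U) (smul h V) n.
Proof.
move=> dE h0 [e [Ve se ie]]; exists (fun i => h * e i); split.
- by move=> i; exists (e i).
- move=> _ [x Vx ->]; have [c Uc] := se x Vx.
  by exists c; exists (x - lcomb c e) => //; rewrite lcomb_mul mulrBr.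
move=> c [y Uy]; rewrite lcomb_mul => /(dom_mulI dE h0) e0.
by apply: ie; rewrite e0.
Qed.

Lemma qd_ext U U' V n : (forall x, U x <-> U' x) -> qd U V n -> qd U' V n.
Proof. by move=> h; have -> : U = U' by apply/funext => x; exact/propext. Qed.
End Codim.

(** * Intersection numbers *)

Section Intersection.
Variables (R : realType) (T1 : fps_theory R[i]) (T2 : fps_theory T1).
Local Notation C := R[i].
Local Notation br := (br T2).
Implicit Types (f g h W X Y F : T2) (c z : C) (u v w : T1) (b : br) (s : seq br).

Local Notation qd1 := (qd (@tconst _ T1)).
Local Notation qd2 := (qd (@k2 _ _ T2)).

Definition idl f g : set T2 := fun x => exists p q : T2, x = p * f + q * g.

Lemma idl_subspace f g : subspace (@k2 _ _ T2) (idl f g).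
Proof.
split.
- by exists 0, 0; rewrite !mul0r addr0.
- by move=> _ _ [a [b ->]] [a' [b' ->]]; exists (a + a'), (b + b'); ring.
- by move=> c _ [a [b ->]]; exists (k2 c * a), (k2 c * b); ring.
Qed.

Definition imult f g n := qd2 (idl f g) setT n.

Lemma imult_inj f g m n : imult f g m -> imult f g n -> m = n.
Proof. exact: qd_inj (idl_subspace f g). Qed.

Lemma imult_idl f g f' g' n : idl f' g' f -> idl f' g' g -> idl f g f' -> idl f g g' ->
  imult f g n -> imult f' g' n.
Proof.
move=> [a [b e1]] [a' [b' e2]] [d [d' e3]] [k [k' e4]]; apply: qd_ext => x; split.
  by move=> [p [q ->]]; exists (p * a + q * a'), (p * b + q * b'); rewrite e1 e2; ring.
by move=> [p [q ->]]; exists (p * d + q * k), (p * d' + q * k'); rewrite e3 e4; ring.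
Qed.

Lemma idll f g : idl f g f. Proof. by exists 1, 0; rewrite mul1r mul0r addr0. Qed.
Lemma idlr f g : idl f g g. Proof. by exists 0, 1; rewrite mul1r mul0r add0r. Qed.

Lemma imultC f g n : imult f g n -> imult g f n.
Proof. by apply: imult_idl; rewrite ?idll ?idlr //; (exact: idll || exact: idlr). Qed.

(** The monomials t^i with i < d form a basis of C[[t]] modulo D. *)
Lemma qd_ord (D : T1) d : has_ord D d -> qd1 (smul D setT) setT d.
Proof.
move=> /has_ordE[e -> e0]; have [w we] : exists w, e * w = 1.
  have : c2 (tconst e : T2) 0 0 <> 0 by rewrite c2_tconst.
  move=> /inverse [w [we _]]; exists (co w 0).
  by rewrite -tconstM we co1E.
have co_l (c : 'I_d -> C) n : co (lcomb (@tconst _ T1) c (fun i : 'I_d => tX ^+ i)) n =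
   \sum_(i < d) (if n == i then c i else 0).
  rewrite /lcomb co_sumE; apply: eq_bigr => i _; rewrite tconstM tXnE.
  by case: eqP; rewrite ?mulr1 ?mulr0.
have co_lt (c : 'I_d -> C) (i : 'I_d) : co (lcomb (@tconst _ T1) c (fun i : 'I_d => tX ^+ i)) i = c i.
  rewrite co_l (bigD1 i) //= eqxx big1 ?addr0 // => j ji.
  by rewrite eq_sym val_eqE (negbTE ji).
exists (fun i => tX ^+ i); split => // [v _|c [y _ e1] i].
  exists (fun i => co v i).
  set r := _ - _; have r0 n : (n < d)%N -> co r n = 0.
    by move=> nd; rewrite coBE (co_lt _ (Ordinal nd)) subrr.
  exists (w * tshift d r) => //; rewrite -mulrA [e * _]mulrA we mul1r.
  exact: tshiftK.
by rewrite -co_lt e1 -mulrA tXnM ltn_ord.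
Qed.

(** Let A be the image of C[[x,y]] in C[[t]] and a that of h. By the conductor A has a finite
    codimension [de], and so has a A in a C[[t]]. The codimension of a A in C[[t]] is thus dim (A /
    a A) + de through A and de + ord a through a C[[t]]. Hence dim (A / a A) = ord a, and A / a A is
    the quotient of C[[x,y]] by h and the equation of the branch. *)
Lemma imult_branch b h : isbr b -> pullb b h <> 0 -> imult h b.1 (ord (pullb b h)).
Proof.
move=> bb a0; set a := pullb b h in a0 *; set m := ord a.
have oa : has_ord a m by exact: ordP.
pose A : set T1 := fun x => exists g, pullb b g = x.
have sA : subspace (@tconst _ T1) A.
  split; first by exists 0; exact: (rmorph0 (pull b.2.1 b.2.2)).
  - by move=> _ _ [g <-] [g' <-]; exists (g + g'); rewrite pullbD.
  by move=> c _ [g <-]; exists (k2 c * g); rewrite pullbM pullb_const.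
have sT : subspace (@tconst _ T1) setT by split.
have [D D0 DA] := branch_cond bb.
have qDB := qd_ord (ordP D0).
have sDB : subspace (@tconst _ T1) (smul D setT) by apply: smul_subspace.
have saA : subspace (@tconst _ T1) (smul a A) by apply: smul_subspace.
have [de qAB] : exists n, qd1 A setT n.
  apply: (@qd_exists _ _ _ _ _ (ord D)) => // k f _ indf.
  apply: (indep_le (f := f) sDB qDB) => // c [y _ e]; apply: indf.
  by have [g ge] := DA y; exists g; rewrite e -ge.
have qaAaB := qd_smul (@dom1 _ T1) a0 qAB.
have qaAB : qd1 (smul a A) setT (de + m).
  apply: (qd_chain _ _ _ _ qaAaB (qd_ord oa)) => //.
  - exact: smul_subspace.
  - by move=> _ [y Ay ->]; exists y.
have [e qaAA] : exists n, qd1 (smul a A) A n.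
  apply: (@qd_exists _ _ _ _ _ (de + m)) => // k f _ indf.
  exact: (indep_le (f := f) saA qaAB).
have em : e = m.
  have : qd1 (smul a A) setT (e + de).
    apply: (qd_chain _ _ _ _ qaAA qAB) => //.
    by move=> _ [y [g <-] ->]; exists (h * g); rewrite pullbM.
  by move=> /(qd_inj saA qaAB); lia.
rewrite em in qaAA; case: qaAA => ev [Aev span ind].
have [G GE] := choice Aev.
have pl (c : 'I_m -> C) : pullb b (lcomb (@k2 _ _ T2) c G) = lcomb (@tconst _ T1) c ev.
  rewrite /lcomb [LHS](rmorph_sum (pull b.2.1 b.2.2)); apply: eq_bigr => i _.
  by rewrite /= -/(pullb b _) pullbM pullb_const GE.
exists G; split => // [g _|c [p [q e1]]].
  have [c [_ [k <-] e1]] := span (pullb b g) (ex_intro _ g erefl).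
  exists c; have : pullb b (g - lcomb (@k2 _ _ T2) c G - h * k) = 0.
    by rewrite !pullbB pl e1 pullbM subrr.
  move=> /(isbr_div bb) [l le]; exists k, l.
  by rewrite [k * h]mulrC [l * _]mulrC -le [RHS]addrC subrK.
apply: ind; rewrite -pl e1 pullbD !pullbM (isbr_vanish bb) mulr0 addr0.
by exists (pullb b p); [exists p | rewrite mulrC].
Qed.

(** Multiplication by f1 embeds the quotient by (h, f2) into the quotient by (h, f1 f2), with
    cokernel the quotient by (h, f1). The hypothesis on p and k says that h is not a zero divisor
    modulo f1 and gives injectivity. *)
Lemma imult_mul h (f1 f2 : T2) m1 m2 : f1 <> 0 ->
  (forall p k : T2, p * h = f1 * k -> exists k', p = f1 * k') ->
  imult h f1 m1 -> imult h f2 m2 -> imult h (f1 * f2) (m2 + m1).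
Proof.
move=> f10 reg q1 [e [_ se ie]].
apply: (qd_chain _ _ _ _ _ q1) => //; try exact: idl_subspace.
  by move=> _ [a [c ->]]; exists a, (c * f2); ring.
exists (fun i => f1 * e i); split.
- by move=> i; exists 0, (e i); ring.
- move=> _ [a [c ->]]; have [d [a' [c' e1]]] := se c I.
  exists d; rewrite lcomb_mul; exists (a + f1 * a'), c'.
  have -> : c = a' * h + c' * f2 + lcomb (@k2 _ _ T2) d e by rewrite -e1 subrK.
  ring.
move=> c [a [d]]; rewrite lcomb_mul => e1.
have [|k ke] := reg a (lcomb (@k2 _ _ T2) c e - d * f2).
  by rewrite mulrBr e1; ring.
apply: ie; exists k, d; apply: (dom_mulI (@dom2 _ _ T2) f10).
by rewrite e1 ke; ring.
Qed.

Lemma imult1 h : imult h 1 0.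
Proof.
exists (fun=> 0); split=> // [v _|c _ []//].
exists (fun=> 0); rewrite /lcomb big_ord0 subr0; exists 0, v; ring.
Qed.

Lemma imult_branches s e h : (forall b, b \in s -> isbr b) -> funit e ->
  (forall b, b \in s -> pullb b h <> 0) ->
  imult h (e * \prod_(b <- s) b.1) (\sum_(b <- s) ord (pullb b h)).
Proof.
move=> sb [e' ee'] sh.
have : imult h (\prod_(b <- s) b.1) (\sum_(b <- s) ord (pullb b h)).
  elim: s sb sh => [|b s IH] sb sh; first by rewrite !big_nil; exact: imult1.
  rewrite !big_cons addnC; have bb := sb b (mem_head _ _); have bh := sh b (mem_head _ _).
  apply: imult_mul.
  - exact: branch_neq0 bb.
  - move=> c k /(congr1 (pullb b)); rewrite !pullbM (isbr_vanish bb) mul0r.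
    by move=> /(@dom1 _ T1) [/(isbr_div bb)|/bh].
  - exact: imult_branch.
  by apply: IH => b' b's; [apply: sb | apply: sh]; rewrite inE b's orbT.
apply: imult_idl; try exact: idll; try exact: idlr.
- by exists 0, e'; rewrite mul0r add0r mulrA [e' * e]mulrC ee' mul1r.
- by exists 0, e; rewrite mul0r add0r.
Qed.
End Intersection.

(** * Generic directions and Teissier's formula *)

Section Teissier.
Variables (R : realType) (T1 : fps_theory R[i]) (T2 : fps_theory T1).
Local Notation C := R[i].
Local Notation br := (br T2).
Implicit Types (f g h W X Y F P Q : T2) (c z : C) (u v w p q : T1) (b : br) (s t : seq br).

Definition avoids (L : seq (C * C)) (z1 z2 : C) := forall l, l \in L -> z1 * l.2 <> z2 * l.1.
(** Unlike in [generic_P1], the pair (0, 0) has no clause of its own: any nonempty list L already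
    rules it out. *)
Definition generic (A : C -> C -> Prop) := exists L : seq (C * C),
  (forall l, l \in L -> l <> (0, 0)) /\ forall z1 z2, avoids L z1 z2 -> A z1 z2.

Lemma genericI (A B : C -> C -> Prop) : generic A -> generic B -> generic (fun x y => A x y /\ B x y).
Proof.
move=> [L [L0 hL]] [M [M0 hM]]; exists (L ++ M); split.
  by move=> l; rewrite mem_cat => /orP[/L0|/M0].
by move=> x y h; split; [apply: hL | apply: hM] => l lL; apply: h; rewrite mem_cat lL ?orbT.
Qed.

Lemma generic_all (I : eqType) (s : seq I) (A : I -> C -> C -> Prop) :
  (forall i, i \in s -> generic (A i)) -> generic (fun x y => forall i, i \in s -> A i x y).
Proof.
elim: s => [|i s IH] h; first by exists [::].
have [] := genericI (h i (mem_head _ _)) (IH (fun j js => h j (mem_behead (s := i :: s) js))).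
move=> L [L0 hL]; exists L; split=> // x y /hL [Ai As] j; rewrite inE => /orP[/eqP ->|/As] //.
Qed.

Lemma generic_sub (A B : C -> C -> Prop) : (forall x y, A x y -> B x y) -> generic A -> generic B.
Proof. by move=> AB [L [L0 hL]]; exists L; split=> // x y /hL /AB. Qed.

Lemma generic_neq1 : generic (fun x y => x <> 0).
Proof.
exists [:: (0, 1)]; split=> [l|x y /(_ _ (mem_head _ _)) /= h x0].
  by rewrite inE => /eqP -> /(congr1 snd) /= /eqP; rewrite oner_eq0.
by apply: h; rewrite x0 mul0r mulr0.
Qed.
Lemma generic_neq2 : generic (fun x y => y <> 0).
Proof.
exists [:: (1, 0)]; split=> [l|x y /(_ _ (mem_head _ _)) /= h x0].
  by rewrite inE => /eqP -> /(congr1 fst) /= /eqP; rewrite oner_eq0.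
by apply: h; rewrite x0 mul0r mulr0.
Qed.

Lemma generic_exists (A : C -> C -> Prop) : generic A -> exists x y, A x y.
Proof.
move=> [L [L0 hL]].
suff [y hy] : exists y : C, forall l, l \in L -> 1 * l.2 <> y * l.1.
  by exists 1, y; apply: hL.
(* A slope of modulus larger than all the forbidden ones. *)
pose m := \sum_(l <- L) ComplexField.Normc.normc (l.2 / l.1) + 1.
exists (m%:C)%C => l lL; rewrite mul1r => e.
have l1 : l.1 != 0.
  apply/eqP => l10; apply: (L0 l lL); move: e; rewrite l10 mulr0.
  by case: l l10 {lL} => a b /= -> ->.
have : ComplexField.Normc.normc (l.2 / l.1) < m.
  rewrite /m ltr_pwDr // (big_rem l) //= lerDl; apply: sumr_ge0 => k _; exact: normc_ge0.
rewrite e mulfK // /ComplexField.Normc.normc /= expr0n addr0 sqrtr_sqr ltNge ler_norm //.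
Qed.

Lemma generic_ord p q : ~ (p = 0 /\ q = 0) ->
  exists n, generic (fun x y => has_ord (tconst x * p + tconst y * q) n).
Proof.
move=> pq.
pose A n := `[< co p n <> 0 \/ co q n <> 0 >].
have exA : exists n, A n.
  apply: contrapT => h; apply: pq.
  have z n : co p n = 0 /\ co q n = 0.
    by split; apply: contrapT => z; apply: h; exists n; apply/asboolP; [left|right].
  by split; apply: coP => n; rewrite co0E; have [] := z n.
case: (ex_minnP exA) => n /asboolP nz nmin; exists n.
(* With n the smaller of the two orders, the only bad direction is the one in which the coefficients
   of degree n cancel. *)
exists [:: (co q n, - co p n)]; split=> [l|x y /(_ _ (mem_head _ _)) /= h].
  by rewrite inE => /eqP -> e; have /= q0 := congr1 fst e; have /= /eqP := congr1 snd e; rewrite oppr_eq0 => /eqP p0; case: nz.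
split=> [i ni|]; last first.
  rewrite coDE !tconstM => e; apply: h; rewrite mulrN; apply/eqP; rewrite -subr_eq0.
  by rewrite -opprD e oppr0.
rewrite coDE !tconstM; have z : ~ A i by move/nmin; rewrite leqNgt ni.
have -> : co p i = 0 by apply: contrapT => ?; apply: z; apply/asboolP; left.
have -> : co q i = 0 by apply: contrapT => ?; apply: z; apply/asboolP; right.
by rewrite !mulr0 addr0.
Qed.

Lemma generic_poly (p : {poly C}) : p != 0 -> generic (fun x y => x <> 0 /\ p.[y / x] <> 0).
Proof.
move=> p0; have [rs e] := closed_field_poly_normal p.
have : generic (fun x y => forall r, r \in rs -> y <> x * r).
  apply: generic_all => r _; exists [:: (1, r)]; split=> [l|x y /(_ _ (mem_head _ _)) /= h e1].
    by rewrite inE => /eqP -> /(congr1 fst) /= /eqP; rewrite oner_eq0.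
  by apply: h; rewrite mulr1 e1.
move=> /(genericI generic_neq1); apply: generic_sub => x y [x0 h]; split => //.
rewrite e hornerZ => /eqP; rewrite mulf_eq0 lead_coef_eq0 (negbTE p0) /=.
rewrite -/(root _ _) root_prod_XsubC => /h; apply.
by rewrite mulrC divfK //; exact/eqP.
Qed.

Definition ord0_at f n := (exists i j, (i + j)%N = n /\ c2 f i j <> 0) /\ low n f.

Lemma ord0_at_inj f m n : ord0_at f m -> ord0_at f n -> m = n.
Proof.
move=> [[i [j [ij fm]]] lm] [[k [l [kl fn]]] ln].
case: (ltngtP m n) => // h; first by case: fm; apply: ln; rewrite ij.
by case: fn; apply: lm; rewrite kl.
Qed.

Lemma ord0_at_exists f : f <> 0 -> exists n, ord0_at f n.
Proof.
move=> f0; pose A n := `[< exists i j, (i + j)%N = n /\ c2 f i j <> 0 >].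
have exA : exists n, A n.
  apply: contrapT => h; apply: f0; apply: c2P => i j; rewrite c20; apply: contrapT => z.
  by apply: h; exists (i + j)%N; apply/asboolP; exists i, j.
case: (ex_minnP exA) => n /asboolP An nmin; exists n; split=> // i j ij.
apply: contrapT => z; have : A (i + j)%N by apply/asboolP; exists i, j.
by move/nmin; rewrite leqNgt ij.
Qed.

(** The right side is the homogeneous part of degree n of f at (1, c). It makes the order of f on a
    generic line through 0 equal to the order of f at 0. *)
Lemma co_line c f n : co (pull tX (tconst c * tX) f) n = \sum_(j < n.+1) c2 f (n - j) j * c ^+ j.
Proof.
have h1 : co (tX : T1) 0 = 0 by rewrite tXE.
have h2 : co (tconst c * tX : T1) 0 = 0 by rewrite tconstM h1 mulr0.
pose phi g : T2 := tconst (pull tX (tconst c * tX) g).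
pose psi g : T2 := tconst (mk (fun n => \sum_(j < n.+1) c2 g (n - j) j * c ^+ j)).
have psiE g k : co (co (psi g) 0) k = \sum_(j < k.+1) c2 g (k - j) j * c ^+ j.
  by rewrite /psi tconstE coK.
have psic g i j : c2 (psi g) i j = if j == 0%N then \sum_(k < i.+1) c2 g (i - k) k * c ^+ k else 0.
  by rewrite /psi c2_tconst coK.
suff e : phi f = psi f by have := psiE f n; rewrite -e /phi tconstE.
apply: (@additive_ext _ _ _ 0).
- by move=> x y; rewrite /phi !rmorphB.
- move=> x y; apply: c2P => i j; rewrite c2B !psic; case: ifP => _; rewrite ?subr0 //.
  by rewrite -sumrB; apply: eq_bigr => k _; rewrite c2B mulrBl.
- by move=> k g gk; rewrite /phi -subst_pull //; apply: subst_low; move: gk; rewrite addn0.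
- move=> k g; rewrite addn0 => gk i j ij; rewrite psic; case: eqP => // j0.
  apply: big1 => l _; have li : (l <= i)%N by rewrite -ltnS.
  by rewrite gk ?mul0r // subnK //; rewrite j0 addn0 in ij.
move=> k a b.
have -> : phi (k2 k * vX ^+ a * vY ^+ b) = tconst (tconst k * tX ^+ a * (tconst c * tX) ^+ b).
  by rewrite /phi; congr tconst; rewrite !rmorphM !rmorphXn /= pull_const pull_X // pull_Y // rmorphM.
apply: c2P => i j; rewrite psic c2_tconst; case: eqP => // _.
rewrite -mulrA tconstM exprMn mulrCA -rmorphXn -exprD tconstM tXnE.
under eq_bigr => l _ do rewrite c2_term.
case: (eqVneq i (a + b)%N) => [->|iab].
  have bl : (b < (a + b).+1)%N by rewrite ltnS leq_addl.
  rewrite (bigD1 (Ordinal bl)) //= addnK !eqxx /= big1 ?addr0 ?mulr1 // => l.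
  by rewrite -val_eqE /= => /negbTE lb; rewrite lb andbF mul0r.
rewrite !mulr0 big1 // => l _; case: ifP; rewrite ?mul0r // => /andP[/eqP la /eqP lb].
by case/eqP: iab; rewrite -la -lb subnK // -ltnS ltn_ord.
Qed.

(** Jacobian form of reducedness: if the equation of b divided f twice, both partial derivatives
    would vanish along b. *)
Definition reduced f s := forall b, b \in s -> ~ (pullb b (pdx f) = 0 /\ pullb b (pdy f) = 0).

Lemma reduced_rest f b g h s : isbr b -> b \in s -> reduced f s -> f = g * b.1 * h -> pullb b (g * h) <> 0.
Proof.
move=> bb bs rf e gh; apply: (rf b bs).
have bv := isbr_vanish bb.
have {}e : f = (g * h) * b.1 by rewrite e; ring.
by rewrite e pdxM pdyM !pullbD (pullbM b (g * h)) (pullbM b (g * h)) (pullbM b (pdx _)) (pullbM b (pdy _))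
  gh bv !mul0r !mulr0 addr0.
Qed.

Lemma reduced_div s e f g : (forall b, b \in s -> isbr b) -> reduced f s ->
  f = e * \prod_(b <- s) b.1 -> (forall b, b \in s -> pullb b g = 0) ->
  exists k, g = \prod_(b <- s) b.1 * k.
Proof.
elim: s e g => [|b s IH] e g sb rf fE h; first by exists g; rewrite big_nil mul1r.
have bb := sb b (mem_head _ _).
have [k ke] := isbr_div bb (h b (mem_head _ _)).
have [||||k' k'e] := IH (e * b.1) k.
- by move=> b' b's; apply: sb; rewrite inE b's orbT.
- by move=> b' b's; apply: rf; rewrite inE b's orbT.
- by rewrite fE big_cons mulrA.
- move=> b' b's; have b's' : b' \in b :: s by rewrite inE b's orbT.
  have := h b' b's'; rewrite ke pullbM => /(@dom1 _ T1) [b0|//].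
  have := @reduced_rest f b' (e * b.1) (\prod_(c <- rem b' s) c.1) (b :: s) (sb _ b's') b's' rf.
  rewrite fE big_cons (big_rem b') //= !mulrA => /(_ erefl) [].
  by rewrite !pullbM b0 mulr0 mul0r.
by exists k'; rewrite ke k'e big_cons mulrA.
Qed.

Lemma at0_pdy f : at0 (pdy f) = tderiv (at0 f).
Proof. by apply: coP => j; rewrite at0E tderivE at0E c2_pdy. Qed.

Lemma tderiv_ord p n : has_ord p n.+1 -> has_ord (tderiv p) n.
Proof.
move=> [h1 h2]; split=> [i ni|]; rewrite tderivE; first by rewrite h1 ?mul0rn.
by move/(mulrn_eq0C (ltn0Sn n)).
Qed.

Lemma ord_gt0 p : p <> 0 -> co p 0 = 0 -> exists2 n, ord p = n.+1 & has_ord p n.+1.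
Proof.
move=> p0 c0; have := ordP p0; case: (ord p) => [[_ /(_ c0)]//|n]; by exists n.
Qed.

Section Curve.
Variables (f e : T2) (s : seq br).
Hypotheses (cf : cvgt f) (ue : funit e) (sb : forall b, b \in s -> isbr b).
Hypotheses (fE : f = e * \prod_(b <- s) b.1) (rf : reduced f s) (f00 : c2 f 0 0 = 0).

Lemma curve_neq0 : f <> 0.
Proof.
rewrite fE; apply: mul_neq0 => //.
  by move=> e0; move/funitE: ue; rewrite e0 c20.
by move=> /(dom_prod (@dom2 _ _ T2)) [b bs]; exact: branch_neq0 (sb bs).
Qed.

Lemma curve_div g : (forall b, b \in s -> pullb b g = 0) -> exists k, g = f * k.
Proof.
move=> h; have [k ke] := reduced_div sb rf fE h.
have [e' ee'] := ue; exists (e' * k); rewrite fE ke.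
by have -> : e * \prod_(b <- s) b.1 * (e' * k) = (e * e') * \prod_(b <- s) b.1 * k;
  [ring | rewrite ee' mul1r].
Qed.

(** Needed for the generic polar to be regular in y, so that it factors into branches. If both
    restrictions vanished, x^2 would divide f; the branch among s that is the line x = 0 would then
    contradict reducedness. *)
Lemma curve_at0 : ~ (at0 (pdx f) = 0 /\ at0 (pdy f) = 0).
Proof.
move=> [x0 y0].
have af : at0 f = 0.
  apply: contrapT => /ord_gt0 [|n _ /tderiv_ord /has_ord_neq0]; first by rewrite at0E.
  by rewrite -at0_pdy.
have bX : branch (vX : T2) 0 tX by right.
have pX g : pull 0 tX g = at0 g by rewrite /pull rmorph0 -/vX (subst_y 0) tconstE.
have [g gE] : exists g, f = vX * g by apply: (branch_div bX); rewrite pX.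
have ag : at0 g = 0.
  by move: x0; rewrite gE pdxM pdx_X mul1r rmorphD rmorphM /= at0_X mul0r addr0.
have [g' g'E] : exists g', g = vX * g' by apply: (branch_div bX); rewrite pX.
have : at0 f = 0 by [].
rewrite fE rmorphM rmorph_prod /= => /(@dom1 _ T1) [e0|/(dom_prod (@dom1 _ T1)) [b bs b0]].
  by move/funitE: ue; rewrite -at0E e0 co0E.
have [k kE] : exists k, b.1 = vX * k by apply: (branch_div bX); rewrite pX.
have := isbr_vanish (sb bs); rewrite kE pullbM => /(@dom1 _ T1) [xb|kb].
  by apply: (rf bs); split; rewrite gE g'E ?(pdxM, pdyM) !(pullbD, pullbM, pdxM, pdyM) xb; ring.
have [k' k'E] := isbr_div (sb bs) kb.
have : b.1 * (vX * k') = b.1 * 1 by rewrite mulr1 [in RHS]kE [in RHS]k'E mulrCA.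
move=> /(dom_mulI (@dom2 _ _ T2) (branch_neq0 (sb bs))) /(congr1 (fun g => c2 g 0 0)).
by rewrite c2M0 c2_X mul0r c21 => /eqP; rewrite eq_sym oner_eq0.
Qed.

Lemma curve_branch b : b \in s -> pullb b f = 0.
Proof.
move=> bs; rewrite fE (big_rem b) //= !pullbM (isbr_vanish (sb bs)); ring.
Qed.

Variables z1 z2 : C.
Let D := k2 z1 * pdx f + k2 z2 * pdy f.
Hypotheses (z10 : z1 <> 0) (z20 : z2 <> 0).
Hypothesis Ds : forall b, b \in s -> pullb b D <> 0.
Hypothesis D0 : at0 D <> 0.
Variable nu : nat.
Hypotheses (fnu : ord0_at f nu)
  (nuz : \sum_(j < nu.+1) c2 f (nu - j) j * (z2 / z1) ^+ j <> 0).

(* Along a branch of the polar curve D = 0 one has z2 df = f_x d(z2 x - z1 y). *)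
Theorem teissier : exists mu, imult (pdx f) (pdy f) mu /\
  (\sum_(b <- s) ord (pullb b D) + 1 = mu + nu)%N.
Proof.
have cD : cvgt D.
  by apply: cvgtD; apply: cvgtM; (exact: cvgt_const || exact: cvgt_pdx || exact: cvgt_pdy).
have z1n : z1 != 0 by exact/eqP.
have [t [e' [tb ue' DE]]] := branch_factorization cD (ordP D0).
have Dt d : d \in t -> pullb d D = 0.
  by move=> dt; rewrite DE (big_rem d) //= !pullbM (isbr_vanish (tb d dt)); ring.
(* If f and D shared the branch d, the cofactor g of d in f would vanish on every branch of f, since
   D does not. Then f would divide g and the equation of d would be a unit. *)
have ft d : d \in t -> pullb d f <> 0.
  move=> dt fd; have [g gE] := isbr_div (tb d dt) fd.
  have [k kE] := isbr_div (tb d dt) (Dt d dt).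
  have [|l lE] := @curve_div g.
    move=> b bs; have := curve_branch bs; rewrite gE pullbM => /(@dom1 _ T1) [b0|//].
    by case: (Ds bs); rewrite kE pullbM b0 mul0r.
  have : f * (d.1 * l) = f * 1 by rewrite mulr1 [in RHS]gE lE; ring.
  move=> /(dom_mulI (@dom2 _ _ T2) curve_neq0) /(congr1 (fun g => c2 g 0 0)).
  by rewrite c2M0 (branch_W00 (tb d dt)) mul0r c21 => /eqP; rewrite eq_sym oner_eq0.
pose L : T2 := k2 z2 * vX - k2 z1 * vY.
have L00 : c2 L 0 0 = 0 by rewrite c2B !c2_constM c2_X c2_Y !mulr0 subr0.
have key d : d \in t -> [/\ pullb d (pdx f) <> 0, pullb d L <> 0 &
    ord (pullb d f) = (ord (pullb d (pdx f)) + ord (pullb d L))%N].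
  move=> dt; have bd := tb d dt; have u0 := branch_u0 bd; have v0 := branch_v0 bd.
  have [n fn of_] := @ord_gt0 (pullb d f) (ft d dt) (etrans (pull_low1 _ _ _) f00).
  have of' := tderiv_ord of_.
  have eq1 : tconst z2 * tderiv (pullb d f) = pullb d (pdx f) * tderiv (pullb d L).
    have -> : pullb d L = tconst z2 * d.2.1 - tconst z1 * d.2.2.
      by rewrite /L pullbB !pullbM !pullb_const /pullb pull_X // pull_Y.
    rewrite /pullb pull_deriv // -/(pullb _ _) -/(pullb _ _).
    rewrite raddfB /= !tderivM !tderiv_const !mul0r !add0r.
    have := Dt d dt; rewrite /D pullbD !pullbM !pullb_const => h.
    have -> : tconst z2 * (pullb d (pdx f) * tderiv d.2.1 + pullb d (pdy f) * tderiv d.2.2) =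
      (tconst z1 * pullb d (pdx f) + tconst z2 * pullb d (pdy f)) * tderiv d.2.2
      + pullb d (pdx f) * (tconst z2 * tderiv d.2.1 - tconst z1 * tderiv d.2.2) by ring.
    by rewrite h mul0r add0r.
  have oz : has_ord (tconst z2 : T1) 0 by split=> //; rewrite tconstE.
  have o1 := has_ordM (@domC R) oz of'; rewrite eq1 add0n in o1.
  have fx0 : pullb d (pdx f) <> 0.
    by move=> fx0; apply: (has_ord_neq0 o1); rewrite fx0 mul0r.
  have L0 : pullb d L <> 0.
    by move=> L0; apply: (has_ord_neq0 o1); rewrite L0 raddf0 mulr0.
  split=> //; have [m Lm oL] := @ord_gt0 (pullb d L) L0 (etrans (pull_low1 _ _ _) L00).
  have := has_ord_inj o1 (has_ordM (@domC R) (ordP fx0) (tderiv_ord oL)).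
  by rewrite fn Lm => ->; rewrite addnS.
(* The intersection number of f and D is computed twice, along the branches of the polar D and along
   those of f. *)
have IfD : imult f D (\sum_(d <- t) ord (pullb d f)).
  by rewrite [D in imult _ D]DE; apply: imult_branches.
have IDf : imult D f (\sum_(b <- s) ord (pullb b D)).
  by rewrite [f in imult _ f]fE; apply: imult_branches.
have e1 := imult_inj IfD (imultC IDf).
have Ifx : imult (pdx f) D (\sum_(d <- t) ord (pullb d (pdx f))).
  by rewrite [D in imult _ D]DE; apply: imult_branches => // d /key [].
have IL : imult L D (\sum_(d <- t) ord (pullb d L)).
  by rewrite [D in imult _ D]DE; apply: imult_branches => // d /key [].
exists (\sum_(d <- t) ord (pullb d (pdx f))); split.
  (* As z2 <> 0, the pairs f_x, D and f_x, f_y generate the same ideal. *)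
  move: Ifx; apply: imult_idl; try exact: idll.
    by exists (k2 z1), (k2 z2).
  exists (- k2 (z1 / z2)), (k2 z2^-1); rewrite /D mulrDr !mulrA -!rmorphM mulVf; last exact/eqP.
  by rewrite rmorph1 mul1r [z2^-1 * _]mulrC; ring.
(* The line L = 0 is itself a branch, y = c x. On it D equals z1 times the derivative of f(t, c t),
   which has order nu - 1 because f(t, c t) has order nu. So L contributes nu - 1 to the sum of the
   orders of f over the branches of D. *)
pose c := z2 / z1; pose vl : T1 := tconst c * tX; pose Wl : T2 := vY - tconst vl.
have vl0 : co vl 0 = 0 by rewrite tconstM tXE mulr0.
have WlE : Wl = vY - k2 c * vX by rewrite /Wl /vl rmorphM.
have bl : isbr ((Wl, (tX, vl)) : br).
  left; exists 1%N, 1; rewrite expr1; split=> //; split=> //.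
  - by rewrite /primitive_root_of_unity; apply/andP; split => //; apply/forallP => i; rewrite ord1 unity_rootE expr1 !eqxx.
  - by rewrite /vl rmorphM; apply: cvgtM; [exact: cvgt_const | exact: cvgt_X].
  - by move=> i; case: i => [|[|i]].
  by rewrite expr1 subst_id big_ord1 expr0 rot1.
have pD : tconst z1 * tderiv (pull tX vl f) = pullb (Wl, (tX, vl)) D.
  rewrite pull_deriv ?tXE // /D pullbD !pullbM !pullb_const -!/(pullb (Wl, (tX, vl)) _).
  have -> : tderiv tX = 1 :> T1.
    by apply: coP => n; rewrite tderivE tXE co1E eqSS; case: n => [|n]; rewrite ?mul0rn.
  have -> : tderiv vl = tconst c.
    rewrite tderivM tderiv_const mul0r add0r.
    have -> : tderiv tX = 1 :> T1.
      by apply: coP => n; rewrite tderivE tXE co1E eqSS; case: n => [|n]; rewrite ?mul0rn.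
    by rewrite mulr1.
  by rewrite mulr1 mulrDr mulrCA -rmorphM /c mulrCA mulfV // mulr1; ring.
have ofl : has_ord (pull tX vl f) nu.
  split=> [i ni|]; rewrite co_line //; apply: big1 => j _.
  have [_ lf] := fnu; have ji : (j <= i)%N by rewrite -ltnS.
  by rewrite lf ?mul0r // subnK.
case En : nu => [|n].
  have [[i [j [ij fij]]] _] := fnu; exfalso; apply: fij; move: ij; rewrite En => /eqP.
  by rewrite addn_eq0 => /andP[/eqP -> /eqP ->].
rewrite En in ofl.
have oDl : has_ord (pullb (Wl, (tX, vl)) D) n.
  rewrite -pD -[n]add0n; apply: has_ordM => //; last exact: tderiv_ord.
  by split=> //; rewrite tconstE.
have IDl : imult D Wl n.
  by have := imult_branch bl (has_ord_neq0 oDl); rewrite (ordE oDl).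
have e0 : k2 z1^-1 * k2 z1 = 1 :> T2 by rewrite -rmorphM mulVf // rmorph1.
have ec : k2 c = k2 z2 * k2 z1^-1 :> T2 by rewrite -rmorphM.
have ILD : imult L D n.
  apply: imult_idl (imultC IDl); try exact: idll; try exact: idlr.
    exists (- k2 z1^-1), 0; rewrite WlE /L ec.
    have -> : - k2 z1^-1 * (k2 z2 * vX - k2 z1 * vY) + 0 * D =
       (k2 z1^-1 * k2 z1) * vY - k2 z2 * k2 z1^-1 * vX by ring.
    by rewrite e0 mul1r.
  exists (- k2 z1), 0; rewrite WlE /L ec.
  have -> : - k2 z1 * (vY - k2 z2 * k2 z1^-1 * vX) + 0 * D =
       (k2 z1^-1 * k2 z1) * (k2 z2 * vX) - k2 z1 * vY by ring.
  by rewrite e0 mul1r.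
have e2 := imult_inj ILD IL.
rewrite -e1 addn1 addnS e2 -big_split /=; congr _.+1.
rewrite !big_seq; apply: eq_bigr => d dt; by have [_ _] := key d dt.
Qed.
End Curve.
End Teissier.

(** * Values of convergent series *)

Section Eval.
Variables (R : realType) (T1 : fps_theory R[i]) (T2 : fps_theory T1).
Local Notation C := R[i].
Local Notation normc := (@ComplexField.Normc.normc R).
Implicit Types (f g h X Y : T2) (c t : C) (u v w : T1) (z : C * C) (r s M : R).

Definition cvC (a : nat -> C) (l : C) :=
  forall e, 0 < e -> exists N, forall n, (N <= n)%N -> normc (a n - l) < e.

Lemma normc_Re c : `|complex.Re c| <= normc c.
Proof.
case: c => a b; rewrite /ComplexField.Normc.normc /= -sqrtr_sqr ler_wsqrtr // lerDl sqr_ge0 //.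
Qed.
Lemma normc_Im c : `|complex.Im c| <= normc c.
Proof.
case: c => a b; rewrite /ComplexField.Normc.normc /= -sqrtr_sqr ler_wsqrtr // lerDr sqr_ge0 //.
Qed.
Lemma normc_ReIm c : normc c <= `|complex.Re c| + `|complex.Im c|.
Proof.
case: c => a b; rewrite /ComplexField.Normc.normc /= -[leRHS]ger0_norm ?addr_ge0 //.
rewrite -sqrtr_sqr ler_wsqrtr // sqrrD !real_normK ?num_real //.
by rewrite addrAC lerDl mulrn_wge0 // mulr_ge0.
Qed.
Lemma normcB c t : normc (c - t) = normc (t - c).
Proof. by rewrite -normcN opprB. Qed.
Lemma normcD_le c t : normc (c + t) <= normc c + normc t.
Proof. exact: le_normcD. Qed.
Lemma normc_dist c t : normc c - normc t <= normc (c - t).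
Proof. by rewrite lerBlDr -{1}(subrK t c) normcD_le. Qed.
Lemma normcX c n : normc (c ^+ n) = normc c ^+ n.
Proof. by elim: n => [|n IH]; rewrite ?expr0 ?nc1 // !exprS ncM IH. Qed.
Lemma normc_eq0 c : normc c = 0 -> c = 0.
Proof. exact: ComplexField.Normc.eq0_normc. Qed.
Lemma normc_gt0 c : c <> 0 -> 0 < normc c.
Proof. by move=> c0; rewrite lt_def normc_ge0 andbT; apply/eqP => /normc_eq0. Qed.
Lemma normcV c : normc c^-1 = (normc c)^-1.
Proof. exact: ComplexField.Normc.normcV. Qed.

Lemma Re_sub c t : complex.Re (c - t) = complex.Re c - complex.Re t.
Proof. by case: c => a b; case: t. Qed.
Lemma Im_sub c t : complex.Im (c - t) = complex.Im c - complex.Im t.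
Proof. by case: c => a b; case: t. Qed.

Lemma cvC_clim a l : cvC a l -> clim a = l.
Proof.
move=> al; have h (p : C -> R) (pB : forall x y, p (x - y) = p x - p y)
    (pn : forall x, `|p x| <= normc x) : lim ((fun n => p (a n)) @ \oo)%classic = p l.
  apply: cvg_lim => //; apply/cvgrPdist_lt => e e0.
  have [N hN] := al e e0; exists N => // n /= Nn.
  by rewrite -pB; apply: le_lt_trans (pn _) _; rewrite normcB; exact: hN.
rewrite /clim (h (@complex.Re R) Re_sub normc_Re) (h (@complex.Im R) Im_sub normc_Im).
by case: (l).
Qed.

Lemma cvC_eq a b l : a =1 b -> cvC a l -> cvC b l.
Proof. by move=> ab al e /al [N hN]; exists N => n /hN; rewrite ab. Qed.
Lemma cvC_sub a b k l : cvC a k -> cvC b l -> cvC (fun n => a n - b n) (k - l).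
Proof.
move=> ak bl e e0; have e2 : 0 < e / 2 by rewrite divr_gt0.
have [N hN] := ak _ e2; have [M hM] := bl _ e2.
exists (maxn N M) => n; rewrite geq_max => /andP[/hN h1 /hM h2].
have -> : a n - b n - (k - l) = (a n - k) + - (b n - l) by ring.
by apply: le_lt_trans (normcD_le _ _) _; rewrite normcN [e]splitr ltrD.
Qed.
Lemma cvC_le a l M : cvC a l -> (forall n, normc (a n) <= M) -> normc l <= M.
Proof.
move=> al aM; apply/ler_addgt0Pl => e /al [N /(_ N (leqnn N)) h].
have -> : l = - (a N - l) + a N by ring.
by apply: le_trans (normcD_le _ _) _; rewrite normcN lerD // ltW.
Qed.

(** For p the real or the imaginary part, p(a) + b and b are both nondecreasing and bounded, so
    their difference p(a) converges. *)
Lemma cvC_exists (a : nat -> C) (b : nat -> R) M : (forall n, b n <= M) ->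
  (forall m n, (n <= m)%N -> normc (a m - a n) <= b m - b n) -> exists l, cvC a l.
Proof.
move=> bM h.
have ndb : nondecreasing_seq b.
  by move=> n m nm; rewrite -subr_ge0; apply: le_trans (h m n nm); exact: normc_ge0.
have cb : cvgn b.
  by apply: nondecreasing_is_cvgn => //; exists M => _ [n _ <-].
have key (p : C -> R) (pB : forall x y, p (x - y) = p x - p y)
    (pn : forall x, `|p x| <= normc x) : cvgn (fun n => p (a n)).
  have -> : (fun n => p (a n)) = (fun n => (p (a n) + b n) - b n) by apply/funext => n; rewrite addrK.
  apply: is_cvgB => //; apply: nondecreasing_is_cvgn.
    move=> n m nm; have := le_trans (pn _) (h m n nm); rewrite pB => /ler_normlP[h1 h2].
    by rewrite -subr_ge0; lra.
  exists (p (a 0%N) + M + M - b 0%N) => _ [n _ <-].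
  have := le_trans (pn _) (h n 0%N (leq0n _)); rewrite pB => /ler_normlP[h1 h2].
  by have := bM n; lra.
have cR := key (@complex.Re R) Re_sub normc_Re; have cI := key (@complex.Im R) Im_sub normc_Im.
exists ((lim ((fun n => complex.Re (a n)) @ \oo)%classic) +i* (lim ((fun n => complex.Im (a n)) @ \oo)%classic))%C.
move=> e e0; have e2 : 0 < e / 2 by rewrite divr_gt0.
move/cvgrPdist_lt: cR => /(_ _ e2)[N1 _ hN1]; move/cvgrPdist_lt: cI => /(_ _ e2)[N2 _ hN2].
exists (maxn N1 N2) => n; rewrite geq_max => /andP[n1 n2].
apply: le_lt_trans (normc_ReIm _) _; rewrite Re_sub Im_sub /= [e]splitr.
by rewrite ltrD // distrC; [exact: hN1 | exact: hN2].
Qed.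

Definition pev f z n : C := \sum_(i < n) \sum_(j < n) c2 f i j * z.1 ^+ i * z.2 ^+ j.
(* Sealed, so that unification does not unfold limits. *)
Fact ev_spec : {e : T2 -> C * C -> C | forall f z, e f z = clim (pev f z)}.
Proof. by exists (fun f z => clim (pev f z)). Qed.
Definition ev : T2 -> C * C -> C := sval ev_spec.

Lemma evE f z : ev f z = clim (pev f z). Proof. exact: (svalP ev_spec). Qed.

Definition inD r z := normc z.1 <= r /\ normc z.2 <= r.

Lemma pev_trunc f z m n : (n <= m)%N -> pev (trunc n f) z m = pev f z n.
Proof.
move=> nm; rewrite /pev.
pose F i j := if (i < n)%N && (j < n)%N then c2 f i j * z.1 ^+ i * z.2 ^+ j else 0.
rewrite (eq_bigr (fun i : 'I_m => \sum_(j < m) F i j)); last first.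
  by move=> i _; apply: eq_bigr => j _; rewrite c2_trunc /F; case: ifP => //; rewrite !mul0r.
have E (G : nat -> C) : (forall i, (n <= i)%N -> G i = 0) -> \sum_(i < m) G i = \sum_(i < n) G i.
  move=> G0; rewrite -(subnKC nm) big_split_ord /= [X in _ + X]big1 ?addr0 // => i _.
  by rewrite G0 // leq_addr.
rewrite (E (fun i => \sum_(j < m) F i j)) => [|i ni].
  apply: eq_bigr => i _; rewrite (E (F i)) => [|j nj].
    by apply: eq_bigr => j _; rewrite /F !ltn_ord.
  by rewrite /F ltn_ord ltnNge nj.
by apply: big1 => j _; rewrite /F ltnNge ni.
Qed.

Lemma pevB f g z n : pev (f - g) z n = pev f z n - pev g z n.
Proof.
rewrite /pev -sumrB; apply: eq_bigr => i _; rewrite -sumrB; apply: eq_bigr => j _.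
by rewrite c2B !mulrBl.
Qed.

Lemma pev_le r f z n : 0 <= r -> inD r z -> normc (pev f z n) <= nm n r r f.
Proof.
move=> r0 [z1 z2]; rewrite nmE exchange_big /pev /=.
apply: le_trans (seminorm_sum _ _ _ (@normc_seminorm R)) _; apply: ler_sum => i _.
apply: le_trans (seminorm_sum _ _ _ (@normc_seminorm R)) _; apply: ler_sum => j _.
rewrite !ncM !normcX -mulrA mulrC ler_wpM2r ?normc_ge0 //.
by apply: ler_pM; rewrite ?exprn_ge0 ?normc_ge0 ?lerXn2r ?nnegrE ?normc_ge0.
Qed.

Lemma nm_trunc m n r f : 0 <= r -> (n <= m)%N -> nm m r r (f - trunc n f) <= nm m r r f - nm n r r f.
Proof.
move=> r0 nm'; rewrite lerBrDr.
apply: (@le_trans _ _ (nm m r r (f - trunc n f) + nm m r r (trunc n f))).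
  rewrite lerD2l; rewrite (@nm_eq _ _ _ n r r f (trunc n f)); last first.
    by move=> i j hi hj; rewrite c2_trunc hi hj.
  exact: nm_mono_n.
rewrite !nmE -big_split; apply: ler_sum => j _; rewrite -big_split; apply: ler_sum => i _ /=.
rewrite c2B c2_trunc; case: ifP => _; first by rewrite subrr nc0 mulr0 add0r.
by rewrite subr0 nc0 mulr0 addr0.
Qed.

Lemma pev_cauchy r f z m n : 0 <= r -> inD r z -> (n <= m)%N ->
  normc (pev f z m - pev f z n) <= nm m r r f - nm n r r f.
Proof.
move=> r0 zr nm'; rewrite -(pev_trunc f z nm') -pevB.
by apply: le_trans (pev_le _ _ r0 zr) _; exact: nm_trunc.
Qed.

Lemma pev_cvC r f z M : 0 <= r -> inD r z -> bnd r r f M -> cvC (pev f z) (ev f z).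
Proof.
move=> r0 zr b.
have [l hl] := cvC_exists (a := pev f z) (b := fun n => nm n r r f) b
  (fun m n nm' => pev_cauchy f r0 zr nm').
by rewrite evE (cvC_clim hl).
Qed.

Lemma ev_le r f z M : 0 <= r -> inD r z -> bnd r r f M -> normc (ev f z) <= M.
Proof.
move=> r0 zr b; apply: (cvC_le (pev_cvC r0 zr b)) => n.
exact: le_trans (pev_le _ _ r0 zr) (b n).
Qed.

Lemma evB r f g z M N : 0 <= r -> inD r z -> bnd r r f M -> bnd r r g N ->
  ev (f - g) z = ev f z - ev g z.
Proof.
move=> r0 zr bf bg; rewrite evE; apply: cvC_clim.
apply: (@cvC_eq (fun n => pev f z n - pev g z n)); first by move=> n; rewrite pevB.
by apply: cvC_sub; [exact: pev_cvC bf | exact: pev_cvC bg].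
Qed.

End Eval.

Lemma subrACA (V : zmodType) (a b c d : V) : a - b - (c - d) = a - c - (b - d).
Proof. by rewrite !opprD !opprK addrACA. Qed.

(** * Evaluation respects products and substitutions *)

Section EvalMorph.
Variables (R : realType) (T1 : fps_theory R[i]) (T2 : fps_theory T1).
Local Notation C := R[i].
Local Notation normc := (@ComplexField.Normc.normc R).
Implicit Types (f g h X Y : T2) (c t : C) (u v w : T1) (z : C * C) (r s M : R).

Lemma bnd_tail r f M : 0 <= r -> bnd r r f M -> forall e, 0 < e ->
  exists n, bnd r r (f - trunc n f) e.
Proof.
move=> r0 b e e0.
pose a n := nm n r r f.
have ca : cvgn a.
  apply: nondecreasing_is_cvgn; first by move=> n m nm'; exact: nm_mono_n.
  by exists M => _ [n _ <-]; exact: b.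
have a_le n : a n <= limn a.
  by apply: nondecreasing_cvgn_le => // i j ij; exact: nm_mono_n.
move/cvgrPdist_lt: (ca) => /(_ _ e0)[n _ hn]; exists n => m.
apply: (@le_trans _ _ (nm (maxn m n) r r (f - trunc n f))).
  by apply: nm_mono_n => //; exact: leq_maxl.
apply: le_trans (nm_trunc _ r0 (leq_maxr m n)) _.
have := hn n (leqnn n); rewrite /= => /ltr_normlW h.
have := a_le (maxn m n); rewrite /a in h *; lra.
Qed.

(** Analytic counterpart of [additive_ext]: polynomials are dense among the series bounded at radius
    r. Additivity of L is assumed only on these series, because evaluation is controlled only
    there. *)
Lemma functional_ext r (L : T2 -> C) (K : R) : 0 <= r -> 0 < K ->
  (forall f g M N, bnd r r f M -> bnd r r g N -> L (f - g) = L f - L g) ->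
  (forall f M, bnd r r f M -> normc (L f) <= K * M) ->
  (forall c a b, L (k2 c * vX ^+ a * vY ^+ b) = 0) ->
  forall f M, bnd r r f M -> L f = 0.
Proof.
move=> r0 K0 LB Lb L0 f M bf.
have bmon c a b : exists N, bnd r r (k2 c * vX ^+ a * vY ^+ b : T2) N.
  have bX : bnd r r (vX : T2) r by move=> n; apply: nm_X.
  have bY : bnd r r (vY : T2) r by move=> n; apply: nm_Y.
  have b1 : bnd r r (1 : T2) 1 by move=> n; apply: nm1_le.
  have bE X k : bnd r r X r -> exists N, bnd r r (X ^+ k) N.
    move=> bx; elim: k => [|k [N IH]]; first by exists 1; rewrite expr0.
    by exists (r * N); rewrite exprS; apply: bndM.
  have [N1 h1] := bE _ a bX; have [N2 h2] := bE _ b bY.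
  by eexists; apply: bndM h2 => //; apply: bndM h1 => //; apply: bnd_const.
have b0 : bnd r r (0 : T2) 0.
  by have := @bnd_const _ _ T2 r r 0 r0 r0; rewrite rmorph0 nc0.
have L00 : L 0 = 0 by have := LB _ _ _ _ b0 b0; rewrite !subrr.
have LN g N : bnd r r g N -> L (- g) = - L g.
  by move=> bg; have := LB _ _ _ _ b0 bg; rewrite !sub0r L00 sub0r.
have Lsum n (F : nat -> T2) : (forall i, exists N, bnd r r (F i) N) -> (forall i, L (F i) = 0) ->
    (exists N, bnd r r (\sum_(i < n) F i) N) /\ L (\sum_(i < n) F i) = 0.
  move=> bF LF; elim: n => [|n [[N IH] IHL]].
    by rewrite big_ord0; split; [exists 0 | ].
  have [N' bN'] := bF n.
  rewrite big_ord_recr /=; split; first by exists (N + N'); apply: bndD.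
  by rewrite -[F n]opprK (LB _ _ _ _ IH (bndN bN')) IHL (LN _ _ bN') LF opprK addr0.
have Lt n : (exists N, bnd r r (trunc n f) N) /\ L (trunc n f) = 0.
  pose F a b : T2 := k2 (c2 f a b) * vX ^+ a * vY ^+ b.
  have h a := Lsum n (F a) (fun b => bmon _ a b) (fun b => L0 _ a b).
  by apply: (Lsum n (fun a => \sum_(b < n) F a b)) => a; have [] := h a.
apply: normc_eq0; apply/eqP; rewrite eq_le normc_ge0 andbT; apply/ler_addgt0Pl => e e0.
have eK : 0 < e / K by rewrite divr_gt0.
have [n hn] := bnd_tail r0 bf eK.
have [[N bN] LN0] := Lt n.
rewrite addr0; have := Lb _ _ hn; rewrite (LB _ _ _ _ bf bN) LN0 subr0.
by rewrite mulrC divfK // gt_eqF.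
Qed.

Lemma ev_term c a b z : ev (k2 c * vX ^+ a * vY ^+ b : T2) z = c * z.1 ^+ a * z.2 ^+ b.
Proof.
rewrite evE; apply: cvC_clim => e e0; exists (maxn a b).+1 => n; rewrite gtn_max => /andP[an bn].
pose F i j := c2 (k2 c * vX ^+ a * vY ^+ b : T2) i j * z.1 ^+ i * z.2 ^+ j.
have -> : pev (k2 c * vX ^+ a * vY ^+ b : T2) z n = F a b.
  apply: (sum2_single (F := F)) => // i j ij.
  by rewrite /F c2_term ij !mul0r.
by rewrite /F c2_term !eqxx subrr nc0.
Qed.

Lemma ev_const c z : ev (k2 c : T2) z = c.
Proof. by have := ev_term c 0 0 z; rewrite !expr0 !mulr1. Qed.
Lemma ev1 z : ev (1 : T2) z = 1.
Proof. by have := ev_const 1 z; rewrite rmorph1. Qed.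
Lemma ev0 z : ev (0 : T2) z = 0.
Proof. by have := ev_const 0 z; rewrite rmorph0. Qed.
Lemma ev_X z : ev (vX : T2) z = z.1.
Proof. by have := ev_term 1 1 0 z; rewrite rmorph1 !expr0 !expr1 !mulr1 !mul1r. Qed.
Lemma ev_Y z : ev (vY : T2) z = z.2.
Proof. by have := ev_term 1 0 1 z; rewrite rmorph1 !expr0 !expr1 !mulr1 !mul1r. Qed.

Lemma evM_bnd r f g z M N : 0 <= r -> inD r z -> bnd r r f M -> bnd r r g N ->
  ev (f * g) z = ev f z * ev g z.
Proof.
move=> r0 zr bf bg; apply/eqP; rewrite -subr_eq0; apply/eqP.
(* With the second factor fixed, monomials suffice for the first one. This is applied with g' = g,
   and then with g' a monomial. *)
have step g' N' (bg' : bnd r r g' N') :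
    (forall c a b, ev (k2 c * vX ^+ a * vY ^+ b * g') z - c * z.1 ^+ a * z.2 ^+ b * ev g' z = 0) ->
    forall f M, bnd r r f M -> ev (f * g') z - ev f z * ev g' z = 0.
  move=> hm; apply: (@functional_ext r _ (2 * (N' + 1))) => //.
  - by rewrite mulr_gt0 // ltr_wpDl // (bnd_ge0 bg').
  - move=> f1 f2 M1 M2 b1 b2; rewrite [(f1 - f2) * g']mulrBl (evB r0 zr (bndM r0 r0 b1 bg') (bndM r0 r0 b2 bg')).
    by rewrite (evB r0 zr b1 b2) mulrBl subrACA.
  - move=> f1 M1 b1; apply: le_trans (normcD_le _ _) _; rewrite normcN ncM.
    have h1 := ev_le r0 zr (bndM r0 r0 b1 bg'); have h2 := ev_le r0 zr b1; have h3 := ev_le r0 zr bg'.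
    apply: (@le_trans _ _ (M1 * N' + M1 * N')); first by rewrite lerD // ler_pM ?normc_ge0.
    by have := bnd_ge0 b1; have := bnd_ge0 bg' => *; nra.
  by move=> c a b; rewrite ev_term.
apply: (step g N bg) bf => c a b.
pose m : T2 := k2 c * vX ^+ a * vY ^+ b.
have [Nm bm] : exists N, bnd r r m N.
  have bX : bnd r r (vX : T2) r by move=> n; apply: nm_X.
  have bY : bnd r r (vY : T2) r by move=> n; apply: nm_Y.
  have b1 : bnd r r (1 : T2) 1 by move=> n; apply: nm1_le.
  have bE X k : bnd r r X r -> exists N, bnd r r (X ^+ k) N.
    move=> bx; elim: k => [|k [N' IH]]; first by exists 1; rewrite expr0.
    by exists (r * N'); rewrite exprS; apply: bndM.
  have [N1 h1] := bE _ a bX; have [N2 h2] := bE _ b bY.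
  by eexists; apply: bndM h2 => //; apply: bndM h1 => //; apply: bnd_const.
have mm : forall f M, bnd r r f M -> ev (f * m) z - ev f z * ev m z = 0.
  apply: step bm _ => c' a' b'; rewrite /m.
  have -> : k2 c' * vX ^+ a' * vY ^+ b' * (k2 c * vX ^+ a * vY ^+ b) =
     k2 (c' * c) * vX ^+ (a' + a) * vY ^+ (b' + b) :> T2 by rewrite rmorphM !exprD; ring.
  by rewrite !ev_term !exprD; ring.
have := mm g N bg; rewrite mulrC /m ev_term => h; rewrite [_ * ev g z]mulrC; exact: h.
Qed.

Lemma ev_subst_bnd r rho X Y f z M : 0 <= r -> inD r z -> low 1 X -> low 1 Y ->
  bnd r r X rho -> bnd r r Y rho -> bnd rho rho f M ->
  ev (subst X Y f) z = ev f (ev X z, ev Y z).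
Proof.
move=> r0 zr hX hY bX bY bf; apply/eqP; rewrite -subr_eq0; apply/eqP; move: f M bf.
have rho0 := bnd_ge0 bX.
have zr' : inD rho (ev X z, ev Y z) by split; [exact: ev_le bX | exact: ev_le bY].
have bs f M (bf : bnd rho rho f M) : bnd r r (subst X Y f) M.
  by apply: bnd_subst bf.
apply: (@functional_ext rho _ 2) => //.
- move=> f g M N bf bg; rewrite rmorphB /= (evB r0 zr (bs _ _ bf) (bs _ _ bg)).
  by rewrite (evB rho0 zr' bf bg) subrACA.
- move=> f M bf; apply: le_trans (normcD_le _ _) _; rewrite normcN.
  have h1 := ev_le r0 zr (bs _ _ bf); have h2 := ev_le rho0 zr' bf.
  by apply: le_trans (lerD h1 h2) _; rewrite mulr_natl mulr2n.
move=> c a b; rewrite subst_mon !nz_id // ev_term.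
have bE (Z : T2) k : bnd r r Z rho -> (exists N, bnd r r (Z ^+ k) N) /\ ev (Z ^+ k) z = ev Z z ^+ k.
  move=> bx; elim: k => [|k [[N IH] IHe]].
    split; last by rewrite [in LHS]expr0 ev1 expr0.
    by exists 1 => n; rewrite expr0; apply: nm1_le.
  by rewrite !exprS; split; [exists (rho * N); apply: bndM | rewrite (evM_bnd r0 zr bx IH) IHe].
have [[N1 h1] e1] := bE X a bX; have [[N2 h2] e2] := bE Y b bY.
have bc := bnd_const T2 c r0 r0.
rewrite (evM_bnd r0 zr (bndM r0 r0 bc h1) h2) (evM_bnd r0 zr bc h1) ev_const e1 e2.
by rewrite subrr.
Qed.

Definition near0 (A : C * C -> Prop) := exists2 r, 0 < r & forall z, normc z.1 < r -> normc z.2 < r -> A z.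
Definition near (A : C -> Prop) := exists2 r : R, 0 < r & forall t, normc t < r -> A t.

Lemma near0I (A B : C * C -> Prop) : near0 A -> near0 B -> near0 (fun z => A z /\ B z).
Proof.
move=> [r r0 hA] [s s0 hB]; exists (Num.min r s); first by rewrite lt_min r0.
by move=> z; rewrite !lt_min => /andP[a b] /andP[c d]; split; [apply: hA | apply: hB].
Qed.
Lemma nearI (A B : C -> Prop) : near A -> near B -> near (fun t => A t /\ B t).
Proof.
move=> [r r0 hA] [s s0 hB]; exists (Num.min r s); first by rewrite lt_min r0.
by move=> z; rewrite !lt_min => /andP[a b]; split; [apply: hA | apply: hB].
Qed.
Lemma near0W (A B : C * C -> Prop) : (forall z, A z -> B z) -> near0 A -> near0 B.
Proof. by move=> h [r r0 hA]; exists r => // z a b; apply: h; apply: hA. Qed.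
Lemma nearW (A B : C -> Prop) : (forall t, A t -> B t) -> near A -> near B.
Proof. by move=> h [r r0 hA]; exists r => // z a; apply: h; apply: hA. Qed.
Lemma near_all (I : eqType) (s : seq I) (A : I -> C -> Prop) :
  (forall i, i \in s -> near (A i)) -> near (fun t => forall i, i \in s -> A i t).
Proof.
elim: s => [|i s IH] h; first by exists 1.
have := nearI (h i (mem_head _ _)) (IH (fun j js => h j (mem_behead (s := i :: s) js))).
by apply: nearW => t [h1 h2] j; rewrite inE => /orP[/eqP ->|/h2].
Qed.
Lemma near0_all (I : eqType) (s : seq I) (A : I -> C * C -> Prop) :
  (forall i, i \in s -> near0 (A i)) -> near0 (fun z => forall i, i \in s -> A i z).
Proof.
elim: s => [|i s IH] h; first by exists 1.
have := near0I (h i (mem_head _ _)) (IH (fun j js => h j (mem_behead (s := i :: s) js))).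
by apply: near0W => z [h1 h2] j; rewrite inE => /orP[/eqP ->|/h2].
Qed.

Lemma near0_evD f g : cvgt f -> cvgt g -> near0 (fun z => ev (f + g) z = ev f z + ev g z).
Proof.
move=> cf /(cvgt2 cf) [r [r0 [M [N [bf bg]]]]]; exists r => // z z1 z2.
have zr : inD r z by split; exact: ltW.
have r0' := ltW r0.
have b0 : bnd r r (0 : T2) 0.
  by have := @bnd_const _ _ T2 r r 0 r0' r0'; rewrite rmorph0 nc0.
have e0 : ev (0 : T2) z = 0 by exact: ev0.
rewrite -{1}[g]opprK (evB r0' zr bf (bndN bg)) -[- g]sub0r (evB r0' zr b0 bg) e0.
by rewrite sub0r opprK.
Qed.
Lemma near0_evB f g : cvgt f -> cvgt g -> near0 (fun z => ev (f - g) z = ev f z - ev g z).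
Proof.
move=> cf /(cvgt2 cf) [r [r0 [M [N [bf bg]]]]]; exists r => // z z1 z2.
by apply: (evB (ltW r0) _ bf bg); split; exact: ltW.
Qed.
Lemma near0_evM f g : cvgt f -> cvgt g -> near0 (fun z => ev (f * g) z = ev f z * ev g z).
Proof.
move=> cf /(cvgt2 cf) [r [r0 [M [N [bf bg]]]]]; exists r => // z z1 z2.
by apply: (evM_bnd (ltW r0) _ bf bg); split; exact: ltW.
Qed.
Lemma near0_evprod (I : eqType) (s : seq I) (F : I -> T2) : (forall i, i \in s -> cvgt (F i)) ->
  near0 (fun z => ev (\prod_(i <- s) F i) z = \prod_(i <- s) ev (F i) z).
Proof.
elim: s => [|i s IH] h.
  by exists 1 => // z _ _; rewrite !big_nil ev1.
have cs : cvgt (\prod_(j <- s) F j) by apply: cvgt_prod => j js; apply: h; rewrite inE js orbT.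
have := near0I (IH (fun j js => h j (mem_behead (s := i :: s) js))) (near0_evM (h i (mem_head _ _)) cs).
by apply: near0W => z [e1 e2]; rewrite !big_cons e2 e1.
Qed.

Lemma near0_evsmall X : cvgt X -> low 1 X -> forall rho, 0 < rho -> near0 (fun z => normc (ev X z) < rho).
Proof.
move=> cX hX rho rho0; have r2 : 0 < rho / 2 by rewrite divr_gt0.
have [r r0 b] := bnd_small cX hX r2; exists r => // z z1 z2.
apply: le_lt_trans (ev_le (ltW r0) _ b) _; first by split; exact: ltW.
by rewrite ltr_pdivrMr // ltr_pMr // ltr1n.
Qed.

Lemma near0_subst X Y f : cvgt X -> cvgt Y -> low 1 X -> low 1 Y -> cvgt f ->
  near0 (fun z => ev (subst X Y f) z = ev f (ev X z, ev Y z)).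
Proof.
move=> cX cY hX hY [rho [rho0 [M bf]]].
have [r r0 bX] := bnd_small cX hX rho0; have [s s0 bY] := bnd_small cY hY rho0.
exists (Num.min r s) => [|z z1 z2]; first by rewrite lt_min r0.
have m0 : 0 <= Num.min r s by rewrite le_min !ltW.
apply: (ev_subst_bnd (r := Num.min r s) m0 _ hX hY) bf.
- by split; exact: ltW.
- by apply: bnd_mono bX; rewrite m0 ge_min lexx.
- by apply: bnd_mono bY; rewrite m0 ge_min lexx orbT.
Qed.

(* Uniform limit of polynomials. *)
Lemma near0_ev_continuous f : cvgt f -> near0 (fun z => forall e, 0 < e -> exists2 d, 0 < d &
  forall z', normc (z'.1 - z.1) < d -> normc (z'.2 - z.2) < d -> normc (ev f z' - ev f z) < e).
Proof.
move=> [r [r0 [M bf]]]; exists r => // z z1 z2 e e0.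
have r0' := ltW r0.
have e3 : 0 < e / 3 by rewrite divr_gt0.
have [n hn] := bnd_tail r0' bf e3.
have app z' : inD r z' -> normc (ev f z' - pev f z' n) <= e / 3.
  move=> zr; have bt : exists N, bnd r r (trunc n f) N.
    exists (M + e / 3); have -> : trunc n f = f - (f - trunc n f) by ring.
    by apply: bndD => //; exact: bndN.
  have [N bN] := bt.
  have <- : ev (trunc n f) z' = pev f z' n.
    by rewrite evE; apply: cvC_clim => e' e'0; exists n => m nm'; rewrite pev_trunc // subrr nc0.
  by rewrite -(evB r0' zr bf bN); exact: ev_le hn.
have polyc (m : nat) (F : nat -> C * C -> C) :
   (forall i, forall e, 0 < e -> exists2 d : R, 0 < d & forall z', normc (z'.1 - z.1) < d -> normc (z'.2 - z.2) < d ->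
      normc (F i z' - F i z) < e) ->
   forall e, 0 < e -> exists2 d : R, 0 < d & forall z', normc (z'.1 - z.1) < d -> normc (z'.2 - z.2) < d ->
      normc ((\sum_(i < m) F i z') - \sum_(i < m) F i z) < e.
  move=> hF; elim: m => [|m IH] e' e'0; first by exists 1 => // z' _ _; rewrite !big_ord0 subrr nc0.
  have e2 : 0 < e' / 2 by rewrite divr_gt0.
  have [d1 d10 h1] := IH _ e2; have [d2 d20 h2] := hF m _ e2.
  exists (Num.min d1 d2) => [|z']; first by rewrite lt_min d10.
  rewrite !lt_min => /andP[a b] /andP[c d]; rewrite !big_ord_recr /=.
  have -> : \sum_(i < m) F i z' + F m z' - (\sum_(i < m) F i z + F m z) =
    (\sum_(i < m) F i z' - \sum_(i < m) F i z) + (F m z' - F m z) by ring.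
  by apply: le_lt_trans (normcD_le _ _) _; rewrite [e']splitr ltrD // ?h1 ?h2.
have mulc (G H : C * C -> C) :
   (forall e, 0 < e -> exists2 d : R, 0 < d & forall z', normc (z'.1 - z.1) < d -> normc (z'.2 - z.2) < d ->
      normc (G z' - G z) < e) ->
   (forall e, 0 < e -> exists2 d : R, 0 < d & forall z', normc (z'.1 - z.1) < d -> normc (z'.2 - z.2) < d ->
      normc (H z' - H z) < e) ->
   forall e, 0 < e -> exists2 d : R, 0 < d & forall z', normc (z'.1 - z.1) < d -> normc (z'.2 - z.2) < d ->
      normc (G z' * H z' - G z * H z) < e.
  move=> hG hH e' e'0.
  pose k := normc (G z) + normc (H z) + 1 + 1.
  have k0 : 0 < k by rewrite /k ltr_wpDl // !addr_ge0 ?normc_ge0.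
  pose d := Num.min 1 (e' / k).
  have d0 : 0 < d by rewrite lt_min ltr01 divr_gt0.
  have [d1 d10 h1] := hG _ d0; have [d2 d20 h2] := hH _ d0.
  exists (Num.min d1 d2) => [|z']; first by rewrite lt_min d10.
  rewrite !lt_min => /andP[a b] /andP[c d'].
  have -> : G z' * H z' - G z * H z = (G z' - G z) * (H z' - H z) +
     ((G z' - G z) * H z + G z * (H z' - H z)) by ring.
  apply: le_lt_trans (normcD_le _ _) _.
  apply: le_lt_trans (lerD (lexx _) (normcD_le _ _)) _; rewrite !ncM.
  have g1 := h1 z' a c; have g2 := h2 z' b d'.
  have dl1 : d <= 1 by rewrite ge_min lexx.
  have dek : d * k <= e' by rewrite -ler_pdivlMr // ge_min lexx orbT.
  have := normc_ge0 (G z' - G z); have := normc_ge0 (H z' - H z).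
  have := normc_ge0 (G z); have := normc_ge0 (H z).
  move: g1 g2 dek; rewrite /k.
  move: (normc (G z' - G z)) (normc (H z' - H z)) (normc (G z)) (normc (H z)) => a' b' g h.
  by move=> *; nra.
have cstc c : forall e, 0 < e -> exists2 d : R, 0 < d & forall z' : C * C, normc (z'.1 - z.1) < d -> normc (z'.2 - z.2) < d ->
      normc (c - c) < e by move=> e' e'0; exists 1 => // z' _ _; rewrite subrr nc0.
have xc : forall k e, 0 < e -> exists2 d : R, 0 < d & forall z' : C * C, normc (z'.1 - z.1) < d -> normc (z'.2 - z.2) < d ->
      normc (z'.1 ^+ k - z.1 ^+ k) < e.
  elim=> [|k IH]; first by move=> e' e'0; exists 1 => // z' _ _; rewrite !expr0 subrr nc0.
  move=> e' e'0; have h1 e1 (e10 : 0 < e1) : exists2 d : R, 0 < d & forall z' : C * C,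
     normc (z'.1 - z.1) < d -> normc (z'.2 - z.2) < d -> normc (z'.1 - z.1) < e1 by exists e1.
  have [d d0 hd] := mulc (fun z => z.1) (fun z => z.1 ^+ k) h1 IH e' e'0.
  by exists d => // z' a b; rewrite !exprS; exact: hd.
have yc : forall k e, 0 < e -> exists2 d : R, 0 < d & forall z' : C * C, normc (z'.1 - z.1) < d -> normc (z'.2 - z.2) < d ->
      normc (z'.2 ^+ k - z.2 ^+ k) < e.
  elim=> [|k IH]; first by move=> e' e'0; exists 1 => // z' _ _; rewrite !expr0 subrr nc0.
  move=> e' e'0; have h1 e1 (e10 : 0 < e1) : exists2 d : R, 0 < d & forall z' : C * C,
     normc (z'.1 - z.1) < d -> normc (z'.2 - z.2) < d -> normc (z'.2 - z.2) < e1 by exists e1.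
  have [d d0 hd] := mulc (fun z => z.2) (fun z => z.2 ^+ k) h1 IH e' e'0.
  by exists d => // z' a b; rewrite !exprS; exact: hd.
have [d d0 hd] := polyc n (fun i z => \sum_(j < n) c2 f i j * z.1 ^+ i * z.2 ^+ j)
  (fun i => polyc n (fun j z => c2 f i j * z.1 ^+ i * z.2 ^+ j) (fun j =>
    mulc _ _ (mulc _ _ (cstc (c2 f i j)) (xc i)) (yc j))) _ e3.
pose d' := Num.min d (Num.min (r - normc z.1) (r - normc z.2)).
have d'0 : 0 < d' by rewrite !lt_min d0 !subr_gt0 z1 z2.
exists d' => // z'; rewrite /d' !lt_min => /andP[a /andP[b _]] /andP[a' /andP[_ b']].
have zr : inD r z by split; exact: ltW.
have zr' : inD r z'.
  split; [have := normc_dist z'.1 z.1 | have := normc_dist z'.2 z.2]; lra.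
have := app _ zr; have := app _ zr'; have := hd z' a a'; rewrite -!/(pev f _ n).
have -> : ev f z' - ev f z = (ev f z' - pev f z' n) + (pev f z' n - pev f z n) + - (ev f z - pev f z n) by ring.
move=> h1 h2 h3; apply: le_lt_trans (normcD_le _ _) _.
apply: le_lt_trans (lerD (normcD_le _ _) (lexx _)) _; rewrite normcN; lra.
Qed.
End EvalMorph.

(** * Curves in the complex plane *)

Section Curves.
Local Open Scope classical_set_scope.
Variable R : realType.
Local Notation C := R[i].
Local Notation normc := (@ComplexField.Normc.normc R).
Implicit Types (s x h e d : R) (c : C) (a b w : R -> C).

(** The derivative with an explicit remainder, in the same form as [cdiff] for curves and [holo] for
    functions of a complex variable; [rdiffP] connects it with [is_derive]. *)
Definition rdiff (f : R -> R) x (d : R) :=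
  forall e, 0 < e -> exists2 de : R, 0 < de & forall h, `|h| < de -> `|f (x + h) - f x - h * d| <= e * `|h|.

Lemma rdiffP (f : R -> R) x d : rdiff f x d <-> is_derive x 1 f d.
Proof.
split=> [fd|fd].
  have cv : (fun h => h^-1 *: (f (h *: 1 + x) - f x)) @ 0^' --> d.
    apply/cvgrPdist_le => e e0; have [de de0 hd] := fd e e0.
    near=> h; have h0 : h != 0 by near: h; exact: nbhs_dnbhs_neq.
    have hs : `|h| < de by near: h; apply: dnbhs0_lt.
    have := hd h hs; rewrite [x + h]addrC -[in X in f (X + _)](mulr1 h) => hle.
    rewrite distrC.
    have -> : h^-1 *: (f (h *: 1 + x) - f x) - d = h^-1 * (f (h * 1 + x) - f x - h * d).
      by rewrite /GRing.scale /=; field.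
    by rewrite normrM normfV ler_pdivrMl ?normr_gt0 // [leRHS]mulrC.
  by apply: DeriveDef; [apply/cvg_ex; exists d; exact: cv | apply: cvg_lim cv].
move=> e e0; have [dv De] := fd.
have cv : (fun h => h^-1 *: (f (h *: 1 + x) - f x)) @ 0^' --> d by rewrite -De.
move/cvgrPdist_le: cv => /(_ e e0); rewrite /prop_near1 /= /dnbhs /within /= => /nbhs_ballP.
move=> [de /= de0 hd]; exists de => // h hde.
have [->|h0] := eqVneq h 0; first by rewrite addr0 subrr mul0r subr0 normr0 mulr0.
have bh : ball (0 : R) de h by rewrite /ball /= sub0r normrN.
have := hd h bh h0; rewrite distrC.
have -> : h^-1 *: (f (h *: 1 + x) - f x) - d = h^-1 * (f (x + h) - f x - h * d).
  by rewrite /GRing.scale /= mulr1 [h + x]addrC; field.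
by rewrite normrM normfV ler_pdivrMl ?normr_gt0 // [leRHS]mulrC.
Unshelve. all: by end_near.
Qed.

Definition cdiff w x c := forall e, 0 < e -> exists2 de : R, 0 < de & forall h, `|h| < de ->
  normc (w (x + h) - w x - h%:C%C * c) <= e * `|h|.

Lemma Re_lin w x h c : complex.Re (w (x + h) - w x - h%:C%C * c) =
  complex.Re (w (x + h)) - complex.Re (w x) - h * complex.Re c.
Proof. by rewrite !Re_sub; case: c => p q /=; rewrite mul0r subr0. Qed.
Lemma Im_lin w x h c : complex.Im (w (x + h) - w x - h%:C%C * c) =
  complex.Im (w (x + h)) - complex.Im (w x) - h * complex.Im c.
Proof. by rewrite !Im_sub; case: c => p q /=; rewrite mul0r addr0. Qed.

Lemma cdiff_ReIm w x c : cdiff w x c <->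
  rdiff (fun x => complex.Re (w x)) x (complex.Re c) /\ rdiff (fun x => complex.Im (w x)) x (complex.Im c).
Proof.
split=> [wd|[rd id]].
  split=> e e0; have [de de0 hd] := wd e e0; exists de => // h /hd; apply: le_trans.
    by rewrite -Re_lin; exact: normc_Re.
  by rewrite -Im_lin; exact: normc_Im.
move=> e e0; have e2 : 0 < e / 2 by rewrite divr_gt0.
have [d1 d10 h1] := rd _ e2; have [d2 d20 h2] := id _ e2.
exists (Num.min d1 d2) => [|h]; first by rewrite lt_min d10.
rewrite lt_min => /andP[/h1 a /h2 b]; apply: le_trans (normc_ReIm _) _.
rewrite Re_lin Im_lin [e]splitr mulrDl; exact: lerD.
Qed.

Lemma cdiffP w x c : cdiff w x c <->
  is_derive x 1 (fun x => complex.Re (w x)) (complex.Re c) /\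
  is_derive x 1 (fun x => complex.Im (w x)) (complex.Im c).
Proof. by rewrite -!rdiffP; exact: cdiff_ReIm. Qed.

Lemma cdiff_cderive w x c : cdiff w x c -> cderive w x = c.
Proof.
move=> /cdiffP[[_ h1] [_ h2]]; rewrite /cderive !derive1E h1 h2.
by case: (c).
Qed.

Lemma cdiff_cont w x c : cdiff w x c -> forall e, 0 < e -> exists2 de : R, 0 < de & forall h, `|h| < de ->
  normc (w (x + h) - w x) < e.
Proof.
move=> wd e e0; have [d1 d10 h1] := wd 1 ltr01.
pose k := normc c + 1 + 1; have k0 : 0 < k by rewrite /k -addrA ltr_wpDl ?normc_ge0.
exists (Num.min d1 (e / k)) => [|h]; first by rewrite lt_min d10 divr_gt0.
rewrite lt_min => /andP[/h1 a hk].
have -> : w (x + h) - w x = (w (x + h) - w x - h%:C%C * c) + h%:C%C * c by ring.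
apply: le_lt_trans (normcD_le _ _) _; rewrite ncM.
have -> : normc h%:C%C = `|h| by rewrite /ComplexField.Normc.normc /= expr0n addr0 sqrtr_sqr.
apply: (@le_lt_trans _ _ (`|h| * (normc c + 1))).
  by rewrite mulrDr mulr1 addrC lerD2l (le_trans a) // mul1r.
apply: (@le_lt_trans _ _ (`|h| * k)); first by rewrite ler_wpM2l // /k lerDl.
by rewrite -ltr_pdivlMr.
Qed.

Lemma cdiff_ext w w' x c : (forall y, w y = w' y) -> cdiff w x c -> cdiff w' x c.
Proof. by move=> e h de d0; have [r r0 hr] := h de d0; exists r => // y /hr; rewrite !e. Qed.

Lemma normc_real h : normc h%:C%C = `|h|.
Proof. by rewrite /ComplexField.Normc.normc /= expr0n addr0 sqrtr_sqr. Qed.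

Lemma cdiff_cst c x : cdiff (fun=> c) x 0.
Proof. by move=> e e0; exists 1 => // h _; rewrite subrr mulr0 subr0 nc0 mulr_ge0 // ltW. Qed.

Lemma cdiff_sub a b x c c' : cdiff a x c -> cdiff b x c' -> cdiff (fun x => a x - b x) x (c - c').
Proof.
move=> /cdiff_ReIm[a1 a2] /cdiff_ReIm[b1 b2].
have sub (f g : R -> R) p q : rdiff f x p -> rdiff g x q -> rdiff (fun x => f x - g x) x (p - q).
  move=> /rdiffP fd /rdiffP gd; apply/rdiffP; exact: is_deriveB.
apply/cdiff_ReIm; split.
  rewrite Re_sub (_ : (fun y => _) = fun y => complex.Re (a y) - complex.Re (b y)); first exact: sub.
  by apply/funext => y; rewrite Re_sub.
rewrite Im_sub (_ : (fun y => _) = fun y => complex.Im (a y) - complex.Im (b y)); first exact: sub.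
by apply/funext => y; rewrite Im_sub.
Qed.

Lemma cdiff_mul a b x c c' : cdiff a x c -> cdiff b x c' ->
  cdiff (fun x => a x * b x) x (c * b x + a x * c').
Proof.
move=> ad bd e e0.
pose k := normc (b x) + 1 + normc c + normc (a x).
have k0 : 0 < k by rewrite /k -addrA ltr_wpDr ?addr_ge0 ?normc_ge0 // ltr_wpDl ?normc_ge0.
have e1 : 0 < e / k by rewrite divr_gt0.
have [d1 d10 h1] := ad _ e1; have [d2 d20 h2] := bd _ e1.
have m0 : 0 < Num.min 1 (e / k) by rewrite lt_min ltr01.
have [d3 d30 h3] := cdiff_cont bd m0.
exists (Num.min d1 (Num.min d2 d3)) => [|h]; first by rewrite !lt_min d10 d20.
rewrite !lt_min => /andP[/h1 A /andP[/h2 B /h3]]; rewrite lt_min => /andP[D1 D].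
have -> : a (x + h) * b (x + h) - a x * b x - h%:C%C * (c * b x + a x * c') =
  (a (x + h) - a x - h%:C%C * c) * b (x + h) + h%:C%C * c * (b (x + h) - b x)
  + a x * (b (x + h) - b x - h%:C%C * c').
  move: (a (x + h)) (b (x + h)) (a x) (b x) h%:C%C => p q p' q' z; ring.
have Bx : normc (b (x + h)) <= normc (b x) + 1.
  by rewrite -lerBlDl (le_trans (normc_dist _ _)) // ltW.
have -> : e * `|h| = (e / k * `|h|) * (normc (b x) + 1) + `|h| * normc c * (e / k) + normc (a x) * (e / k * `|h|).
  by rewrite -{1}(divfK (lt0r_neq0 k0) e) /k; ring.
apply: le_trans (normcD_le _ _) _; rewrite ncM lerD ?ler_wpM2l ?normc_ge0 //.
apply: le_trans (normcD_le _ _) _; rewrite !ncM normc_real lerD //.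
  by rewrite ler_pM ?normc_ge0.
by rewrite ler_wpM2l ?mulr_ge0 ?normc_ge0 // ltW.
Qed.

Definition holo (p : C -> C) (z c : C) := forall e, 0 < e -> exists2 r : R, 0 < r &
  forall h : C, normc h < r -> normc (p (z + h) - p z - h * c) <= e * normc h.

Lemma holo_quad (p : C -> C) (z c : C) (K r : R) : 0 <= K -> 0 < r ->
  (forall h : C, normc h < r -> normc (p (z + h) - p z - h * c) <= K * normc h ^+ 2) -> holo p z c.
Proof.
move=> K0 r0 hp e e0; exists (Num.min r (e / (K + 1))).
  by rewrite lt_min r0 divr_gt0 // ltr_wpDl.
move=> h; rewrite lt_min => /andP[/hp A]; rewrite ltr_pdivlMr ?ltr_wpDl // => B.
apply: le_trans A _; rewrite expr2 mulrA ler_wpM2r ?normc_ge0 //.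
by have := normc_ge0 h; move: (normc h) B => q *; nra.
Qed.

Lemma holo_cont (p : C -> C) (z c : C) : holo p z c -> forall e, 0 < e -> exists2 r : R, 0 < r &
  forall h : C, normc h < r -> normc (p (z + h) - p z) < e.
Proof.
move=> hp e e0; have [r r0 hr] := hp 1 ltr01; pose k := normc c + 1.
have k0 : 0 < k by rewrite ltr_wpDl ?normc_ge0.
exists (Num.min r (e / k)); first by rewrite lt_min r0 divr_gt0.
move=> h; rewrite lt_min => /andP[/hr A]; rewrite ltr_pdivlMr // => B.
rewrite -[p (z + h) - p z](subrK (h * c)); apply: le_lt_trans (normcD_le _ _) _.
apply: le_lt_trans B; rewrite ncM /k mulrDr mulr1 addrC lerD2l.
by rewrite -[leRHS]mul1r.
Qed.

Lemma holo_comp (p g : C -> C) (z c c' : C) : holo p z c -> holo g (p z) c' ->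
  holo (fun z => g (p z)) z (c * c').
Proof.
move=> hp hg e e0.
pose A := normc c + 1; have A0 : 0 < A by rewrite ltr_wpDl ?normc_ge0.
pose k := A + normc c'; have k0 : 0 < k by rewrite ltr_wpDr ?normc_ge0.
have ek : 0 < e / k by rewrite divr_gt0.
have m0 : 0 < Num.min 1 (e / k) by rewrite lt_min ltr01.
have [d1 d10 h1] := hp _ m0; have [d d0 hd] := hg _ ek; have [d2 d20 h2] := holo_cont hp d0.
exists (Num.min d1 d2) => [|h]; first by rewrite lt_min d10.
rewrite lt_min => /andP[/h1 B /h2 /hd].
set dw := p (z + h) - p z in B *; rewrite (_ : p z + dw = p (z + h)); last by rewrite /dw addrC subrK.
move=> P.
have -> : g (p (z + h)) - g (p z) - h * (c * c') =
   (g (p (z + h)) - g (p z) - dw * c') + (dw - h * c) * c'.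
  by move: (g (p (z + h))) (g (p z)) (dw) => p1 p2 d'; ring.
have dA : normc dw <= normc h * A.
  rewrite -[dw](subrK (h * c)); apply: le_trans (normcD_le _ _) _; rewrite ncM mulrDr mulr1 addrC lerD2l.
  apply: le_trans B _; rewrite -[leRHS]mul1r ler_wpM2r ?normc_ge0 // ge_min lexx //.
apply: le_trans (normcD_le _ _) _; rewrite ncM.
apply: (@le_trans _ _ (e / k * (normc h * A) + (e / k * normc h) * normc c')).
  apply: lerD; first by apply: le_trans P _; rewrite ler_wpM2l // ltW.
  by rewrite ler_wpM2r ?normc_ge0 // (le_trans B) // ler_wpM2r ?normc_ge0 // ge_min lexx orbT.
by rewrite -(mulrA (e / k)) -mulrDr -mulrDr -/k mulrCA divfK ?gt_eqF // mulrC.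
Qed.

Lemma cdiff_comp (p : C -> C) w x c c' : cdiff w x c -> holo p (w x) c' ->
  cdiff (fun x => p (w x)) x (c * c').
Proof.
move=> hp hg e e0.
pose A := normc c + 1; have A0 : 0 < A by rewrite ltr_wpDl ?normc_ge0.
pose k := A + normc c'; have k0 : 0 < k by rewrite ltr_wpDr ?normc_ge0.
have ek : 0 < e / k by rewrite divr_gt0.
have m0 : 0 < Num.min 1 (e / k) by rewrite lt_min ltr01.
have [d1 d10 h1] := hp _ m0; have [d d0 hd] := hg _ ek; have [d2 d20 h2] := cdiff_cont hp d0.
exists (Num.min d1 d2) => [|h]; first by rewrite lt_min d10.
rewrite lt_min => /andP[/h1 B /h2 /hd].
set dw := w (x + h) - w x in B *; rewrite (_ : w x + dw = w (x + h)); last by rewrite /dw addrC subrK.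
move=> P.
have -> : p (w (x + h)) - p (w x) - h%:C%C * (c * c') =
   (p (w (x + h)) - p (w x) - dw * c') + (dw - h%:C%C * c) * c'.
  by move: (p (w (x + h))) (p (w x)) (dw) h%:C%C => p1 p2 d' z; ring.
have dA : normc dw <= `|h| * A.
  rewrite -[dw](subrK (h%:C%C * c)); apply: le_trans (normcD_le _ _) _; rewrite ncM normc_real mulrDr mulr1 addrC lerD2l.
  apply: le_trans B _; rewrite -[leRHS]mul1r ler_wpM2r // ge_min lexx //.
apply: le_trans (normcD_le _ _) _; rewrite ncM.
apply: (@le_trans _ _ (e / k * (`|h| * A) + (e / k * `|h|) * normc c')).
  apply: lerD; first by apply: le_trans P _; rewrite ler_wpM2l // ltW.
  by rewrite ler_wpM2r ?normc_ge0 // (le_trans B) // ler_wpM2r // ge_min lexx orbT.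
by rewrite -(mulrA (e / k)) -mulrDr -mulrDr -/k mulrCA divfK ?gt_eqF // mulrC.
Qed.

Lemma holo_inv (z : C) : z <> 0 -> holo (fun z => z^-1) z (- (z^-1 ^+ 2)).
Proof.
move=> z0; have n0 := normc_gt0 z0.
apply: (@holo_quad _ _ _ (2 * (normc z)^-1 ^+ 3) (normc z / 2)).
- by rewrite mulr_ge0 // exprn_ge0 // invr_ge0 ltW.
- by rewrite divr_gt0.
move=> h hs.
have zh : normc z / 2 <= normc (z + h).
  have := normc_dist z (- h); rewrite normcN opprK => le; lra.
have zh0 : normc (z + h) > 0 by apply: lt_le_trans zh; rewrite divr_gt0.
have zh1 : z + h != 0 by apply/eqP => e; move: zh0; rewrite e nc0 ltxx.
have -> : (z + h)^-1 - z^-1 - h * - z^-1 ^+ 2 = h ^+ 2 * (z^-1 ^+ 2 * (z + h)^-1).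
  by field; rewrite zh1; apply/eqP.
rewrite (ncM (h ^+ 2)) normcX [leRHS]mulrC; apply: ler_wpM2l; first by rewrite exprn_ge0 ?normc_ge0.
rewrite (ncM (z^-1 ^+ 2)) normcX !normcV.
have mn : (normc (z + h))^-1 <= 2 * (normc z)^-1.
  by rewrite -[leLHS]mul1r ler_pdivrMr // mulrAC ler_pdivlMr // mul1r -ler_pdivrMl // mulrC.
by rewrite (exprSr _ 2) mulrCA; apply: ler_wpM2l mn; rewrite exprn_ge0 // invr_ge0 normc_ge0.
Qed.

Lemma cdiff_inv w x c : w x <> 0 -> cdiff w x c -> cdiff (fun x => (w x)^-1) x (c * - ((w x)^-1 ^+ 2)).
Proof. by move=> w0 wd; apply: (cdiff_comp wd); exact: holo_inv. Qed.

Lemma cdiff_div a b x c c' : b x <> 0 -> cdiff a x c -> cdiff b x c' ->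
  cdiff (fun x => a x / b x) x (c / b x + a x * (c' * - ((b x)^-1 ^+ 2))).
Proof. by move=> b0 ad bd; apply: cdiff_mul => //; exact: cdiff_inv. Qed.

Lemma cdiff_add a b x c c' : cdiff a x c -> cdiff b x c' -> cdiff (fun x => a x + b x) x (c + c').
Proof.
move=> ad bd; have := cdiff_sub ad (cdiff_sub (cdiff_cst 0 x) bd).
rewrite sub0r opprK; apply: cdiff_ext => y; by rewrite sub0r opprK.
Qed.

Lemma cdiff_scale a x c k : cdiff a x c -> cdiff (fun x => k * a x) x (k * c).
Proof. by move=> ad; have := cdiff_mul (cdiff_cst k x) ad; rewrite mul0r add0r. Qed.

Lemma cdiff_exp a x c n : cdiff a x c -> cdiff (fun x => a x ^+ n.+1) x (n.+1%:R * a x ^+ n * c).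
Proof.
move=> ad; elim: n => [|n IH].
  by rewrite expr0 !mul1r; apply: cdiff_ext ad => y; rewrite expr1.
have := cdiff_mul ad IH.
have -> : c * a x ^+ n.+1 + a x * (n.+1%:R * a x ^+ n * c) = n.+2%:R * a x ^+ n.+1 * c.
  by rewrite exprS -[n.+2]addn1 natrD; ring.
by apply: cdiff_ext => y; rewrite -exprS.
Qed.

Lemma cdiff_id x : cdiff (fun x => x%:C%C) x 1.
Proof.
move=> e e0; exists 1 => // h _.
have -> : (x + h)%:C%C = x%:C%C + h%:C%C :> C by rewrite -rmorphD.
by rewrite mulr1 (addrC x%:C%C) addrK subrr nc0 mulr_ge0 // ltW.
Qed.

Definition ccont w := forall x e, 0 < e -> exists2 de : R, 0 < de & forall h, `|h| < de ->
  normc (w (x + h) - w x) < e.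

Lemma cdiff_ccont w w' : (forall x, cdiff w x (w' x)) -> ccont w.
Proof. by move=> wd x; apply: cdiff_cont (wd x). Qed.

Lemma ccont_part (p : C -> R) w : (forall x y : C, p (x - y) = p x - p y) -> (forall x : C, `|p x| <= normc x) ->
  ccont w -> continuous (fun x => p (w x)).
Proof.
move=> pB pn wc x; apply/cvgrPdist_lt => e e0; have [d d0 hd] := wc x e e0.
apply/nbhs_ballP; exists d => //= y; rewrite /ball /= => yd.
rewrite distrC -pB; apply: le_lt_trans (pn _) _.
have -> : y = x + (y - x) by rewrite addrC subrK.
by apply: hd; rewrite distrC.
Qed.

Lemma ccont_Re w : ccont w -> continuous (fun x => complex.Re (w x)).
Proof. by apply: ccont_part; [exact: Re_sub | exact: normc_Re]. Qed.
Lemma ccont_Im w : ccont w -> continuous (fun x => complex.Im (w x)).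
Proof. by apply: ccont_part; [exact: Im_sub | exact: normc_Im]. Qed.

Lemma ccontP w : continuous (fun x => complex.Re (w x)) -> continuous (fun x => complex.Im (w x)) -> ccont w.
Proof.
move=> cR cI x e e0; have e2 : 0 < e / 2 by rewrite divr_gt0.
have key (f : R -> R) : continuous f -> exists2 de : R, 0 < de & forall h, `|h| < de -> `|f (x + h) - f x| < e / 2.
  move=> /(_ x) /cvgrPdist_lt /(_ _ e2) /nbhs_ballP[d /= d0 hd]; exists d => // h hh.
  by rewrite distrC; apply: hd; rewrite /ball /= opprD addrA subrr sub0r normrN.
have [d1 d10 h1] := key _ cR; have [d2 d20 h2] := key _ cI.
exists (Num.min d1 d2) => [|h]; first by rewrite lt_min d10.
rewrite lt_min => /andP[/h1 a /h2 b]; apply: le_lt_trans (normc_ReIm _) _.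
by rewrite Re_sub Im_sub [e]splitr ltrD.
Qed.

Lemma ccont_mul a b : ccont a -> ccont b -> ccont (fun x => a x * b x).
Proof.
move=> ac bc; have [[[a1 a2] b1] b2] := (ccont_Re ac, ccont_Im ac, (ccont_Re bc), (ccont_Im bc)).
apply: (@ccontP (fun x => a x * b x)) => x.
  rewrite (_ : (fun _ => _) = fun x => complex.Re (a x) * complex.Re (b x) - complex.Im (a x) * complex.Im (b x)).
    by apply: cvgB; apply: cvgM; [exact: a1|exact: b1|exact: a2|exact: b2].
  by apply/funext => y; case: (a y) => ? ?; case: (b y).
rewrite (_ : (fun _ => _) = fun x => complex.Re (a x) * complex.Im (b x) + complex.Im (a x) * complex.Re (b x)).
  by apply: cvgD; apply: cvgM; [exact: a1|exact: b2|exact: a2|exact: b1].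
by apply/funext => y; case: (a y) => ? ?; case: (b y) => ? ? /=; ring.
Qed.

Lemma ccont_add a b : ccont a -> ccont b -> ccont (fun x => a x + b x).
Proof.
move=> ac bc x e e0; have e2 : 0 < e / 2 by rewrite divr_gt0.
have [d1 d10 h1] := ac x _ e2; have [d2 d20 h2] := bc x _ e2.
exists (Num.min d1 d2) => [|h]; first by rewrite lt_min d10.
rewrite lt_min => /andP[/h1 A /h2 B].
by rewrite opprD addrACA (le_lt_trans (normcD_le _ _)) // [e]splitr ltrD.
Qed.

Lemma ccont_cst c : ccont (fun=> c).
Proof. by move=> x e e0; exists 1 => // h _; rewrite subrr nc0. Qed.

Lemma ccont_inv a : (forall x, a x <> 0) -> ccont a -> ccont (fun x => (a x)^-1).
Proof.
move=> a0 ac x e e0; have [r r0 hp] := holo_cont (holo_inv (a0 x)) e0.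
have [d d0 hd] := ac x _ r0; exists d => // h /hd /hp.
by rewrite [a x + _]addrC subrK.
Qed.

End Curves.

(** * Primitives, exponential and continuous choices along a real curve *)

Section RealCurves.
Local Open Scope classical_set_scope.
Variable R : realType.
Local Notation C := R[i].
Local Notation normc := (@ComplexField.Normc.normc R).
Implicit Types (s x h e d : R) (c : C) (a b w : R -> C).

Lemma cdiff0_cst w : (forall x, cdiff w x 0) -> forall x y, w x = w y.
Proof.
move=> wd x y; have h z : is_derive z (1 : R) (fun x => complex.Re (w x)) 0 by have /cdiffP[] := wd z.
have k z : is_derive z (1 : R) (fun x => complex.Im (w x)) 0 by have /cdiffP[] := wd z.
have := is_derive_0_is_cst x y h; have := is_derive_0_is_cst x y k.
by case: (w x) (w y) => ? ? [? ?] /= -> ->.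
Qed.

Lemma rdiff_continuous (f f' : R -> R) : (forall x, rdiff f x (f' x)) -> continuous f.
Proof.
move=> fd x; apply: differentiable_continuous; apply/derivable1_diffP.
by have /rdiffP[] := fd x.
Qed.

Lemma rdiff_increasing (f f' : R -> R) : (forall x, rdiff f x (f' x)) -> (forall x, 0 < f' x) ->
  forall x y, x < y -> f x < f y.
Proof.
move=> fd f0 x y xy.
have [c _ h] := MVT xy (fun z _ => (iffLR (rdiffP f z (f' z)) (fd z)))
  (continuous_subspaceT (rdiff_continuous fd)).
by rewrite -subr_gt0 h mulr_gt0 // subr_gt0.
Qed.

(** The integrals from - n differ by constants. Normalized to vanish at 0 they agree wherever both
    are defined, and [N x] picks one whose interval contains x in its interior. *)
Lemma real_primitive (f : R -> R) : continuous f -> exists F : R -> R, forall x, rdiff F x (f x).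
Proof.
move=> fc.
pose G (n : nat) x := Rintegral lebesgue_measure `[- n%:R, x] f.
have Gd (n : nat) x : - n%:R < x -> rdiff (G n) x (f x).
  move=> nx; have xu : x < x + 1 by rewrite ltrDl.
  have fi : lebesgue_measure.-integrable `[- n%:R, x + 1] (EFin \o f).
    by apply: continuous_compact_integrable; [exact: segment_compact | exact: continuous_subspaceT].
  have [dF F'] := continuous_FTC1_closed xu fi nx (fc x).
  by apply/rdiffP; exact: (DeriveDef dF (etrans (esym (derive1E _ _)) F')).
pose H (n : nat) x := G n.+1 x - G n.+1 0.
have Hd (n : nat) x : - n%:R <= x -> rdiff (H n) x (f x).
  move=> nx; have lt : - n.+1%:R < x by rewrite -natr1 opprD (lt_le_trans _ nx) // gtrDl oppr_lt0.
  have := (iffLR (rdiffP _ _ _) (Gd n.+1 x lt)) => g; apply/rdiffP.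
  by have := is_deriveB g (is_derive_cst (G n.+1 0) x 1); rewrite subr0.
have HE (m n : nat) x : - n%:R <= x -> - m%:R <= x -> H n x = H m x.
  move=> nx mx; pose D y := H n y - H m y.
  have Dd y : - n%:R <= y -> - m%:R <= y -> rdiff D y 0.
    move=> ny my; have := is_deriveB (iffLR (rdiffP _ _ _) (Hd n y ny)) (iffLR (rdiffP _ _ _) (Hd m y my)).
    by rewrite subrr => ?; apply/rdiffP.
  have D0 : D 0 = 0 by rewrite /D /H !subrr.
  suff: D x = D 0 by rewrite D0 => /eqP; rewrite subr_eq0 => /eqP.
  have n0 : - n%:R <= 0 :> R by rewrite oppr_le0. have m0 : - m%:R <= 0 :> R by rewrite oppr_le0.
  have cD u v : - n%:R <= u -> - m%:R <= u -> {within `[u, v], continuous D}.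
    move=> nu mu; apply: derivable_within_continuous => y; rewrite in_itv => /andP[uy _].
    by have /rdiffP[] := Dd y (le_trans nu uy) (le_trans mu uy).
  have key u v : - n%:R <= u -> - m%:R <= u -> u < v -> D v = D u.
    move=> nu mu uv; apply/eqP; rewrite -subr_eq0.
    have dv z : z \in `]u, v[%R -> is_derive z (1 : R) D 0.
      rewrite in_itv => /andP[/ltW uz _]; apply/rdiffP; apply: Dd; exact: le_trans uz.
    by have [c _ ->] := MVT uv dv (cD u v nu mu); rewrite mul0r.
  have [x0|x0|->//] := ltgtP x 0; first exact/esym/key.
  exact: key.
pose N x := Num.truncn (`|x| + 1).
have NP x : - (N x)%:R < x.
  rewrite ltrNl (le_lt_trans (ler_norm (- x))) // normrN.
  have /andP[_] := truncn_itv (addr_ge0 (normr_ge0 x) ler01).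
  by rewrite -/(N x) -natr1 ltrD2r.
exists (fun x => H (N x) x) => x e e0.
have [d d0 hd] := Hd _ _ (ltW (NP x)) e e0.
exists (Num.min d (x + (N x)%:R)) => [|h]; first by have := NP x; rewrite lt_min d0 /=; lra.
rewrite lt_min => /andP[/hd + hx].
rewrite (HE (N x) (N (x + h)) (x + h)) //; first exact: ltW.
by have := ler_normlW (ltW hx); have := ler_norm (- h); rewrite normrN => *; lra.
Qed.

Lemma primitive w : ccont w -> exists W, forall x, cdiff W x (w x).
Proof.
move=> wc; have [F hF] := real_primitive (ccont_Re wc); have [G hG] := real_primitive (ccont_Im wc).
by exists (fun x => (F x +i* G x)%C) => x; apply/cdiff_ReIm.
Qed.

Lemma cintegral01E w W : (forall x, cdiff W x (w x)) -> ccont w -> cintegral01 w = W 1 - W 0.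
Proof.
move=> Wd wc.
have key (p : C -> R) (pB : forall x y : C, p (x - y) = p x - p y) : continuous (fun x => p (w x)) ->
    (forall x, rdiff (fun x => p (W x)) x (p (w x))) ->
    Rintegral lebesgue_measure `[0, 1] (fun s => p (w s)) = p (W 1 - W 0).
  move=> pc pd; have cp := rdiff_continuous pd.
  rewrite /Rintegral (@continuous_FTC2 _ (fun s => p (w s)) (fun s => p (W s)) 0 1) //=.
  - exact: continuous_subspaceT.
  - split.
    + by move=> x _; have /rdiffP[] := pd x.
    + exact/cvg_at_right_filter/cp.
    + exact/cvg_at_left_filter/cp.
  - by move=> x _ /=; rewrite derive1E; have /rdiffP[] := pd x.
rewrite /cintegral01 (key (@complex.Re R) (@Re_sub R)) ?(key (@complex.Im R) (@Im_sub R)).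
- by case: (W 1 - W 0).
- exact: ccont_Im.
- by move=> x; have /cdiff_ReIm[] := Wd x.
- exact: ccont_Re.
- by move=> x; have /cdiff_ReIm[] := Wd x.
Qed.

(** The indicator function of D has derivative 0 everywhere, hence is constant. *)
Lemma locally_constant (D : R -> Prop) :
  (forall x, exists2 r : R, 0 < r & forall h, `|h| < r -> (D x <-> D (x + h))) -> forall x y, D x -> D y.
Proof.
move=> Dl x y Dx; pose f z : R := if `[< D z >] then 1 else 0.
have fd z : is_derive z (1 : R) f 0.
  apply/rdiffP => e e0; have [r r0 hr] := Dl z; exists r => // h /hr zh.
  by rewrite /f (asbool_equiv_eq zh) subrr mulr0 subr0 normr0 mulr_ge0 // ltW.
have := is_derive_0_is_cst x y fd; rewrite /f (asboolT Dx).
by case: asboolP => // _ /eqP; rewrite oner_eq0.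
Qed.

(** At each x exactly one F i vanishes. Nonvanishing is an open condition and there are finitely
    many indices, so the vanishing index is locally constant. This follows one conjugate, or one
    branch, along a curve. *)
Lemma continuous_choice (n : nat) (F : 'I_n -> R -> C) : (forall i, ccont (F i)) ->
  (forall x, exists i, F i x = 0) -> (forall x i j, F i x = 0 -> F j x = 0 -> i = j) ->
  forall x0 i, F i x0 = 0 -> forall x, F i x = 0.
Proof.
move=> Fc Fe Fu x0 i Fi x; apply: (@locally_constant (fun x => F i x = 0) _ x0) => // {x0 Fi}x.
have loc j : exists2 r : R, 0 < r & forall h, `|h| < r -> F j x <> 0 -> F j (x + h) <> 0.
  have [F0|F0] := pselect (F j x = 0); first by exists 1.
  have [r r0 hr] := Fc j x _ (normc_gt0 F0); exists r => // h /hr + _ F0'.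
  by rewrite F0' sub0r normcN ltxx.
have [r r0 hr] : exists2 r : R, 0 < r & forall h, `|h| < r -> forall j, F j x <> 0 -> F j (x + h) <> 0.
  have /boolp.choice[s hs] (j : 'I_n) : exists r : R, 0 < r /\ forall h, `|h| < r -> F j x <> 0 -> F j (x + h) <> 0.
    by have [r r0 h] := loc j; exists r.
  exists (\big[Num.min/1]_j s j).
    by apply: lt_bigmin => // j _; case: (hs j).
  by move=> h hh j; have [_] := hs j; apply; apply: lt_le_trans hh _; exact: bigmin_le_cond.
exists r => // h hh; split=> Fi.
  have [j Fj] := Fe (x + h); suff: j = i by move=> <-.
  apply: (Fu x) => //; apply: contrapT => Fjx; exact: (hr h hh j Fjx).
have [j Fj] := Fe x; suff: j = i by move=> <-.
apply: (Fu (x + h)) => //; have [k Fk] := Fe (x + h).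
have Fkx : F k x = 0 by apply: contrapT => Fkx; exact: (hr h hh k Fkx).
by rewrite (Fu x j k Fj Fkx).
Qed.

Definition cexp c : C := (expR (complex.Re c) * cos (complex.Im c) +i* (expR (complex.Re c) * sin (complex.Im c)))%C.

Lemma cexpD c c' : cexp (c + c') = cexp c * cexp c'.
Proof.
case: c c' => p q [p' q'] /=; rewrite /cexp /= expRD cosD sinD.
by apply/eqP; rewrite eq_complex /=; apply/andP; split; apply/eqP; ring.
Qed.

Lemma cexp0 : cexp 0 = 1.
Proof. by rewrite /cexp /= expR0 cos0 sin0 mulr1 mulr0. Qed.

Lemma normc_cexp c : normc (cexp c) = expR (complex.Re c).
Proof.
rewrite /ComplexField.Normc.normc /= !exprMn -mulrDr cos2Dsin2 mulr1 sqrtr_sqr.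
by rewrite ger0_norm // expR_ge0.
Qed.

Lemma cexp_neq0 c : cexp c <> 0.
Proof. by move=> h; have := expR_gt0 (complex.Re c); rewrite -normc_cexp h nc0 ltxx. Qed.

Lemma cexp_rdiff (f g : R -> R) x p q : is_derive x (1 : R) f p -> is_derive x (1 : R) g q ->
  is_derive x (1 : R) (fun x => expR (f x) * cos (g x)) (p * (expR (f x) * cos (g x)) - q * (expR (f x) * sin (g x))) /\
  is_derive x (1 : R) (fun x => expR (f x) * sin (g x)) (p * (expR (f x) * sin (g x)) + q * (expR (f x) * cos (g x))).
Proof.
move=> fd gd.
have e1 : is_derive x (1 : R) (expR \o f) (expR (f x) * p) by exact: is_derive1_comp.
have c1 : is_derive x (1 : R) (cos \o g) (- sin (g x) * q) by exact: is_derive1_comp.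
have s1 : is_derive x (1 : R) (sin \o g) (cos (g x) * q) by exact: is_derive1_comp.
split.
  have := is_deriveM e1 c1; rewrite /= => h; apply: is_derive_eq h _.
  by rewrite /GRing.scale /=; ring.
have := is_deriveM e1 s1; rewrite /= => h; apply: is_derive_eq h _.
by rewrite /GRing.scale /=; ring.
Qed.

Lemma cdiff_cexp a x c : cdiff a x c -> cdiff (fun x => cexp (a x)) x (c * cexp (a x)).
Proof.
move=> /cdiffP[h1 h2]; apply/cdiffP => /=.
by have [e1 e2] := cexp_rdiff h1 h2; case: c h1 h2 e1 e2 => p q /=.
Qed.

Lemma cexp_eq1 (x : R) : 0 <= x < 2 * pi -> cexp (0 +i* x)%C = 1 -> x = 0.
Proof.
move=> /andP[x0 x2]; rewrite /cexp /= expR0 !mul1r => -[c1 s0].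
have pi0 := pi_gt0 R.
have [xp|px|xp] := ltgtP x pi.
- apply/eqP; rewrite eq_le x0 andbT leNgt; apply/negP => xg.
  by have := @sin_gt0_pi _ x; rewrite xg xp s0 ltxx => /(_ isT).
- have := @sin_gt0_pi _ (x - pi); rewrite subr_gt0 px ltrBlDr -mulr2n -mulr_natl x2 => /(_ isT).
  have := sinDpi (x - pi); rewrite subrK s0 => /eqP; rewrite eq_sym oppr_eq0 => /eqP ->.
  by rewrite ltxx.
by move: c1; rewrite xp cospi => h; exfalso; lra.
Qed.

Lemma cexp_surj c : c <> 0 -> exists (p x : R), 0 <= x < 2 * pi /\ c = cexp (p +i* x)%C.
Proof.
move=> c0; pose n := normc c; have n0 : 0 < n := normc_gt0 c0.
case: c c0 @n n0 => u v c0 n n0.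
have uv : n ^+ 2 = u ^+ 2 + v ^+ 2 by rewrite /n /ComplexField.Normc.normc sqr_sqrtr // addr_ge0 ?sqr_ge0.
pose y := u / n; pose z := v / n.
have yz : y ^+ 2 + z ^+ 2 = 1 by rewrite /y /z !expr_div_n -mulrDl -uv divff // expf_neq0 // gt_eqF.
have y1 : -1 <= y <= 1.
  by rewrite -ler_norml -(expr_le1 (n := 2)) // real_normK ?num_real // -yz lerDl sqr_ge0.
have [a0 ap] := (acos_ge0 y1, acos_lepi y1).
have ca : cos (acos y) = y by apply: acosK; rewrite in_itv.
have sa : sin (acos y) = `|z|.
  rewrite sin_acos // -sqrtr_sqr; congr Num.sqrt; by rewrite -yz addrC addKr.
have E : expR (ln n) = n by rewrite lnK // posrE.
have pi0 := pi_gt0 R.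
have un : u = n * y by rewrite /y mulrC divfK // gt_eqF.
have vn : v = n * z by rewrite /z mulrC divfK // gt_eqF.
have [z0|z0] := leP 0 z.
  exists (ln n), (acos y); split; first by rewrite a0 (le_lt_trans ap) //; lra.
  by rewrite /cexp /= E ca sa ger0_norm // -un -vn.
exists (ln n), (2 * pi - acos y); split.
  apply/andP; split; first lra.
  rewrite ltrBlDr ltrDl lt_def a0 andbT; apply/eqP => e0.
  by move: sa; rewrite e0 sin0 => /esym/normr0_eq0 z0'; rewrite z0' ltxx in z0.
have := cosD2pi (- acos y); have := sinD2pi (- acos y).
rewrite cosN sinN ca sa => s c; rewrite [_ + _]addrC in s; rewrite [_ + _]addrC in c.
by rewrite /cexp /= E (mulr_natl pi 2) c s ltr0_norm // opprK -un -vn.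
Qed.
End RealCurves.

(** * Values of convergent series in one variable *)

Section OneVariable.
Variables (R : realType) (T1 : fps_theory R[i]) (T2 : fps_theory T1).
Local Notation C := R[i].
Local Notation normc := (@ComplexField.Normc.normc R).
Local Notation cv1 u := (cvgt (tconst u : T2)).
Implicit Types (u v w : T1) (f g h : T2) (t c : C).

Definition evt u t : C := ev (tconst u : T2) (t, 0).

Lemma near0_near (A : C * C -> Prop) : near0 A -> near (fun t => A (t, 0)).
Proof. by move=> [r r0 h]; exists r => // t tr; apply: h; rewrite //= nc0. Qed.

Lemma near_gt0 (A : C -> Prop) : near A -> A 0.
Proof. by move=> [r r0 h]; apply: h; rewrite nc0. Qed.

Lemma cv1_tderiv u : cv1 u -> cv1 (tderiv u).
Proof.
move=> cu; suff -> : tconst (tderiv u) = pdx (tconst u) :> T2 by exact: cvgt_pdx.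
by apply: c2P => i j; rewrite c2_pdx !c2_tconst tderivE; case: ifP => // _; rewrite mul0rn.
Qed.

Lemma cv1_mul u v : cv1 u -> cv1 v -> cv1 (u * v).
Proof. by rewrite rmorphM; exact: cvgtM. Qed.
Lemma cv1_add u v : cv1 u -> cv1 v -> cv1 (u + v).
Proof. by rewrite rmorphD; exact: cvgtD. Qed.
Lemma cv1_sub u v : cv1 u -> cv1 v -> cv1 (u - v).
Proof. by rewrite rmorphB; exact: cvgtB. Qed.
Lemma cv1_exp u n : cv1 u -> cv1 (u ^+ n).
Proof. by rewrite rmorphXn; exact: cvgt_exp. Qed.

Lemma near_evtM u v : cv1 u -> cv1 v -> near (fun t => evt (u * v) t = evt u t * evt v t).
Proof. by move=> cu cv; rewrite /evt rmorphM /=; exact: near0_near (near0_evM cu cv). Qed.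
Lemma near_evtD u v : cv1 u -> cv1 v -> near (fun t => evt (u + v) t = evt u t + evt v t).
Proof. by move=> cu cv; rewrite /evt rmorphD /=; exact: near0_near (near0_evD cu cv). Qed.
Lemma near_evtB u v : cv1 u -> cv1 v -> near (fun t => evt (u - v) t = evt u t - evt v t).
Proof. by move=> cu cv; rewrite /evt rmorphB /=; exact: near0_near (near0_evB cu cv). Qed.
Lemma evt_tX t : evt tX t = t. Proof. exact: ev_X. Qed.
Lemma evt0 t : evt 0 t = 0. Proof. by rewrite /evt rmorph0 ev0. Qed.
Lemma evt1 t : evt 1 t = 1. Proof. by rewrite /evt rmorph1 ev1. Qed.
Lemma evt_const c t : evt (tconst c) t = c. Proof. exact: ev_const. Qed.
Lemma cv1_tX : cv1 tX. Proof. exact: (@cvgt_X _ _ T2). Qed.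
Lemma cv1_const c : cv1 (tconst c). Proof. exact: (@cvgt_const _ _ T2). Qed.

Lemma near_evtX u n : cv1 u -> near (fun t => evt (u ^+ n) t = evt u t ^+ n).
Proof.
move=> cu; elim: n => [|n IH]; first by exists 1 => // t _; rewrite !expr0 evt1.
by apply: nearW (nearI IH (near_evtM cu (cv1_exp n cu))) => t [h1]; rewrite -exprS => ->; rewrite h1 exprS.
Qed.

Lemma near_evt_small u : cv1 u -> co u 0 = 0 -> forall e : R, 0 < e -> near (fun t => normc (evt u t) < e).
Proof. by move=> cu u0 e e0; have h := near0_evsmall cu (@low_tconst _ _ T2 _ u0) e0; exact: (near0_near h). Qed.

Lemma near0_evtX u : cv1 u -> near0 (fun z => ev (tconst u : T2) z = evt u z.1).
Proof.
move=> cu; have := near0_subst (@cvgt_X _ _ T2) (@cvgt_const _ _ T2 0) (@low_X _ _ T2) _ cu.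
rewrite rmorph0 => /(_ (@low0 _ _ T2 1)); apply: near0W => z.
have -> : subst vX 0 (tconst u) = tconst u :> T2 by rewrite -(subst_tconst vY) ?subst_id.
by rewrite ev_X ev0.
Qed.

Lemma near_evt_pull u v f : cv1 u -> cv1 v -> co u 0 = 0 -> co v 0 = 0 -> cvgt f ->
  near (fun t => evt (pull u v f) t = ev f (evt u t, evt v t)).
Proof.
move=> cu cv u0 v0 cf; have := near0_subst cu cv (@low_tconst _ _ T2 _ u0) (@low_tconst _ _ T2 _ v0) cf.
by rewrite subst_pull //; exact: near0_near.
Qed.

Lemma near_evt_rot z v : cv1 v -> near (fun t => evt (rot z v) t = evt v (z * t)).
Proof.
move=> cv.
have h1 : cvgt (k2 z * vX : T2) by apply: cvgtM; [exact: (@cvgt_const _ _ T2) | exact: (@cvgt_X _ _ T2)].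
have h2 : low 1 (k2 z * vX : T2) by exact: lowMl.
have := near0_subst h1 (@cvgt_const _ _ T2 0) h2 _ cv; rewrite rmorph0 => /(_ (@low0 _ _ T2 1)).
rewrite subst_rot_tconst => A; have B := near0_evM (@cvgt_const _ _ T2 z) (@cvgt_X _ _ T2).
apply: nearW (near0_near (near0I A B)) => t [h k]; rewrite /evt h k ev_const ev_X ev0.
by [].
Qed.

Lemma bounded_ev f : cvgt f -> exists2 M : R, 0 <= M & near0 (fun z => normc (ev f z) <= M).
Proof.
move=> [r [r0 [M bf]]]; exists M; first exact: bnd_ge0 bf.
by exists r => // z z1 z2; apply: ev_le bf; [exact: ltW | split; exact: ltW].
Qed.

(** As convergent series, u(x + y) = u(x) + y u'(x) + y^2 G(x, y), and G is bounded near 0; this is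
    a quadratic bound on the remainder at every small t. *)
Lemma near_holo u : cv1 u -> near (fun t => holo (evt u) t (evt (tderiv u) t)).
Proof.
move=> cu; pose S := vX + vY : T2.
have lS : low 1 S by apply: lowD.
have cS : cvgt S by apply: cvgtD; [exact: (@cvgt_X _ _ T2) | exact: cvgt_Y].
have l0 := @low0 _ _ T2 1; have c0 : cvgt (0 : T2) by have := (@cvgt_const _ _ T2)  0; rewrite rmorph0.
pose F w : T2 := subst S 0 (tconst w).
have F0 w : co (F w) 0 = w.
  have := subst_ydrop (F w); rewrite /F subst_comp // [subst vX 0 S]rmorphD /= subst_X // subst_Y // addr0 rmorph0.
  rewrite -(subst_tconst vY _ (low_X T2)) subst_id => /(congr1 (fun f : T2 => co f 0)).
  by rewrite !tconstE.
have dd : pdx (tconst u) = tconst (tderiv u) :> T2.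
  by apply: c2P => i j; rewrite c2_pdx !c2_tconst tderivE; case: ifP => // _; rewrite mul0rn.
have F1 : co (F u) 1 = tderiv u.
  have : pdy (F u) = F (tderiv u).
    rewrite /F pdy_subst // raddf0 mulr0 addr0 dd /S raddfD /= pdy_X pdy_Y add0r mulr1 //.
  by move=> /(congr1 (fun f : T2 => co f 0)); rewrite F0 tderivE mulr1n.
pose G : T2 := tshift 2 (F u).
have FE : F u = tconst u + vY * tconst (tderiv u) + vY ^+ 2 * G.
  by rewrite {1}(taylor_split 2 (F u)) !big_ord_recr big_ord0 /= F0 F1 expr0 expr1 mulr1 add0r [vY * _]mulrC.
have cF : cvgt (F u) by exact: cvgt_subst.
have ct := cv1_tderiv cu; have cY := @cvgt_Y _ _ T2.
have cG : cvgt G.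
  apply: (@cvgt_divY _ _ _ 2 (F u - (tconst u + vY * tconst (tderiv u)))); last by rewrite FE addrAC subrr add0r.
  by apply: cvgtB => //; apply: cvgtD => //; apply: cvgtM.
have [M M0 GM] := bounded_ev cG.
have A : near0 (fun z => evt u (z.1 + z.2) = evt u z.1 + z.2 * evt (tderiv u) z.1 + z.2 ^+ 2 * ev G z).
  have h1 := near0_subst cS c0 lS l0 cu; rewrite -/(F u) in h1.
  have h2 := near0_evD (cvgtD cu (cvgtM cY ct)) (cvgtM (cvgt_exp 2 cY) cG); rewrite -FE in h2.
  have h3 := near0_evD cu (cvgtM cY ct).
  have h4 := near0_evM cY ct.
  have h5 := near0_evM (cvgt_exp 2 cY) cG.
  have h6 : near0 (fun z => ev (vY ^+ 2 : T2) z = z.2 ^+ 2).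
    by apply: near0W (near0_evM cY cY) => z; rewrite ev_Y.
  have h7 := near0_evD (@cvgt_X _ _ T2) cY.
  have := near0I h1 (near0I h2 (near0I h3 (near0I h4 (near0I h5 (near0I h6 (near0I h7 (near0I (@near0_evtX _ cu) (near0_evtX ct)))))))).
  apply: near0W => z [e1 [e2 [e3 [e4 [e5 [e6 [e7 [e8 e9]]]]]]]].
  by rewrite {1}/evt; move: e1; rewrite e2 e3 e4 e5 e6 /S e7 e8 e9 ev0 ev_X ev_Y => <-.
have [r r0 hr] := near0I GM A.
exists r => // t tr; apply: (holo_quad M0 r0) => h hh.
have /= [g ->] := hr (t, h) tr hh; rewrite -(addrA (evt u t)) (addrC (evt u t)) addrK addrAC subrr add0r.
by rewrite ncM normcX mulrC ler_wpM2r // exprn_ge0 // normc_ge0.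
Qed.

Definition tint u : T1 := tX * mk (fun n => co u n / n.+1%:R).

Lemma tderiv_tint u : tderiv (tint u) = u.
Proof.
by apply: coP => n; rewrite tderivE /tint tXM coK /= -[LHS]mulr_natr divfK ?pnatr_eq0.
Qed.

Lemma cv1_tint u : cv1 u -> cv1 (tint u).
Proof.
move=> cu; apply: cv1_mul; first exact: cv1_tX.
apply: (@cvgt_sub_coef _ _ _ 0 0 (tconst u) _ 1) => // i j; rewrite !addn0 !c2_tconst mul1r.
case: ifP => // _; rewrite coK ncM normcV ler_piMr ?normc_ge0 //.
have -> : normc i.+1%:R = i.+1%:R.
  by rewrite -(rmorph_nat (real_complex R)) normc_real ger0_norm.
by rewrite invf_le1 // ler1n.
Qed.

Lemma cv1_inv u : cv1 u -> co u 0 <> 0 -> exists2 w, u * w = 1 & cv1 w.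
Proof.
move=> cu u0; have [|w [uw /(_ cu) cw]] := @inverse _ _ T2 (tconst u); first by rewrite c2_tconst.
exists (co w 0); last first.
  rewrite -subst_ydrop; apply: cvgt_subst => //; first exact: (@cvgt_X _ _ T2).
  by have := (@cvgt_const _ _ T2)  0; rewrite rmorph0.
have /(congr1 (@cst0 _ T2)) := uw; rewrite rmorphM rmorph1 /= /cst0 tconstE.
by [].
Qed.

Lemma log_derivative u : cv1 u -> co u 0 <> 0 -> exists2 l, cv1 l & tderiv u = u * tderiv l.
Proof.
move=> cu u0; have [w uw cw] := cv1_inv cu u0.
exists (tint (w * tderiv u)); first by apply/cv1_tint/cv1_mul => //; exact: cv1_tderiv.
by rewrite tderiv_tint mulrA uw mul1r.
Qed.

(** The logarithmic derivative t u' / u = n + t l', multiplied out. Along a loop around 0 the term n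
    produces the winding, while the holomorphic l returns to its initial value. *)
Lemma has_ord_log u n : cv1 u -> has_ord u n -> exists l w, [/\ cv1 l, cv1 w, co w 0 <> 0,
  u = tX ^+ n * w & tX * tderiv u = u * (tconst n%:R + tX * tderiv l)].
Proof.
move=> cu /has_ordE[w uE w0].
have cw : cv1 w.
  apply: (@cvgt_divX _ _ _ n (tconst u)) => //.
  by rewrite uE rmorphM rmorphXn.
have [l cl le] := log_derivative cw w0; exists l, w; split=> //.
have dX : tX * tderiv (tX ^+ n : T1) = tconst n%:R * tX ^+ n.
  apply: coP => i; rewrite tXM tconstM tXnE; case: i => [|i].
    by case: n uE => [|n] uE; rewrite ?mulr0 ?mul0r.
  rewrite tderivE tXnE; have [->|ne] := eqVneq i.+1 n; first by rewrite mulr1.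
  by rewrite mul0rn mulr0.
rewrite uE tderivM mulrDr mulrA dX le.
by move: (tX ^+ n) (tconst n%:R) (tderiv l) => a b c; ring.
Qed.

Lemma near_evt_lower u n : cv1 u -> has_ord u n ->
  exists2 K : R, 0 < K & near (fun t => K * normc t ^+ n <= normc (evt u t)).
Proof.
move=> cu un; have [l [w [_ cw w0 uE _]]] := has_ord_log cu un.
pose k := normc (co w 0); have k0 : 0 < k := normc_gt0 w0.
exists (k / 2); first by rewrite divr_gt0.
pose w' := w - tconst (co w 0).
have cw' : cv1 w' by apply: cv1_sub => //; exact: cv1_const.
have w'0 : co w' 0 = 0 by rewrite coBE tconstE /= subrr.
have k2 : 0 < k / 2 by rewrite divr_gt0.
have h1 := near_evt_small cw' w'0 k2.
have h2 := near_evtD cw' (cv1_const (co w 0)); rewrite subrK in h2.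
have h3 := near_evtM (cv1_exp n cv1_tX) cw; rewrite -uE in h3.
have h4 := near_evtX n cv1_tX.
apply: nearW (nearI h1 (nearI h2 (nearI h3 h4))) => t [e1 [e2 [e3 e4]]].
rewrite e3 e4 evt_tX ncM normcX mulrC ler_wpM2l ?exprn_ge0 ?normc_ge0 //.
rewrite e2 evt_const addrC; have := normc_dist (co w 0) (- evt w' t).
by rewrite opprK normcN -/k => h; apply: le_trans h; lra.
Qed.

Lemma near_evt_neq0 u : cv1 u -> u <> 0 -> near (fun t => t <> 0 -> evt u t <> 0).
Proof.
move=> cu /ordP un; have [K K0 h] := near_evt_lower cu un.
apply: nearW h => t h t0 e; move: h; rewrite e nc0 leNgt mulr_gt0 // exprn_gt0 //.
exact: normc_gt0.
Qed.

Lemma near_rot (A : C -> Prop) z : normc z <= 1 -> near A -> near (fun t => A (z * t)).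
Proof.
move=> z1 [r r0 h]; exists r => // t tr; apply: h; rewrite ncM.
by apply: le_lt_trans tr; rewrite -[leRHS]mul1r ler_wpM2r ?normc_ge0.
Qed.
End OneVariable.

(** * Local parametrization of a branch *)

Section Charts.
Variables (R : realType) (T1 : fps_theory R[i]) (T2 : fps_theory T1).
Local Notation C := R[i].
Local Notation normc := (@ComplexField.Normc.normc R).
Local Notation cv1 u := (cvgt (tconst u : T2)).
Implicit Types (u v w : T1) (f g h : T2) (t c : C) (b : br T2).

Definition gam b t : C * C := (evt T2 b.2.1 t, evt T2 b.2.2 t).
Definition rho b t : R := normc (gam b t).1 ^+ 2 + normc (gam b t).2 ^+ 2.
(** For t = exp (a + i y), the partial derivatives of [rho b] in a and y are 2 Re [bform] and - 2 Im
    [bform]. *)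
Definition bform b t : C := t * (evt T2 (tderiv b.2.1) t * conjc (evt T2 b.2.1 t) +
  evt T2 (tderiv b.2.2) t * conjc (evt T2 b.2.2 t)).

Lemma normc_sq c : normc c ^+ 2 = complex.Re c ^+ 2 + complex.Im c ^+ 2.
Proof.
by case: c => p q; rewrite /ComplexField.Normc.normc sqr_sqrtr // addr_ge0 ?sqr_ge0.
Qed.

Lemma mul_conjc c : c * conjc c = (normc c ^+ 2)%:C%C.
Proof.
rewrite normc_sq; case: c => p q /=; apply/eqP; rewrite eq_complex /=.
by apply/andP; split; apply/eqP; ring.
Qed.

Lemma Re_real_mul (x : R) c : complex.Re (x%:C%C * c) = x * complex.Re c.
Proof. by case: c => p q /=; rewrite mul0r subr0. Qed.
Lemma Im_real_mul (x : R) c : complex.Im (x%:C%C * c) = x * complex.Im c.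
Proof. by case: c => p q /=; rewrite mul0r addr0. Qed.

Lemma ReD c t : complex.Re (c + t) = complex.Re c + complex.Re t.
Proof. by case: c t => ? ? [? ?]. Qed.

Lemma Re_nat n : complex.Re (n%:R : C) = n%:R.
Proof. by rewrite -(rmorph_nat (real_complex R)). Qed.

(** By [has_ord_log] the expression equals |w|^2 (ord w + t l'), and t l' is smaller than 1 in
    modulus near 0. The weak inequality covers a coordinate that vanishes identically. *)
Lemma near_form_ge0 w : cv1 w -> co w 0 = 0 ->
  near (fun t => t <> 0 -> 0 <= complex.Re (t * (evt T2 (tderiv w) t * conjc (evt T2 w t))) /\
     (w <> 0 -> 0 < complex.Re (t * (evt T2 (tderiv w) t * conjc (evt T2 w t))))).
Proof.
move=> cw w0; have [->|wn] := pselect (w = 0).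
  by exists 1 => // t _ _; rewrite !evt0 conjc0 !mulr0.
have wo := ordP wn; have [l [w' [cl _ _ _ wE]]] := has_ord_log cw wo.
have n0 : (0 < ord w)%N.
  by case: (ord w) wo => // -[_]; rewrite w0.
have cl' := cv1_tderiv cl; have cX := @cv1_tX _ _ T2.
have c1 := cv1_mul cX cl'; have cn := @cv1_const _ _ T2 (ord w)%:R.
have h1 := near_evtM cX (cv1_tderiv cw); have h2 := near_evtM cw (cv1_add cn c1).
have h3 := near_evtD cn c1; have z0 : co (tX * tderiv l) 0 = 0 by rewrite tXM.
have h4 := near_evt_small c1 z0 (ltr01 : (0 : R) < 1); have h5 := near_evt_neq0 cw wn.
apply: nearW (nearI h1 (nearI h2 (nearI h3 (nearI h4 h5)))) => t [e1 [e2 [e3 [e4 e5]]]] t0.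
have -> : t * (evt T2 (tderiv w) t * conjc (evt T2 w t)) =
    (normc (evt T2 w t) ^+ 2)%:C%C * ((ord w)%:R + evt T2 (tX * tderiv l) t).
  rewrite -mul_conjc mulrA -[X in X * _ * _](evt_tX T2) -e1 wE e2 e3 evt_const.
  by rewrite mulrAC.
rewrite Re_real_mul ReD Re_nat.
have k0 : 0 < (ord w)%:R + complex.Re (evt T2 (tX * tderiv l) t).
  have := le_lt_trans (normc_Re _) e4; rewrite ltr_norml => /andP[a _].
  have : 1 <= (ord w)%:R :> R by rewrite ler1n.
  lra.
split; first by rewrite mulr_ge0 ?exprn_ge0 ?normc_ge0 // ltW.
by move=> _; rewrite mulr_gt0 // exprn_gt0 // normc_gt0 //; exact: e5.
Qed.

Lemma near_bform b : isbr b -> near (fun t => t <> 0 -> 0 < complex.Re (bform b t)).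
Proof.
move=> bb; have h1 := near_form_ge0 (branch_cu bb) (branch_u0 bb).
have h2 := near_form_ge0 (branch_cv bb) (branch_v0 bb).
apply: nearW (nearI h1 h2) => t [k1 k2] t0; have [a1 a2] := k1 t0; have [a3 a4] := k2 t0.
rewrite /bform mulrDr ReD.
have [u0|v0] := branch_uv_neq0 bb; first by rewrite ltr_wpDr // a2.
by rewrite ltr_wpDl // a4.
Qed.

Lemma near_rho_lower b : isbr b -> exists (n : nat) (K : R), 0 < K /\ near (fun t => K * normc t ^+ n <= rho b t).
Proof.
move=> bb; have key w : cv1 w -> w <> 0 -> exists (n : nat) (K : R), 0 < K /\
    near (fun t => K * normc t ^+ n <= normc (evt T2 w t) ^+ 2).
  move=> cw /ordP wo; have [K K0 h] := near_evt_lower cw wo.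
  exists (ord w * 2)%N, (K ^+ 2); split; first by rewrite exprn_gt0.
  apply: nearW h => t h; rewrite exprM -exprMn ler_sqr ?nnegrE ?normc_ge0 //.
  by rewrite mulr_ge0 ?exprn_ge0 ?normc_ge0 // ltW.
have [u0|v0] := branch_uv_neq0 bb.
  have [n [K [K0 h]]] := key _ (branch_cu bb) u0; exists n, K; split=> //.
  by apply: nearW h => t h; apply: le_trans h _; rewrite lerDl exprn_ge0 // normc_ge0.
have [n [K [K0 h]]] := key _ (branch_cv bb) v0; exists n, K; split=> //.
by apply: nearW h => t h; apply: le_trans h _; rewrite lerDr exprn_ge0 // normc_ge0.
Qed.

Lemma near_near0 (A : C -> Prop) : near A -> near0 (fun z => A z.1).
Proof. by move=> [r r0 h]; exists r => // z z1 _; exact: h. Qed.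

Lemma normc_prim q z : q.-primitive_root z -> normc z = 1.
Proof.
move=> zq; have q0 := prim_order_gt0 zq; apply/eqP.
rewrite -(pexpr_eq1 q0 (normc_ge0 z)) -normcX prim_expr_order //.
by rewrite nc1.
Qed.

Lemma puiseux_values q z v (W : T2) : puiseux_branch q z v W ->
  near0 (fun p : C * C => ev W (p.1 ^+ q, p.2) = \prod_(i < q) (p.2 - evt T2 v (z ^+ i * p.1))) /\
  near (fun t => t <> 0 -> forall i j, (i < q)%N -> (j < q)%N ->
     evt T2 v (z ^+ i * t) = evt T2 v (z ^+ j * t) -> i = j).
Proof.
move=> [zq v0 cv vd WE]; have q0 := prim_order_gt0 zq.
have cr i := @cvgt_rot _ _ T2 (z ^+ i) v cv.
have hr (i : nat) := @near_evt_rot _ _ T2 (z ^+ i) v cv.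
split.
  have cX := @cvgt_X _ _ T2; have cY := @cvgt_Y _ _ T2.
  have cW : cvgt W by apply: (@branch_cW _ _ _ W (tX ^+ q) v); left; exists q, z.
  have h1 := near0_subst (cvgt_exp q cX) cY (@low_Xn _ _ T2 q q0) (@low_Y _ _ T2) cW.
  rewrite WE in h1.
  have h2 : near0 (fun p : C * C => ev (vX ^+ q : T2) p = p.1 ^+ q).
    have := near_near0 (near_evtX q (@cv1_tX _ _ T2)).
    rewrite /vX -rmorphXn => k2; apply: near0W (near0I (near0_evtX (cv1_exp q (@cv1_tX _ _ T2))) k2).
    by move=> p [-> ->]; rewrite evt_tX.
  have h3 := @near0_evprod _ _ T2 _ (index_enum 'I_q) (fun i => vY - tconst (rot (z ^+ i) v))
    (fun i _ => cvgtB cY (cr i)).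
  have h4 : near0 (fun p : C * C => forall i, i \in index_enum 'I_q ->
      ev (vY - tconst (rot (z ^+ i) v) : T2) p = p.2 - evt T2 v (z ^+ i * p.1)).
    apply: near0_all => i _.
    apply: near0W (near0I (near0_evB cY (cr i)) (near0I (near0_evtX (cr i)) (near_near0 (hr i)))).
    by move=> p [-> [-> ->]]; rewrite ev_Y.
  apply: near0W (near0I h1 (near0I h2 (near0I h3 h4))) => p [e1 [e2 [e3 e4]]].
  rewrite -e2 -[X in ev W (_, X)](ev_Y T2 p) -e1 e3; apply: eq_bigr => i _; apply: e4; exact: mem_index_enum.
have key (i j : nat) : near (fun t => t <> 0 -> (i < q)%N -> (j < q)%N ->
    evt T2 v (z ^+ i * t) = evt T2 v (z ^+ j * t) -> i = j).
  have [ij|ij] := pselect ((i < q)%N /\ (j < q)%N /\ i <> j); last first.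
    by exists 1 => // t _ _ iq jq _; apply: contrapT => ne; exact: ij.
  have [iq [jq ne]] := ij.
  have d0 : rot (z ^+ i) v - rot (z ^+ j) v <> 0.
    move=> /eqP; rewrite subr_eq0 => /eqP e; apply: ne.
    exact: (conj_inj zq vd iq jq e).
  have := near_evt_neq0 (cv1_sub (cr i) (cr j)) d0.
  move=> h; apply: nearW (nearI h (nearI (near_evtB (cr i) (cr j)) (nearI (hr i) (hr j)))).
  by move=> t [k [e [e1 e2]]] t0 _ _ e3; case: (k t0); rewrite e e1 e2 e3 subrr.
have := near_all (s := [seq (i, j) | i <- iota 0 q, j <- iota 0 q])
  (A := fun ij t => t <> 0 -> (ij.1 < q)%N -> (ij.2 < q)%N ->
    evt T2 v (z ^+ ij.1 * t) = evt T2 v (z ^+ ij.2 * t) -> ij.1 = ij.2) (fun ij _ => key ij.1 ij.2).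
apply: nearW => t h t0 i j iq jq e; apply: (h (i, j)) => //.
by apply/allpairsP; exists (i, j); rewrite !mem_iota.
Qed.

(** Lifting of curves is a clause of its own because the inverse of [gam b] is in general not given
    by a convergent series in x and y. *)
Definition chart b (r r' : R) := [/\
  forall t t', normc t < r -> normc t' < r -> gam b t = gam b t' -> t = t',
  forall p, normc p.1 < r' -> normc p.2 < r' -> ev b.1 p = 0 -> exists t, normc t < r /\ gam b t = p &
  forall c1 c2 c1' c2' : R -> C, (forall s, cdiff c1 s (c1' s)) -> (forall s, cdiff c2 s (c2' s)) ->
    ccont c1' -> ccont c2' ->
    (forall s, [/\ normc (c1 s) < r', normc (c2 s) < r', ev b.1 (c1 s, c2 s) = 0 & (c1 s, c2 s) <> (0, 0)]) ->
    exists T T', (forall s, [/\ normc (T s) < r, T s <> 0, gam b (T s) = (c1 s, c2 s) & cdiff T s (T' s)]) /\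
      ccont T'].

Lemma exists_root q c : (0 < q)%N -> exists t, t ^+ q = c.
Proof. by move=> q0; exists (q.-root c); rewrite rootCK. Qed.

Lemma chart_vertical b r : 0 < r -> [/\ b.2.1 = 0, b.2.2 = tX & b.1 = vX] -> chart b r r.
Proof.
move=> r0 [u v W]; have g t : gam b t = (0, t) by rewrite /gam u v evt0 evt_tX.
split=> [t t' _ _|p p1 p2|c1 c2 c1' c2' d1 d2 k1 k2 h].
- by rewrite !g => -[].
- by rewrite W ev_X => e; exists p.2; rewrite g -e; split=> //; case: (p).
exists c2, c2'; split=> // s; have [a1 a2] := h s.
rewrite W ev_X g /= => e ne; split=> //; last by rewrite e.
by move=> e2; apply: ne; rewrite e e2.
Qed.

Lemma chart_puiseux b q z : b.2.1 = tX ^+ q -> puiseux_branch q z b.2.2 b.1 ->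
  exists2 r0 : R, 0 < r0 & forall r, 0 < r < r0 -> exists2 r' : R, 0 < r' & chart b r r'.
Proof.
move=> uE pb; have [hW hd] := puiseux_values pb; have [zq v0 cv _ _] := pb.
have q0 := prim_order_gt0 zq; have nz := normc_prim zq.
have nzi (i : nat) : normc (z ^+ i) <= 1 by rewrite normcX nz expr1n.
have hX := near_evtX q (@cv1_tX _ _ T2).
have hh : near (fun t => forall i, i \in iota 0 q.+1 ->
    holo (evt T2 b.2.2) (z ^+ i * t) (evt T2 (tderiv b.2.2) (z ^+ i * t))).
  by apply: near_all => i _; exact: (near_rot (nzi i) (near_holo cv)).
have ev0' : evt T2 b.2.2 0 = 0.
  by rewrite /evt; apply: normc_eq0; apply/eqP; rewrite eq_le normc_ge0 andbT; apply/ler_addgt0Pl => e e0;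
     rewrite addr0; apply: ltW; exact: (near_gt0 (near_evt_small cv v0 e0)).
have [ra ra0 HW] := hW; have [rb rb0 H] := nearI hd (nearI hX hh).
exists (Num.min ra rb); first by rewrite lt_min ra0.
move=> r /andP[r0]; rewrite lt_min => /andP[rra rrb].
have HX t : normc t < r -> evt T2 (tX ^+ q) t = t ^+ q.
  by move=> tr; have [_ [-> _]] := H t (lt_trans tr rrb); rewrite evt_tX.
have gE t : normc t < r -> gam b t = (t ^+ q, evt T2 b.2.2 t) by move=> tr; rewrite /gam uE HX.
exists (Num.min (r ^+ q) ra); first by rewrite lt_min exprn_gt0.
have root_lt t p : t ^+ q = p -> normc p < r ^+ q -> normc t < r.
  by move=> <-; rewrite normcX ltr_pXn2r ?nnegrE ?normc_ge0 // ltW.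
have zt (i : nat) t : normc (z ^+ i * t) = normc t by rewrite ncM normcX nz expr1n mul1r.
split=> [t t' tr tr'|p|c1 c2 c1' c2' d1 d2 k1 k2 h].
- rewrite !gE // => -[eq ev].
  have [t0|t0] := pselect (t = 0).
    move: eq; rewrite t0 expr0n gtn_eqF // => /esym/eqP; rewrite expf_eq0 q0 => /eqP ->.
    by [].
  have : (t' / t) ^+ q = 1 by rewrite expr_div_n -eq divff // expf_neq0 //; exact/eqP.
  move/(prim_rootP zq) => [i ie].
  have t'E : t' = z ^+ i * t by rewrite -ie divfK //; exact/eqP.
  have [D _] := H t (lt_trans tr rrb).
  have := D t0 i 0%N (ltn_ord i) q0; rewrite expr0 mul1r -t'E ev => /(_ erefl) i0.
  by rewrite t'E i0 expr0 mul1r.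
- rewrite !lt_min => /andP[p1 p1'] /andP[_ p2] e.
  have [t te] := exists_root p.1 q0; have tr := root_lt _ _ te p1.
  have := HW (t, p.2) (lt_trans tr rra) p2; rewrite /= te -surjective_pairing e.
  move/esym/eqP/prodf_eq0 => [i _]; rewrite subr_eq0 => /eqP pe.
  exists (z ^+ i * t); rewrite zt; split=> //; rewrite gE ?zt // -pe exprMn te.
  by rewrite exprAC (prim_expr_order zq) expr1n mul1r -surjective_pairing.
(* On this branch x = 0 forces y = 0, which the curve avoids. *)
have cn s : c1 s <> 0.
  have [_ ] := h s; rewrite lt_min => /andP[_ a] e ne z0; apply: ne; rewrite z0 in e *.
  have := HW (0, c2 s); rewrite /= nc0 expr0n gtn_eqF // e => /(_ ra0 a) /esym/eqP/prodf_eq0[i _].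
  rewrite mulr0 ev0' subr0 => /eqP ->.
  by [].
have [t0 [t0r t0g]] : exists t, normc t < r /\ t ^+ q = c1 0 /\ c2 0 = evt T2 b.2.2 t.
  have [a1 a2 e _] := h 0; move: a1 a2; rewrite !lt_min => /andP[p1 p1'] /andP[_ p2].
  have [t te] := exists_root (c1 0) q0; have tr := root_lt _ _ te p1.
  have := HW (t, c2 0) (lt_trans tr rra) p2; rewrite /= te e.
  move/esym/eqP/prodf_eq0 => [i _]; rewrite subr_eq0 => /eqP pe.
  exists (z ^+ i * t); rewrite zt; split=> //; split=> //.
  by rewrite exprMn te exprAC (prim_expr_order zq) expr1n mul1r.
have [t0q t0v] := t0g; have qn : q%:R != 0 :> C by rewrite pnatr_eq0 -lt0n.
(* If T^q = c1, then T' / T = c1' / (q c1). Exponentiating a primitive of the right side follows one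
   q-th root of c1 continuously. *)
pose sg s := c1' s / (q%:R * c1 s).
have csg : ccont sg.
  apply: ccont_mul => //; apply: ccont_inv.
    by move=> s /eqP; rewrite mulf_eq0 (negPf qn) => /eqP; exact: cn.
  by apply: ccont_mul; [exact: ccont_cst | exact: cdiff_ccont d1].
have [A dA] := primitive csg.
pose T s := t0 * cexp (A s - A 0).
have dT s : cdiff T s (sg s * T s).
  have := cdiff_scale t0 (cdiff_cexp (cdiff_sub (dA s) (cdiff_cst (A 0) s))).
  by rewrite subr0 mulrCA.
have Tq s : T s ^+ q = c1 s.
  have dD x : cdiff (fun s => T s ^+ q / c1 s) x 0.
    have := cdiff_div (@cn x) (cdiff_exp q.-1 (dT x)) (d1 x); rewrite prednK //.
    have -> : q%:R * T x ^+ q.-1 * (sg x * T x) / c1 x + T x ^+ q * (c1' x * - (c1 x)^-1 ^+ 2) = 0.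
      have -> : q%:R * T x ^+ q.-1 * (sg x * T x) = q%:R * sg x * T x ^+ q.
        rewrite -[X in _ = _ * T x ^+ X](prednK q0) exprSr.
        by move: (T x) (T x ^+ _) => a b'; ring.
      rewrite /sg; have c0 : c1 x != 0 by exact/eqP.
      by move: (T x ^+ q) => a; field; rewrite c0 qn.
    by [].
  have := cdiff0_cst dD s 0; rewrite {2}/T subrr cexp0 mulr1 t0q divff; last exact/eqP.
  by move/(congr1 (fun x => x * c1 s)); rewrite divfK ?mul1r //; exact/eqP.
have Tr s : normc (T s) < r.
  have [a1 _ _ _] := h s; move: a1; rewrite lt_min => /andP[a _]; exact: root_lt (Tq s) a.
have T0 s : T s <> 0.
  by move=> e; apply: (@cn s); rewrite -Tq e expr0n gtn_eqF.
have Tv s : c2 s = evt T2 b.2.2 (T s).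
  pose F (i : 'I_q) s := c2 s - evt T2 b.2.2 (z ^+ i * T s).
  have FF : forall x, F (Ordinal q0) x = 0.
    apply: (@continuous_choice _ _ F _ _ _ 0).
    - move=> i; pose F' s := c2' s - z ^+ i * (sg s * T s) * evt T2 (tderiv b.2.2) (z ^+ i * T s).
      apply: (@cdiff_ccont _ _ F') => x; apply: cdiff_sub (d2 x) _.
      apply: (@cdiff_comp _ (evt T2 b.2.2) (fun x => z ^+ i * T x)); first exact: cdiff_scale.
      have [_ [_ hi]] := H (T x) (lt_trans (Tr x) rrb); apply: hi.
      by rewrite mem_iota /= ltnS ltnW.
    - move=> x; have [_ a e _] := h x; move: a; rewrite lt_min => /andP[_ a].
      have := HW (T x, c2 x) (lt_trans (Tr x) rra) a; rewrite /= Tq e.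
      by move/esym/eqP/prodf_eq0 => [i _ /eqP ie]; exists i.
    - move=> x i j /eqP; rewrite subr_eq0 => /eqP e1 /eqP; rewrite subr_eq0 => /eqP e2.
      have [D _] := H (T x) (lt_trans (Tr x) rrb).
      apply/val_inj; exact: (D (T0 x) i j (ltn_ord i) (ltn_ord j) (etrans (esym e1) e2)).
    - by rewrite /F /= expr0 mul1r /T subrr cexp0 mulr1 t0v subrr.
  by have := FF s; rewrite /F /= expr0 mul1r => /eqP; rewrite subr_eq0 => /eqP.
exists T, (fun s => sg s * T s); split.
  by move=> s; split => //; rewrite gE // Tq Tv.
by apply: ccont_mul => //; exact: cdiff_ccont dT.
Qed.

Lemma chart_exists b : isbr b ->
  exists2 r0 : R, 0 < r0 & forall r, 0 < r < r0 -> exists2 r' : R, 0 < r' & chart b r r'.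
Proof.
move=> [[q [z [uE pb]]]|vb]; first exact: chart_puiseux pb.
by exists 1 => // r /andP[r0 _]; exists r => //; exact: chart_vertical.
Qed.
End Charts.

(** * Closed curves on a branch *)

Section ClosedCurves.
Variables (R : realType) (T1 : fps_theory R[i]) (T2 : fps_theory T1).
Local Notation C := R[i].
Local Notation normc := (@ComplexField.Normc.normc R).
Local Notation cv1 u := (cvgt (tconst u : T2)).
Implicit Types (u v w : T1) (f g k : T2) (t : C) (b : br T2) (x y s : R).

Lemma C1_cdiff (w : R -> C) : C1_complex w -> (forall s, cdiff w s (cderive w s)) /\ ccont (cderive w).
Proof.
move=> [[d1 c1] [d2 c2]]; split.
  by move=> s; apply/cdiffP; split; rewrite /= derive1E; apply: DeriveDef.
exact: (@ccontP _ (cderive w) c1 c2).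
Qed.

Lemma cdiff_C1 (w w' : R -> C) : (forall s, cdiff w s (w' s)) -> ccont w' -> C1_complex w.
Proof.
move=> d c; have E (p : C -> R) : (forall s, is_derive s (1 : R) (fun x => p (w x)) (p (w' s))) ->
    continuous (fun x => p (w' x)) -> C1_real (fun x => p (w x)).
  move=> pd pc; split=> s; first by have [] := pd s.
  rewrite (_ : derive1 _ = fun x => p (w' x)); first exact: pc.
  by apply/funext => x; rewrite derive1E; have [] := pd x.
split; apply: E.
- by move=> s; have /cdiffP[] := d s.
- exact: ccont_Re.
- by move=> s; have /cdiffP[] := d s.
- exact: ccont_Im.
Qed.

Lemma rdiff_normsq (w : R -> C) x (c : C) : cdiff w x c ->
  rdiff (fun x => normc (w x) ^+ 2) x (2 * complex.Re (c * conjc (w x))).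
Proof.
move=> /cdiffP[h1 h2]; apply/rdiffP.
have := is_deriveD (is_deriveM h1 h1) (is_deriveM h2 h2).
rewrite (_ : (fun x => normc (w x) ^+ 2) =
   (fun x => complex.Re (w x)) * (fun x => complex.Re (w x)) + (fun x => complex.Im (w x)) * (fun x => complex.Im (w x))).
  move=> h; apply: is_derive_eq h _; rewrite /GRing.scale /=.
  by case: (w x) (c) => ? ? [? ?] /=; ring.
by apply/funext => y; rewrite normc_sq !expr2.
Qed.

Lemma rdiff_lt (p p' : R -> R) x y : x < y -> (forall z, x <= z <= y -> rdiff p z (p' z)) ->
  (forall z, x <= z <= y -> 0 < p' z) -> p x < p y.
Proof.
move=> xy pd p0.
have pd' z : z \in `]x, y[%R -> is_derive z (1 : R) p (p' z).
  by rewrite in_itv => /andP[/ltW a /ltW b']; apply/rdiffP/pd; rewrite a.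
have pc : {within `[x, y]%classic, continuous p}%classic.
  apply: derivable_within_continuous => z; rewrite in_itv => h.
  by have /rdiffP[] := pd z h.
have [z] := MVT xy pd' pc; rewrite in_itv => /andP[/ltW a /ltW b'] h.
by rewrite -subr_gt0 h mulr_gt0 ?p0 ?a // subr_gt0.
Qed.

Definition dform b t : C := evt T2 (tderiv b.2.1) t * conjc (evt T2 b.2.1 t) +
  evt T2 (tderiv b.2.2) t * conjc (evt T2 b.2.2 t).

Definition hgood b t := [/\ holo (evt T2 b.2.1) t (evt T2 (tderiv b.2.1) t),
  holo (evt T2 b.2.2) t (evt T2 (tderiv b.2.2) t), t <> 0 -> 0 < complex.Re (bform b t) &
  ev b.1 (gam b t) = 0].

Lemma near_hgood b : isbr b -> near (hgood b).
Proof.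
move=> bb; have h1 := near_holo (branch_cu bb); have h2 := near_holo (branch_cv bb).
have h3 := near_evt_pull (branch_cu bb) (branch_cv bb) (branch_u0 bb) (branch_v0 bb) (branch_cW bb).
apply: nearW (nearI h1 (nearI h2 (nearI (near_bform bb) h3))) => t [? [? [? e]]]; split=> //.
by rewrite /gam -e (branch_vanish bb) evt0.
Qed.

Lemma rho_path b (T : R -> C) x (c : C) : hgood b (T x) -> cdiff T x c ->
  rdiff (fun x => rho b (T x)) x (2 * complex.Re (c * dform b (T x))).
Proof.
move=> [h1 h2 _ _] d.
have e1 := rdiff_normsq (cdiff_comp d h1); have e2 := rdiff_normsq (cdiff_comp d h2).
apply/rdiffP; apply: is_derive_eq (is_deriveD (iffLR (rdiffP _ _ _) e1) (iffLR (rdiffP _ _ _) e2)) _.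
by rewrite -mulrDr -ReD /dform mulrDr !mulrA.
Qed.

Definition rexp x : C := cexp x%:C%C.

Lemma normc_rexp x : normc (rexp x) = expR x. Proof. exact: normc_cexp. Qed.

Lemma ray_lt b (r : R) t x y : (forall t, normc t < r -> hgood b t) -> t <> 0 -> x < y ->
  normc (t * rexp y) < r -> rho b (t * rexp x) < rho b (t * rexp y).
Proof.
move=> H t0 xy ty; have tz z : x <= z <= y -> normc (t * rexp z) < r.
  move=> /andP[_ zy]; apply: le_lt_trans ty; rewrite !ncM !normc_rexp ler_wpM2l ?normc_ge0 //.
  by rewrite ler_expR.
have d z : cdiff (fun x => t * rexp x) z (1 * (t * rexp z)).
  have := cdiff_scale t (cdiff_cexp (cdiff_id z)); by rewrite mul1r mulrCA mul1r.
apply: (rdiff_lt (p := fun x => rho b (t * rexp x)) (p' := fun z => 2 * complex.Re (bform b (t * rexp z)))) => // z zz.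
  by have := rho_path (H _ (tz z zz)) (d z); rewrite mul1r.
have [_ _ h _] := H _ (tz z zz); rewrite mulr_gt0 // h // => /eqP.
by rewrite mulf_eq0 => /orP[/eqP //|/eqP]; exact: cexp_neq0.
Qed.

Lemma ray_inj b (r : R) t x : (forall t, normc t < r -> hgood b t) -> t <> 0 ->
  normc t < r -> normc (t * rexp x) < r -> rho b t = rho b (t * rexp x) -> t * rexp x = t.
Proof.
move=> H t0 tr txr e; have e0 : t * rexp 0 = t by rewrite /rexp rmorph0 cexp0 mulr1.
have [x0|x0|->//] := ltgtP x 0.
  have := ray_lt H t0 x0; rewrite e0 => /(_ tr); by rewrite e ltxx.
by have := ray_lt H t0 x0 txr; rewrite e0 e ltxx.
Qed.

Lemma link_lift b (r r' eps : R) (c : R -> C * C) :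
  (forall t, normc t < r -> hgood b t) -> chart b r r' -> 0 < eps < r' ->
  C1_complex (fun s => (c s).1) -> C1_complex (fun s => (c s).2) ->
  c (0 + 1) = c 0 -> (forall s s', 0 <= s < 1 -> 0 <= s' < 1 -> c s = c s' -> s = s') ->
  (forall s, normc (c s).1 ^+ 2 + normc (c s).2 ^+ 2 = eps ^+ 2) ->
  (forall s, ev b.1 (c s) = 0) ->
  (forall s, 0 < complex.Im (cderive (fun y => (c y).1) s * conjc (c s).1 +
                             cderive (fun y => (c y).2) s * conjc (c s).2)) ->
  exists T T' A : R -> C, [/\ forall s, [/\ normc (T s) < r, T s <> 0 & gam b (T s) = c s],
    forall s, cdiff T s (T' s), ccont T', (forall s, cdiff A s (T' s / T s)) &
    [/\ A 1 - A 0 = (0 +i* (2 * pi))%C, T 1 = T 0 &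
      forall t, normc t < r -> t <> 0 -> rho b t = eps ^+ 2 -> exists2 s, 0 <= s < 1 & T s = t]].
Proof.
move=> H [inj onto lift] /andP[eps0 epsr] c1 c2 per cinj sph zero ori.
have [d1 k1] := C1_cdiff c1; have [d2 k2] := C1_cdiff c2.
have le1 p : normc p.1 ^+ 2 + normc p.2 ^+ 2 = eps ^+ 2 -> normc p.1 < r' /\ normc p.2 < r'.
  have en := ltW eps0.
  move=> e; split; apply: le_lt_trans epsr; rewrite -ler_sqr ?nnegrE ?normc_ge0 // -e.
    by rewrite lerDl exprn_ge0 // normc_ge0.
  by rewrite lerDr exprn_ge0 // normc_ge0.
have [|T [T' [hT cT']]] := lift _ _ _ _ d1 d2 k1 k2.
  move=> s; have [a1 a2] := le1 _ (sph s); split=> //; first by rewrite -surjective_pairing.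
  rewrite -surjective_pairing => e; have := sph s; rewrite e /= nc0 expr0n addr0 => /esym/eqP.
  by rewrite expf_eq0 /= gt_eqF.
have Tr s : normc (T s) < r by have [] := hT s.
have T0 s : T s <> 0 by have [] := hT s.
have Tg s : gam b (T s) = c s by have [_ _ -> _] := hT s; rewrite -surjective_pairing.
have dT s : cdiff T s (T' s) by have [] := hT s.
have Trho s : rho b (T s) = eps ^+ 2 by rewrite /rho Tg.
pose tau s := T' s / T s.
have ctau : ccont tau by apply: ccont_mul => //; apply: ccont_inv => //; exact: cdiff_ccont dT.
have [A dA] := primitive ctau.
(* Both sides have logarithmic derivative tau; A is thus a continuous logarithm of T up to a
   constant. *)
have TA s : T s = T 0 * cexp (A s - A 0).
  have dE x : cdiff (fun x => cexp (A x - A 0)) x (tau x * cexp (A x - A 0)).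
    by have := cdiff_cexp (cdiff_sub (dA x) (cdiff_cst (A 0) x)); rewrite subr0.
  have dD x : cdiff (fun s => T s / cexp (A s - A 0)) x 0.
    have := cdiff_div (@cexp_neq0 _ _) (dT x) (dE x).
    have -> : T' x / cexp (A x - A 0) + T x * (tau x * cexp (A x - A 0) * - (cexp (A x - A 0))^-1 ^+ 2) = 0.
      rewrite /tau; have c0 : cexp (A x - A 0) != 0 by apply/eqP; exact: cexp_neq0.
      have t0 : T x != 0 by exact/eqP.
      by move: (cexp _) c0 (T x) t0 => a a0 t t0; field; rewrite a0 t0.
    by [].
  have := cdiff0_cst dD s 0; rewrite subrr cexp0 divr1 => /(congr1 (fun z : C => z * cexp (A s - A 0))).
  by rewrite divfK //; apply/eqP; exact: cexp_neq0.
pose al s := complex.Im (A s - A 0).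
have dal s : rdiff al s (complex.Im (tau s)).
  by have /cdiff_ReIm[_] := cdiff_sub (dA s) (cdiff_cst (A 0) s); rewrite subr0.
(* Let B be [bform b (T s)]. Since rho is constant along the curve, Re (tau B) = 0, and the
   orientation says Im (tau B) > 0. As Re B > 0, it follows that Im tau > 0, so the argument [al]
   increases. *)
have tau0 s : 0 < complex.Im (tau s).
  have [h1 h2 hB _] := H _ (Tr s); have := hB (T0 s).
  have e1 : cderive (fun y => (c y).1) s = T' s * evt T2 (tderiv b.2.1) (T s).
    apply: cdiff_cderive; apply: (@cdiff_ext _ (fun y => evt T2 b.2.1 (T y)) _ _ _ (fun y => congr1 fst (Tg y))).
    exact: (cdiff_comp (dT s) h1).
  have e2 : cderive (fun y => (c y).2) s = T' s * evt T2 (tderiv b.2.2) (T s).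
    apply: cdiff_cderive; apply: (@cdiff_ext _ (fun y => evt T2 b.2.2 (T y)) _ _ _ (fun y => congr1 snd (Tg y))).
    exact: (cdiff_comp (dT s) h2).
  have := ori s; rewrite e1 e2 -Tg /= -!mulrA -mulrDr -/(dform b (T s)).
  have dr := rho_path (H _ (Tr s)) (dT s).
  have dr0 : rdiff (fun x => rho b (T x)) s 0.
    by move=> e e0; exists 1 => // h _; rewrite !Trho subrr mulr0 subr0 normr0 mulr_ge0 // ltW.
  have r0 : complex.Re (T' s * dform b (T s)) = 0.
    have /rdiffP[_ k] := dr; have /rdiffP[_ k'] := dr0; move: k; rewrite k' => /esym/eqP.
    by rewrite mulf_eq0 pnatr_eq0 /= => /eqP.
  move: r0; have -> : T' s * dform b (T s) = tau s * bform b (T s).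
    by rewrite /tau /bform -/(dform b (T s)) mulrA divfK //; exact/eqP.
  case: (tau s) (bform b (T s)) => p q [X Y] /= z0 i0 X0.
  have : 0 < q * (X ^+ 2 + Y ^+ 2).
    have -> : q * (X ^+ 2 + Y ^+ 2) = X * (p * Y + q * X) - Y * (p * X - q * Y) by ring.
    by rewrite z0 mulr0 subr0 mulr_gt0.
  by rewrite pmulr_lgt0 // ltr_pwDl ?exprn_gt0 // sqr_ge0.
have al_lt x y : x < y -> al x < al y by exact: (rdiff_increasing dal tau0).
have al0 : al 0 = 0 by rewrite /al subrr.
have T10 : T 1 = T 0 by apply: inj => //; rewrite !Tg -[1]add0r.
have real s (p : R) : T s = T 0 * rexp p -> T s = T 0.
  by move=> e; rewrite e; apply: (ray_inj H) => //; rewrite -?e // !Trho.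
have ivt (v : R) : 0 <= v <= al 1 -> exists2 s, 0 <= s <= 1 & al s = v.
  move=> /andP[v0 v1]; have [|s] := @IVT _ al 0 1 v ler01 (continuous_subspaceT (rdiff_continuous dal)).
    have a1 : 0 < al 1 by rewrite -al0 al_lt.
    by rewrite al0 minElt maxElt a1 v0 v1.
  by rewrite in_itv => h e; exists s.
have pi0 := pi_gt0 R.
have A1 : cexp (A 1 - A 0) = 1.
  by have := TA 1; rewrite T10 -{1}[T 0]mulr1 => /mulfI ->//; exact/eqP.
have Re1 : complex.Re (A 1 - A 0) = 0.
  by have := normc_cexp (A 1 - A 0); rewrite A1 nc1 -expR0 => /expR_inj.
have AE s : A s - A 0 = ((complex.Re (A s - A 0)) +i* al s)%C by rewrite /al; case: (A s - A 0).
have AE1 : A 1 - A 0 = (0 +i* al 1)%C by rewrite AE Re1.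
(* The curve closes up, so [al 1] is at least 2 pi. If it were larger, the curve would be back on
   its initial ray at some s with 0 < s < 1; [rho] being injective on rays, it would be at its
   initial point, against injectivity. *)
have al1 : al 1 = 2 * pi.
  have a1 : 0 < al 1 by rewrite -al0 al_lt.
  apply/eqP; rewrite eq_le; apply/andP; split; last first.
    rewrite leNgt; apply/negP => lt; have := @cexp_eq1 _ (al 1); rewrite (ltW a1) lt => /(_ isT).
    by rewrite -AE1 A1 => /(_ erefl) e; rewrite e ltxx in a1.
  rewrite leNgt; apply/negP => lt; have [|s /andP[s0 s1] se] := ivt (2 * pi).
    by rewrite (ltW lt) mulr_ge0 // ltW.
  have s1' : s < 1 by rewrite lt_def s1 andbT; apply/eqP => e; move: lt; rewrite -se -e ltxx.
  have Ts : T s = T 0.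
    apply: (real s (complex.Re (A s - A 0))); rewrite TA; congr (_ * _).
    rewrite [in LHS]AE se /rexp /cexp /= mulr_natl -[pi *+ 2]add0r cosD2pi sinD2pi.
    by rewrite cos0 sin0.
  have : s = 0 by apply: cinj; rewrite ?lexx ?s0 ?ltr01 // -!Tg Ts.
  by move=> e; move: se; rewrite e al0 => /esym/eqP; rewrite mulf_eq0 pnatr_eq0 /= gt_eqF.
exists T, T', A; split=> //; split=> //; first by rewrite AE Re1 al1.
move=> t tr t0 trho.
(* The argument of t / T 0 is a value of [al], so T s lies on the ray of t for some s; the equality
   of [rho] then gives T s = t. *)
have tT : t / T 0 <> 0 by move/eqP; rewrite mulf_eq0 invr_eq0 => /orP[] /eqP //; exact: T0.
have [p [x [/andP[x0 x2] xe]]] := cexp_surj tT.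
have [|s /andP[s0 s1] se] := ivt x; first by rewrite x0 al1 ltW.
have Tt : T s = t.
  have tE : t = T 0 * cexp (p +i* x)%C by rewrite -xe mulrC divfK //; exact/eqP.
  have TE : T s = t * rexp (complex.Re (A s - A 0) - p).
    rewrite tE TA -mulrA; congr (_ * _); rewrite /rexp -cexpD [in LHS]AE se.
    by congr cexp; apply/eqP; rewrite eq_complex /= addr0 subrKC !eqxx.
  by rewrite TE; apply: (ray_inj H) => //; rewrite -?TE // Trho.
have [e|ne] := eqVneq s 1; first by exists 0; [rewrite lexx ltr01 | rewrite -T10 -e].
by exists s => //; rewrite s0 lt_def eq_sym ne.
Qed.
End ClosedCurves.

(** * The index integral over a link *)

Section LinkIntegral.
Variables (R : realType) (T1 : fps_theory R[i]) (T2 : fps_theory T1).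
Local Notation C := R[i].
Local Notation normc := (@ComplexField.Normc.normc R).
Local Notation cv1 u := (cvgt (tconst u : T2)).
Implicit Types (u v w l : T1) (f g k : T2) (t : C) (b : br T2) (x y : R).

Definition ev_integral g k (c : R -> C * C) : C :=
  cintegral01 (fun s => ev g (c s) / ev k (c s) *
    cderive (fun y => ev k (c y) / ev g (c y)) s).

Definition lgood b f l t := [/\ t <> 0 -> evt T2 (pullb b f) t <> 0,
  ev f (gam b t) = evt T2 (pullb b f) t,
  holo (evt T2 (pullb b f)) t (evt T2 (tderiv (pullb b f)) t),
  t * evt T2 (tderiv (pullb b f)) t = evt T2 (pullb b f) t * ((ord (pullb b f))%:R + t * evt T2 (tderiv l) t) &
  holo (evt T2 l) t (evt T2 (tderiv l) t) /\ holo (evt T2 (tderiv l)) t (evt T2 (tderiv (tderiv l)) t)].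

Lemma cv1_pullb b f : isbr b -> cvgt f -> cv1 (pullb b f).
Proof.
move=> bb cf; rewrite -subst_pull ?(branch_u0 bb) ?(branch_v0 bb) //.
exact: (cvgt_subst (branch_cu bb) (branch_cv bb) (@low_tconst _ _ T2 _ (branch_u0 bb))
  (@low_tconst _ _ T2 _ (branch_v0 bb)) cf).
Qed.

Lemma near_lgood b f : isbr b -> cvgt f -> pullb b f <> 0 -> exists l, near (lgood b f l).
Proof.
move=> bb cf f0; have cF := cv1_pullb bb cf.
have [l [w [cl _ _ _ wE]]] := has_ord_log cF (ordP f0); exists l.
have cl' := cv1_tderiv cl; have cX := @cv1_tX _ _ T2.
have h1 := near_evt_neq0 cF f0.
have h2 := near_evt_pull (branch_cu bb) (branch_cv bb) (branch_u0 bb) (branch_v0 bb) cf.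
have h3 := near_holo cF.
have cn := @cv1_const _ _ T2 (ord (pullb b f))%:R.
have h4 := nearI (near_evtM cX (cv1_tderiv cF)) (nearI (near_evtM cF (cv1_add cn (cv1_mul cX cl')))
  (nearI (near_evtD cn (cv1_mul cX cl')) (near_evtM cX cl'))).
apply: nearW (nearI h1 (nearI h2 (nearI h3 (nearI h4 (nearI (near_holo cl) (near_holo cl')))))).
move=> t [e1 [e2 [e3 [[a1 [a2 [a3 a4]]] [e5 e6]]]]]; split=> //.
by rewrite -{1}(evt_tX T2 t) -a1 wE a2 a3 a4 evt_const evt_tX.
Qed.

(** By the logarithmic derivatives of g and k, the integrand is (ord k - ord g) T' / T plus the
    derivative of lk - lg along T. The second part integrates to 0, as T is closed. *)
Lemma branch_integral b g k lg lk (T T' A : R -> C) (c : R -> C * C) :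
  (forall s, [/\ T s <> 0, gam b (T s) = c s, lgood b g lg (T s) & lgood b k lk (T s)]) ->
  (forall s, cdiff T s (T' s)) -> ccont T' -> (forall s, cdiff A s (T' s / T s)) -> T 1 = T 0 ->
  ev_integral g k c = ((ord (pullb b k))%:R - (ord (pullb b g))%:R) * (A 1 - A 0).
Proof.
move=> H dT cT' dA T10.
pose m : C := (ord (pullb b k))%:R - (ord (pullb b g))%:R.
pose W s := m * A s + (evt T2 lk (T s) - evt T2 lg (T s)).
pose W' s := m * (T' s / T s) + (T' s * evt T2 (tderiv lk) (T s) - T' s * evt T2 (tderiv lg) (T s)).
have dW s : cdiff W s (W' s).
  have [_ _ [_ _ _ _ [hg _]] [_ _ _ _ [hk _]]] := H s.
  by apply: cdiff_add; [exact: cdiff_scale | apply: cdiff_sub; exact: cdiff_comp].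
have ccT : ccont T by exact: cdiff_ccont dT.
have ccN a : ccont a -> ccont (fun s => - a s).
  by move=> ca x e e0; have [d d0 hd] := ca x e e0; exists d => // h /hd; rewrite -opprD normcN.
have cW : ccont W'.
  apply: ccont_add.
    apply: ccont_mul; first exact: ccont_cst.
    apply: ccont_mul => //; apply: ccont_inv => // s; by have [] := H s.
  apply: ccont_add; last apply: ccN.
    apply: ccont_mul => //; apply: (@cdiff_ccont _ _ (fun s => T' s * evt T2 (tderiv (tderiv lk)) (T s))) => s.
    by have [_ _ _ [_ _ _ _ [_ hk]]] := H s; exact: cdiff_comp.
  apply: ccont_mul => //; apply: (@cdiff_ccont _ _ (fun s => T' s * evt T2 (tderiv (tderiv lg)) (T s))) => s.
  by have [_ _ [_ _ _ _ [_ hg]] _] := H s; exact: cdiff_comp.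
rewrite /ev_integral.
rewrite (_ : (fun s => _) = W'); last first.
  apply/funext => s; have [T0 gc [g0 ge hg lge _] [k0 ke hk lke _]] := H s.
  rewrite -gc ge ke; move: (g0 T0) (k0 T0) => {}g0 {}k0.
  have e y : evt T2 (pullb b k) (T y) / evt T2 (pullb b g) (T y) = ev k (c y) / ev g (c y).
    by have [_ <- [_ -> _ _ _] [_ -> _ _ _]] := H y.
  rewrite (cdiff_cderive (cdiff_ext e (cdiff_div g0 (cdiff_comp (dT s) hk) (cdiff_comp (dT s) hg)))).
  rewrite /W' /m; move: (evt T2 (pullb b k) (T s)) (evt T2 (pullb b g) (T s)) k0 g0 lke lge => K G /eqP K0 /eqP G0.
  move: (evt T2 (tderiv (pullb b k)) (T s)) (evt T2 (tderiv (pullb b g)) (T s)) => K' G'.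
  move: (evt T2 (tderiv lk) (T s)) (evt T2 (tderiv lg) (T s)) (T' s) => a a' d.
  move/eqP: T0; move: (T s) => t t0 ek eg.
  have -> : K' = K * ((ord (pullb b k))%:R + t * a) / t by rewrite -ek mulrC mulKf.
  have -> : G' = G * ((ord (pullb b g))%:R + t * a') / t by rewrite -eg mulrC mulKf.
  by move: (_%:R) (_%:R) => p q; field; rewrite K0 G0 t0.
by rewrite (cintegral01E dW cW) /W T10; move: (evt T2 lk _) (evt T2 lg _) => a a'; rewrite /m; ring.
Qed.

Lemma evt_at0 u : cv1 u -> co u 0 = 0 -> evt T2 u 0 = 0.
Proof.
move=> cu u0; apply: normc_eq0; apply/eqP; rewrite eq_le normc_ge0 andbT.
by apply/ler_addgt0Pl => e e0; rewrite addr0; apply: ltW; exact: (near_gt0 (near_evt_small cu u0 e0)).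
Qed.

Lemma rho_at0 b : isbr b -> rho b 0 = 0.
Proof.
move=> bb; rewrite /rho /gam /= (evt_at0 (branch_cu bb) (branch_u0 bb)) (evt_at0 (branch_cv bb) (branch_v0 bb)).
by rewrite nc0 expr0n addr0.
Qed.

(** On every ray [rho] takes a value below eps^2 close to 0 and a value at least K r1^n at radius
    r1. From eps < 1 and eps < K r1^n one gets eps^2 < K r1^n, so eps^2 is attained, and the bound
    on eps is the same for all rays. *)
Lemma exists_radius b (r : R) : isbr b -> 0 < r -> (forall t, normc t < r -> hgood b t) ->
  exists2 eps1 : R, 0 < eps1 & forall eps, 0 < eps < eps1 -> forall w : C, normc w = 1 ->
    exists x, normc (w * rexp x) < r /\ rho b (w * rexp x) = eps ^+ 2.
Proof.
move=> bb r0 H; have [n [K [K0 [ra ra0 hra]]]] := near_rho_lower bb.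
pose r1 := Num.min r ra / 2; have m0 : 0 < Num.min r ra by rewrite lt_min r0.
have r10 : 0 < r1 by rewrite divr_gt0.
have r1m : r1 < Num.min r ra by rewrite ltr_pdivrMr // mulr_natr mulr2n ltrDl.
have [r1r r1ra] : r1 < r /\ r1 < ra by move: r1m; rewrite lt_min => /andP[].
exists (Num.min 1 (K * r1 ^+ n)); first by rewrite lt_min ltr01 mulr_gt0 // exprn_gt0.
move=> eps /andP[eps0]; rewrite lt_min => /andP[eps1 epsK] w w1.
have nw x : normc (w * rexp x) = expR x by rewrite ncM w1 mul1r normc_rexp.
have e20 : 0 < eps / 2 by rewrite divr_gt0.
have [rb rb0 hb] := nearI (near_evt_small (branch_cu bb) (branch_u0 bb) e20) (near_evt_small (branch_cv bb) (branch_v0 bb) e20).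
pose r2 := Num.min rb r1 / 2; have m20 : 0 < Num.min rb r1 by rewrite lt_min rb0.
have r20 : 0 < r2 by rewrite divr_gt0.
have r2m : r2 < Num.min rb r1 by rewrite ltr_pdivrMr // mulr_natr mulr2n ltrDl.
have [r2b r21] : r2 < rb /\ r2 < r1 by move: r2m; rewrite lt_min => /andP[].
have E1 : expR (ln r1) = r1 by rewrite lnK // posrE.
have E2 : expR (ln r2) = r2 by rewrite lnK // posrE.
have le : ln r2 <= ln r1 by rewrite ler_ln ?posrE // ltW.
have lo : rho b (w * rexp (ln r2)) < eps ^+ 2.
  have [h1 h2] : normc (gam b (w * rexp (ln r2))).1 < eps / 2 /\ normc (gam b (w * rexp (ln r2))).2 < eps / 2.
    by apply: hb; rewrite nw E2.
  rewrite /rho; move: (normc _) (normc _) h1 h2 (normc_ge0 (gam b (w * rexp (ln r2))).1) (normc_ge0 (gam b (w * rexp (ln r2))).2).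
  by move=> p q *; nra.
have hi : eps ^+ 2 < rho b (w * rexp (ln r1)).
  have := hra (w * rexp (ln r1)); rewrite nw E1 => /(_ r1ra); apply: lt_le_trans.
  by apply: lt_trans epsK; rewrite expr2 gtr_pMr.
have pd z : z <= ln r1 -> is_derive z (1 : R) (fun x => rho b (w * rexp x)) (2 * complex.Re (w * rexp z * dform b (w * rexp z))).
  move=> zz; have zr : normc (w * rexp z) < r.
    by rewrite nw (le_lt_trans _ r1r) // -E1 ler_expR.
  have d : cdiff (fun x => w * rexp x) z (w * rexp z).
    by have := cdiff_scale w (cdiff_cexp (cdiff_id z)); rewrite mul1r.
  by apply/rdiffP; have := rho_path (H _ zr) d.
have [||z zz ze] := @IVT _ (fun x => rho b (w * rexp x)) _ _ (eps ^+ 2) le.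
- apply: derivable_within_continuous => z; rewrite in_itv => /andP[_ zz].
  by have [] := pd z zz.
- by rewrite minElt maxElt (lt_trans lo hi) !ltW.
exists z; split=> //; rewrite nw (le_lt_trans _ r1r) // -E1 ler_expR.
by move: zz; rewrite in_itv => /andP[].
Qed.

(** [link_parametrization] with the sealed evaluation [ev]. *)
Definition alink f (eps : R) (n : nat) (c : 'I_n -> R -> C * C) :=
  [/\ forall j, C1_complex (fun s => (c j s).1) /\ C1_complex (fun s => (c j s).2),
      forall j s, c j (s + 1) = c j s,
      forall j j' s s', 0 <= s < 1 -> 0 <= s' < 1 -> c j s = c j' s' -> j = j' /\ s = s',
      forall z : C * C,
        (ev f z = 0 /\ normc z.1 ^+ 2 + normc z.2 ^+ 2 = eps ^+ 2) <-> (exists j s, c j s = z) &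
      forall j s,
        0 < complex.Im (cderive (fun y => (c j y).1) s * conjc (c j s).1 +
                        cderive (fun y => (c j y).2) s * conjc (c j s).2)].

(** P is not assumed monotone in d, so each b keeps its own d and only the lower bound d0 is
    common. *)
Lemma finite_radius (s : seq (br T2)) (P : br T2 -> R -> Prop) :
  (forall b, b \in s -> exists2 d : R, 0 < d & P b d) ->
  exists2 d0 : R, 0 < d0 & forall b, b \in s -> exists d : R, d0 <= d /\ P b d.
Proof.
elim: s => [|b s IH] h; first by exists 1.
have [d d0 hd] := h b (mem_head _ _).
have [d' d'0 hd'] := IH (fun b' bs => h b' (mem_behead (s := b :: s) bs)).
exists (Num.min d d') => [|b']; first by rewrite lt_min d0.
rewrite inE => /orP[/eqP ->|/hd'[d'' [le hh]]]; first by exists d; rewrite ge_min lexx.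
by exists d''; rewrite ge_min le orbT.
Qed.

Lemma sphere_le (p : C * C) (eps : R) : 0 <= eps -> normc p.1 ^+ 2 + normc p.2 ^+ 2 = eps ^+ 2 ->
  normc p.1 <= eps /\ normc p.2 <= eps.
Proof.
move=> e0 e; split; rewrite -ler_sqr ?nnegrE ?normc_ge0 // -e.
  by rewrite lerDl exprn_ge0 // normc_ge0.
by rewrite lerDr exprn_ge0 // normc_ge0.
Qed.

(** * Components of the link and branches of the curve *)

Section Link.
Variables (f e : T2) (s : seq (br T2)).
Hypotheses (ce : cvgt e) (ue : funit e) (sb : forall b, b \in s -> isbr b) (us : uniq s).
Hypotheses (fE : f = e * \prod_(b <- s) b.1)
  (sd : forall b b', b \in s -> b' \in s -> b' <> b -> pullb b b'.1 <> 0).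

Lemma near0_zeros : near0 (fun p => ev f p = 0 <-> exists2 b, b \in s & ev b.1 p = 0).
Proof.
have cW b : b \in s -> cvgt b.1 by move=> /sb; exact: branch_cW.
have [w [ew /(_ ce) cw]] : exists w : T2, e * w = 1 /\ (cvgt e -> cvgt w).
  by apply: inverse; exact/funitE.
have h1 := near0_evM ce (cvgt_prod cW); rewrite -fE in h1.
have h3 := near0_evM ce cw; rewrite ew in h3.
apply: near0W (near0I h1 (near0I (near0_evprod cW) h3)) => p [-> [-> e3]].
have e0 : ev e p != 0 by apply/eqP => z; move: e3; rewrite ev1 z mul0r => /eqP; rewrite oner_eq0.
split=> [/eqP|[b bs bz]]; last by rewrite (big_rem b) //= bz mul0r mulr0.
rewrite mulf_eq0 (negPf e0) /= prodf_seq_eq0 => /hasP[b bs /= /eqP bz].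
by exists b.
Qed.

Lemma near_disjoint b : b \in s -> near (fun t => t <> 0 -> forall b', b' \in s -> b' <> b -> ev b'.1 (gam b t) <> 0).
Proof.
move=> bs; have bb := sb bs.
have := near_all (s := s) (A := fun b' t => b' <> b -> t <> 0 -> ev b'.1 (gam b t) <> 0).
case; last by move=> r r0 h; exists r => // t /h k t0 b' b's ne; exact: k.
move=> b' b's; have [->|ne] := pselect (b' = b); first by exists 1.
have cW' := branch_cW (sb b's).
have h1 := near_evt_neq0 (cv1_pullb bb cW') (sd bs b's ne).
have h2 := near_evt_pull (branch_cu bb) (branch_cv bb) (branch_u0 bb) (branch_v0 bb) cW'.
by apply: nearW (nearI h1 h2) => t [k1 k2] _ t0; rewrite /gam -k2; exact: k1.
Qed.

(** Gathers all the local conditions at a branch. A is left open: it is the logarithmic data of g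
    and k for computing integrals, and the second derivatives for constructing links. *)
Lemma good_radius b (A : C -> Prop) : b \in s -> near A ->
  exists2 eps1 : R, 0 < eps1 & exists r r' : R, [/\ chart b r r', eps1 <= r',
  forall t, normc t < r -> hgood b t /\ A t,
  forall t, normc t < r -> t <> 0 -> forall b', b' \in s -> b' <> b -> ev b'.1 (gam b t) <> 0 &
  forall eps, 0 < eps < eps1 -> forall w : C, normc w = 1 ->
    exists x, normc (w * rexp x) < r /\ rho b (w * rexp x) = eps ^+ 2].
Proof.
move=> bs nA; have bb := sb bs; have [r0 r00 hc] := chart_exists bb.
have [ra ra0 ha] := nearI (nearI (near_hgood bb) nA) (near_disjoint bs).
pose r := Num.min r0 ra / 2; have m0 : 0 < Num.min r0 ra by rewrite lt_min r00.
have r_0 : 0 < r by rewrite divr_gt0.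
have : r < Num.min r0 ra by rewrite ltr_pdivrMr // mulr_natr mulr2n ltrDl.
rewrite lt_min => /andP[rr0 rra]; have [|r' r'0 hr'] := hc r; first by rewrite r_0.
have H t : normc t < r -> hgood b t /\ A t by move=> /lt_trans /(_ rra) /ha[].
have [eps1 e10 he] := exists_radius bb r_0 (fun t tr => (H t tr).1).
exists (Num.min eps1 r'); first by rewrite lt_min e10.
exists r, r'; split=> //; first by rewrite ge_min lexx orbT.
  by move=> t /lt_trans /(_ rra) /ha[].
by move=> eps /andP[e0]; rewrite lt_min => /andP[e1 _]; apply: he; rewrite e0.
Qed.

Lemma link_integral g k : cvgt g -> cvgt k -> (forall b, b \in s -> pullb b g <> 0) ->
  (forall b, b \in s -> pullb b k <> 0) ->
  exists2 eps0 : R, 0 < eps0 & forall eps : R, 0 < eps < eps0 -> forall n (c : 'I_n -> R -> C * C),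
    alink f eps c -> \sum_j ev_integral g k (c j) =
      (\sum_(b <- s) ((ord (pullb b k))%:R - (ord (pullb b g))%:R)) * (0 +i* (2 * pi))%C.
Proof.
move=> cg ck g0 k0.
have [|d1 d10 hd1] := @finite_radius s (fun b eps1 => exists r r' : R, [/\ chart b r r', eps1 <= r',
  forall t, normc t < r -> hgood b t /\ exists lg lk, (forall t, normc t < r -> lgood b g lg t /\ lgood b k lk t),
  forall t, normc t < r -> t <> 0 -> forall b', b' \in s -> b' <> b -> ev b'.1 (gam b t) <> 0 &
  forall eps, 0 < eps < eps1 -> forall w : C, normc w = 1 ->
    exists x, normc (w * rexp x) < r /\ rho b (w * rexp x) = eps ^+ 2]).
  move=> b bs; have [lg hg] := near_lgood (sb bs) cg (g0 b bs); have [lk hk] := near_lgood (sb bs) ck (k0 b bs).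
  have [d d0 [r [r' [h1 h2 h3 h4 h5]]]] := good_radius bs (nearI hg hk); exists d => //.
  exists r, r'; split=> // t tr; have [a _] := h3 t tr; split=> //.
  by exists lg, lk => t' t'r; have [_ []] := h3 t' t'r.
have [rf rf0 hf] := near0_zeros.
have cW b : b \in s -> cvgt b.1 by move=> /sb; exact: branch_cW.
have [rc rc0 hcont] := near0_all (fun b bs => near0_ev_continuous (cW b bs)).
exists (Num.min d1 (Num.min rf rc)); first by rewrite !lt_min d10 rf0.
move=> eps /andP[eps0]; rewrite !lt_min => /and3P[ed1 erf erc] n c [lC1 lper linj lz lori].
have sph p : normc p.1 ^+ 2 + normc p.2 ^+ 2 = eps ^+ 2 -> normc p.1 <= eps /\ normc p.2 <= eps.
  by apply: sphere_le; exact: ltW.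
have hfe p : normc p.1 ^+ 2 + normc p.2 ^+ 2 = eps ^+ 2 -> ev f p = 0 <-> exists2 b, b \in s & ev b.1 p = 0.
  by move=> /sph[a1 a2]; apply: hf; exact: le_lt_trans erf.
have onlink j x : ev f (c j x) = 0 /\ normc (c j x).1 ^+ 2 + normc (c j x).2 ^+ 2 = eps ^+ 2.
  by apply/lz; exists j, x.
(* Near 0 two branches meet only at 0, which is not on the sphere. *)
have disj b b' p : b \in s -> b' \in s -> ev b.1 p = 0 -> ev b'.1 p = 0 ->
    normc p.1 ^+ 2 + normc p.2 ^+ 2 = eps ^+ 2 -> b' = b.
  move=> bs b's z z' pe; have [d [dd [r [r' [[_ onto _] h2 h3 h4 _]]]]] := hd1 b bs.
  have [a1 a2] := sph _ pe; have er : eps < r' by apply: lt_le_trans ed1 _; exact: le_trans h2.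
  have [t [tr tp]] := onto p (le_lt_trans a1 er) (le_lt_trans a2 er) z.
  apply: contrapT => ne; apply: (h4 t tr _ b' b's ne); last by rewrite tp.
  move=> t0; have := rho_at0 (sb bs); rewrite -t0 /rho tp pe => /eqP.
  by rewrite expf_eq0 /= gt_eqF.
have comp j : exists b, [/\ b \in s, forall x, ev b.1 (c j x) = 0,
    forall p, ev b.1 p = 0 -> normc p.1 ^+ 2 + normc p.2 ^+ 2 = eps ^+ 2 -> exists2 x, 0 <= x < 1 & c j x = p &
    ev_integral g k (c j) = ((ord (pullb b k))%:R - (ord (pullb b g))%:R) * (0 +i* (2 * pi))%C].
  have [/C1_cdiff[dc1 _] /C1_cdiff[dc2 _]] := lC1 j.
  pose F (i : 'I_(size s)) x := ev (tnth (in_tuple s) i).1 (c j x).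
  have Fs i : tnth (in_tuple s) i \in s by exact: mem_tnth.
  have [z0 sph0] := onlink j 0; have /(hfe _ sph0)[b bs bz0] := z0.
  have bi : (index b s < size s)%N by rewrite index_mem.
  have bE : tnth (in_tuple s) (Ordinal bi) = b by rewrite (tnth_nth b) /= nth_index.
  have bz x : ev b.1 (c j x) = 0.
    have := @continuous_choice _ _ F _ _ _ 0 (Ordinal bi); rewrite /F bE; apply=> //.
    - move=> i y e' e'0; have [_ sy] := onlink j y; have [a1 a2] := sph _ sy.
      have [d d0 hd] := hcont (c j y) (le_lt_trans a1 erc) (le_lt_trans a2 erc) _ (Fs i) e' e'0.
      have [p1 p10 hp1] := cdiff_cont (dc1 y) d0; have [p2 p20 hp2] := cdiff_cont (dc2 y) d0.
      exists (Num.min p1 p2); first by rewrite lt_min p10.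
      by move=> h; rewrite lt_min => /andP[/hp1 q1 /hp2 q2]; exact: hd.
    - move=> y; have [z sy] := onlink j y; have /(hfe _ sy)[b' b's b'z] := z.
      have b'i : (index b' s < size s)%N by rewrite index_mem.
      by exists (Ordinal b'i); rewrite (tnth_nth b) /= nth_index.
    - move=> y i i' zi zi'; have [_ sy] := onlink j y.
      have := disj _ _ _ (Fs i') (Fs i) zi' zi sy; rewrite !(tnth_nth b) /= => /eqP.
      by rewrite nth_uniq // => /eqP /val_inj.
  have [d [dd [r [r' [ch h2 h3 h4 _]]]]] := hd1 b bs.
  have er : 0 < eps < r' by rewrite eps0 (lt_le_trans ed1) // (le_trans dd).
  have [c1 c2] := lC1 j.
  have [T [T' [A [hT dT cT' dA [A1 T10 cov]]]]] := link_lift (fun t tr => (h3 t tr).1) ch er c1 c2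
    (lper j 0) (fun x x' hx hx' e' => (linj j j x x' hx hx' e').2) (fun x => (onlink j x).2) bz (lori j).
  exists b; split=> //.
    move=> p pz pe; have [a1 a2] := sph _ pe; have /andP[_ er'] := er; have [_ onto _] := ch.
    have [t [tr tp]] := onto p (le_lt_trans a1 er') (le_lt_trans a2 er') pz.
    have [||x hx xe] := cov t tr; last by exists x => //; have [_ _ <-] := hT x; rewrite xe.
      move=> t0; have := rho_at0 (sb bs); rewrite -t0 /rho tp pe => /eqP.
      by rewrite expf_eq0 /= gt_eqF.
    by rewrite /rho tp.
  have [Tr0 _ _] := hT 0; have [_ [lg [lk hl]]] := h3 _ Tr0.
  rewrite -A1; apply: (@branch_integral b g k lg lk T T') => // x.
  by have [a1 a2 a3] := hT x; have [? ?] := hl _ a1; split.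
have [be hbe] := boolp.choice comp.
rewrite (eq_bigr (fun j => ((ord (pullb (be j) k))%:R - (ord (pullb (be j) g))%:R) * (0 +i* (2 * pi))%C)); last first.
  by move=> j _; have [] := hbe j.
rewrite -mulr_suml; congr (_ * _).
(* A component covers every point of its branch on the sphere, so two components on the same branch
   would share a point. *)
have bei : injective be.
  move=> j j' e'; have [_ _ cov _] := hbe j; have [_ z' _ _] := hbe j'.
  have [x hx xe] := cov (c j' 0) (eq_ind_r (fun b => ev b.1 _ = 0) (z' 0) e') (onlink j' 0).2.
  have h01 : 0 <= (0 : R) < 1 by rewrite lexx ltr01.
  by have [] := linj j j' x 0 hx h01 xe.
(* Every branch has a point on the sphere, found on the ray of argument 0, so it carries a
   component. *)
have per : perm_eq (map be (index_enum 'I_n)) s.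
  apply: uniq_perm => //; first by rewrite map_inj_uniq // index_enum_uniq.
  move=> b; apply/mapP/idP => [[j _ ->]|bs]; first by have [] := hbe j.
  have [d [dd [r [r' [[_ onto _] h2 h3 h4 h5]]]]] := hd1 b bs.
  have ed : 0 < eps < d by rewrite eps0 (lt_le_trans ed1).
  have [x [xr xe]] := h5 eps ed 1 (nc1 R); rewrite mul1r in xr xe.
  have bz : ev b.1 (gam b (rexp x)) = 0.
    by have [[_ _ _ z] _] := h3 _ xr.
  have /lz[j [y yE]] : ev f (gam b (rexp x)) = 0 /\ rho b (rexp x) = eps ^+ 2.
    by split=> //; apply/(hfe _ xe); exists b.
  exists j; first exact: mem_index_enum.
  have [js jz _ _] := hbe j; apply: (disj (be j) b (gam b (rexp x))) => //.
  by rewrite -yE.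
by rewrite -(perm_big _ per) big_map.
Qed.
End Link.
End LinkIntegral.

(** * Existence of links *)

Section LinkExists.
Variables (R : realType) (T1 : fps_theory R[i]) (T2 : fps_theory T1).
Local Notation C := R[i].
Local Notation normc := (@ComplexField.Normc.normc R).
Local Notation cv1 u := (cvgt (tconst u : T2)).
Implicit Types (u v w l : T1) (f g : T2) (t z : C) (b : br T2) (x y h : R).

Definition iexp x : C := cexp (0 +i* x)%C.

Lemma cdiff_im x : cdiff (fun x => (0 +i* x)%C : C) x (0 +i* 1)%C.
Proof.
apply: (@cdiff_ext _ (fun x => (0 +i* 1)%C * x%:C%C)).
  by move=> y; apply/eqP; rewrite eq_complex /= ?(mul0r, mulr0, mul1r, mulr1, subr0, addr0, add0r, subrr, oppr0, mulrBr) !eqxx.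
by have := cdiff_scale (0 +i* 1)%C (cdiff_id x); rewrite mulr1.
Qed.

Lemma cdiff_iexp x : cdiff iexp x ((0 +i* 1)%C * iexp x).
Proof. exact: (cdiff_cexp (cdiff_im x)). Qed.

Lemma cdiff_rexp x : cdiff (@rexp R) x (rexp x).
Proof. by have := cdiff_cexp (cdiff_id x); rewrite mul1r. Qed.

Lemma cexp_split (p x : R) : cexp (p +i* x)%C = iexp x * rexp p.
Proof. by rewrite /iexp /rexp -cexpD; congr cexp; apply/eqP; rewrite eq_complex /= ?(mul0r, mulr0, mul1r, mulr1, subr0, addr0, add0r, subrr, oppr0, mulrBr) !eqxx. Qed.

Lemma normc_iexp x : normc (iexp x) = 1.
Proof. by rewrite normc_cexp expR0. Qed.

(** exp (p + i x) is the product of exp p and exp (i x), each differentiable in one real variable; e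
    / 4 leaves room for the error terms of the product. *)
Lemma holo_cexp0 : holo (@cexp R) 0 1.
Proof.
move=> e e0; pose e1 := Num.min 1 (e / 4).
have e10 : 0 < e1 by rewrite lt_min ltr01 divr_gt0.
have [d1 d10 h1] := cdiff_rexp 0 e10; have [d2 d20 h2] := cdiff_iexp 0 e10.
have [d3 d30 h3] := cdiff_cont (cdiff_rexp 0) e10.
exists (Num.min d1 (Num.min d2 d3)); first by rewrite !lt_min d10 d20.
move=> [p x] hh; have := le_lt_trans (normc_Re _) hh; have := le_lt_trans (normc_Im _) hh.
rewrite /= !lt_min => /and3P[_ /h2 + _] /and3P[/h1 + _ /h3].
rewrite !add0r /rexp /iexp rmorph0 cexp0 -/(rexp p) -/(iexp x) !mulr1 => I E E'.
rewrite cexp_split.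
have xE : x%:C%C * (0 +i* 1)%C = (0 +i* x)%C :> C.
  by apply/eqP; rewrite eq_complex /= ?(mul0r, mulr0, mul1r, mulr1, subr0, addr0, add0r, subrr, oppr0, mulrBr) !eqxx.
rewrite xE in I.
have -> : iexp x * rexp p - 1 - (p +i* x)%C =
    rexp p * (iexp x - 1 - (0 +i* x)%C) + (rexp p - 1 - p%:C%C) + (0 +i* x)%C * (rexp p - 1).
  have -> : (p +i* x)%C = p%:C%C + (0 +i* x)%C :> C.
    by apply/eqP; rewrite eq_complex /= ?(mul0r, mulr0, mul1r, mulr1, subr0, addr0, add0r, subrr, oppr0, mulrBr) !eqxx.
  by move: (iexp x) (rexp p) p%:C%C (0 +i* x)%C => a b q y; ring.
have nx : normc (0 +i* x)%C = `|x| by rewrite /ComplexField.Normc.normc /= expr0n add0r sqrtr_sqr.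
have np : normc (rexp p) <= 2.
  rewrite -[rexp p](subrK 1); apply: le_trans (normcD_le _ _) _; rewrite nc1.
  have e11 : e1 <= 1 by rewrite ge_min lexx.
  by move: E' e11 => p1 p2; lra.
have [kx kp] : `|x| <= normc (p +i* x)%C /\ `|p| <= normc (p +i* x)%C by split; [exact: (normc_Im (p +i* x)%C) | exact: (normc_Re (p +i* x)%C)].
have e14 : 4 * e1 <= e by rewrite mulrC -ler_pdivlMr // ge_min lexx orbT.
apply: le_trans (normcD_le _ _) _; rewrite ncM nx.
apply: (@le_trans _ _ (2 * (e1 * `|x|) + e1 * `|p| + `|x| * e1)).
  apply: lerD; last by rewrite ler_wpM2l // ltW.
  apply: le_trans (normcD_le _ _) _; rewrite ncM; apply: lerD => //.
  by apply: ler_pM => //; exact: normc_ge0.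
have := normr_ge0 x; have := normr_ge0 p.
move: (normc _) `|x| `|p| kx kp => n a b' *; nra.
Qed.

Lemma holo_cexp z : holo (@cexp R) z (cexp z).
Proof.
move=> e e0; have n0 : 0 < normc (cexp z) by apply: normc_gt0; exact: cexp_neq0.
have en : 0 < e / normc (cexp z) by rewrite divr_gt0.
have [r r0 hr] := holo_cexp0 en; exists r => // h /hr.
rewrite add0r mulr1 cexp0 => A.
have -> : cexp (z + h) - cexp z - h * cexp z = (cexp h - 1 - h) * cexp z by rewrite cexpD; ring.
by rewrite ncM -ler_pdivlMr // mulrAC.
Qed.

Lemma holo_normsq (p : C -> C) (z c : C) : holo p z c -> forall e, 0 < e -> exists2 r : R, 0 < r &
  forall h : C, normc h < r ->
    `|normc (p (z + h)) ^+ 2 - normc (p z) ^+ 2 - 2 * complex.Re (h * (c * conjc (p z)))| <= e * normc h.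
Proof.
move=> hp e e0; pose a := normc c + 1; have a0 : 0 < a by rewrite ltr_wpDl ?normc_ge0.
pose m := 4 * (normc (p z) + 1); have m0 : 0 < m by rewrite mulr_gt0 // ltr_wpDl ?normc_ge0.
pose e1 := Num.min 1 (e / m); have e10 : 0 < e1 by rewrite lt_min ltr01 divr_gt0.
have [r r0 hr] := hp e1 e10.
exists (Num.min r (e / (2 * a ^+ 2))); first by rewrite lt_min r0 divr_gt0 // mulr_gt0 // exprn_gt0.
move=> h; rewrite lt_min => /andP[/hr]; set D := p (z + h) - p z => A.
rewrite ltr_pdivlMr ?mulr_gt0 ?exprn_gt0 // => B.
have -> : normc (p (z + h)) ^+ 2 - normc (p z) ^+ 2 - 2 * complex.Re (h * (c * conjc (p z))) =
    normc D ^+ 2 + 2 * complex.Re ((D - h * c) * conjc (p z)).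
  rewrite !normc_sq /D; move: (p (z + h)) (p z) => [a1 a2] [b1 b2]; case: (h) (c) => h1 h2 [c1 c2] /=; ring.
have nD : normc D <= a * normc h.
  rewrite -[D](subrK (h * c)); apply: le_trans (normcD_le _ _) _; rewrite ncM /a mulrDl mul1r [normc c * _]mulrC addrC lerD2l.
  by apply: le_trans A _; rewrite -[leRHS]mul1r ler_wpM2r ?normc_ge0 // ge_min lexx.
apply: le_trans (ler_normD _ _) _; rewrite ger0_norm ?exprn_ge0 ?normc_ge0 // normrM ger0_norm //.
have R1 : `|complex.Re ((D - h * c) * conjc (p z))| <= e1 * normc h * normc (p z).
  apply: le_trans (normc_Re _) _; rewrite ncM (_ : normc (conjc (p z)) = normc (p z)).
    by rewrite ler_wpM2r ?normc_ge0.
  by case: (p z) => ? ?; rewrite /ComplexField.Normc.normc /= sqrrN.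
have e1m : e1 * m <= e by rewrite -ler_pdivlMr // ge_min lexx orbT.
have D2 : normc D ^+ 2 <= (a * normc h) ^+ 2 by rewrite ler_sqr ?nnegrE ?normc_ge0 // mulr_ge0 ?normc_ge0 // ltW.
have h0 := normc_ge0 h; have p0 := normc_ge0 (p z).
apply: (@le_trans _ _ (e / 2 * normc h + e / 2 * normc h)); last by rewrite -mulrDl -splitr.
apply: lerD.
  apply: le_trans D2 _; rewrite exprMn expr2 mulrA ler_wpM2r //.
  by rewrite ler_pdivlMr // mulrC mulrA mulrC ltW.
rewrite /m in e1m; apply: (@le_trans _ _ (2 * (e1 * normc h * normc (p z)))); first by rewrite ler_pM2l.
rewrite (_ : 2 * _ = (2 * e1 * normc (p z)) * normc h); last by ring.
rewrite ler_wpM2r //; move: (normc (p z)) e1m p0 => q *; nra.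
Qed.

Lemma rdiff_cont (p : R -> R) x (d : R) : rdiff p x d -> forall e, 0 < e -> exists2 r : R, 0 < r &
  forall h, `|h| < r -> `|p (x + h) - p x| < e.
Proof.
move=> pd e e0; have [r r0 hr] := pd 1 ltr01; pose k := `|d| + 1.
have k0 : 0 < k by rewrite ltr_wpDl.
exists (Num.min r (e / k)); first by rewrite lt_min r0 divr_gt0.
move=> h; rewrite lt_min => /andP[/hr A]; rewrite ltr_pdivlMr // => B.
rewrite -[_ - p x](subrK (h * d)); apply: le_lt_trans (ler_normD _ _) _.
by apply: le_lt_trans B; rewrite normrM /k mulrDr mulr1 addrC lerD2l -[leRHS]mul1r.
Qed.

(** Implicit differentiation for a function a whose existence and continuity are already known. *)
Lemma implicit_rdiff (G : R -> R -> R) (a : R -> R) x (p q : R) : 0 < p ->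
  (forall e, 0 < e -> exists2 d : R, 0 < d & forall k h, `|k| < d -> `|h| < d ->
     `|G (a x + k) (x + h) - G (a x) x - (k * p + h * q)| <= e * (`|k| + `|h|)) ->
  (forall e, 0 < e -> exists2 d : R, 0 < d & forall h, `|h| < d -> `|a (x + h) - a x| < e) ->
  (forall h, G (a (x + h)) (x + h) = G (a x) x) -> rdiff a x (- q / p).
Proof.
move=> p0 Gd ac Ga e e0; pose L := 2 * `|q| / p + 1.
have L0 : 0 <= L by rewrite addr_ge0 // divr_ge0 ?mulr_ge0 // ltW.
pose e1 := Num.min (p / 2) (e * p / (L + 1)).
have L10 : 0 < L + 1 by rewrite ltr_wpDl.
have e10 : 0 < e1 by rewrite lt_min !divr_gt0 // mulr_gt0.
have [d d0 hd] := Gd e1 e10; have [d' d'0 hd'] := ac d d0.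
exists (Num.min d d'); first by rewrite lt_min d0.
move=> h; rewrite lt_min => /andP[hd0 /hd' kd]; set k := a (x + h) - a x in kd *.
have := hd k h kd hd0; rewrite (_ : a x + k = a (x + h)); last by rewrite /k addrC subrK.
rewrite Ga subrr sub0r normrN => A.
have A1 : e1 <= p / 2 by rewrite ge_min lexx.
have A2 : e1 * (L + 1) <= e * p by rewrite -ler_pdivlMr // ge_min lexx orbT.
have k0 := normr_ge0 k; have h0 := normr_ge0 h; have q0 := normr_ge0 q.
(* A first estimate of the increment of a by that of x, after which the remainder e1 (|k| + |h|) is
   small compared with |h|. *)
have kL : `|k| <= L * `|h|.
  have B : `|k| * p <= `|h| * `|q| + p / 2 * (`|k| + `|h|).
    have -> : `|k| * p = `|k * p| by rewrite normrM (gtr0_norm p0).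
    rewrite -[k * p](addrK (h * q)); apply: le_trans (ler_normB _ _) _.
    rewrite addrC normrM lerD2l; apply: le_trans A _; rewrite ler_wpM2r // addr_ge0 //.
  have -> : L * `|h| = (2 * `|h| * `|q| + p * `|h|) / p by rewrite /L; field; rewrite gt_eqF.
  by rewrite ler_pdivlMr //; lra.
have -> : k - h * (- q / p) = (k * p + h * q) / p by field; rewrite gt_eqF.
rewrite normrM normfV (gtr0_norm p0) ler_pdivrMr //; apply: le_trans A _.
apply: (@le_trans _ _ (e1 * ((L + 1) * `|h|))).
  by apply: ler_wpM2l; [exact: ltW | rewrite mulrDl mul1r lerD2r].
by rewrite mulrA [leRHS]mulrAC ler_wpM2r.
Qed.

Lemma cdiff_lin (w : R -> C) (m : R) x (c : C) : 0 < m -> cdiff w (m * x) c ->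
  cdiff (fun x => w (m * x)) x (m%:C%C * c).
Proof.
move=> m0 wd e e0; have em : 0 < e / m by rewrite divr_gt0.
have [d d0 hd] := wd _ em; exists (d / m); first by rewrite divr_gt0.
move=> h; rewrite ltr_pdivlMr // => hm.
have E1 : h%:C%C * (m%:C%C * c) = (m * h)%:C%C * c :> C by rewrite mulrA -rmorphM [h * m]mulrC.
have E2 : e * `|h| = e / m * `|m * h| by rewrite normrM (gtr0_norm m0) mulrA divfK // gt_eqF.
by rewrite mulrDr E1 E2; apply: hd; rewrite normrM (gtr0_norm m0) mulrC.
Qed.

Lemma ccont_conj (a : R -> C) : ccont a -> ccont (fun x => conjc (a x)).
Proof.
move=> ac x e e0; have [d d0 hd] := ac x e e0; exists d => // h /hd.
rewrite (_ : normc (conjc (a (x + h)) - conjc (a x)) = normc (a (x + h) - a x)) //.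
by case: (a _) (a x) => ? ? [? ?]; rewrite /ComplexField.Normc.normc /= -opprD sqrrN.
Qed.

(** Differentiability of the first derivatives, from which [cdiff_ccont] obtains their continuity
    along a curve. *)
Definition hgood2 b t := holo (evt T2 (tderiv b.2.1)) t (evt T2 (tderiv (tderiv b.2.1)) t) /\
  holo (evt T2 (tderiv b.2.2)) t (evt T2 (tderiv (tderiv b.2.2)) t).

Lemma near_hgood2 b : isbr b -> near (hgood2 b).
Proof.
move=> bb; exact: (nearI (near_holo (cv1_tderiv (branch_cu bb))) (near_holo (cv1_tderiv (branch_cv bb)))).
Qed.

Lemma branch_loop b (r r' eps : R) : isbr b -> chart b r r' -> 0 < eps < r' ->
  (forall t, normc t < r -> hgood b t /\ hgood2 b t) ->
  (forall w : C, normc w = 1 -> exists x, normc (w * rexp x) < r /\ rho b (w * rexp x) = eps ^+ 2) ->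
  exists c : R -> C * C, [/\ C1_complex (fun s => (c s).1) /\ C1_complex (fun s => (c s).2),
    forall s, c (s + 1) = c s, forall s s', 0 <= s < 1 -> 0 <= s' < 1 -> c s = c s' -> s = s',
    forall p, (ev b.1 p = 0 /\ normc p.1 ^+ 2 + normc p.2 ^+ 2 = eps ^+ 2) <-> (exists s, c s = p) &
    forall s, 0 < complex.Im (cderive (fun y => (c y).1) s * conjc (c s).1 +
                        cderive (fun y => (c y).2) s * conjc (c s).2)].
Proof.
move=> bb [inj onto _] /andP[eps0 epsr] H hr.
have H1 t : normc t < r -> hgood b t by move=> /H[].
have pi0 := pi_gt0 R.
have /boolp.choice[a0 ha0] (w : C) : exists x, normc w = 1 -> normc (w * rexp x) < r /\ rho b (w * rexp x) = eps ^+ 2.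
  by have [/hr[x hx]|nw] := pselect (normc w = 1); [exists x | exists 0].
(* The level curve in polar form: [a y] is the logarithm of the radius at which the ray of argument
   y meets rho = eps^2. Choosing it through [iexp y] makes it periodic. *)
pose a y := a0 (iexp y); pose T y := iexp y * rexp (a y).
have Tr y : normc (T y) < r by have [] := ha0 _ (normc_iexp y).
have Trho y : rho b (T y) = eps ^+ 2 by have [] := ha0 _ (normc_iexp y).
have ie0 y : iexp y <> 0 by exact: cexp_neq0.
have T0 y : T y <> 0 by rewrite /T -cexp_split; exact: cexp_neq0.
have nT x y : normc (iexp x * rexp y) = expR y by rewrite ncM normc_iexp mul1r normc_rexp.
have auniq x y : normc (iexp x * rexp y) < r -> rho b (iexp x * rexp y) = eps ^+ 2 -> y = a x.
  move=> yr ye; have [lt|lt|//] := ltgtP y (a x).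
    by have := ray_lt H1 (ie0 x) lt (Tr x); rewrite ye -/(T x) Trho ltxx.
  by have := ray_lt H1 (ie0 x) lt yr; rewrite ye -/(T x) Trho ltxx.
have Tper y : T (y + 2 * pi) = T y.
  have e : iexp (y + 2 * pi) = iexp y by rewrite /iexp /cexp /= mulr_natl cosD2pi sinD2pi.
  by rewrite /T /a e.
have Gcont x y : expR y < r -> forall e, 0 < e -> exists2 d : R, 0 < d & forall h, `|h| < d ->
    `|rho b (iexp (x + h) * rexp y) - rho b (iexp x * rexp y)| < e.
  move=> yr; have d : cdiff (fun x => iexp x * rexp y) x ((0 +i* 1)%C * iexp x * rexp y).
    by have := cdiff_mul (cdiff_iexp x) (cdiff_cst (rexp y) x); rewrite mulr0 addr0.
  by apply: (@rdiff_cont (fun x => rho b (iexp x * rexp y))); apply: rho_path d; apply: H1; rewrite nT.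
(* At the logarithmic radii a x - e' and a x + e' the values of [rho] lie strictly on either side of
   eps^2, and still do so on nearby rays. Monotonicity on rays then traps a (x + h) between them.
   The bound on e' keeps both points inside the disc. *)
have acont x : forall e, 0 < e -> exists2 d : R, 0 < d & forall h, `|h| < d -> `|a (x + h) - a x| < e.
  move=> e e0; have ar : expR (a x) < r by rewrite -(nT x); exact: Tr.
  have r0 : 0 < r by apply: lt_trans ar; exact: expR_gt0.
  have lr : a x < ln r by rewrite -ltr_expR lnK // posrE.
  pose e' := Num.min e ((ln r - a x) / 2); have e'0 : 0 < e' by rewrite lt_min e0 divr_gt0 // subr_gt0.
  have e'e : e' <= e by rewrite ge_min lexx.
  have e'r : e' <= (ln r - a x) / 2 by rewrite ge_min lexx orbT.
  have up : expR (a x + e') < r by rewrite -[r]lnK ?posrE // ltr_expR; lra.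
  have dn : expR (a x - e') < r by apply: lt_trans ar; rewrite ltr_expR gtrDl oppr_lt0.
  have lu : eps ^+ 2 < rho b (iexp x * rexp (a x + e')).
    rewrite -(Trho x); apply: (ray_lt H1) => //; rewrite ?nT ?ltrDl //; exact: ie0.
  have ld : rho b (iexp x * rexp (a x - e')) < eps ^+ 2.
    rewrite -(Trho x); apply: (ray_lt H1) => //; rewrite ?nT ?gtrDl ?oppr_lt0 //; exact: ie0.
  rewrite -subr_gt0 in lu; rewrite -subr_gt0 in ld.
  have [d1 d10 hd1] := Gcont x _ up _ lu; have [d2 d20 hd2] := Gcont x _ dn _ ld.
  exists (Num.min d1 d2); first by rewrite lt_min d10.
  move=> h; rewrite lt_min => /andP[/hd1 A /hd2 B].
  suff: - e' < a (x + h) - a x < e' by rewrite -ltr_norml => /lt_le_trans; apply.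
  apply/andP; split.
    rewrite ltNge; apply/negP => le; have le' : a (x + h) <= a x - e' by lra.
    have : eps ^+ 2 <= rho b (iexp (x + h) * rexp (a x - e')).
      rewrite -(Trho (x + h)) /T; move: le'; rewrite le_eqVlt => /orP[/eqP -> //|lt].
      by apply: ltW; apply: (ray_lt H1 (ie0 _) lt); rewrite nT.
    by move: B; rewrite ltr_norml => /andP[_]; lra.
  rewrite ltNge; apply/negP => le; have le' : a x + e' <= a (x + h) by lra.
  have : rho b (iexp (x + h) * rexp (a x + e')) <= eps ^+ 2.
    rewrite -(Trho (x + h)) /T; move: le'; rewrite le_eqVlt => /orP[/eqP -> //|lt].
    by apply: ltW; exact: (ray_lt H1 (ie0 _) lt (Tr _)).
  by move: A; rewrite ltr_norml => /andP[+ _]; lra.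
pose B y := bform b (T y).
have B0 y : 0 < complex.Re (B y) by have [_ _ + _] := H1 _ (Tr y); apply.
(* The slope of the level curve, since [rho] at exp (a + i y) has partial derivatives 2 Re B and - 2
   Im B. *)
pose a' y := complex.Im (B y) / complex.Re (B y).
have da x : rdiff a x (a' x).
  have -> : a' x = - (- 2 * complex.Im (B x)) / (2 * complex.Re (B x)).
    by rewrite /a'; have := B0 x; move: (B x) => [X Y] /= X0; field; rewrite gt_eqF.
  apply: (@implicit_rdiff (fun y x => rho b (iexp x * rexp y))).
  - by rewrite mulr_gt0.
  - move=> e e0; have e20 : 0 < e / 2 by rewrite divr_gt0.
    have [h1 h2 _ _] := H1 _ (Tr x); pose z := ((a x) +i* x)%C : C.
    have zT : cexp z = T x by rewrite cexp_split.
    rewrite -zT in h1 h2.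
    have [d1 d10 k1] := holo_normsq (holo_comp (@holo_cexp z) h1) e20.
    have [d2 d20 k2] := holo_normsq (holo_comp (@holo_cexp z) h2) e20.
    pose d := Num.min d1 d2 / 2; have m0 : 0 < Num.min d1 d2 by rewrite lt_min d10.
    exists d; first by rewrite divr_gt0.
    move=> k h kd hd; pose kh := (k +i* h)%C : C.
    have nkh : normc kh <= `|k| + `|h| by exact: normc_ReIm.
    have : normc kh < Num.min d1 d2 by apply: le_lt_trans nkh _; rewrite [ltRHS]splitr ltrD.
    rewrite lt_min => /andP[/k1 + /k2]; rewrite !zT.
    have -> : z + kh = ((a x + k) +i* (x + h))%C by [].
    rewrite cexp_split => A1 A2.
    rewrite (_ : _ - _ - _ = (normc (evt T2 b.2.1 (iexp (x + h) * rexp (a x + k))) ^+ 2 -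
        normc (evt T2 b.2.1 (T x)) ^+ 2 - 2 * complex.Re (kh * (T x * evt T2 (tderiv b.2.1) (T x) * conjc (evt T2 b.2.1 (T x))))) +
      (normc (evt T2 b.2.2 (iexp (x + h) * rexp (a x + k))) ^+ 2 -
        normc (evt T2 b.2.2 (T x)) ^+ 2 - 2 * complex.Re (kh * (T x * evt T2 (tderiv b.2.2) (T x) * conjc (evt T2 b.2.2 (T x)))))).
      apply: le_trans (ler_normD _ _) _; apply: le_trans (lerD A1 A2) _.
      by rewrite -mulrDl -splitr ler_wpM2l // ltW.
    have -> : k * (2 * complex.Re (B x)) + h * (- 2 * complex.Im (B x)) = 2 * complex.Re (kh * B x).
      by rewrite /kh; case: (B x) => ? ? /=; ring.
    rewrite /B /bform mulrDr mulrDr ReD !mulrA /rho /gam /= -/(T x).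
    by move: (normc _) (normc _) (normc _) (normc _) (complex.Re _) (complex.Re _) => *; ring.
  - exact: acont.
  - by move=> h; rewrite -!/(T _) !Trho.
pose T' y := ((a' y) +i* 1)%C * T y.
have dT y : cdiff T y (T' y).
  have d : cdiff (fun x => ((a x) +i* x)%C) y ((a' y) +i* 1)%C.
    by apply/cdiff_ReIm; split => //=; have /cdiff_ReIm[_] := cdiff_id y => _; have /cdiff_ReIm[] := cdiff_id y.
  have := cdiff_cexp d; rewrite /T' cexp_split -/(T y).
  by apply: cdiff_ext => x; rewrite cexp_split.
have ccT : ccont T by exact: cdiff_ccont dT.
have cev w (w' : R -> C) : (forall y, holo (evt T2 w) (T y) (w' y)) -> ccont (fun y => evt T2 w (T y)).
  move=> hw; apply: (@cdiff_ccont _ _ (fun y => T' y * w' y)) => y; exact: (cdiff_comp (dT y) (hw y)).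
have cu : ccont (fun y => evt T2 b.2.1 (T y)).
  by apply: (cev _ (fun y => evt T2 (tderiv b.2.1) (T y))) => y; have [] := H1 _ (Tr y).
have cv : ccont (fun y => evt T2 b.2.2 (T y)).
  by apply: (cev _ (fun y => evt T2 (tderiv b.2.2) (T y))) => y; have [] := H1 _ (Tr y).
have cu' : ccont (fun y => evt T2 (tderiv b.2.1) (T y)).
  by apply: (cev _ (fun y => evt T2 (tderiv (tderiv b.2.1)) (T y))) => y; have [_ []] := H _ (Tr y).
have cv' : ccont (fun y => evt T2 (tderiv b.2.2) (T y)).
  by apply: (cev _ (fun y => evt T2 (tderiv (tderiv b.2.2)) (T y))) => y; have [_ []] := H _ (Tr y).
have cB : ccont B.
  apply: ccont_mul => //; apply: ccont_add; apply: ccont_mul => //; exact: ccont_conj.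
have cT' : ccont T'.
  apply: ccont_mul => //; apply: (@ccontP _ (fun y => ((a' y) +i* 1)%C)) => y /=; last exact: cvg_cst.
  apply: cvgM; first exact: (ccont_Im cB).
  by apply: cvgV; [rewrite gt_eqF | exact: (ccont_Re cB)].
pose S y := T (2 * pi * y); pose S' y := (2 * pi)%:C%C * T' (2 * pi * y).
have p20 : 0 < 2 * pi :> R by rewrite mulr_gt0.
have dS y : cdiff S y (S' y) by exact: cdiff_lin.
have clin (w : R -> C) : ccont w -> ccont (fun y => w (2 * pi * y)).
  move=> cw y e e0; have [d d0 hd] := cw (2 * pi * y) e e0.
  exists (d / (2 * pi)); first by rewrite divr_gt0.
  move=> h; rewrite ltr_pdivlMr // => hh; have := hd (2 * pi * h); rewrite -mulrDr; apply.
  by rewrite normrM (gtr0_norm p20) mulrC.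
have cS' : ccont S' by apply: ccont_mul; [exact: ccont_cst | exact: clin].
have Sr y : normc (S y) < r by exact: Tr.
have d1 y : cdiff (fun s => evt T2 b.2.1 (S s)) y (S' y * evt T2 (tderiv b.2.1) (S y)).
  by have [h1 _ _ _] := H1 _ (Sr y); exact: cdiff_comp (dS y) h1.
have d2 y : cdiff (fun s => evt T2 b.2.2 (S s)) y (S' y * evt T2 (tderiv b.2.2) (S y)).
  by have [_ h2 _ _] := H1 _ (Sr y); exact: cdiff_comp (dS y) h2.
exists (fun s => gam b (S s)); split.
- split; [apply: (cdiff_C1 d1) | apply: (cdiff_C1 d2)]; apply: ccont_mul => //.
    exact: (clin _ cu').
  exact: (clin _ cv').
- by move=> s; rewrite /S mulrDr mulr1 Tper.
- move=> s s' hs hs' e; have SS : S s = S s' by exact: inj.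
  have aa : a (2 * pi * s) = a (2 * pi * s').
    by apply: expR_inj; have := congr1 normc SS; rewrite !nT.
  have II : iexp (2 * pi * s) = iexp (2 * pi * s').
    move: SS; rewrite /S /T aa => /mulIf; apply; apply/eqP; exact: cexp_neq0.
  have key x y : 0 <= x < 1 -> 0 <= y < 1 -> x <= y -> iexp (2 * pi * x) = iexp (2 * pi * y) -> x = y.
    move=> /andP[x0 x1] /andP[y0 y1] xy E.
    have := @cexp_eq1 _ (2 * pi * (y - x)).
    have -> : 0 <= 2 * pi * (y - x) < 2 * pi.
      apply/andP; split; first by apply: mulr_ge0; [exact: ltW | rewrite subr_ge0].
      by rewrite gtr_pMr //; lra.
    have -> : cexp (0 +i* (2 * pi * (y - x)))%C = 1 :> C.
      have -> : (0 +i* (2 * pi * (y - x)))%C = (0 +i* (2 * pi * y))%C + (0 +i* (- (2 * pi * x)))%C :> C.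
        by apply/eqP; rewrite eq_complex /= ?(mul0r, mulr0, mul1r, mulr1, subr0, addr0, add0r, subrr, oppr0, mulrBr) !eqxx.
      rewrite cexpD -/(iexp _) -E /iexp -cexpD -[RHS]cexp0; congr cexp.
      by apply/eqP; rewrite eq_complex /= ?(mul0r, mulr0, mul1r, mulr1, subr0, addr0, add0r, subrr, oppr0, mulrBr) !eqxx.
    move=> /(_ isT erefl) /eqP; rewrite mulf_eq0 gt_eqF //= subr_eq0 => /eqP ->.
    by [].
  have [le|/ltW le] := leP s s'; first exact: key.
  by apply/esym/key.
- move=> p; split=> [[pz pe]|[s <-]]; last first.
    by have [_ _ _ z] := H1 _ (Sr s); split=> //; exact: (Trho _).
  have [p1 p2] := sphere_le (ltW eps0) pe.
  have [t [tr tp]] := onto p (le_lt_trans p1 epsr) (le_lt_trans p2 epsr) pz.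
  have t0 : t <> 0.
    by move=> t0; have := rho_at0 bb; rewrite -t0 /rho tp pe => /eqP; rewrite expf_eq0 /= gt_eqF.
  have [q [x [_ tE]]] := cexp_surj t0; rewrite cexp_split in tE.
  have qa : q = a x by apply: auniq; rewrite -tE // /rho tp.
  exists (x / (2 * pi)); rewrite /S mulrC divfK; last by rewrite gt_eqF.
  by rewrite /T -qa -tE.
move=> s; suff : 0 < complex.Im (S' s * dform b (S s)).
  by rewrite /dform mulrDr !mulrA /gam /= (cdiff_cderive (d1 s)) (cdiff_cderive (d2 s)).
(* Orientation: Im ((a' + i) B) = (Im B)^2 / Re B + Re B, which is positive. *)
have -> : S' s * dform b (S s) = (2 * pi)%:C%C * (((a' (2 * pi * s)) +i* 1)%C * B (2 * pi * s)).
  by rewrite /S' /T' /B (_ : bform b _ = T (2 * pi * s) * dform b (S s)) // !mulrA.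
rewrite Im_real_mul mulr_gt0 //.
have := B0 (2 * pi * s); rewrite /a'; case: (B _) => X Y /= X0.
by rewrite mul1r mulrAC -expr2 ltr_wpDl // divr_ge0 ?sqr_ge0 // ltW.
Qed.

Lemma link_exists f e (s : seq (br T2)) : cvgt e -> funit e -> (forall b, b \in s -> isbr b) -> uniq s ->
  f = e * \prod_(b <- s) b.1 ->
  (forall b b', b \in s -> b' \in s -> b' <> b -> pullb b b'.1 <> 0) ->
  exists2 eps0 : R, 0 < eps0 & forall eps, 0 < eps < eps0 -> exists n (c : 'I_n -> R -> C * C), alink f eps c.
Proof.
move=> ce ue sb us fE sd.
have [|d1 d10 hd1] := @finite_radius _ _ _ s (fun b eps1 => exists r r' : R, [/\ chart b r r', eps1 <= r',
  forall t, normc t < r -> hgood b t /\ hgood2 b t,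
  forall t, normc t < r -> t <> 0 -> forall b', b' \in s -> b' <> b -> ev b'.1 (gam b t) <> 0 &
  forall eps, 0 < eps < eps1 -> forall w : C, normc w = 1 ->
    exists x, normc (w * rexp x) < r /\ rho b (w * rexp x) = eps ^+ 2]).
  by move=> b bs; have [d d0 hd] := good_radius sb sd bs (near_hgood2 (sb b bs)); exists d.
have [rf rf0 hf] := near0_zeros ce ue sb fE.
exists (Num.min d1 rf); first by rewrite lt_min d10.
move=> eps /andP[eps0]; rewrite lt_min => /andP[ed1 erf].
have loop (i : 'I_(size s)) : exists c : R -> C * C,
    [/\ C1_complex (fun s => (c s).1) /\ C1_complex (fun s => (c s).2),
    forall s, c (s + 1) = c s, forall s s', 0 <= s < 1 -> 0 <= s' < 1 -> c s = c s' -> s = s',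
    forall p, (ev (tnth (in_tuple s) i).1 p = 0 /\ normc p.1 ^+ 2 + normc p.2 ^+ 2 = eps ^+ 2) <-> (exists s, c s = p) &
    forall s, 0 < complex.Im (cderive (fun y => (c y).1) s * conjc (c s).1 +
                        cderive (fun y => (c y).2) s * conjc (c s).2)].
  have bs : tnth (in_tuple s) i \in s by exact: mem_tnth.
  have [d [dd [r [r' [h1 h2 h3 _ h5]]]]] := hd1 _ bs.
  apply: (branch_loop (sb _ bs) h1 _ h3 (h5 eps _)); rewrite eps0 /= (lt_le_trans ed1) //.
  exact: le_trans h2.
have [c hc] := boolp.choice loop.
exists (size s), c; split.
- by move=> j; have [] := hc j.
- by move=> j x; have [] := hc j.
- move=> j j' x x' hx hx' e'; suff E : j = j' by split=> //; subst j'; have [_ _ + _ _] := hc j; apply.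
  have [_ _ _ zj _] := hc j; have [_ _ _ zj' _] := hc j'.
  have bs : tnth (in_tuple s) j \in s by exact: mem_tnth.
  have bs' : tnth (in_tuple s) j' \in s by exact: mem_tnth.
  have [z pe] := (zj (c j x)).2 (ex_intro _ x erefl).
  have [z' _] := (zj' (c j x)).2 (ex_intro _ x' (esym e')).
  have [p1 p2] := sphere_le (ltW eps0) pe.
  have [d [dd [r [r' [[_ onto _] h2 h3 h4 _]]]]] := hd1 _ bs.
  have er : eps < r' by apply: lt_le_trans ed1 _; exact: le_trans h2.
  have [t [tr tp]] := onto _ (le_lt_trans p1 er) (le_lt_trans p2 er) z.
  have t0 : t <> 0.
    by move=> t0; have := rho_at0 (sb _ bs); rewrite -t0 /rho tp pe => /eqP; rewrite expf_eq0 /= gt_eqF.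
  have bb : tnth (in_tuple s) j' = tnth (in_tuple s) j.
    by apply: contrapT => ne; apply: (h4 t tr t0 _ bs' ne); rewrite tp.
  pose b0 := tnth (in_tuple s) j.
  by move/eqP: bb; rewrite !(tnth_nth b0) /= nth_uniq // => /eqP/val_inj.
- move=> p; split=> [[pz pe]|[j [x cx]]].
    have [p1 p2] := sphere_le (ltW eps0) pe.
    have /(hf p (le_lt_trans p1 erf) (le_lt_trans p2 erf))[b bs bz] := pz.
    have bi : (index b s < size s)%N by rewrite index_mem.
    exists (Ordinal bi); have [_ _ _ zj _] := hc (Ordinal bi); apply/zj.
    by rewrite (tnth_nth b) /= nth_index.
  have [_ _ _ zj _] := hc j; have [z pe] := (zj p).2 (ex_intro _ x cx); split=> //.
  have [p1 p2] := sphere_le (ltW eps0) pe.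
  apply/(hf p (le_lt_trans p1 erf) (le_lt_trans p2 erf)).
  by exists (tnth (in_tuple s) j) => //; exact: mem_tnth.
- by move=> j x; have [] := hc j.
Qed.
End LinkExists.

(** * The polar excess of a product of branches *)

Section PolarExcess.
Variables (R : realType) (T1 : fps_theory R[i]) (T2 : fps_theory T1).
Local Notation C := R[i].
Implicit Types (f g h k P Q d : T2) (b : br T2) (a c : C) (s : seq (br T2)).

Definition coprime_conv f g := forall d, cvgt d ->
  (exists2 u, cvgt u & f = d * u) -> (exists2 v, cvgt v & g = d * v) ->
  exists2 w, cvgt w & d * w = 1.

Definition assoc f g := exists2 u, funit u & f = u * g.

Lemma pullb_prod b (I : eqType) (r : seq I) (F : I -> T2) : (forall i, i \in r -> pullb b (F i) <> 0) ->
  pullb b (\prod_(i <- r) F i) <> 0.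
Proof.
move=> h; rewrite /pullb rmorph_prod => /(dom_prod (@dom1 _ T1))[i ir]; exact: h.
Qed.

Lemma irreducible_assoc g g' e e' b b' : firreducible g -> firreducible g' -> isbr b ->
  funit e -> funit e' -> g = e * b.1 -> g' = e' * b'.1 -> pullb b b'.1 = 0 -> assoc g' g.
Proof.
move=> [g0 gn _] [_ _ irr'] bb [w ew] ue' gE g'E /(isbr_div bb)[k kE].
have E : g' = g * (w * e' * k).
  have -> : g * (w * e' * k) = (e * w) * (e' * (b.1 * k)) by rewrite gE; ring.
  by rewrite ew mul1r g'E kE.
case: (irr' _ _ E) => // u; exists (w * e' * k) => //; by rewrite E mulrC.
Qed.

Lemma assocC f g : assoc f g -> assoc g f.
Proof.
move=> [u [w uw] ->]; exists w; first by exists u; rewrite mulrC.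
by rewrite mulrA [w * u]mulrC uw mul1r.
Qed.

Lemma funitM f g : funit f -> funit g -> funit (f * g).
Proof. by move=> [u e] [w e']; exists (u * w); rewrite mulrACA e e' mulr1. Qed.

Lemma branches_of_product (gs : seq T2) : (forall g, g \in gs -> firreducible g /\ cvgt g) ->
  (forall i j, (i < j < size gs)%N -> ~ assoc gs`_i gs`_j) ->
  exists e s, [/\ cvgt e, funit e, forall b, b \in s -> isbr b,
    \prod_(g <- gs) g = e * \prod_(b <- s) b.1 &
    [/\ uniq s, forall b b', b \in s -> b' \in s -> b' <> b -> pullb b b'.1 <> 0, size s = size gs &
     forall b, b \in s -> exists g e', [/\ g \in gs, funit e' & g = e' * b.1]]].
Proof.
elim: gs => [|g gs IH] hg na.
  exists 1, [::]; rewrite !big_nil mulr1; split=> //.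
  - by have := @cvgt_const _ _ T2 1; rewrite rmorph1.
  - by exists 1; rewrite mulr1.
have [||e [s [ce ue sb pE [us sd sz sg]]]] := IH.
- by move=> g' gs'; apply: hg; rewrite inE gs' orbT.
- by move=> i j ij; apply: (na i.+1 j.+1).
have na' g' : g' \in gs -> ~ assoc g g'.
  move=> gs'; have := na 0%N (index g' gs).+1; rewrite /= ltnS index_mem gs' => /(_ isT).
  by rewrite nth_index.
have [ig cg] := hg g (mem_head _ _).
have [b [e1 [bb ue1 ce1 gE]]] := irreducible_branch ig cg.
have d1 b' : b' \in s -> pullb b b'.1 <> 0 /\ pullb b' b.1 <> 0.
  move=> b's; have [g' [e' [gs' ue' g'E]]] := sg _ b's.
  have [ig' _] : firreducible g' /\ cvgt g' by apply: hg; rewrite inE gs' orbT.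
  split=> z; apply: (na' _ gs').
    by apply: assocC; exact: (irreducible_assoc ig ig' bb ue1 ue' gE g'E z).
  exact: (irreducible_assoc ig' ig (sb _ b's) ue' ue1 g'E gE z).
exists (e1 * e), (b :: s); split.
- exact: cvgtM.
- exact: funitM.
- by move=> b'; rewrite inE => /orP[/eqP ->|/sb].
- by rewrite !big_cons pE gE; ring.
split=> /=.
- rewrite us andbT; apply/negP => bs; have [h _] := d1 b bs; apply: h; exact: isbr_vanish.
- move=> b1 b2; rewrite !inE => /orP[/eqP ->|b1s] /orP[/eqP ->|b2s] ne //.
  + by have [] := d1 _ b2s.
  + by have [] := d1 _ b1s.
  + exact: sd.
- by rewrite sz.
move=> b'; rewrite inE => /orP[/eqP ->|/sg[g' [e' [gs' ? ?]]]].
  by exists g, e1; rewrite mem_head.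
by exists g', e'; rewrite inE gs' orbT.
Qed.

(** If f has order n > 0, one of its partial derivatives has order n - 1, while multiples of f have
    order at least n. *)
Lemma pdx_multiple f k k' : f <> 0 -> c2 f 0 0 = 0 -> pdx f = f * k -> pdy f = f * k' -> False.
Proof.
move=> f0 f00 ex ey; have [n [[i [j [ij fij]]] lf]] := ord0_at_exists f0.
have lx : low n (pdx f) by rewrite ex; apply: lowMr.
have ly : low n (pdy f) by rewrite ey; apply: lowMr.
case: i ij fij => [|i] ij fij.
  case: j ij fij => [|j] ij fij; first by rewrite f00 in fij.
  have := ly 0%N j; rewrite -ij add0n ltnSn => /(_ isT); rewrite c2_pdy.
  by move/(mulrn_eq0C (ltn0Sn j)).
have := lx i j; rewrite -ij addSn ltnSn => /(_ isT); rewrite c2_pdx.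
by move/(mulrn_eq0C (ltn0Sn i)).
Qed.

Lemma isbr_reduced b : isbr b -> ~ (pullb b (pdx b.1) = 0 /\ pullb b (pdy b.1) = 0).
Proof.
move=> bb [/(isbr_div bb)[k kE] /(isbr_div bb)[k' k'E]].
exact: (pdx_multiple (branch_neq0 bb) (branch_W00 bb) kE k'E).
Qed.

Section Excess.
Variables (P Q f e : T2) (s : seq (br T2)).
Hypotheses (cP : cvgt P) (cQ : cvgt Q) (PQ : coprime_conv P Q).
Hypotheses (ce : cvgt e) (ue : funit e) (sb : forall b, b \in s -> isbr b) (us : uniq s).
Hypotheses (fE : f = e * \prod_(b <- s) b.1)
  (sd : forall b b', b \in s -> b' \in s -> b' <> b -> pullb b b'.1 <> 0).
Hypotheses (s0 : s <> [::]) (h : T2) (fol : P * pdy f - Q * pdx f = f * h).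

Lemma rest_split b : b \in s -> exists2 r, cvgt r & f = b.1 * r /\ pullb b r <> 0.
Proof.
move=> bs; exists (e * \prod_(b' <- rem b s) b'.1).
  apply: cvgtM => //; apply: cvgt_prod => b' /mem_rem /sb; exact: branch_cW.
split; first by rewrite fE (big_rem b) //=; ring.
rewrite pullbM; apply: mul_neq0; [exact: dom1 | exact: pullb_unit | ].
apply: pullb_prod => b'; rewrite mem_rem_uniq // inE => /andP[/eqP ne b's]; exact: sd.
Qed.

Lemma product_cvgt : cvgt f.
Proof.
by rewrite fE; apply: cvgtM => //; apply: cvgt_prod => b /sb; exact: branch_cW.
Qed.

Lemma product_f00 : c2 f 0 0 = 0.
Proof.
case: s s0 sb fE => // b s' _ sb' ->; rewrite big_cons !c2M0 (branch_W00 (sb' b (mem_head _ _))).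
by rewrite mul0r mulr0.
Qed.

Lemma product_reduced : reduced f s.
Proof.
move=> b bs [x0 y0]; have [r _ [rE r0]] := rest_split bs; have bb := sb bs.
apply: (isbr_reduced bb); move: x0 y0; rewrite rE pdxM pdyM !pullbD !pullbM (isbr_vanish bb) !mul0r !addr0.
by split; [case: (@dom1 _ T1 _ _ x0) | case: (@dom1 _ T1 _ _ y0)] => // r0'; case: r0.
Qed.

Let cf := product_cvgt.
Let rf := product_reduced.
Let f0 := curve_neq0 ue sb fE.

Lemma coprime_pull g b : cvgt g -> coprime_conv g f -> b \in s -> pullb b g <> 0.
Proof.
move=> cg gf bs g0; have bb := sb bs; have cW := branch_cW bb; have W0 := branch_neq0 bb.
have [k kE] := isbr_div bb g0; have [r cr [rE _]] := rest_split bs.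
have [||w _ w1] := gf b.1 cW.
- by exists k => //; apply: (divide W0 cW); rewrite -kE.
- by exists r.
have := congr1 (fun g => c2 g 0 0) w1; rewrite c2M0 (branch_W00 bb) mul0r c21 => /eqP.
by rewrite eq_sym oner_eq0.
Qed.

(** A common divisor d of g and f vanishes on no branch of f, so the cofactor of d in f vanishes on
    all of them and is a multiple of f; hence d is a unit. *)
Lemma pull_coprime g : (forall b, b \in s -> pullb b g <> 0) -> coprime_conv g f.
Proof.
move=> hg d cd [u cu gE] [v cv fE'].
have [k kE] : exists k, v = f * k.
  apply: (curve_div ue sb fE rf) => b bs; have := curve_branch sb fE bs.
  rewrite fE' pullbM => /(@dom1 _ T1)[d0|//].
  by case: (hg b bs); rewrite gE pullbM d0 mul0r.
have dk : d * k = 1.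
  apply: (dom_mulI (@dom2 _ _ T2) f0); rewrite mulr1 {2}fE' kE; ring.
have [|w [dw /(_ cd) cw]] := @inverse _ _ T2 d; first by apply/funitE; exists k.
by exists w.
Qed.

Lemma form_pull b : b \in s -> ~ (pullb b P = 0 /\ pullb b Q = 0).
Proof.
move=> bs [P0 Q0]; have bb := sb bs; have cW := branch_cW bb; have W0 := branch_neq0 bb.
have [k kE] := isbr_div bb P0; have [k' k'E] := isbr_div bb Q0.
have [||w _ w1] := PQ cW.
- by exists k => //; apply: (divide W0 cW); rewrite -kE.
- by exists k' => //; apply: (divide W0 cW); rewrite -k'E.
have := congr1 (fun g => c2 g 0 0) w1; rewrite c2M0 (branch_W00 bb) mul0r c21 => /eqP.
by rewrite eq_sym oner_eq0.
Qed.

Lemma pull_comb b a c g k : pullb b (k2 a * g + k2 c * k) = tconst a * pullb b g + tconst c * pullb b k.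
Proof. by rewrite pullbD !pullbM !pullb_const. Qed.

Definition decomposition g k := [/\ cvgt g, cvgt k, coprime_conv g f, coprime_conv k f &
  exists a b : T2, [/\ cvgt a, cvgt b, g * P = k * pdx f + f * a & g * Q = k * pdy f + f * b]].

Theorem polar_excess_sum : exists p0 mu nu, [/\
  generic (fun a c => imult (k2 a * P + k2 c * Q) f p0), imult (pdx f) (pdy f) mu, ord0_at f nu,
  exists g k, decomposition g k &
  forall g k, decomposition g k ->
    \sum_(b <- s) ((ord (pullb b k))%:Z - (ord (pullb b g))%:Z) = p0%:Z - mu%:Z - nu%:Z + 1].
Proof.
have [nu fnu] := ord0_at_exists f0.
(* The order of a P + c Q along b for generic (a : c), which depends on b only; M is the same for
   f_x and f_y. *)
pose N b := xget 0%N [set n | generic (fun x y => has_ord (tconst x * pullb b P + tconst y * pullb b Q) n)]%classic.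
pose M b := xget 0%N [set n | generic (fun x y => has_ord (tconst x * pullb b (pdx f) + tconst y * pullb b (pdy f)) n)]%classic.
have hN b : b \in s -> generic (fun x y => has_ord (tconst x * pullb b P + tconst y * pullb b Q) (N b)).
  move=> bs; rewrite /N; case: xgetP => [n -> //|no].
  by have [n hn] := generic_ord (form_pull bs); case: (no n).
have hM b : b \in s -> generic (fun x y => has_ord (tconst x * pullb b (pdx f) + tconst y * pullb b (pdy f)) (M b)).
  move=> bs; rewrite /M; case: xgetP => [n -> //|no].
  by have [n hn] := generic_ord (rf bs); case: (no n).
have gN := generic_all hN; have gM := generic_all hM.
have [n0 g0] := generic_ord (curve_at0 ue sb fE rf product_f00).
pose p := \poly_(j < nu.+1) c2 f (nu - j) j.
have pn : p != 0.
  have [[i [j [ij fij]]] _] := fnu; apply/eqP => p0; apply: fij.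
  have := congr1 (fun p : {poly C} => p`_j) p0; rewrite coef0 coef_poly ltnS -ij leq_addl addnK.
  by [].
have gp := generic_poly pn.
pose p0 := (\sum_(b <- s) N b)%N.
have gI : generic (fun a c => imult (k2 a * P + k2 c * Q) f p0).
  apply: generic_sub gN => a c hac.
  have hb b : b \in s -> pullb b (k2 a * P + k2 c * Q) <> 0.
    by move=> bs; rewrite pull_comb; exact: has_ord_neq0 (hac b bs).
  rewrite [f in imult _ f]fE (_ : p0 = \sum_(b <- s) ord (pullb b (k2 a * P + k2 c * Q)))%N; first exact: imult_branches.
  by rewrite /p0 !big_seq; apply: eq_bigr => b bs; rewrite pull_comb (ordE (hac b bs)).
(* One direction (z1 : z2) meets all the generic conditions at once, for the polar of the foliation
   and for Teissier's formula. *)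
have gall := genericI gN (genericI gM (genericI g0 (genericI gp (genericI (@generic_neq1 R) (@generic_neq2 R))))).
have [z1 [z2 [zN [zM [z0 [[_ zp] [z10 z20]]]]]]] := generic_exists gall.
pose D := k2 z1 * pdx f + k2 z2 * pdy f; pose K := k2 z1 * P + k2 z2 * Q.
have Ds b : b \in s -> pullb b D <> 0.
  by move=> bs; rewrite pull_comb; exact: has_ord_neq0 (zM b bs).
have Ks b : b \in s -> pullb b K <> 0.
  by move=> bs; rewrite pull_comb; exact: has_ord_neq0 (zN b bs).
have D0 : at0 D <> 0.
  have -> : at0 D = tconst z1 * at0 (pdx f) + tconst z2 * at0 (pdy f).
    by rewrite /D rmorphD !rmorphM /= /k2 !at0_tconst !tconstE.
  exact: has_ord_neq0 z0.
have nuz : \sum_(j < nu.+1) c2 f (nu - j) j * (z2 / z1) ^+ j <> 0.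
  by move: zp; rewrite horner_poly.
have [mu [hmu te]] := teissier cf ue sb fE rf product_f00 z10 z20 Ds D0 fnu nuz.
have cD : cvgt D.
  by apply: cvgtD; apply: cvgtM; (exact: cvgt_const || exact: cvgt_pdx || exact: cvgt_pdy).
have cK : cvgt K by apply: cvgtD; apply: cvgtM => //; exact: cvgt_const.
exists p0, mu, nu; split=> //.
  (* D P - K f_x = z2 (P f_y - Q f_x) and D Q - K f_y = - z1 (P f_y - Q f_x); by invariance both are
     multiples of f. *)
  exists D, K; split=> //; [exact: pull_coprime | exact: pull_coprime | ].
  have ch : cvgt h.
    apply: (divide f0 cf); rewrite -fol.
    by apply: cvgtB; apply: cvgtM => //; [exact: cvgt_pdy | exact: cvgt_pdx].
  exists (k2 z2 * h), (- (k2 z1 * h)); split.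
  - by apply: cvgtM => //; exact: cvgt_const.
  - by apply: cvgtN; apply: cvgtM => //; exact: cvgt_const.
  - have -> : f * (k2 z2 * h) = k2 z2 * (f * h) by ring.
    by rewrite -fol /D /K; ring.
  have -> : f * - (k2 z1 * h) = - k2 z1 * (f * h) by ring.
  by rewrite -fol /D /K; ring.
move=> g k [cg ck gf kf [a' [b' [_ _ eP eQ]]]].
have key b : b \in s -> (ord (pullb b k))%:Z - (ord (pullb b g))%:Z = (N b)%:Z - (ord (pullb b D))%:Z.
  move=> bs; have gb := coprime_pull cg gf bs; have kb := coprime_pull ck kf bs.
  (* Combine the two equations of the decomposition with weights z1 and z2: the error term is a
     multiple of f, which vanishes along b. *)
  have E : pullb b g * pullb b K = pullb b k * pullb b D.
    rewrite -!pullbM; have -> : g * K = k * D + f * (k2 z1 * a' + k2 z2 * b').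
      have -> : g * K = k2 z1 * (g * P) + k2 z2 * (g * Q) by rewrite /K; ring.
      by rewrite eP eQ /D; ring.
    by rewrite pullbD [X in _ + X]pullbM (curve_branch sb fE bs) mul0r addr0.
  have := congr1 (@ord _ T1) E; rewrite !ordM //; try exact: domC; try exact: Ds; try exact: Ks.
  have -> : ord (pullb b K) = N b by rewrite pull_comb (ordE (zN b bs)).
  by move=> e1; lia.
rewrite (eq_big_seq _ key) sumrB.
have -> : \sum_(b <- s) (N b)%:Z = p0%:Z by rewrite /p0 (big_morph Posz PoszD (erefl 0)).
have -> : \sum_(b <- s) (ord (pullb b D))%:Z = (\sum_(b <- s) ord (pullb b D))%N%:Z.
  by rewrite (big_morph Posz PoszD (erefl 0)).
by move: te; rewrite /D; lia.
Qed.
End Excess.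
End PolarExcess.

(** * The index as an integer on every small link *)

Section Index.
Variables (R : realType) (T1 : fps_theory R[i]) (T2 : fps_theory T1).
Local Notation C := R[i].
Implicit Types (f g h k P Q : T2) (eps : R).

Definition index_eq f (m : int) g k := exists2 eps0 : R, 0 < eps0 & forall eps, 0 < eps < eps0 ->
  forall n (c : 'I_n -> R -> C * C), alink f eps c ->
  (0 +i* (2 * pi))%C^-1 * \sum_j ev_integral g k (c j) = m%:~R.

Lemma separatrix_prod P Q (gs : seq T2) :
  (forall g, g \in gs -> exists h, P * pdy g - Q * pdx g = g * h) ->
  exists h, P * pdy (\prod_(g <- gs) g) - Q * pdx (\prod_(g <- gs) g) = (\prod_(g <- gs) g) * h.
Proof.
elim: gs => [|g gs IH] H.
  have := pdx_const T2 1; have := pdy_const T2 1; rewrite !rmorph1 => ey ex.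
  by exists 0; rewrite !big_nil ex ey !mulr0 subrr.
have [h hE] := H g (mem_head _ _).
have [|h' h'E] := IH; first by move=> g' gs'; apply: H; rewrite inE gs' orbT.
exists (h + h'); rewrite !big_cons; move: (\prod_(j <- gs) j) h'E => r rE.
rewrite pdxM pdyM [RHS]mulrDr.
have -> : g * r * h = (g * h) * r by ring.
have -> : g * r * h' = g * (r * h') by ring.
by rewrite -hE -rE; ring.
Qed.

Theorem index_polar_excess P Q (gs : seq T2) : cvgt P -> cvgt Q -> coprime_conv P Q -> gs <> [::] ->
  (forall g, g \in gs -> [/\ firreducible g, cvgt g & exists h, P * pdy g - Q * pdx g = g * h]) ->
  (forall i j, (i < j < size gs)%N -> ~ assoc gs`_i gs`_j) ->
  let f := \prod_(g <- gs) g in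
  exists p0 mu nu, [/\
    generic (fun a c => imult (k2 a * P + k2 c * Q) f p0), imult (pdx f) (pdy f) mu, ord0_at f nu,
    exists2 eps0 : R, 0 < eps0 & forall eps, 0 < eps < eps0 -> exists n (c : 'I_n -> R -> C * C), alink f eps c &
    (exists g k, decomposition P Q f g k) /\
    forall g k, decomposition P Q f g k -> index_eq f (p0%:Z - mu%:Z - nu%:Z + 1) g k].
Proof.
move=> cP cQ PQ gs0 hg na f.
have [||e [s [ce ue sb fE [us sd sz _]]]] := @branches_of_product _ _ T2 gs.
- by move=> g /hg[].
- exact: na.
have s0 : s <> [::] by move=> s0; apply: gs0; apply: size0nil; rewrite -sz s0.
have [h fol] : exists h, P * pdy f - Q * pdx f = f * h by apply: separatrix_prod => g /hg[].
have [p0 [mu [nu [h1 h2 h3 h4 h5]]]] := polar_excess_sum cP cQ PQ ce ue sb us fE sd s0 fol.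
exists p0, mu, nu; split=> //; first exact: (link_exists ce ue sb us fE sd).
split=> // g k dgk; have [cg ck gf kf _] := dgk.
have [eps0 e0 he] := link_integral ce ue sb us fE sd cg ck
  (fun b => coprime_pull ce ue sb us fE sd cg gf) (fun b => coprime_pull ce ue sb us fE sd ck kf).
exists eps0 => // eps ee n c lc; rewrite (he eps ee n c lc) -(h5 g k dgk).
have p20 : (0 +i* (2 * pi))%C != 0 :> C.
  by apply/eqP => /(congr1 (@complex.Im R)) /= /eqP; rewrite gt_eqF // mulr_gt0 // pi_gt0.
rewrite mulrC mulfK // rmorph_sum; apply: eq_bigr => b _.
by rewrite rmorphB.
Qed.
End Index.

(** * The theorem *)

Section Concrete.
Variable R : realType.
Local Notation C := R[i].
Local Notation normc := (@ComplexField.Normc.normc R).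

Fact fps_model_one (K : comNzRingType) n : (1 : fps K) n = (n == 0%N)%:R.
Proof. by case: n. Qed.

Definition fps_model (K : comNzRingType) : fps_theory K :=
  @FpsTheory K (fps K) (@fps_coef K) (@Fps K) (fun _ _ => erefl) (@fpsP K)
    (fun _ _ _ => erefl) (fun _ _ => erefl) (@fps_model_one K) (fun _ _ _ => erefl).

Let A1 : fps_theory C := fps_model C.
Let A2 : fps_theory A1 := fps_model (fps C).

Lemma model_cvgt (f : fps2 R) : @cvgt R A1 A2 f <-> convergent f.
Proof.
have E (r : R) n : @nm R A1 A2 n r r f = \sum_(i < n) \sum_(j < n) normc (coef2 f i j) * r ^+ (i + j).
  rewrite nmE exchange_big /=; apply: eq_bigr => i _; apply: eq_bigr => j _.
  by rewrite -exprD mulrC.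
split=> [[r [r0 [M hM]]]|[r r0 [M hM]]].
  by exists r => //; exists M => n; rewrite -E; exact: hM.
by exists r; split=> //; exists M => n; rewrite E; exact: hM.
Qed.

Lemma model_imult (g f : fps2 R) n : @imult R A1 A2 g f n <-> intersection_mult g f n.
Proof.
split=> [[e [_ h1 h2]]|[e [h1 h2]]]; exists e.
  by split=> [v|]; [exact: (h1 v I) | exact: h2].
by split=> // v _; exact: (h1 v).
Qed.

Lemma model_ev (f : fps2 R) : @ev R A1 A2 f = Defs.eval f.
Proof. by apply/funext => z; rewrite evE. Qed.

Lemma model_link (f : fps2 R) eps n (c : 'I_n -> R -> C * C) :
  @alink R A1 A2 f eps n c <-> link_parametrization f eps c.
Proof. by rewrite /alink model_ev. Qed.

Lemma model_integral (g k : fps2 R) (c : R -> C * C) :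
  @ev_integral R A1 A2 g k c = gsv_integral g k c.
Proof. by rewrite /ev_integral !model_ev. Qed.

Lemma model_coprime (f g : fps2 R) : @coprime_conv R A1 A2 f g <-> coprime_cv f g.
Proof.
split=> h d /model_cvgt cd [u /model_cvgt cu fE] [v /model_cvgt cv gE].
  by have [||w /model_cvgt cw dw] := h d cd; [exists u|exists v|exists w].
by have [||w /model_cvgt cw dw] := h d cd; [exists u|exists v|exists w].
Qed.

Lemma model_decomposition (P Q f g k : fps2 R) :
  @decomposition R A1 A2 P Q f g k <-> gsv_decomposition P Q f g k.
Proof.
split=> [[cg ck gf kf [a [b [ca cb eP eQ]]]]|[cg ck gf kf [a [b [ca cb eP eQ]]]]].
  by split; [exact/model_cvgt|exact/model_cvgt|exact/model_coprime|exact/model_coprime|];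
    exists a, b; split=> //; exact/model_cvgt.
by split; [exact/model_cvgt|exact/model_cvgt|exact/model_coprime|exact/model_coprime|];
  exists a, b; split=> //; exact/model_cvgt.
Qed.

Lemma xget_unique (T : choiceType) (x0 x : T) (A : set T) : A x -> (forall y, A y -> y = x) -> xget x0 A = x.
Proof. by move=> Ax h; case: xgetP => [y _ /h //|/(_ x)]. Qed.

(** Existence takes one decomposition and the constructed links. For uniqueness, any other
    decomposition is tested on a sphere small enough for both its own bound and that of the computed
    index. *)
Lemma model_is_GSV (P Q f : fps2 R) (m : int) v :
  (exists2 eps0 : R, 0 < eps0 & forall eps, 0 < eps < eps0 -> exists n (c : 'I_n -> R -> C * C),
     @alink R A1 A2 f eps n c) ->
  (exists g k, @decomposition R A1 A2 P Q f g k) ->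
  (forall g k, @decomposition R A1 A2 P Q f g k -> @index_eq R A1 A2 f m g k) ->
  is_GSV P Q f v <-> v = m%:~R.
Proof.
move=> [e1 e10 hl] [g [k gk]] hi; split=> [[g' [k' [/model_decomposition dgk [e2 e20 hv]]]]|->].
  have [e3 e30 h3] := hi _ _ dgk.
  have [eps [he2 he3]] : exists eps, 0 < eps < e2 /\ 0 < eps < e3.
    have m0 : 0 < Num.min e2 e3 by rewrite lt_min e20.
    exists (Num.min e2 e3 / 2); have : Num.min e2 e3 / 2 < Num.min e2 e3.
      by rewrite ltr_pdivrMr // mulr_natr mulr2n ltrDl.
    by rewrite lt_min divr_gt0 // => /andP[-> ->].
  have [n [c [/model_link lc ->]]] := hv eps he2.
  by rewrite (eq_bigr _ (fun j _ => esym (model_integral g' k' (c j)))); exact: (h3 eps he3 n c lc).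
exists g, k; split; first exact/model_decomposition.
have [e3 e30 h3] := hi _ _ gk; exists (Num.min e1 e3); first by rewrite lt_min e10.
move=> eps /andP[ep]; rewrite lt_min => /andP[p1 p3].
have he1 : 0 < eps < e1 by rewrite ep p1.
have he3 : 0 < eps < e3 by rewrite ep p3.
have [n [c lc]] := hl eps he1; exists n, c; split; first exact/model_link.
rewrite (eq_bigr _ (fun j _ => esym (model_integral g k (c j)))).
exact: (esym (h3 eps he3 n c lc)).
Qed.

Lemma generic_P1E (Z : C -> C -> Prop) : generic Z -> generic_P1 Z.
Proof. by move=> [L [L0 hL]]; exists L; split=> // a b _ h; exact: hL. Qed.

Lemma generic_P1_generic (Z : C -> C -> Prop) : generic_P1 Z -> generic Z.
Proof.
(* Appending M, which forces a <> 0, rules out the pair (0, 0). *)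
move=> [L [L0 hL]]; have [M [M0 hM]] := generic_neq1 R; exists (L ++ M); split.
  by move=> l; rewrite mem_cat => /orP[/L0|/M0].
move=> a b h; apply: hL => [[a0 _]|l lL]; last by apply: h; rewrite mem_cat lL.
by apply: (hM a b _ a0) => l lM; apply: h; rewrite mem_cat lM orbT.
Qed.
End Concrete.

Theorem proposition4 (R : realType) (P Q f : fps2 R) :
  foliation P Q ->
  non_dicritical P Q ->
  convergent_separatrices P Q f ->
  GSV P Q f = (polar_excess P Q f)%:~R.
Proof.
move=> [/model_cvgt cP /model_cvgt cQ /model_coprime PQ] _ [gs [gs0 hg na fE]].
have [|p0 [mu [nu [h1 h2 h3 h4 [h5 h6]]]]] := index_polar_excess cP cQ PQ gs0 _ na.
  by move=> g /hg[[irr _ eq] /model_cvgt cg].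
rewrite -fE in h1 h2 h3 h4 h5 h6.
have -> : polar_excess P Q f = p0%:Z - mu%:Z - nu%:Z + 1.
  rewrite /polar_excess; congr (_%:Z - _%:Z - _%:Z + 1).
  - apply: xget_unique => [|n /generic_P1_generic hn].
      apply: generic_P1E; apply: generic_sub h1 => a b; move/model_imult; exact.
    (* Two generic conditions hold at a common (a : b), where the intersection multiplicity has a
       single value. *)
    have [a [b [/model_imult i1 i2]]] := generic_exists (genericI hn h1).
    exact: (imult_inj i1 i2).
  - apply: xget_unique => [|n /model_imult hn]; first exact/model_imult.
    exact: (imult_inj hn h2).
  apply: xget_unique => [|n hn]; first exact: h3.
  exact: (@ord0_at_inj R (fps_model R[i]) (fps_model (fps R[i])) f n nu hn h3).
apply: xget_unique => [|v]; first exact/(model_is_GSV _ h4 h5 h6).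
by move/(model_is_GSV _ h4 h5 h6).
Qed.
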